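(* For each $p\in\mathbb{N}$, $\vec r=(r_1,\dots,r_p)\in\mathbb{N}^p_{\mathrm{ord}}$, $\vec a=(a_1,\dots,a_p)\in\mathbb{R}_+^p$, $\sigma\in\{0,1\}$, $T>0$, $x_0\in\mathbb{R}$ and $\delta\in(0,1)$, there exist Schwartz class solutions $u:\mathbb{R}\times[0,T)\to\mathbb{R}$ of the Boussinesq equation $u_{tt}=u_{xx}+(u^2)_{xx}+u_{xxxx}$ on $\mathbb{R}\times[0,T)$ such that $$u(x_0,t)\asymp \frac{\mathrm{LOG}\big(\tfrac{1}{T-t};\vec r,\vec a,\sigma\big)}{(T-t)^{\delta}}\quad\text{as } t\to T,$$ and $$|u(x,t)|\le C\,\frac{1+x^2}{(x-x_0)^2},\qquad x\in\mathbb{R}\setminus\{x_0\},\ t\in[0,T),$$ for some constant $C>0$. If $\delta\in(0,\tfrac12)$, then the last bound can be replaced by $$|u(x,t)|\le C\,\frac{1+|x|}{|x-x_0|},\qquad x\in\mathbb{R}\setminus\{x_0\},\ t\in[0,T).$$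
   Context: $\mathbb{N}=\{0,1,2,\dots\}$, $\mathbb{N}_{>0}=\{1,2,\dots\}$, $\mathbb{R}_+=[0,+\infty)$, and $\mathbb{N}^p_{\mathrm{ord}}=\{(r_1,\dots,r_p)\in(\mathbb{N}_{>0})^p: r_1<r_2<\dots<r_p\}$. For $r\in\mathbb{N}_{>0}$, $\log_r$ denotes the $r$-th iterate of the logarithm ($\log_1 s=\log s$, $\log_2 s=\log\log s$, etc.). Define $\mathrm{LOG}(s;\vec r,\vec a,\sigma)=(-1)^\sigma\prod_{j=1}^p(\log_{r_j}s)^{a_j}$, with the convention $\mathrm{LOG}\equiv(-1)^\sigma$ if $p=0$. For real functions $f,g$ defined for $t<T$ close to $T$, $f(t)\asymp g(t)$ as $t\to T$ means there exist $T_0\in(0,T)$ and $c_1,c_2>0$ with $c_1 g(t)\le f(t)\le c_2 g(t)$ for all $t\in[T_0,T)$. For $T\in(0,\infty]$, $u$ is a Schwartz class solution of the Boussinesq equation on $\mathbb{R}\times[0,T)$ if $u$ is a smooth real-valued solution of $u_{tt}=u_{xx}+(u^2)_{xx}+u_{xxxx}$ on $\mathbb{R}\times[0,T)$ and for each integer $N\ge1$ and each $\tau\in[0,T)$, $\sup_{x\in\mathbb{R},t\in[0,\tau]}\sum_{i=0}^N(1+|x|)^N|\partial_x^i u(x,t)|<\infty$. *)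

(* Defs.v *)
From Stdlib Require Import Reals Lra Lia.
From Coquelicot Require Import Coquelicot.
Open Scope R_scope.

Definition logn (r : nat) (s : R) : R := Nat.iter r ln s.

Fixpoint prodR (p : nat) (f : nat -> R) : R :=
  match p with
  | O => 1
  | S q => prodR q f * f q
  end.

(** Vectors r = (r_1,...,r_p), a = (a_1,...,a_p) are represented by
    functions on indices 0..p-1. *)
Definition ord_vec (p : nat) (r : nat -> nat) : Prop :=
  (forall j, (j < p)%nat -> (1 <= r j)%nat) /\
  (forall j, (S j < p)%nat -> (r j < r (S j))%nat).

Definition nonneg_vec (p : nat) (a : nat -> R) : Prop :=
  forall j, (j < p)%nat -> 0 <= a j.

(** LOG(s; r, a, sigma) = (-1)^sigma * prod_j (log_{r_j} s)^{a_j}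
    (real powers via Rpower; for s large all log_{r_j} s > 0). *)
Definition LOG (p : nat) (r : nat -> nat) (a : nat -> R) (sigma : nat) (s : R) : R :=
  (-1) ^ sigma * prodR p (fun j => Rpower (logn (r j) s) (a j)).

Definition asymp_at (T : R) (f g : R -> R) : Prop :=
  exists T0 c1 c2, 0 < T0 < T /\ 0 < c1 /\ 0 < c2 /\
    forall t, T0 <= t < T -> c1 * g t <= f t /\ f t <= c2 * g t.

Definition in_dom (T : R) (p : R * R) : Prop := 0 <= snd p < T.

(** [D i j] is the family of partial derivatives  d_x^i d_t^j u  on R x [0,T):
    each D i j is jointly continuous on R x [0,T) (relative topology),
    has x-derivative D (i+1) j, and t-derivative D i (j+1) (one-sided at t=0,
    i.e. derivative relative to [0,T)).  This is C^infty on R x [0,T). *)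
Definition smooth_family (T : R) (u : R -> R -> R) (D : nat -> nat -> R -> R -> R) : Prop :=
  D 0%nat 0%nat = u /\
  forall i j x t, 0 <= t < T ->
    is_derive (fun y => D i j y t) x (D (S i) j x t) /\
    filterlim (fun s => (D i j x s - D i j x t) / (s - t))
      (within (fun s => 0 <= s < T /\ s <> t) (locally t))
      (locally (D i (S j) x t)) /\
    filterlim (fun q : R * R => D i j (fst q) (snd q))
      (within (in_dom T) (locally (x, t)))
      (locally (D i j x t)).

Definition schwartz_boussinesq (T : R) (u : R -> R -> R) : Prop :=
  exists D, smooth_family T u D /\
    (forall x t, 0 <= t < T ->
       D 0%nat 2%nat x t =
         D 2%nat 0%nat x t + Derive_n (fun y => (u y t) ^ 2) 2 x + D 4%nat 0%nat x t) /\
    (forall (N : nat) tau, (1 <= N)%nat -> 0 <= tau < T ->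
       exists M, forall x t, 0 <= t <= tau ->
         sum_f_R0 (fun i => (1 + Rabs x) ^ N * Rabs (D i 0%nat x t)) N <= M).

(* Main.v *)
Require Import Defs.
From Stdlib Require Import Reals Lra Lia ClassicalEpsilon FunctionalExtensionality.
From Coquelicot Require Import Coquelicot.
Open Scope R_scope.

(** Measure time backwards from the blow-up, [tau = T - t], and shift [x0] to the origin. For the
    even Fourier transform [U(k, tau)] of [u], the equation reads
    [U'' = (k^4 - k^2) U - k^2 (U * U)]. Its linear part has the exact decaying solutions
    [v = A(k) exp (- lam(k) tau)], [lam(k) = sqrt (k^4 - k^2)], [k] large; with
    [A(k) = eps |k|^(2 delta - 1) prod_j (log_{r_j} k^2)^(a_j)] the integral of [v] over [k] has
    the prescribed growth as [tau -> 0], since only [k^2 <= 1/tau] matters. A Green's function [K]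
    that decays exponentially in [|tau - s|] for large [k^2 s], and vanishes for [s < tau] when
    [k^2 s] is small, turns the nonlinear problem into [U = v + K (U * U)], and [K] maps
    [O(tau^(-1-q))], [q = delta^2], into [O(tau^(-q'))] for any [q' > q]. For small [eps] this is solved by contraction in the norm
    [sup tau^d (1 + |k|)^(1+eta) exp (sqrt tau |k|) |U|], [d = (1 + q)/2], and [U - v] contributes
    only [O(tau^(-q'))] with [q' < delta] to [u(x0, t)]. Each [k]-derivative of [v] or [K] gains a
    power of [tau]: the second one of [U] (the first one if [delta < 1/2]) is integrable
    uniformly in [tau], which gives the bounds away from [x0] by integration by parts; for fixed
    [tau], the exponential weight and the [k]-smoothness give the Schwartz bounds. *)

(* [ring] and [lra] do not recognise equations typed in the carrier of a Coquelicot structure. *)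
Ltac Req := match goal with |- @eq _ ?a ?b => change (@eq R a b) end.

(** Forward in [t] the linear equation amplifies the frequency [k] like [exp (k^2 t)], so no initial
    value problem is solved: the blow-up is prescribed at [tau = 0] through modes that decay in
    [tau], and the data at [t = 0] are whatever results. The obstacle is the source [U * U] of order
    [tau^(-1-q)], not integrable at 0, against which a purely decaying kernel, integrated over all
    [s < tau], has no bound. The cutoff in [k^2 s] removes the part where the exponential does not
    compensate; the price is a Volterra kernel with zero data at the far end [T1], bounded for small
    [k^2 s]. The exponent [d] satisfies [delta < d < (1 + delta) / 2]: the first inequality leaves
    room for the logarithms, the second makes the correction, of order just above
    [2 d - 1 = delta^2], weaker than [tau^(-delta)]. The length [T1] is arbitrary; smallness comes
    from the amplitude [eps] alone, which [asymp_at] does not detect. A [k]-derivative of [U * U]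
    can be put on one factor, so the derivatives of [U] solve linear equations with [U] frozen as a
    coefficient. *)

(** * Continuity and differentiation of integrals with parameters *)

Lemma locally_pos (x : R) : 0 < x -> locally x (fun y => 0 < y).
Proof. intros H; apply (open_gt 0); exact H. Qed.

Lemma locally_lt (x b : R) : x < b -> locally x (fun y => y < b).
Proof. intros H; apply (open_lt b); exact H. Qed.

Lemma continuous_fst' {U V : UniformSpace} (q : U * V) : continuous (fun z : U * V => fst z) q.
Proof. destruct q as [u v]; apply (continuous_fst u v). Qed.

Lemma continuous_snd' {U V : UniformSpace} (q : U * V) : continuous (fun z : U * V => snd z) q.
Proof. destruct q as [u v]; apply (continuous_snd u v). Qed.

Lemma locally_fst {U V : UniformSpace} (Q : U -> Prop) (u : U) (v : V) :
  locally u Q -> locally (u, v) (fun z : U * V => Q (fst z)).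
Proof. intros H; apply (continuous_fst u v); exact H. Qed.

Lemma locally_snd {U V : UniformSpace} (Q : V -> Prop) (u : U) (v : V) :
  locally v Q -> locally (u, v) (fun z : U * V => Q (snd z)).
Proof. intros H; apply (continuous_snd u v); exact H. Qed.

Lemma continuous_pair {U V W : UniformSpace} (f : U -> V) (g : U -> W) (x : U) :
  continuous f x -> continuous g x -> continuous (fun y => (f y, g y)) x.
Proof.
  intros Hf Hg; apply (continuous_comp_2 f g (fun a b => (a, b)) x Hf Hg).
  apply continuous_ext with (f := fun z => z); [now intros [? ?]|apply continuous_id].
Qed.

Lemma continuous_slice {U V W : UniformSpace} (f : U -> V -> W) (u : U) (v : V) :
  continuous (fun q : U * V => f (fst q) (snd q)) (u, v) -> continuous (f u) v.
Proof.
  intros H; apply (continuous_comp_2 (fun _ => u) (fun y => y) f v).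
  - apply continuous_const.
  - apply continuous_id.
  - exact H.
Qed.

Lemma continuous_slice_l {U V W : UniformSpace} (f : U -> V -> W) (u : U) (v : V) :
  continuous (fun q : U * V => f (fst q) (snd q)) (u, v) -> continuous (fun x => f x v) u.
Proof.
  intros H; apply (continuous_comp_2 (fun y => y) (fun _ => v) f u).
  - apply continuous_id.
  - apply continuous_const.
  - exact H.
Qed.

Lemma continuous_R_eps {U : UniformSpace} (f : U -> R) (x : U) :
  continuous f x <-> forall eps, 0 < eps -> locally x (fun y => Rabs (f y - f x) < eps).
Proof.
  split.
  - intros H eps He; apply (H (fun z => Rabs (z - f x) < eps)).
    exists (mkposreal eps He); intros y Hy; exact Hy.
  - intros H Q [eps HQ]; unfold filtermap.
    generalize (H eps (cond_pos eps)); apply filter_imp; intros y Hy; apply HQ; exact Hy.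
Qed.

(** Compactness of [[a, b]] makes joint continuity uniform in the second variable. The parameter
    ranges over an arbitrary uniform space, because a pair such as [(k, tau)] later serves as a
    single parameter. *)
Lemma tube {P : UniformSpace} (f : P -> R -> R) (a b : R) (p0 : P) :
  (forall y, a <= y <= b -> continuous (fun q : P * R => f (fst q) (snd q)) (p0, y)) ->
  forall eps, 0 < eps ->
  locally p0 (fun p => forall y, a <= y <= b -> Rabs (f p y - f p0 y) < eps).
Proof.
  intros Hc eps He.
  assert (Hd : forall t, exists d : posreal, a <= t <= b -> forall p y,
    ball p0 d p -> Rabs (y - t) < d -> Rabs (f p y - f p0 t) < eps / 2).
  { intros t; destruct (excluded_middle_informative (a <= t <= b)) as [Ht|Ht].
    - assert (H := proj1 (continuous_R_eps _ _) (Hc t Ht) (eps / 2) ltac:(lra)).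
      destruct H as [d H]; exists d; intros _ p y Hp Hy.
      apply (H (p, y)); split; [exact Hp|exact Hy].
    (* The radius must be a total function of [t], so points outside [[a, b]] receive the dummy
       value 1. *)
    - exists (mkposreal 1 Rlt_0_1); intros; contradiction. }
  destruct (choice _ Hd) as [dl Hdl].
  destruct (compactness_value_1d a b dl) as [d Hcov].
  exists d; intros p Hp y Hy.
  assert (HH := Hcov y Hy).
  (* The covering lemma yields a centre [t] only under a double negation. *)
  destruct (excluded_middle_informative (exists t, a <= t <= b /\ Rabs (y - t) < dl t /\ d <= dl t))
    as [[t [Ht [Hyt Hdt]]]|Hn]; [|contradiction].
  assert (H1 : Rabs (f p y - f p0 t) < eps / 2).
  { apply (Hdl t Ht); [|exact Hyt]. apply ball_le with (1 := Hdt); exact Hp. }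
  assert (H2 : Rabs (f p0 y - f p0 t) < eps / 2).
  { apply (Hdl t Ht); [|exact Hyt]. apply ball_center. }
  replace (f p y - f p0 y) with ((f p y - f p0 t) - (f p0 y - f p0 t)) by ring.
  eapply Rle_lt_trans; [apply Rabs_triang|]. rewrite Rabs_Ropp. lra.
Qed.

Lemma ex_RInt_cont (f : R -> R) (a b : R) : a <= b ->
  (forall y, a <= y <= b -> continuous f y) -> ex_RInt f a b.
Proof.
  intros Hab H; apply (ex_RInt_continuous (V := R_CompleteNormedModule)).
  intros z Hz; apply H. rewrite Rmin_left, Rmax_right in Hz; lra.
Qed.

Lemma RInt_plusR (f g : R -> R) (a b : R) : ex_RInt f a b -> ex_RInt g a b ->
  RInt (fun y => f y + g y) a b = RInt f a b + RInt g a b.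
Proof. intros; apply (RInt_plus (V := R_CompleteNormedModule)); assumption. Qed.

Lemma RInt_minusR (f g : R -> R) (a b : R) : ex_RInt f a b -> ex_RInt g a b ->
  RInt (fun y => f y - g y) a b = RInt f a b - RInt g a b.
Proof. intros; apply (RInt_minus (V := R_CompleteNormedModule)); assumption. Qed.

Lemma RInt_scalR (f : R -> R) (a b c : R) : ex_RInt f a b ->
  RInt (fun y => c * f y) a b = c * RInt f a b.
Proof. intros; apply (RInt_scal (V := R_CompleteNormedModule)); assumption. Qed.

Lemma ex_RInt_plusR (f g : R -> R) (a b : R) : ex_RInt f a b -> ex_RInt g a b ->
  ex_RInt (fun y => f y + g y) a b.
Proof. intros; apply (ex_RInt_plus (V := R_NormedModule)); assumption. Qed.

Lemma ex_RInt_minusR (f g : R -> R) (a b : R) : ex_RInt f a b -> ex_RInt g a b ->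
  ex_RInt (fun y => f y - g y) a b.
Proof. intros; apply (ex_RInt_minus (V := R_NormedModule)); assumption. Qed.

Lemma ex_RInt_scalR (f : R -> R) (a b c : R) : ex_RInt f a b -> ex_RInt (fun y => c * f y) a b.
Proof. intros; apply (ex_RInt_scal (V := R_NormedModule)); assumption. Qed.

Lemma RInt_minus_abs (f g : R -> R) (a b c : R) : a <= b -> ex_RInt f a b -> ex_RInt g a b ->
  (forall y, a <= y <= b -> Rabs (f y - g y) <= c) -> Rabs (RInt f a b - RInt g a b) <= (b - a) * c.
Proof.
  intros Hab Hf Hg H.
  rewrite <- (RInt_minusR f g a b Hf Hg).
  apply abs_RInt_le_const; [exact Hab|apply ex_RInt_minusR; assumption|exact H].
Qed.

Lemma continuous_RInt_param {P : UniformSpace} (f : P -> R -> R) (a b : R) (p0 : P) : a <= b ->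
  locally p0 (fun p => forall y, a <= y <= b -> continuous (f p) y) ->
  (forall y, a <= y <= b -> continuous (fun q : P * R => f (fst q) (snd q)) (p0, y)) ->
  continuous (fun p => RInt (f p) a b) p0.
Proof.
  intros Hab Hl Hc; apply continuous_R_eps; intros eps He.
  assert (He' : 0 < eps / (b - a + 1)) by (apply Rdiv_lt_0_compat; lra).
  generalize (filter_and _ _ Hl (tube f a b p0 Hc _ He')).
  apply filter_imp; intros p [H1 H2].
  eapply Rle_lt_trans.
  - apply (RInt_minus_abs (f p) (f p0) a b (eps / (b - a + 1)) Hab).
    + apply ex_RInt_cont; assumption.
    + apply ex_RInt_cont; [assumption|]. intros y Hy; apply (continuous_slice f p0 y (Hc y Hy)).
    + intros y Hy; left; apply H2; exact Hy.
  - unfold Rdiv; rewrite Rmult_comm, Rmult_assoc.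
    rewrite <- (Rmult_1_r eps) at 2. apply Rmult_lt_compat_l; [exact He|].
    rewrite Rmult_comm; fold (Rdiv (b - a) (b - a + 1)).
    apply Rlt_div_l; lra.
Qed.

(** The mean value theorem turns the increment of the integrand into [h * f1 c t] with [c] between
    [x] and [x + h], and [tube] makes [f1 c t - f1 x t] small uniformly in [t]. *)
Lemma is_derive_RInt_par (f f1 : R -> R -> R) (a b x : R) : a <= b ->
  locally x (fun u => forall t, a <= t <= b -> is_derive (fun z => f z t) u (f1 u t)) ->
  locally x (fun u => forall t, a <= t <= b -> continuous (f u) t) ->
  (forall t, a <= t <= b -> continuous (fun q : R * R => f1 (fst q) (snd q)) (x, t)) ->
  is_derive (fun u => RInt (f u) a b) x (RInt (f1 x) a b).
Proof.
  intros Hab Hd Hcf Hc; apply is_derive_Reals; intros eps He.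
  assert (He' : 0 < eps / (b - a + 1)) by (apply Rdiv_lt_0_compat; lra).
  destruct (filter_and _ _ Hd (filter_and _ _ Hcf (tube f1 a b x Hc _ He'))) as [d H].
  exists d; intros h Hh0 Hh.
  assert (Hbx : forall u, Rmin x (x + h) <= u <= Rmax x (x + h) -> ball x d u).
  { intros u Hu. change (Rabs (u - x) < d). revert Hu Hh.
    unfold Rmin, Rmax, Rabs; destruct (Rle_dec x (x+h)), (Rcase_abs h), (Rcase_abs (u - x)); lra. }
  assert (Hx : ball x d x) by apply ball_center.
  assert (Hxh : ball x d (x + h)).
  { apply Hbx; unfold Rmin, Rmax; destruct (Rle_dec x (x + h)); lra. }
  assert (Hf1 : ex_RInt (f1 x) a b).
  { apply ex_RInt_cont; [assumption|]. intros y Hy; apply (continuous_slice f1 x y (Hc y Hy)). }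
  assert (Hfx : ex_RInt (f x) a b) by (apply ex_RInt_cont; [assumption|apply (proj1 (proj2 (H x Hx)))]).
  assert (Hfxh : ex_RInt (f (x+h)) a b) by (apply ex_RInt_cont; [assumption|apply (proj1 (proj2 (H _ Hxh)))]).
  assert (Hkey : Rabs (RInt (f (x + h)) a b - RInt (fun t => f x t + h * f1 x t) a b)
      <= (b - a) * (Rabs h * (eps / (b - a + 1)))).
  { apply RInt_minus_abs; [assumption|assumption| |].
    - apply ex_RInt_plusR; [assumption|]. apply ex_RInt_scalR; assumption.
    - intros t Ht.
      destruct (MVT_gen (fun z => f z t) x (x + h) (fun u => f1 u t)) as [c [Hcc Hm]].
      + intros u Hu; apply (proj1 (H u ltac:(apply Hbx; lra))); exact Ht.
      + intros u Hu. apply continuity_pt_filterlim.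
        apply (ex_derive_continuous (V := R_NormedModule) (fun z => f z t)).
        eexists; apply (proj1 (H u ltac:(apply Hbx; lra))); exact Ht.
      + replace (f (x + h) t - (f x t + h * f1 x t)) with (h * (f1 c t - f1 x t))
          by (replace (x + h - x) with h in Hm by ring; lra).
        rewrite Rabs_mult; apply Rmult_le_compat_l; [apply Rabs_pos|].
        left; apply (H c (Hbx c Hcc)); exact Ht. }
  assert (Hs : RInt (fun t => f x t + h * f1 x t) a b = RInt (f x) a b + h * RInt (f1 x) a b).
  { rewrite (RInt_plusR (f x) (fun t => h * f1 x t) a b); [|assumption|apply ex_RInt_scalR; assumption].
    rewrite (RInt_scalR (f1 x) a b h Hf1); reflexivity. }
  rewrite Hs in Hkey.
  replace ((RInt (f (x + h)) a b - RInt (f x) a b) / h - RInt (f1 x) a b) with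
    ((RInt (f (x + h)) a b - (RInt (f x) a b + h * RInt (f1 x) a b)) / h) by (field; exact Hh0).
  unfold Rdiv at 1; rewrite Rabs_mult, Rabs_inv.
  apply Rle_lt_trans with ((b - a) * (Rabs h * (eps / (b - a + 1))) * / Rabs h).
  { apply Rmult_le_compat_r; [|exact Hkey]. left; apply Rinv_0_lt_compat, Rabs_pos_lt, Hh0. }
  assert (Rabs h <> 0) by (apply Rabs_no_R0; exact Hh0).
  replace ((b - a) * (Rabs h * (eps / (b - a + 1))) * / Rabs h) with (eps * ((b - a) / (b - a + 1)))
    by (field; split; [assumption|lra]).
  rewrite <- (Rmult_1_r eps) at 2; apply Rmult_lt_compat_l; [exact He|]. apply Rlt_div_l; lra.
Qed.

Lemma Rpower_pos (x y : R) : 0 < Rpower x y.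
Proof. apply exp_pos. Qed.

Lemma Rpower_le_1 (x y : R) : 1 <= x -> y <= 0 -> Rpower x y <= 1.
Proof.
  intros Hx Hy; rewrite <- (Rpower_O x) by lra; apply Rle_Rpower; assumption.
Qed.

Lemma is_derive_Rpower (a x : R) : 0 < x -> is_derive (fun y => Rpower y a) x (a * Rpower x (a - 1)).
Proof. intros Hx; apply is_derive_Reals, derivable_pt_lim_power, Hx. Qed.

Lemma continuous_Rpower (a x : R) : 0 < x -> continuous (fun y => Rpower y a) x.
Proof.
  intros Hx; apply (ex_derive_continuous (V := R_NormedModule)).
  eexists; apply is_derive_Rpower, Hx.
Qed.

(** * Integrals over the line *)

(** An integrable majorant with an explicit primitive. The exponent stays just above 1, with [eta]
    small, so that it costs as little as possible in the weighted norms. *)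
Definition rho (eta k : R) : R := Rpower (1 + Rabs k) (- (1 + eta)).

(** Bound for the integral of [rho eta] over [|k| >= A]. *)
Definition tl (eta A : R) : R := 2 / eta * Rpower (1 + A) (- eta).

Lemma rho_pos (eta k : R) : 0 < rho eta k.
Proof. apply Rpower_pos. Qed.

Lemma rho_le_1 (eta k : R) : 0 < eta -> rho eta k <= 1.
Proof. intros He; apply Rpower_le_1; [generalize (Rabs_pos k)|]; lra. Qed.

Lemma rho_even (eta k : R) : rho eta (- k) = rho eta k.
Proof. unfold rho; rewrite Rabs_Ropp; reflexivity. Qed.

Lemma continuous_rho (eta k : R) : continuous (rho eta) k.
Proof.
  unfold rho; apply (continuous_comp (fun k => 1 + Rabs k) (fun y => Rpower y (- (1 + eta)))).
  - apply (continuous_plus (V := R_NormedModule)); [apply continuous_const|apply continuous_Rabs].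
  - apply continuous_Rpower; generalize (Rabs_pos k); lra.
Qed.

Lemma is_RInt_rho (eta a b : R) : 0 < eta -> 0 <= a <= b ->
  is_RInt (rho eta) a b ((Rpower (1 + a) (- eta) - Rpower (1 + b) (- eta)) / eta).
Proof.
  intros He Hab.
  assert (H : is_RInt (fun k => Rpower (1 + k) (- (1 + eta))) a b
     (minus ((fun k => - Rpower (1 + k) (- eta) / eta) b) ((fun k => - Rpower (1 + k) (- eta) / eta) a))).
  { apply (is_RInt_derive (fun k => - Rpower (1 + k) (- eta) / eta)).
    - intros x Hx; rewrite Rmin_left, Rmax_right in Hx by lra.
      assert (Hd : is_derive (fun k => Rpower (1 + k) (- eta)) x (- eta * Rpower (1 + x) (- eta - 1))).
      { evar_last.
        - apply (is_derive_comp (fun y => Rpower y (- eta)) (fun k => 1 + k)).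
          + apply is_derive_Rpower; lra.
          + apply (is_derive_plus (V := R_NormedModule)); [apply is_derive_const|apply is_derive_id].
        - cbn; unfold mult, plus, zero, one; simpl. unfold mult; simpl; ring. }
      evar_last.
      + apply is_derive_ext with (f := fun k => (- / eta) * Rpower (1 + k) (- eta)).
        * intros t; simpl; field; lra.
        * apply is_derive_scal; exact Hd.
      + simpl. replace (- eta - 1) with (- (1 + eta)) by ring. field; lra.
    - intros x Hx; rewrite Rmin_left, Rmax_right in Hx by lra.
      apply (continuous_comp (fun k => 1 + k) (fun y => Rpower y (- (1 + eta)))).
      + apply (continuous_plus (V := R_NormedModule)); [apply continuous_const|apply continuous_id].
      + apply continuous_Rpower; lra. }
  replace ((Rpower (1 + a) (- eta) - Rpower (1 + b) (- eta)) / eta) with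
   (minus ((fun k => - Rpower (1 + k) (- eta) / eta) b) ((fun k => - Rpower (1 + k) (- eta) / eta) a)).
  - apply is_RInt_ext with (2 := H).
    intros x Hx; rewrite Rmin_left, Rmax_right in Hx by lra.
    unfold rho; rewrite Rabs_pos_eq by lra; reflexivity.
  - unfold minus, plus, opp; simpl; field; lra.
Qed.

Lemma is_RInt_rho_neg (eta a b : R) : 0 < eta -> 0 <= a <= b ->
  is_RInt (rho eta) (- b) (- a) ((Rpower (1 + a) (- eta) - Rpower (1 + b) (- eta)) / eta).
Proof.
  intros He Hab.
  assert (H := is_RInt_rho eta a b He Hab).
  assert (H1 : is_RInt (fun y => scal (-1) (rho eta (-1 * y + 0))) (- a) (- b)
             ((Rpower (1 + a) (- eta) - Rpower (1 + b) (- eta)) / eta)).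
  { apply (is_RInt_comp_lin (rho eta) (-1) 0).
    replace (-1 * - a + 0) with a by ring; replace (-1 * - b + 0) with b by ring; exact H. }
  apply is_RInt_swap in H1. apply is_RInt_opp in H1.
  rewrite opp_opp in H1.
  apply is_RInt_ext with (2 := H1).
  intros x _; unfold opp, scal; simpl; unfold mult; simpl.
  replace (-1 * x + 0) with (- x) by ring; rewrite rho_even; ring.
Qed.

(** Continuity with an explicit majorant takes the place of integrability: tails are bounded by
    [M * tl eta A], uniformly over any family with the same [M], which is what limits, derivatives
    and Fubini require. *)
Definition adm (eta M : R) (f : R -> R) : Prop :=
  (forall k, continuous f k) /\ (forall k, Rabs (f k) <= M * rho eta k).

Lemma adm_ex (eta M : R) (f : R -> R) (a b : R) : adm eta M f -> ex_RInt f a b.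
Proof. intros [H _]; apply (ex_RInt_continuous (V := R_CompleteNormedModule)); intros; apply H. Qed.

Lemma adm_M_pos (eta M : R) (f : R -> R) : adm eta M f -> 0 <= M.
Proof.
  intros [_ H]. specialize (H 0). generalize (Rabs_pos (f 0)) (rho_pos eta 0); intros.
  apply Rmult_le_reg_r with (rho eta 0); lra.
Qed.

Lemma abs_RInt_le_is (f g : R -> R) (a b lg : R) : a <= b -> ex_RInt f a b ->
  (forall x, a <= x <= b -> Rabs (f x) <= g x) -> is_RInt g a b lg -> Rabs (RInt f a b) <= lg.
Proof.
  intros Hab [lf Hf] Hfg Hg; rewrite (is_RInt_unique _ _ _ _ Hf).
  apply (norm_RInt_le (V := R_NormedModule) f g a b lf lg Hab Hfg Hf Hg).
Qed.

Lemma adm_diff (eta M : R) (f : R -> R) (A B : R) : 0 < eta -> adm eta M f -> 0 <= A <= B ->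
  Rabs (RInt f (- B) B - RInt f (- A) A) <= M * (tl eta A - tl eta B).
Proof.
  intros He Hf HAB.
  assert (Hex : forall a b, ex_RInt f a b) by (intros; eapply adm_ex; eassumption).
  assert (E : RInt f (- B) B - RInt f (- A) A = RInt f (- B) (- A) + RInt f A B).
  { assert (E1 : RInt f (-B) (-A) + RInt f (-A) B = RInt f (-B) B) by (apply (RInt_Chasles f); apply Hex).
    assert (E2 : RInt f (-A) A + RInt f A B = RInt f (-A) B) by (apply (RInt_Chasles f); apply Hex).
    lra. }
  rewrite E; eapply Rle_trans; [apply Rabs_triang|].
  assert (H1 : Rabs (RInt f (- B) (- A)) <= M * ((Rpower (1 + A) (- eta) - Rpower (1 + B) (- eta)) / eta)).
  { apply abs_RInt_le_is with (g := fun k => M * rho eta k); [lra|apply Hex|intros; apply Hf|].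
    apply (is_RInt_scal (V := R_NormedModule)), is_RInt_rho_neg; assumption. }
  assert (H2 : Rabs (RInt f A B) <= M * ((Rpower (1 + A) (- eta) - Rpower (1 + B) (- eta)) / eta)).
  { apply abs_RInt_le_is with (g := fun k => M * rho eta k); [lra|apply Hex|intros; apply Hf|].
    apply (is_RInt_scal (V := R_NormedModule)), is_RInt_rho; assumption. }
  unfold tl.
  replace (M * (2 / eta * Rpower (1 + A) (- eta) - 2 / eta * Rpower (1 + B) (- eta))) with
   (M * ((Rpower (1 + A) (- eta) - Rpower (1 + B) (- eta)) / eta) +
    M * ((Rpower (1 + A) (- eta) - Rpower (1 + B) (- eta)) / eta)) by (field; lra).
  lra.
Qed.

Lemma tl_pos (eta A : R) : 0 < eta -> 0 < tl eta A.
Proof.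
  intros; unfold tl; apply Rmult_lt_0_compat; [apply Rdiv_lt_0_compat; lra|apply Rpower_pos].
Qed.

Lemma tl_lim (eta eps : R) : 0 < eta -> 0 < eps -> exists A0, 0 <= A0 /\ forall A, A0 <= A -> tl eta A < eps.
Proof.
  intros He Hp. set (c := eps * eta / 2).
  assert (Hc : 0 < c) by (unfold c; apply Rdiv_lt_0_compat; [apply Rmult_lt_0_compat; assumption|lra]).
  set (A0 := Rpower c (- / eta)).
  exists A0; split; [left; apply Rpower_pos|].
  intros A HA. unfold tl.
  assert (HA0 : 0 < A0) by apply Rpower_pos.
  assert (H : Rpower (1 + A) (- eta) < c).
  { replace c with (Rpower A0 (- eta)).
    - rewrite !Rpower_Ropp. apply Rinv_lt_contravar; [apply Rmult_lt_0_compat; apply Rpower_pos|].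
      apply Rlt_Rpower_l; lra.
    - unfold A0; rewrite Rpower_mult. replace (- / eta * - eta) with 1 by (field; lra).
      apply Rpower_1; exact Hc. }
  apply Rlt_le_trans with (2 / eta * c).
  - apply Rmult_lt_compat_l; [apply Rdiv_lt_0_compat; lra|exact H].
  - unfold c; right; field; lra.
Qed.

(** Improper integral over the line; a junk value unless [f] is, e.g., [adm]. *)
Definition IR (f : R -> R) : R := real (Lim_seq (fun n => RInt f (- INR n) (INR n))).

Lemma IR_is_lim (eta M : R) (f : R -> R) : 0 < eta -> adm eta M f ->
  is_lim_seq (fun n => RInt f (- INR n) (INR n)) (IR f).
Proof.
  intros He Hf; apply Lim_seq_correct', ex_lim_seq_cauchy_corr.
  intros eps.
  assert (HM := adm_M_pos _ _ _ Hf).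
  destruct (tl_lim eta (eps / (2 * (M + 1))) He) as [A0 [HA0 HA]].
  { apply Rdiv_lt_0_compat; [apply cond_pos|lra]. }
  destruct (nfloor_ex A0 HA0) as [N HN].
  assert (Hone : forall n, (S N <= n)%nat ->
     Rabs (RInt f (- INR n) (INR n) - RInt f (- INR (S N)) (INR (S N))) < eps / 2).
  { intros n Hn. apply le_INR in Hn.
    assert (HSN : A0 <= INR (S N)) by (rewrite S_INR; lra).
    eapply Rle_lt_trans; [apply (adm_diff eta M f (INR (S N)) (INR n) He Hf)|].
    - split; [apply pos_INR|exact Hn].
    - assert (H1 := HA _ HSN). assert (H2 := tl_pos eta (INR n) He).
      apply Rle_lt_trans with (M * tl eta (INR (S N))).
      + apply Rmult_le_compat_l; lra.
      + apply Rle_lt_trans with (M * (eps / (2 * (M + 1)))).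
        * apply Rmult_le_compat_l; lra.
        * apply Rlt_div_r in H1; [|lra].
          replace (M * (eps / (2 * (M + 1)))) with (eps / 2 * (M / (M + 1))) by (field; lra).
          rewrite <- (Rmult_1_r (eps / 2)) at 2.
          apply Rmult_lt_compat_l; [generalize (cond_pos eps); lra|]. apply Rlt_div_l; lra. }
  exists (S N); intros n m Hn Hm.
  generalize (Hone n Hn) (Hone m Hm); intros H1 H2.
  replace (RInt f (- INR n) (INR n) - RInt f (- INR m) (INR m)) with
   ((RInt f (- INR n) (INR n) - RInt f (- INR (S N)) (INR (S N))) -
    (RInt f (- INR m) (INR m) - RInt f (- INR (S N)) (INR (S N)))) by ring.
  eapply Rle_lt_trans; [apply Rabs_triang|]. rewrite Rabs_Ropp. lra.
Qed.

Lemma IR_approx (eta M : R) (f : R -> R) (A : R) : 0 < eta -> adm eta M f -> 0 <= A ->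
  Rabs (IR f - RInt f (- A) A) <= M * tl eta A.
Proof.
  intros He Hf HA.
  assert (HM := adm_M_pos _ _ _ Hf).
  destruct (nfloor_ex A HA) as [N HN].
  apply (is_lim_seq_le_loc (fun n => Rabs (RInt f (- INR n) (INR n) - RInt f (- A) A)) (fun _ => M * tl eta A)
    (Rabs (IR f - RInt f (- A) A)) (M * tl eta A)).
  - exists (S N); intros n Hn; apply le_INR in Hn; rewrite S_INR in Hn.
    eapply Rle_trans; [apply (adm_diff eta M f A (INR n) He Hf); lra|].
    apply Rmult_le_compat_l; [lra|]. generalize (tl_pos eta (INR n) He); lra.
  - apply (is_lim_seq_abs _ (Finite (IR f - RInt f (- A) A))).
    apply is_lim_seq_minus'; [eapply IR_is_lim; eassumption|apply is_lim_seq_const].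
  - apply is_lim_seq_const.
Qed.

(** Identifies the integral along all large symmetric windows, although [IR] is defined by integer
    ones. *)
Lemma IR_unique (eta M l : R) (f : R -> R) : 0 < eta -> adm eta M f ->
  (forall eps, 0 < eps -> exists A0, forall A, A0 <= A -> Rabs (l - RInt f (- A) A) <= eps) -> IR f = l.
Proof.
  intros He Hf H. assert (HM := adm_M_pos _ _ _ Hf).
  apply Rminus_diag_uniq.
  assert (Hsmall : forall eps, 0 < eps -> Rabs (IR f - l) <= eps).
  { intros eps Hp. destruct (H (eps / 2) ltac:(lra)) as [A0 HA0].
    destruct (tl_lim eta (eps / (2 * (M + 1))) He) as [A1 [HA1 HA]].
    { apply Rdiv_lt_0_compat; lra. }
    set (A := Rmax A0 A1).
    assert (hA0 := Rmax_l A0 A1); assert (hA1 := Rmax_r A0 A1); fold A in hA0, hA1.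
    specialize (HA0 A hA0). specialize (HA A hA1).
    assert (H2 := IR_approx eta M f A He Hf ltac:(lra)).
    assert (H3 : M * tl eta A <= eps / 2).
    { apply Rle_trans with (M * (eps / (2 * (M + 1)))); [apply Rmult_le_compat_l; lra|].
      replace (M * (eps / (2 * (M + 1)))) with (eps / 2 * (M / (M + 1))) by (field; lra).
      rewrite <- (Rmult_1_r (eps / 2)) at 2. apply Rmult_le_compat_l; [lra|].
      apply Rle_div_l; lra. }
    replace (IR f - l) with ((IR f - RInt f (- A) A) - (l - RInt f (- A) A)) by ring.
    eapply Rle_trans; [apply Rabs_triang|]. rewrite Rabs_Ropp. lra. }
  destruct (Req_dec (IR f - l) 0) as [E|E]; [exact E|].
  apply Rabs_pos_lt in E. specialize (Hsmall (Rabs (IR f - l) / 2) ltac:(lra)). lra.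
Qed.

Lemma IR_bound (eta M : R) (f : R -> R) : 0 < eta -> adm eta M f -> Rabs (IR f) <= M * (2 / eta).
Proof.
  intros He Hf. assert (H := IR_approx eta M f 0 He Hf (Rle_refl 0)).
  rewrite Ropp_0, RInt_point in H. unfold zero in H; simpl in H.
  rewrite Rminus_0_r in H. unfold tl in H. rewrite Rplus_0_r in H.
  replace (Rpower 1 (- eta)) with 1 in H; [lra|].
  unfold Rpower; rewrite ln_1, Rmult_0_r, exp_0; reflexivity.
Qed.

Lemma IR_ext (f g : R -> R) : (forall k, f k = g k) -> IR f = IR g.
Proof. intros H; f_equal; apply functional_extensionality, H. Qed.

Lemma adm_plus (eta M M' : R) (f g : R -> R) : adm eta M f -> adm eta M' g ->
  adm eta (M + M') (fun k => f k + g k).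
Proof.
  intros [H1 H2] [H3 H4]; split.
  - intros k; apply (continuous_plus (V := R_NormedModule)); auto.
  - intros k; eapply Rle_trans; [apply Rabs_triang|]. rewrite Rmult_plus_distr_r.
    apply Rplus_le_compat; auto.
Qed.

Lemma adm_scal (eta M c : R) (f : R -> R) : adm eta M f -> adm eta (Rabs c * M) (fun k => c * f k).
Proof.
  intros [H1 H2]; split.
  - intros k; apply (continuous_mult (K := R_AbsRing)); [apply continuous_const|auto].
  - intros k; rewrite Rabs_mult, Rmult_assoc; apply Rmult_le_compat_l; [apply Rabs_pos|auto].
Qed.

Lemma IR_plus (eta M M' : R) (f g : R -> R) : 0 < eta -> adm eta M f -> adm eta M' g ->
  IR (fun k => f k + g k) = IR f + IR g.
Proof.
  intros He Hf Hg.
  assert (H1 := IR_is_lim _ _ _ He Hf); assert (H2 := IR_is_lim _ _ _ He Hg).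
  assert (H3 := IR_is_lim _ _ _ He (adm_plus _ _ _ _ _ Hf Hg)).
  assert (H4 := is_lim_seq_plus' _ _ _ _ H1 H2).
  assert (H5 : is_lim_seq (fun n => RInt (fun k => f k + g k) (- INR n) (INR n)) (IR f + IR g)).
  { eapply is_lim_seq_ext; [|exact H4]. intros n; simpl.
    rewrite RInt_plusR; [reflexivity|eapply adm_ex; eassumption|eapply adm_ex; eassumption]. }
  apply is_lim_seq_unique in H3; apply is_lim_seq_unique in H5.
  rewrite H3 in H5; injection H5; auto.
Qed.

Lemma IR_scal (eta M c : R) (f : R -> R) : 0 < eta -> adm eta M f -> IR (fun k => c * f k) = c * IR f.
Proof.
  intros He Hf.
  assert (H1 := IR_is_lim _ _ _ He Hf).
  assert (H3 := IR_is_lim _ _ _ He (adm_scal _ _ c _ Hf)).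
  assert (H4 := is_lim_seq_scal_l _ c _ H1).
  assert (H5 : is_lim_seq (fun n => RInt (fun k => c * f k) (- INR n) (INR n)) (Rbar_mult c (IR f))).
  { eapply is_lim_seq_ext; [|exact H4]. intros n; simpl.
    rewrite RInt_scalR; [reflexivity|eapply adm_ex; eassumption]. }
  apply is_lim_seq_unique in H3; apply is_lim_seq_unique in H5.
  rewrite H3 in H5; simpl in H5; injection H5; auto.
Qed.

Lemma IR_minus (eta M M' : R) (f g : R -> R) : 0 < eta -> adm eta M f -> adm eta M' g ->
  IR (fun k => f k - g k) = IR f - IR g.
Proof.
  intros He Hf Hg.
  replace (IR f - IR g) with (IR f + (-1) * IR g) by ring.
  rewrite <- (IR_scal eta M' (-1) g He Hg).
  rewrite <- (IR_plus eta M (Rabs (-1) * M') f (fun k => -1 * g k) He Hf); [|apply adm_scal, Hg].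
  apply IR_ext; intros; ring.
Qed.

Lemma IR_le (eta M M' : R) (f g : R -> R) : 0 < eta -> adm eta M f -> adm eta M' g ->
  (forall k, f k <= g k) -> IR f <= IR g.
Proof.
  intros He Hf Hg Hle.
  apply (is_lim_seq_le _ _ _ _ (fun n => RInt_le f g (- INR n) (INR n) ltac:(generalize (pos_INR n); lra)
    (adm_ex _ _ _ _ _ Hf) (adm_ex _ _ _ _ _ Hg) (fun x _ => Hle x)) (IR_is_lim _ _ _ He Hf) (IR_is_lim _ _ _ He Hg)).
Qed.

Lemma IR_abs_le (eta M M' : R) (f g : R -> R) : 0 < eta -> adm eta M f -> adm eta M' g ->
  (forall k, Rabs (f k) <= g k) -> Rabs (IR f) <= IR g.
Proof.
  intros He Hf Hg Hle; apply Rabs_le; split.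
  - replace (- IR g) with ((-1) * IR g) by ring.
    rewrite <- (IR_scal eta M' (-1) g He Hg).
    eapply IR_le; [exact He|apply adm_scal, Hg|exact Hf|].
    intros k; specialize (Hle k); revert Hle; unfold Rabs; destruct (Rcase_abs (f k)); lra.
  - eapply IR_le; [exact He|exact Hf|exact Hg|].
    intros k; eapply Rle_trans; [apply Rle_abs|apply Hle].
Qed.

(** Peetre's inequality [1 + |k| <= (1 + |c|) (1 + |k + c|)], raised to a power. *)
Lemma rho_shift (eta k c : R) : 0 < eta -> rho eta (k + c) <= Rpower (1 + Rabs c) (1 + eta) * rho eta k.
Proof.
  intros He. unfold rho.
  assert (H : 1 + Rabs k <= (1 + Rabs c) * (1 + Rabs (k + c))).
  { assert (Rabs k <= Rabs (k + c) + Rabs c).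
    { replace k with ((k + c) + - c) at 1 by ring. eapply Rle_trans; [apply Rabs_triang|]. rewrite Rabs_Ropp; lra. }
    generalize (Rabs_pos c) (Rabs_pos (k + c)); nra. }
  rewrite !Rpower_Ropp.
  assert (P1 := Rpower_pos (1 + Rabs (k + c)) (1 + eta)). assert (P2 := Rpower_pos (1 + Rabs k) (1 + eta)).
  apply Rmult_le_reg_r with (Rpower (1 + Rabs (k + c)) (1 + eta) * Rpower (1 + Rabs k) (1 + eta)).
  { apply Rmult_lt_0_compat; assumption. }
  replace (/ Rpower (1 + Rabs (k + c)) (1 + eta) * (Rpower (1 + Rabs (k + c)) (1 + eta) * Rpower (1 + Rabs k) (1 + eta)))
    with (Rpower (1 + Rabs k) (1 + eta)) by (field; lra).
  replace (Rpower (1 + Rabs c) (1 + eta) * / Rpower (1 + Rabs k) (1 + eta) *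
   (Rpower (1 + Rabs (k + c)) (1 + eta) * Rpower (1 + Rabs k) (1 + eta))) with
   (Rpower (1 + Rabs c) (1 + eta) * Rpower (1 + Rabs (k + c)) (1 + eta)) by (field; lra).
  rewrite Rpower_mult_distr by (generalize (Rabs_pos c) (Rabs_pos (k + c)); lra).
  apply Rle_Rpower_l; [lra|]. split; [generalize (Rabs_pos k); lra|exact H].
Qed.

Lemma adm_shift (eta M c : R) (f : R -> R) : 0 < eta -> adm eta M f ->
  adm eta (M * Rpower (1 + Rabs c) (1 + eta)) (fun k => f (k + c)).
Proof.
  intros He Hf; assert (HM := adm_M_pos _ _ _ Hf); destruct Hf as [H1 H2]; split.
  - intros k; apply (continuous_comp (fun k => k + c) f); [|apply H1].
    apply (continuous_plus (V := R_NormedModule)); [apply continuous_id|apply continuous_const].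
  - intros k; eapply Rle_trans; [apply H2|]. rewrite Rmult_assoc; apply Rmult_le_compat_l; [exact HM|].
    apply rho_shift, He.
Qed.

Lemma IR_shift (eta M c : R) (f : R -> R) : 0 < eta -> adm eta M f -> IR (fun k => f (k + c)) = IR f.
Proof.
  intros He Hf; assert (HM := adm_M_pos _ _ _ Hf).
  eapply IR_unique; [exact He|apply adm_shift; eassumption|].
  intros eps Hp.
  destruct (tl_lim eta (eps / (3 * (M + 1))) He) as [A1 [HA1 HA]].
  { apply Rdiv_lt_0_compat; lra. }
  exists (A1 + Rabs c); intros A hA.
  assert (Hex : forall a b, ex_RInt f a b) by (intros; eapply adm_ex; eassumption).
  assert (Esh : RInt (fun k => f (k + c)) (- A) A = RInt f (- A + c) (A + c)).
  { assert (E := RInt_comp_lin f 1 c (- A) A).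
    replace (1 * - A + c) with (- A + c) in E by ring; replace (1 * A + c) with (A + c) in E by ring.
    rewrite <- E by apply Hex. apply RInt_ext; intros x _; unfold scal; simpl; unfold mult; simpl.
    rewrite Rmult_1_l. f_equal; ring. }
  (* The window [[-B, B]] lies inside the translated window [[-A + c, A + c]]; outside it only tails
     remain. *)
  set (B := A - Rabs c). assert (HB : A1 <= B) by (unfold B; lra). assert (HAB : B <= A) by (unfold B; generalize (Rabs_pos c); lra).
  assert (HcB : - A + c <= - B /\ B <= A + c).
  { unfold B; generalize (Rle_abs c) (Rle_abs (- c)); rewrite Rabs_Ropp; lra. }
  set (D := Rabs (RInt f (- A + c) (-B)) + Rabs (RInt f B (A + c))).
  assert (E1 : RInt f (- A + c) (A + c) - RInt f (- B) B = RInt f (- A + c) (- B) + RInt f B (A + c)).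
  { assert (E2 : RInt f (- A + c) (- B) + RInt f (- B) (A + c) = RInt f (- A + c) (A + c)) by (apply (RInt_Chasles f); apply Hex).
    assert (E3 : RInt f (- B) B + RInt f B (A + c) = RInt f (- B) (A + c)) by (apply (RInt_Chasles f); apply Hex).
    lra. }
  assert (HB0 : 0 <= B) by lra.
  assert (Hb : forall X Y, 0 <= X <= Y -> Rpower (1 + X) (- eta) / eta - Rpower (1 + Y) (- eta) / eta <= tl eta X / 2).
  { intros X Y HXY; unfold tl. assert (0 < Rpower (1 + Y) (- eta) / eta) by (apply Rdiv_lt_0_compat; [apply Rpower_pos|lra]).
    replace (2 / eta * Rpower (1 + X) (- eta) / 2) with (Rpower (1 + X) (- eta) / eta) by (field; lra). lra. }
  assert (H1 : Rabs (RInt f (- A + c) (- B)) <= M * (tl eta B / 2)).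
  { eapply Rle_trans; [apply abs_RInt_le_is with (g := fun k => M * rho eta k) (lg := M * ((Rpower (1 + B) (- eta) - Rpower (1 + (A - c)) (- eta)) / eta)); [lra|apply Hex|intros; apply Hf|]|].
    - apply (is_RInt_scal (V := R_NormedModule)). replace (- A + c) with (- (A - c)) by ring. apply is_RInt_rho_neg; [assumption|lra].
    - apply Rmult_le_compat_l; [exact HM|]. generalize (Hb B (A - c) ltac:(lra)); unfold Rdiv; lra. }
  assert (H2 : Rabs (RInt f B (A + c)) <= M * (tl eta B / 2)).
  { eapply Rle_trans; [apply abs_RInt_le_is with (g := fun k => M * rho eta k) (lg := M * ((Rpower (1 + B) (- eta) - Rpower (1 + (A + c)) (- eta)) / eta)); [lra|apply Hex|intros; apply Hf|]|].
    - apply (is_RInt_scal (V := R_NormedModule)). apply is_RInt_rho; [assumption|lra].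
    - apply Rmult_le_compat_l; [exact HM|]. generalize (Hb B (A + c) ltac:(lra)); unfold Rdiv; lra. }
  assert (H3 := IR_approx eta M f B He Hf HB0).
  specialize (HA B HB).
  assert (H4 : M * tl eta B <= eps / 2).
  { apply Rle_trans with (M * (eps / (3 * (M + 1)))); [apply Rmult_le_compat_l; lra|].
    replace (M * (eps / (3 * (M + 1)))) with (eps / 3 * (M / (M + 1))) by (field; lra).
    apply Rle_trans with (eps / 3 * 1); [|lra]. apply Rmult_le_compat_l; [lra|].
    apply Rle_div_l; lra. }
  rewrite Esh.
  replace (IR f - RInt f (- A + c) (A + c)) with
    ((IR f - RInt f (- B) B) - (RInt f (- A + c) (A + c) - RInt f (- B) B)) by ring.
  rewrite E1.
  eapply Rle_trans; [apply Rabs_triang|]. rewrite Rabs_Ropp.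
  generalize (Rabs_triang (RInt f (- A + c) (- B)) (RInt f B (A + c))). lra.
Qed.

Lemma IR_opp (f : R -> R) : (forall k, continuous f k) -> IR (fun k => f (- k)) = IR f.
Proof.
  intros Hc; unfold IR; f_equal; apply Lim_seq_ext; intros n.
  assert (E := RInt_comp_lin f (-1) 0 (- INR n) (INR n)).
  replace (-1 * - INR n + 0) with (INR n) in E by ring; replace (-1 * INR n + 0) with (- INR n) in E by ring.
  assert (Hex : forall a b, ex_RInt f a b) by (intros; apply (ex_RInt_continuous (V := R_CompleteNormedModule)); auto).
  specialize (E (Hex _ _)).
  assert (E2 : RInt (fun y => scal (-1) (f (-1 * y + 0))) (- INR n) (INR n) = - RInt (fun k => f (- k)) (- INR n) (INR n)).
  { rewrite <- (RInt_opp (V := R_CompleteNormedModule) (fun k => f (- k))).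
    - apply RInt_ext; intros x _; unfold opp, scal; simpl; unfold mult; simpl.
      replace (-1 * x + 0) with (- x) by ring; ring.
    - apply (ex_RInt_continuous (V := R_CompleteNormedModule)); intros.
      apply (continuous_comp (fun k => - k) f); [|apply Hc].
      apply (continuous_opp (V := R_NormedModule)), continuous_id. }
  assert (E3 : RInt f (INR n) (- INR n) = - RInt f (- INR n) (INR n)).
  { symmetry; apply (opp_RInt_swap f); apply Hex. }
  assert (E4 : - RInt (fun k => f (- k)) (- INR n) (INR n) = - RInt f (- INR n) (INR n)).
  { rewrite <- E2, <- E3; exact E. }
  apply Ropp_eq_compat in E4; rewrite !Ropp_involutive in E4; exact E4.
Qed.

Lemma tl_small (eta M eps : R) : 0 < eta -> 0 <= M -> 0 < eps ->
  exists A0, 0 <= A0 /\ forall A, A0 <= A -> M * tl eta A <= eps.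
Proof.
  intros He HM Hp. destruct (tl_lim eta (eps / (M + 1)) He) as [A0 [H0 H]].
  { apply Rdiv_lt_0_compat; lra. }
  exists A0; split; [exact H0|]. intros A HA; specialize (H A HA).
  apply Rle_trans with (M * (eps / (M + 1))); [apply Rmult_le_compat_l; lra|].
  replace (M * (eps / (M + 1))) with (eps * (M / (M + 1))) by (field; lra).
  rewrite <- (Rmult_1_r eps) at 2. apply Rmult_le_compat_l; [lra|]. apply Rle_div_l; lra.
Qed.

Lemma eq_of_small (x y : R) : (forall eps, 0 < eps -> Rabs (x - y) <= eps) -> x = y.
Proof.
  intros H; apply Rminus_diag_uniq. destruct (Req_dec (x - y) 0) as [E|E]; [exact E|].
  apply Rabs_pos_lt in E. specialize (H (Rabs (x - y) / 2) ltac:(lra)). lra.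
Qed.

Lemma IR_continuous {P : UniformSpace} (eta M : R) (f : P -> R -> R) (p0 : P) : 0 < eta ->
  locally p0 (fun p => adm eta M (f p)) ->
  (forall k, continuous (fun q : P * R => f (fst q) (snd q)) (p0, k)) ->
  continuous (fun p => IR (f p)) p0.
Proof.
  intros He Hl Hc; apply continuous_R_eps; intros eps Hp.
  assert (H0 : adm eta M (f p0)) by exact (locally_singleton _ _ Hl).
  assert (HM := adm_M_pos _ _ _ H0).
  destruct (tl_small eta M (eps / 4) He HM ltac:(lra)) as [A [HA0 HA]].
  specialize (HA A (Rle_refl A)).
  assert (HcA : continuous (fun p => RInt (f p) (- A) A) p0).
  { apply continuous_RInt_param; [lra| |intros y _; apply Hc].
    generalize Hl; apply filter_imp; intros p Hp' y _; apply Hp'. }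
  assert (HcA' := proj1 (continuous_R_eps _ _) HcA (eps / 4) ltac:(lra)).
  generalize (filter_and _ _ Hl HcA'); apply filter_imp; intros p [H1 H2].
  assert (H3 := IR_approx eta M (f p) A He H1 HA0).
  assert (H4 := IR_approx eta M (f p0) A He H0 HA0).
  replace (IR (f p) - IR (f p0)) with ((IR (f p) - RInt (f p) (- A) A)
     + ((RInt (f p) (- A) A - RInt (f p0) (- A) A) - (IR (f p0) - RInt (f p0) (- A) A))) by ring.
  eapply Rle_lt_trans; [apply Rabs_triang|].
  generalize (Rabs_triang (RInt (f p) (- A) A - RInt (f p0) (- A) A) (- (IR (f p0) - RInt (f p0) (- A) A))).
  rewrite Rabs_Ropp; unfold Rminus in *; lra.
Qed.

(** The remainder [F] of the first-order expansion is admissible with a constant proportional to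
    [|h|], so its tail beyond a fixed [A] is a small multiple of [|h|]; on [[-A, A]] the derivative
    is uniformly continuous by [tube]. *)
Lemma IR_is_derive (eta M : R) (f f1 : R -> R -> R) (x : R) : 0 < eta ->
  locally x (fun u => forall k, is_derive (fun z => f z k) u (f1 u k)) ->
  locally x (fun u => adm eta M (f u)) -> locally x (fun u => adm eta M (f1 u)) ->
  (forall k, continuous (fun q : R * R => f1 (fst q) (snd q)) (x, k)) ->
  is_derive (fun u => IR (f u)) x (IR (f1 x)).
Proof.
  intros He Hd Hf Hf1 Hc.
  assert (HM : 0 <= M) by (apply (adm_M_pos eta M (f x)); exact (locally_singleton _ _ Hf)).
  apply is_derive_Reals; intros eps Hp.
  destruct (tl_small eta (2 * M) (eps / 4) He ltac:(lra) ltac:(lra)) as [A [HA0 HA]].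
  specialize (HA A (Rle_refl A)).
  set (e' := eps / (4 * (2 * A + 1))).
  assert (He' : 0 < e') by (apply Rdiv_lt_0_compat; lra).
  destruct (filter_and _ _ Hd (filter_and _ _ Hf (filter_and _ _ Hf1
    (tube f1 (- A) A x (fun y _ => Hc y) e' He')))) as [d H].
  exists d; intros h Hh0 Hh.
  assert (Hbx : forall u, Rmin x (x + h) <= u <= Rmax x (x + h) -> ball x d u).
  { intros u Hu. change (Rabs (u - x) < d). revert Hu Hh.
    unfold Rmin, Rmax, Rabs; destruct (Rle_dec x (x+h)), (Rcase_abs h), (Rcase_abs (u - x)); lra. }
  assert (Hx : ball x d x) by apply ball_center.
  assert (Hxh : ball x d (x + h)).
  { apply Hbx; unfold Rmin, Rmax; destruct (Rle_dec x (x + h)); lra. }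
  destruct (H x Hx) as [_ [Hfx [Hf1x _]]]. destruct (H _ Hxh) as [_ [Hfxh _]].
  set (F := fun k => f (x + h) k - f x k - h * f1 x k).
  assert (EF : IR F = IR (f (x + h)) - IR (f x) - h * IR (f1 x)).
  { unfold F. rewrite (IR_minus eta (M + M) (Rabs h * M) (fun k => f (x + h) k - f x k) (fun k => h * f1 x k)).
    - rewrite (IR_minus eta M M) by assumption. rewrite (IR_scal eta M) by assumption. reflexivity.
    - assumption.
    - replace (fun k => f (x + h) k - f x k) with (fun k => f (x + h) k + -1 * f x k)
        by (apply functional_extensionality; intros; ring).
      apply adm_plus; [assumption|]. replace M with (Rabs (-1) * M) by (rewrite Rabs_left by lra; ring).
      apply adm_scal; assumption.
    - apply adm_scal; assumption. }
  assert (Hmv : forall k, exists c, ball x d c /\ F k = h * (f1 c k - f1 x k)).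
  { intros k. destruct (MVT_gen (fun z => f z k) x (x + h) (fun u => f1 u k)) as [c [Hcc Hm]].
    - intros u Hu; apply (proj1 (H u ltac:(apply Hbx; lra))).
    - intros u Hu. apply continuity_pt_filterlim.
      apply (ex_derive_continuous (V := R_NormedModule) (fun z => f z k)).
      eexists; apply (proj1 (H u ltac:(apply Hbx; lra))).
    - exists c; split; [apply Hbx, Hcc|]. unfold F.
      replace (x + h - x) with h in Hm by ring; lra. }
  assert (HF : adm eta (Rabs h * (2 * M)) F).
  { split.
    - intros k; unfold F. apply (continuous_minus (V := R_NormedModule)).
      + apply (continuous_minus (V := R_NormedModule)); [apply Hfxh|apply Hfx].
      + apply (continuous_mult (K := R_AbsRing)); [apply continuous_const|apply Hf1x].
    - intros k; destruct (Hmv k) as [c [Hcb Ec]]. rewrite Ec, Rabs_mult, Rmult_assoc.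
      apply Rmult_le_compat_l; [apply Rabs_pos|].
      eapply Rle_trans; [apply Rabs_triang|]. rewrite Rabs_Ropp.
      destruct (H c Hcb) as [_ [_ [Hf1c _]]].
      generalize (proj2 Hf1c k) (proj2 Hf1x k); lra. }
  assert (H1 := IR_approx _ _ _ A He HF HA0).
  assert (H2 : Rabs (RInt F (- A) A) <= (A - - A) * (Rabs h * e')).
  { apply abs_RInt_le_const; [lra|eapply adm_ex; exact HF|].
    intros k Hk; destruct (Hmv k) as [c [Hcb Ec]]. rewrite Ec, Rabs_mult.
    apply Rmult_le_compat_l; [apply Rabs_pos|]. left; apply (H c Hcb); exact Hk. }
  assert (Hhp : 0 < Rabs h) by (apply Rabs_pos_lt, Hh0).
  assert (H3 : Rabs (IR F) <= Rabs h * (eps / 2)).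
  { replace (IR F) with ((IR F - RInt F (- A) A) + RInt F (- A) A) by ring.
    eapply Rle_trans; [apply Rabs_triang|].
    assert (Rabs h * (2 * M) * tl eta A <= Rabs h * (eps / 4)).
    { rewrite Rmult_assoc; apply Rmult_le_compat_l; lra. }
    assert ((A - - A) * (Rabs h * e') <= Rabs h * (eps / 4)).
    { unfold e'. replace ((A - - A) * (Rabs h * (eps / (4 * (2 * A + 1))))) with
       (Rabs h * (eps / 4 * (2 * A / (2 * A + 1)))) by (field; lra).
      apply Rmult_le_compat_l; [lra|]. rewrite <- (Rmult_1_r (eps / 4)) at 2.
      apply Rmult_le_compat_l; [lra|]. apply Rle_div_l; lra. }
    lra. }
  replace ((IR (f (x + h)) - IR (f x)) / h - IR (f1 x)) with (IR F / h) by (rewrite EF; field; exact Hh0).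
  unfold Rdiv; rewrite Rabs_mult, Rabs_inv.
  apply Rle_lt_trans with (Rabs h * (eps / 2) * / Rabs h).
  - apply Rmult_le_compat_r; [left; apply Rinv_0_lt_compat; assumption|exact H3].
  - replace (Rabs h * (eps / 2) * / Rabs h) with (eps / 2) by (field; lra). lra.
Qed.

Lemma continuous_RInt_param_all {P : UniformSpace} (f : P -> R -> R) (a b : R) (p0 : P) :
  (forall p y, continuous (fun q : P * R => f (fst q) (snd q)) (p, y)) ->
  continuous (fun p => RInt (f p) a b) p0.
Proof.
  intros Hc.
  assert (Hs : forall p y, continuous (f p) y) by (intros p y; apply (continuous_slice f), Hc).
  destruct (Rle_dec a b) as [H|H].
  - apply continuous_RInt_param; [exact H|apply filter_forall; auto|auto].
  - apply continuous_ext with (f := fun p => - RInt (f p) b a).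
    + intros p; apply (opp_RInt_swap (f p)). apply (ex_RInt_continuous (V := R_CompleteNormedModule)); auto.
    + apply (continuous_opp (V := R_NormedModule)), continuous_RInt_param; [lra|apply filter_forall; auto|auto].
Qed.

(** As functions of the upper limit in [x], both iterated integrals have the same derivative and
    vanish at [a]. *)
Lemma RInt_fubini (f : R -> R -> R) (a b c d : R) : a <= b -> c <= d ->
  (forall x y, continuous (fun q : R * R => f (fst q) (snd q)) (x, y)) ->
  RInt (fun x => RInt (f x) c d) a b = RInt (fun y => RInt (fun x => f x y) a b) c d.
Proof.
  intros Hab Hcd Hc.
  assert (Hc' : forall x y, continuous (fun q : R * R => f (snd q) (fst q)) (x, y)).
  { intros x y. apply (continuous_comp_2 (fun q : R * R => snd q) (fun q => fst q) f (x, y)).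
    - apply continuous_snd'.
    - apply continuous_fst'.
    - apply Hc. }
  assert (Hs1 : forall x y, continuous (f x) y) by (intros; apply (continuous_slice f), Hc).
  assert (Hs2 : forall x y, continuous (fun x => f x y) x) by (intros; apply (continuous_slice_l f), Hc).
  set (g := fun x => RInt (f x) c d).
  assert (Hg : forall x, continuous g x) by (intros x; unfold g; apply (continuous_RInt_param_all f); auto).
  set (D := fun y => RInt g a y - RInt (fun t => RInt (fun x => f x t) a y) c d).
  assert (HD : forall y, is_derive D y 0).
  { intros y; unfold D. replace 0 with (minus (g y) (RInt (f y) c d)) by (unfold minus, plus, opp; simpl; unfold g; ring).
    apply (is_derive_minus (V := R_NormedModule)).
    - apply (is_derive_RInt (V := R_NormedModule)) with (a := a); [|apply Hg].
      apply filter_forall; intros z. apply (RInt_correct g).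
      apply (ex_RInt_continuous (V := R_CompleteNormedModule)); auto.
    - apply (is_derive_RInt_par (fun y t => RInt (fun x => f x t) a y) f); [exact Hcd| | |auto].
      + apply filter_forall; intros u t _.
        apply (is_derive_RInt (V := R_NormedModule) (fun x => f x t)) with (a := a); [|apply Hs2].
        apply filter_forall; intros z. apply (RInt_correct (fun x => f x t)).
        apply (ex_RInt_continuous (V := R_CompleteNormedModule)); auto.
      + apply filter_forall; intros u t _.
        apply (continuous_RInt_param_all (fun t x => f x t)); auto. }
  assert (E : D b = D a).
  { destruct (MVT_gen D a b (fun _ => 0)) as [z [_ Hz]].
    - intros; apply HD.
    - intros x _; apply continuity_pt_filterlim, (ex_derive_continuous (V := R_NormedModule) D). eexists; apply HD.
    - lra. }
  unfold D in E. rewrite (RInt_point a g) in E.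
  rewrite (RInt_ext (fun t => RInt (fun x => f x t) a a) (fun _ => 0)) in E.
  2: { intros x _; apply (RInt_point a (fun x0 => f x0 x)). }
  rewrite RInt_const in E. unfold zero, scal in E; simpl in E; unfold mult in E; simpl in E. fold g. lra.
Qed.

(** Compares the iterated integral over the plane with that over a square, where [RInt_fubini]
    applies. The product majorant reduces both errors to one-dimensional tails. *)
Lemma IR_fubini_aux (eta M : R) (f : R -> R -> R) (A : R) : 0 < eta -> 0 <= A ->
  (forall x y, continuous (fun q : R * R => f (fst q) (snd q)) (x, y)) ->
  (forall x y, Rabs (f x y) <= M * (rho eta x * rho eta y)) ->
  adm eta (M * (2 / eta)) (fun x => IR (f x)) /\
  Rabs (IR (fun x => IR (f x)) - RInt (fun x => RInt (f x) (- A) A) (- A) A) <= 2 * (M * (2 / eta)) * tl eta A.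
Proof.
  intros He HA Hc Hb.
  assert (HM : 0 <= M).
  { specialize (Hb 0 0); generalize (Rabs_pos (f 0 0)) (rho_pos eta 0); intros.
    apply Rmult_le_reg_r with (rho eta 0 * rho eta 0); [apply Rmult_lt_0_compat; lra|lra]. }
  assert (Hx : forall x, adm eta (M * rho eta x) (f x)).
  { intros x; split; [intros; apply (continuous_slice f), Hc|]. intros y; rewrite Rmult_assoc; apply Hb. }
  assert (Hx1 : forall x, adm eta M (f x)).
  { intros x; split; [apply Hx|]. intros y; eapply Rle_trans; [apply Hb|].
    apply Rmult_le_compat_l; [exact HM|]. rewrite <- (Rmult_1_l (rho eta y)) at 2.
    apply Rmult_le_compat_r; [left; apply rho_pos|apply rho_le_1, He]. }
  assert (Ha : adm eta (M * (2 / eta)) (fun x => IR (f x))).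
  { split.
    - intros x; apply (IR_continuous eta M f); [exact He|apply filter_forall; auto|auto].
    - intros x; eapply Rle_trans; [apply (IR_bound _ _ _ He (Hx x))|]. right; ring. }
  split; [exact Ha|].
  assert (H1 := IR_approx _ _ _ A He Ha HA).
  assert (H2 : Rabs (RInt (fun x => IR (f x) - RInt (f x) (- A) A) (- A) A) <= M * tl eta A * (2 / eta)).
  { assert (Hex : ex_RInt (fun x => IR (f x) - RInt (f x) (- A) A) (- A) A).
    { apply ex_RInt_minusR; [eapply adm_ex; exact Ha|].
      apply (ex_RInt_continuous (V := R_CompleteNormedModule)); intros.
      apply (continuous_RInt_param_all f); auto. }
    apply Rle_trans with (M * tl eta A * (2 * ((Rpower (1 + 0) (- eta) - Rpower (1 + A) (- eta)) / eta))).
    - apply abs_RInt_le_is with (g := fun x => M * tl eta A * rho eta x); [lra|exact Hex| |].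
      + intros x _; eapply Rle_trans; [apply (IR_approx _ _ _ A He (Hx x) HA)|]. right; ring.
      + apply (is_RInt_scal (V := R_NormedModule)).
        replace (2 * ((Rpower (1 + 0) (- eta) - Rpower (1 + A) (- eta)) / eta)) with
          (plus ((Rpower (1 + 0) (- eta) - Rpower (1 + A) (- eta)) / eta)
                ((Rpower (1 + 0) (- eta) - Rpower (1 + A) (- eta)) / eta)) by (unfold plus; simpl; ring).
        apply (is_RInt_Chasles (V := R_NormedModule)) with (b := 0).
        * rewrite <- Ropp_0 at 1. apply is_RInt_rho_neg; lra.
        * apply is_RInt_rho; lra.
    - apply Rmult_le_compat_l; [apply Rmult_le_pos; [exact HM|left; apply tl_pos, He]|].
      rewrite Rplus_0_r. replace (Rpower 1 (- eta)) with 1 by (unfold Rpower; rewrite ln_1, Rmult_0_r, exp_0; reflexivity).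
      replace (2 / eta) with (2 * (1 / eta)) by (field; lra). apply Rmult_le_compat_l; [lra|].
      apply Rmult_le_compat_r; [left; apply Rinv_0_lt_compat, He|]. generalize (Rpower_pos (1 + A) (- eta)); lra. }
  rewrite RInt_minusR in H2.
  - replace (IR (fun x => IR (f x)) - RInt (fun x => RInt (f x) (- A) A) (- A) A) with
     ((IR (fun x => IR (f x)) - RInt (fun x => IR (f x)) (- A) A) +
      (RInt (fun x => IR (f x)) (- A) A - RInt (fun x => RInt (f x) (- A) A) (- A) A)) by ring.
    eapply Rle_trans; [apply Rabs_triang|]. lra.
  - eapply adm_ex; exact Ha.
  - apply (ex_RInt_continuous (V := R_CompleteNormedModule)); intros. apply (continuous_RInt_param_all f); auto.
Qed.

Lemma IR_fubini (eta M : R) (f : R -> R -> R) : 0 < eta ->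
  (forall x y, continuous (fun q : R * R => f (fst q) (snd q)) (x, y)) ->
  (forall x y, Rabs (f x y) <= M * (rho eta x * rho eta y)) ->
  IR (fun x => IR (f x)) = IR (fun y => IR (fun x => f x y)).
Proof.
  intros He Hc Hb; apply eq_of_small; intros eps Hp.
  assert (HM : 0 <= M * (2 / eta)).
  { destruct (IR_fubini_aux eta M f 0 He (Rle_refl 0) Hc Hb) as [H _]; exact (adm_M_pos _ _ _ H). }
  destruct (tl_small eta (4 * (M * (2 / eta))) eps He ltac:(lra) Hp) as [A [HA0 HA]].
  specialize (HA A (Rle_refl A)).
  assert (H1 := proj2 (IR_fubini_aux eta M f A He HA0 Hc Hb)).
  assert (Hc' : forall x y, continuous (fun q : R * R => f (snd q) (fst q)) (x, y)).
  { intros x y. apply (continuous_comp_2 (fun q : R * R => snd q) (fun q => fst q) f (x, y)).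
    - apply continuous_snd'.
    - apply continuous_fst'.
    - apply Hc. }
  assert (H2 := proj2 (IR_fubini_aux eta M (fun y x => f x y) A He HA0 Hc'
     (fun y x => ltac:(rewrite (Rmult_comm (rho eta y)); apply Hb)))).
  rewrite (RInt_fubini f) in H1 by (assumption || lra).
  replace (IR (fun x => IR (f x)) - IR (fun y => IR (fun x => f x y))) with
   ((IR (fun x => IR (f x)) - RInt (fun y => RInt (fun x => f x y) (- A) A) (- A) A) -
    (IR (fun y => IR (fun x => f x y)) - RInt (fun y => RInt (fun x => f x y) (- A) A) (- A) A)) by ring.
  eapply Rle_trans; [apply Rabs_triang|]. rewrite Rabs_Ropp. lra.
Qed.

(** The boundary terms of the fundamental theorem are bounded by [rho] and tend to 0, so integration
    by parts over the line leaves no boundary contribution. *)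
Lemma IR_derivative (eta M M' : R) (H H1 : R -> R) : 0 < eta -> (forall k, is_derive H k (H1 k)) ->
  adm eta M H1 -> (forall k, Rabs (H k) <= M' * rho eta k) -> IR H1 = 0.
Proof.
  intros He Hd Ha Hb; eapply IR_unique; [exact He|exact Ha|]. intros eps Hp.
  assert (HM : 0 <= M').
  { specialize (Hb 0); generalize (Rabs_pos (H 0)) (rho_pos eta 0); intros.
    apply Rmult_le_reg_r with (rho eta 0); lra. }
  destruct (tl_small eta (M' * eta) eps He ltac:(apply Rmult_le_pos; lra) Hp) as [A0 [HA0 HA]].
  exists A0; intros A hA; specialize (HA A hA).
  assert (E : RInt H1 (- A) A = H A - H (- A)).
  { apply (is_RInt_unique (V := R_CompleteNormedModule)), (is_RInt_derive (V := R_CompleteNormedModule) H H1).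
    - intros; apply Hd.
    - intros; apply Ha. }
  rewrite E. assert (Hr : rho eta A <= eta / 2 * tl eta A).
  { unfold tl, rho. rewrite Rabs_pos_eq by lra.
    replace (eta / 2 * (2 / eta * Rpower (1 + A) (- eta))) with (Rpower (1 + A) (- eta)) by (field; lra).
    apply Rle_Rpower; lra. }
  assert (H2 := Hb A). assert (H3 := Hb (- A)). rewrite rho_even in H3.
  replace (0 - (H A - H (- A))) with (- H A + H (- A)) by ring.
  eapply Rle_trans; [apply Rabs_triang|]. rewrite Rabs_Ropp.
  assert (M' * rho eta A <= M' * (eta / 2 * tl eta A)) by (apply Rmult_le_compat_l; assumption). lra.
Qed.

(** * Functions smooth in the frequency *)

Definition jcont {P : UniformSpace} (F : R -> P -> R) (k : R) (p : P) : Prop :=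
  continuous (fun q : R * P => F (fst q) (snd q)) (k, p).

(** [ksmooth Dm n W F]: on the domain [Dm], the function [F] has [n] jointly continuous derivatives
    in its first variable, the [j]-th one being [O(W j)]. *)
Fixpoint ksmooth {P : UniformSpace} (Dm : R -> P -> Prop) (n : nat) (W : nat -> R -> P -> R)
    (F : R -> P -> R) : Prop :=
  (forall k p, Dm k p -> jcont F k p) /\
  (exists C, 0 <= C /\ forall k p, Dm k p -> Rabs (F k p) <= C * W O k p) /\
  match n with
  | O => True
  | S m => exists F1, (forall k p, Dm k p -> is_derive (fun y => F y p) k (F1 k p)) /\
                      ksmooth Dm m (fun j => W (S j)) F1
  end.

(** Unlike in [ksmooth], a single function [chi] bounds all derivatives: for cutoffs it is the
    indicator of a set containing the support, for entire functions an exponential. *)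
Fixpoint smooth1 (n : nat) (chi : R -> R) (e : R -> R) : Prop :=
  (forall y, continuous e y) /\
  (exists C, 0 <= C /\ forall y, Rabs (e y) <= C * chi y) /\
  match n with
  | O => True
  | S m => exists e1, (forall y, is_derive e y (e1 y)) /\ smooth1 m chi e1
  end.

Definition wle {P : UniformSpace} (Dm : R -> P -> Prop) (w w' : R -> P -> R) : Prop :=
  exists C, 0 <= C /\ forall k p, Dm k p -> w k p <= C * w' k p.

(** The shift [s] counts derivatives already spent: 0 for a plain product, 1 when the second factor
    is a logarithmic or an inner derivative. *)
Definition wcompat {P : UniformSpace} (Dm : R -> P -> Prop) (s : nat) (W W' W'' : nat -> R -> P -> R) : Prop :=
  forall a b, wle Dm (fun k p => W a k p * W' b k p) (W'' (s + a + b)%nat).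

Section KSmooth.
Context {P : UniformSpace}.
Implicit Types (Dm : R -> P -> Prop) (W : nat -> R -> P -> R) (F G : R -> P -> R).

Lemma ksmooth_cont Dm n W F : ksmooth Dm n W F -> forall k p, Dm k p -> jcont F k p.
Proof. destruct n; intros H; apply H. Qed.

Lemma ksmooth_bd Dm n W F : ksmooth Dm n W F -> exists C, 0 <= C /\ forall k p, Dm k p -> Rabs (F k p) <= C * W O k p.
Proof. destruct n; intros H; apply H. Qed.

Lemma ksmooth_pred Dm n W F : ksmooth Dm (S n) W F -> ksmooth Dm n W F.
Proof.
  revert W F; induction n; intros W F (H1 & H2 & F1 & H3 & H4).
  - repeat split; assumption.
  - split; [assumption|split; [assumption|]]. exists F1; split; [assumption|apply IHn, H4].
Qed.

Lemma ksmooth_weaken Dm n W W' F : ksmooth Dm n W F -> (forall j, wle Dm (W j) (W' j)) -> ksmooth Dm n W' F.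
Proof.
  revert W W' F; induction n; intros W W' F H Hw.
  all: assert (Hb : exists C, 0 <= C /\ forall k p, Dm k p -> Rabs (F k p) <= C * W' O k p) by
   (destruct (ksmooth_bd _ _ _ _ H) as (C & HC & Hb); destruct (Hw O) as (C' & HC' & Hb');
    exists (C * C'); split; [apply Rmult_le_pos; assumption|];
    intros k p Hkp; eapply Rle_trans; [apply Hb, Hkp|]; rewrite Rmult_assoc;
    apply Rmult_le_compat_l; [assumption|apply Hb', Hkp]).
  - split; [apply H|split; [assumption|exact I]].
  - destruct H as (H1 & H2 & F1 & H3 & H4). split; [assumption|split; [assumption|]].
    exists F1; split; [assumption|]. apply IHn with (1 := H4). intros j; apply Hw.
Qed.

Lemma ksmooth_dom Dm (Dm' : R -> P -> Prop) n W F : ksmooth Dm n W F -> (forall k p, Dm' k p -> Dm k p) -> ksmooth Dm' n W F.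
Proof.
  revert W F; induction n; intros W F H HD.
  - destruct H as (H1 & (C & HC & H2) & _). split; [auto|split; [exists C; auto|exact I]].
  - destruct H as (H1 & (C & HC & H2) & F1 & H3 & H4).
    split; [auto|split; [exists C; auto|]]. exists F1; split; [auto|apply IHn; auto].
Qed.

Lemma ksmooth_ext Dm n W F G : (forall k p, F k p = G k p) -> ksmooth Dm n W F -> ksmooth Dm n W G.
Proof.
  intros E; replace G with F; [auto|].
  apply functional_extensionality; intros k; apply functional_extensionality; intros p; apply E.
Qed.

Lemma ksmooth_plus Dm n W F G : ksmooth Dm n W F -> ksmooth Dm n W G -> ksmooth Dm n W (fun k p => F k p + G k p).
Proof.
  revert W F G; induction n; intros W F G HF HG.
  all: assert (Hc : forall k p, Dm k p -> jcont (fun k p => F k p + G k p) k p) by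
   (intros k p Hkp; apply (continuous_plus (V := R_NormedModule)); [apply (ksmooth_cont _ _ _ _ HF), Hkp|apply (ksmooth_cont _ _ _ _ HG), Hkp]).
  all: assert (Hb : exists C, 0 <= C /\ forall k p, Dm k p -> Rabs (F k p + G k p) <= C * W O k p) by
   (destruct (ksmooth_bd _ _ _ _ HF) as (C & HC & Hb); destruct (ksmooth_bd _ _ _ _ HG) as (C' & HC' & Hb');
    exists (C + C'); split; [lra|]; intros k p Hkp; eapply Rle_trans; [apply Rabs_triang|];
    rewrite Rmult_plus_distr_r; apply Rplus_le_compat; auto).
  - split; [assumption|split; [assumption|exact I]].
  - destruct HF as (_ & _ & F1 & H3 & H4). destruct HG as (_ & _ & G1 & H5 & H6).
    split; [assumption|split; [assumption|]].
    exists (fun k p => F1 k p + G1 k p); split; [|apply IHn; assumption].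
    intros k p Hkp; apply (is_derive_plus (V := R_NormedModule)); auto.
Qed.

Lemma ksmooth_zero Dm n W : (forall j k p, Dm k p -> 0 <= W j k p) -> ksmooth Dm n W (fun _ _ => 0).
Proof.
  revert W; induction n; intros W HW.
  all: split; [intros k p _; apply continuous_const|split].
  all: try (exists 1; split; [lra|]; intros k p Hkp; rewrite Rabs_R0, Rmult_1_l; apply HW, Hkp).
  - exact I.
  - exists (fun _ _ => 0); split; [intros; apply (is_derive_const (V := R_NormedModule))|apply IHn; auto].
Qed.

Lemma ksmooth_const_k Dm n W (c : P -> R) : (forall k p, Dm k p -> continuous c p) ->
  wle Dm (fun _ p => Rabs (c p)) (W O) -> (forall j k p, Dm k p -> 0 <= W j k p) ->
  ksmooth Dm n W (fun _ p => c p).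
Proof.
  intros Hc (C & HC & Hb) HW.
  assert (Hc' : forall k p, Dm k p -> jcont (fun _ p => c p) k p).
  { intros k p Hkp; apply (continuous_comp (fun q : R * P => snd q) c); [apply continuous_snd'|apply (Hc k), Hkp]. }
  destruct n; (split; [exact Hc'|split; [exists C; auto|]]); [exact I|].
  exists (fun _ _ => 0); split; [intros; apply (is_derive_const (V := R_NormedModule))|apply ksmooth_zero; auto].
Qed.

Lemma ksmooth_mult Dm n W (W' W'' : nat -> R -> P -> R) F G : ksmooth Dm n W F -> ksmooth Dm n W' G -> wcompat Dm 0 W W' W'' ->
  ksmooth Dm n W'' (fun k p => F k p * G k p).
Proof.
  revert W W' W'' F G; induction n; intros W W' W'' F G HF HG Hw.
  all: assert (Hc : forall k p, Dm k p -> jcont (fun k p => F k p * G k p) k p) by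
   (intros k p Hkp; apply (continuous_mult (K := R_AbsRing)); [apply (ksmooth_cont _ _ _ _ HF), Hkp|apply (ksmooth_cont _ _ _ _ HG), Hkp]).
  all: assert (Hb : exists C, 0 <= C /\ forall k p, Dm k p -> Rabs (F k p * G k p) <= C * W'' O k p) by
   (destruct (ksmooth_bd _ _ _ _ HF) as (C & HC & Hb); destruct (ksmooth_bd _ _ _ _ HG) as (C' & HC' & Hb');
    destruct (Hw O O) as (C'' & HC'' & Hb'');
    exists (C * C' * C''); split; [repeat apply Rmult_le_pos; assumption|]; intros k p Hkp; rewrite Rabs_mult;
    apply Rle_trans with ((C * W O k p) * (C' * W' O k p));
    [apply Rmult_le_compat; [apply Rabs_pos|apply Rabs_pos|auto|auto]|];
    replace (C * W O k p * (C' * W' O k p)) with (C * C' * (W O k p * W' O k p)) by ring;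
    rewrite (Rmult_assoc (C * C')); apply Rmult_le_compat_l; [apply Rmult_le_pos; assumption|apply (Hb'' k p Hkp)]).
  - split; [assumption|split; [assumption|exact I]].
  - assert (HF' := ksmooth_pred _ _ _ _ HF); assert (HG' := ksmooth_pred _ _ _ _ HG).
    destruct HF as (_ & _ & F1 & H3 & H4). destruct HG as (_ & _ & G1 & H5 & H6).
    split; [assumption|split; [assumption|]].
    exists (fun k p => F1 k p * G k p + F k p * G1 k p); split.
    + intros k p Hkp. apply (is_derive_mult (fun y => F y p) (fun y => G y p) k (F1 k p) (G1 k p)); auto.
      intros; apply Rmult_comm.
    + apply ksmooth_plus.
      * apply (IHn _ _ _ _ _ H4 HG'). intros a b; apply (Hw (S a) b).
      * apply (IHn _ _ _ _ _ HF' H6). intros a b.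
        replace (S (0 + a + b)) with (0 + a + S b)%nat by lia. apply (Hw a (S b)).
Qed.

Lemma ksmooth_scal Dm n W F (c : R) : ksmooth Dm n W F -> ksmooth Dm n W (fun k p => c * F k p).
Proof.
  revert W F; induction n; intros W F HF.
  all: assert (Hc : forall k p, Dm k p -> jcont (fun k p => c * F k p) k p) by
   (intros k p Hkp; apply (continuous_mult (K := R_AbsRing)); [apply continuous_const|apply (ksmooth_cont _ _ _ _ HF), Hkp]).
  all: assert (Hb : exists C, 0 <= C /\ forall k p, Dm k p -> Rabs (c * F k p) <= C * W O k p) by
   (destruct (ksmooth_bd _ _ _ _ HF) as (C & HC & Hb);
    exists (Rabs c * C); split; [apply Rmult_le_pos; [apply Rabs_pos|assumption]|]; intros k p Hkp; rewrite Rabs_mult, Rmult_assoc;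
    apply Rmult_le_compat_l; [apply Rabs_pos|auto]).
  - split; [assumption|split; [assumption|exact I]].
  - destruct HF as (_ & _ & F1 & H3 & H4). split; [assumption|split; [assumption|]].
    exists (fun k p => c * F1 k p); split; [|apply IHn, H4].
    intros k p Hkp; apply is_derive_scal; auto.
Qed.

(** Since [F' = F L], smoothness of order [n] of [F] and [L] is smoothness of order [n + 1] of [F].
    Both amplitudes, [amp] and [amplF], are controlled in this way. *)
Lemma ksmooth_logder Dm W WL F L : (forall n, ksmooth Dm n WL L) ->
  (forall k p, Dm k p -> jcont F k p) -> wle Dm (fun k p => Rabs (F k p)) (W O) ->
  (forall k p, Dm k p -> is_derive (fun y => F y p) k (F k p * L k p)) ->
  wcompat Dm 1 W WL W -> forall n, ksmooth Dm n W F.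
Proof.
  intros HL Hc Hb Hd Hw; induction n; (split; [exact Hc|split; [exact Hb|]]); [exact I|].
  exists (fun k p => F k p * L k p); split; [exact Hd|].
  apply (ksmooth_mult Dm n W WL _ F L IHn (HL n)). intros a b; apply (Hw a b).
Qed.

(** The derivative of [e (A k p)] is [e1 (A k p) * A1 k p], where [e1] obeys the same bound [chi] as
    [e]; the induction therefore replaces the expansion of higher derivatives of a composition. *)
Lemma ksmooth_chain Dm W WA (A A1 : R -> P -> R) (chi : R -> R) : (forall n, ksmooth Dm n WA A1) ->
  (forall k p, Dm k p -> jcont A k p) ->
  (forall k p, Dm k p -> is_derive (fun y => A y p) k (A1 k p)) ->
  wle Dm (fun k p => chi (A k p)) (W O) -> wcompat Dm 1 W WA W ->
  forall n e, smooth1 n chi e -> ksmooth Dm n W (fun k p => e (A k p)).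
Proof.
  intros HA Hc Hd (C0 & HC0 & Hchi) Hw; induction n; intros e He.
  all: assert (Hc' : forall k p, Dm k p -> jcont (fun k p => e (A k p)) k p) by
    (intros k p Hkp; apply (continuous_comp (fun q : R * P => A (fst q) (snd q)) e); [apply Hc, Hkp|apply He]).
  all: assert (Hb : exists C, 0 <= C /\ forall k p, Dm k p -> Rabs (e (A k p)) <= C * W O k p) by
    (destruct He as (_ & (C & HC & Hb) & _); exists (C * C0); split; [apply Rmult_le_pos; assumption|];
     intros k p Hkp; eapply Rle_trans; [apply Hb|]; rewrite Rmult_assoc; apply Rmult_le_compat_l; [assumption|apply Hchi, Hkp]).
  - split; [assumption|split; [assumption|exact I]].
  - destruct He as (_ & _ & e1 & H1 & H2). split; [assumption|split; [assumption|]].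
    exists (fun k p => e1 (A k p) * A1 k p); split.
    + intros k p Hkp. rewrite Rmult_comm.
      apply (is_derive_comp e (fun y => A y p) k (e1 (A k p)) (A1 k p)); auto.
    + apply (ksmooth_mult Dm n W WA _ _ _ (IHn e1 H2) (HA n)). intros a b; apply (Hw a b).
Qed.

(** Here [G] is smooth only on [D], while [F] vanishes on the open set [V]; together they cover
    [Dm]. On [V] the product is locally zero, whatever [G] does there, and on [D] the product rule
    applies. *)
Lemma ksmooth_cut Dm (D V : R -> P -> Prop) n W W' W'' F G :
  (forall k p, V k p -> locally (k, p) (fun q => V (fst q) (snd q))) ->
  (forall k p, V k p -> Dm k p) -> (forall k p, Dm k p -> V k p \/ D k p) ->
  (forall k p, V k p -> F k p = 0) ->
  (forall j k p, Dm k p -> 0 <= W'' j k p) ->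
  ksmooth Dm n W F -> ksmooth (fun k p => Dm k p /\ D k p) n W' G ->
  wcompat (fun k p => Dm k p /\ D k p) 0 W W' W'' ->
  ksmooth Dm n W'' (fun k p => F k p * G k p).
Proof.
  intros HV HVD HDV. revert W W' W'' F G; induction n; intros W W' W'' F G H0 Hpos HF HG Hw.
  all: assert (Hz : forall k p, V k p -> locally (k, p) (fun q => F (fst q) (snd q) * G (fst q) (snd q) = 0)) by
    (intros k p Hv; generalize (HV k p Hv); apply filter_imp; intros q Hq; rewrite (H0 _ _ Hq); ring).
  all: assert (Hc : forall k p, Dm k p -> jcont (fun k p => F k p * G k p) k p) by
   (intros k p Hkp; destruct (HDV k p Hkp) as [Hv|Hd];
    [apply continuous_ext_loc with (g := fun _ => 0);
      [generalize (Hz k p Hv); apply filter_imp; intros q Hq; symmetry; exact Hq|apply continuous_const]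
    |apply (continuous_mult (K := R_AbsRing)); [apply (ksmooth_cont _ _ _ _ HF), Hkp|apply (ksmooth_cont _ _ _ _ HG); split; assumption]]).
  all: assert (Hb : exists C, 0 <= C /\ forall k p, Dm k p -> Rabs (F k p * G k p) <= C * W'' O k p) by
   (destruct (ksmooth_bd _ _ _ _ HF) as (C & HC & Hb); destruct (ksmooth_bd _ _ _ _ HG) as (C' & HC' & Hb');
    destruct (Hw O O) as (C'' & HC'' & Hb'');
    assert (HCC : 0 <= C * C' * C'') by (repeat apply Rmult_le_pos; assumption);
    exists (C * C' * C''); split; [exact HCC|]; intros k p Hkp;
    destruct (HDV k p Hkp) as [Hv|Hd];
    [rewrite (H0 k p Hv), Rmult_0_l, Rabs_R0; apply Rmult_le_pos; [exact HCC|auto]|];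
    rewrite Rabs_mult;
    apply Rle_trans with ((C * W O k p) * (C' * W' O k p));
    [apply Rmult_le_compat; [apply Rabs_pos|apply Rabs_pos|auto|apply Hb'; split; assumption]|];
    replace (C * W O k p * (C' * W' O k p)) with (C * C' * (W O k p * W' O k p)) by ring;
    rewrite (Rmult_assoc (C * C')); apply Rmult_le_compat_l; [apply Rmult_le_pos; assumption|apply (Hb'' k p); split; assumption]).
  - split; [assumption|split; [assumption|exact I]].
  - assert (HF' := ksmooth_pred _ _ _ _ HF); assert (HG' := ksmooth_pred _ _ _ _ HG).
    destruct HF as (_ & _ & F1 & H3 & H4). destruct HG as (_ & _ & G1 & H5 & H6).
    (* Openness of [V] passes the vanishing on to the derivative of [F], which keeps the induction
       going. *)
    assert (HF10 : forall k p, Dm k p -> V k p -> F1 k p = 0).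
    { intros k p Hkp Hv. assert (Hd := H3 k p Hkp). apply is_derive_unique in Hd. rewrite <- Hd.
      rewrite <- (Derive_const 0 k). apply Derive_ext_loc.
      destruct (HV k p Hv) as [d Hd']. exists d; intros y Hy. apply H0. apply (Hd' (y, p)).
      split; [exact Hy|apply ball_center]. }
    split; [assumption|split; [assumption|]].
    exists (fun k p => F1 k p * G k p + F k p * G1 k p); split.
    + intros k p Hkp. destruct (HDV k p Hkp) as [Hv|Hd].
      * rewrite (HF10 k p Hkp Hv), (H0 k p Hv), !Rmult_0_l, Rplus_0_l.
        apply is_derive_ext_loc with (f := fun _ => 0); [|apply (is_derive_const (V := R_NormedModule))].
        destruct (HV k p Hv) as [d Hd']. exists d; intros y Hy. rewrite (H0 y p), Rmult_0_l; [reflexivity|].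
        apply (Hd' (y, p)). split; [exact Hy|apply ball_center].
      * apply (is_derive_mult (fun y => F y p) (fun y => G y p) k (F1 k p) (G1 k p)); auto.
        intros; apply Rmult_comm.
    + apply ksmooth_plus.
      * apply (IHn _ _ _ _ _ (fun k p Hv => HF10 k p (HVD k p Hv) Hv) (fun j => Hpos (S j)) H4 HG'). intros a b; apply (Hw (S a) b).
      * apply (IHn _ _ _ _ _ H0 (fun j => Hpos (S j)) HF' H6). intros a b.
        replace (S (0 + a + b)) with (0 + a + S b)%nat by lia. apply (Hw a (S b)).
Qed.
End KSmooth.

(** A single Taylor term of [exp (y / 2)] dominates the power, so half of the exponential is spent
    and half is left. *)
Lemma pow_exp_bound (i : nat) : exists C, 0 < C /\ forall y, 0 <= y -> y ^ i * exp (- y) <= C * exp (- (y / 2)).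
Proof.
  exists (2 ^ i * INR (Factorial.fact i)). split.
  { apply Rmult_lt_0_compat; [apply pow_lt; lra|apply INR_fact_lt_0]. }
  intros y Hy.
  assert (H : (y / 2) ^ i / INR (Factorial.fact i) <= exp (y / 2)).
  { eapply Rle_trans; [|apply (exp_ge_taylor (y / 2) i); lra].
    destruct i; [simpl; lra|]. rewrite tech5.
    assert (0 <= sum_f_R0 (fun k => (y / 2) ^ k / INR (Factorial.fact k)) i).
    { apply cond_pos_sum; intros n; apply Rdiv_le_0_compat; [apply pow_le; lra|apply INR_fact_lt_0]. }
    lra. }
  replace (exp (- y)) with (exp (- (y / 2)) * exp (- (y / 2))) by (rewrite <- exp_plus; f_equal; lra).
  replace (exp (- (y / 2))) with (/ exp (y / 2)) by (rewrite exp_Ropp; reflexivity).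
  assert (He := exp_pos (y / 2)).
  apply Rle_div_l in H; [|apply INR_fact_lt_0].
  replace (y ^ i) with (2 ^ i * (y / 2) ^ i) by (rewrite <- Rpow_mult_distr; f_equal; lra).
  rewrite <- Rmult_assoc. apply Rmult_le_compat_r; [left; apply Rinv_0_lt_compat, He|].
  apply Rle_div_l; [exact He|]. unfold Rdiv. rewrite !Rmult_assoc. apply Rmult_le_compat_l; [apply pow_le; lra|].
  lra.
Qed.

Definition ind (Q : Prop) : R := if excluded_middle_informative Q then 1 else 0.

Lemma ind_true (Q : Prop) : Q -> ind Q = 1.
Proof. intros H; unfold ind; destruct (excluded_middle_informative Q); [reflexivity|contradiction]. Qed.

Lemma ind_false (Q : Prop) : ~ Q -> ind Q = 0.
Proof. intros H; unfold ind; destruct (excluded_middle_informative Q); [contradiction|reflexivity]. Qed.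

Lemma ind_pos (Q : Prop) : 0 <= ind Q.
Proof. unfold ind; destruct (excluded_middle_informative Q); lra. Qed.

Lemma ind_le_1 (Q : Prop) : ind Q <= 1.
Proof. unfold ind; destruct (excluded_middle_informative Q); lra. Qed.

Lemma smooth1_bd n chi e : smooth1 n chi e -> exists C, 0 <= C /\ forall y, Rabs (e y) <= C * chi y.
Proof. destruct n; intros H; apply H. Qed.

Lemma smooth1_pred n chi e : smooth1 (S n) chi e -> smooth1 n chi e.
Proof.
  revert e; induction n; intros e (H1 & H2 & e1 & H3 & H4).
  - repeat split; assumption.
  - split; [assumption|split; [assumption|]]. exists e1; split; [assumption|apply IHn, H4].
Qed.

Lemma smooth1_weaken n chi chi' e : (exists C, 0 <= C /\ forall y, chi y <= C * chi' y) -> smooth1 n chi e -> smooth1 n chi' e.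
Proof.
  intros (C' & HC' & Hw); revert e; induction n; intros e He.
  all: assert (Hb : exists C, 0 <= C /\ forall y, Rabs (e y) <= C * chi' y) by
   (destruct (smooth1_bd _ _ _ He) as (C & HC & Hb); exists (C * C'); split; [apply Rmult_le_pos; assumption|];
    intros y; eapply Rle_trans; [apply Hb|]; rewrite Rmult_assoc; apply Rmult_le_compat_l; auto).
  - split; [apply He|split; [assumption|exact I]].
  - destruct He as (H1 & H2 & e1 & H3 & H4); split; [assumption|split; [assumption|]]. exists e1; auto.
Qed.

Lemma smooth1_plus n chi e f : smooth1 n chi e -> smooth1 n chi f -> smooth1 n chi (fun y => e y + f y).
Proof.
  revert e f; induction n; intros e f He Hf.
  all: assert (Hb : exists C, 0 <= C /\ forall y, Rabs (e y + f y) <= C * chi y) by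
   (destruct (smooth1_bd _ _ _ He) as (C & HC & Hb); destruct (smooth1_bd _ _ _ Hf) as (C' & HC' & Hb');
    exists (C + C'); split; [lra|]; intros y; eapply Rle_trans; [apply Rabs_triang|];
    rewrite Rmult_plus_distr_r; apply Rplus_le_compat; auto).
  all: destruct He as (H1 & _ & H3); destruct Hf as (H4 & _ & H5).
  all: split; [intros y; apply (continuous_plus (V := R_NormedModule)); auto|split; [assumption|]].
  - exact I.
  - destruct H3 as (e1 & H6 & H7); destruct H5 as (f1 & H8 & H9).
    exists (fun y => e1 y + f1 y); split; [intros; apply (is_derive_plus (V := R_NormedModule)); auto|auto].
Qed.

Lemma smooth1_scal n chi e c : smooth1 n chi e -> smooth1 n chi (fun y => c * e y).
Proof.
  revert e; induction n; intros e He.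
  all: assert (Hb : exists C, 0 <= C /\ forall y, Rabs (c * e y) <= C * chi y) by
   (destruct (smooth1_bd _ _ _ He) as (C & HC & Hb);
    exists (Rabs c * C); split; [apply Rmult_le_pos; [apply Rabs_pos|assumption]|]; intros y; rewrite Rabs_mult, Rmult_assoc;
    apply Rmult_le_compat_l; [apply Rabs_pos|auto]).
  all: destruct He as (H1 & _ & H3).
  all: split; [intros y; apply (continuous_mult (K := R_AbsRing)); [apply continuous_const|auto]|split; [assumption|]].
  - exact I.
  - destruct H3 as (e1 & H6 & H7). exists (fun y => c * e1 y); split; [intros; apply is_derive_scal; auto|auto].
Qed.

Lemma smooth1_mult n chi chi' e f : smooth1 n chi e -> smooth1 n chi' f -> smooth1 n (fun y => chi y * chi' y) (fun y => e y * f y).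
Proof.
  revert e f; induction n; intros e f He Hf.
  all: assert (Hb : exists C, 0 <= C /\ forall y, Rabs (e y * f y) <= C * (chi y * chi' y)) by
   (destruct (smooth1_bd _ _ _ He) as (C & HC & Hb); destruct (smooth1_bd _ _ _ Hf) as (C' & HC' & Hb');
    exists (C * C'); split; [apply Rmult_le_pos; assumption|]; intros y; rewrite Rabs_mult;
    replace (C * C' * (chi y * chi' y)) with ((C * chi y) * (C' * chi' y)) by ring;
    apply Rmult_le_compat; [apply Rabs_pos|apply Rabs_pos|auto|auto]).
  all: assert (He' := He); assert (Hf' := Hf); destruct He as (H1 & _ & H3); destruct Hf as (H4 & _ & H5).
  all: split; [intros y; apply (continuous_mult (K := R_AbsRing)); auto|split; [assumption|]].
  - exact I.
  - destruct H3 as (e1 & H6 & H7); destruct H5 as (f1 & H8 & H9).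
    exists (fun y => e1 y * f y + e y * f1 y); split.
    + intros y; apply (is_derive_mult e f y (e1 y) (f1 y)); auto. intros; apply Rmult_comm.
    + apply smooth1_plus; apply IHn; auto; apply smooth1_pred; assumption.
Qed.

Lemma smooth1_affine n chi e a b : smooth1 n chi e -> smooth1 n (fun y => chi (a * y + b)) (fun y => e (a * y + b)).
Proof.
  assert (Hd : forall y, is_derive (fun y => a * y + b) y a).
  { intros y; auto_derive; [exact I|ring]. }
  revert e; induction n; intros e He.
  all: assert (Hb : exists C, 0 <= C /\ forall y, Rabs (e (a * y + b)) <= C * chi (a * y + b)) by
   (destruct (smooth1_bd _ _ _ He) as (C & HC & Hb); exists C; auto).
  all: assert (Hc : forall y, continuous (fun y => e (a * y + b)) y) by
   (intros y; apply (continuous_comp (fun y => a * y + b) e); [apply (ex_derive_continuous (V := R_NormedModule)); eexists; apply Hd|apply He]).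
  all: destruct He as (H1 & _ & H3); split; [assumption|split; [assumption|]].
  - exact I.
  - destruct H3 as (e1 & H6 & H7). exists (fun y => a * e1 (a * y + b)); split.
    + intros y; apply (is_derive_comp e (fun y => a * y + b)); auto.
    + apply smooth1_scal, IHn, H7.
Qed.

(** * Cutoffs and entire functions *)

(** The classical flat functions [x^(-i) exp (-1/x)], taken for all [i] at once because their span
    is closed under differentiation. *)
Definition gflat (i : nat) (x : R) : R := if Rlt_dec 0 x then (/ x) ^ i * exp (- / x) else 0.

Lemma gflat_bd (i : nat) : exists C, 0 <= C /\ forall x, Rabs (gflat i x) <= C * ind (0 < x).
Proof.
  destruct (pow_exp_bound i) as (C & HC & H). exists C; split; [lra|]. intros x; unfold gflat.
  destruct (Rlt_dec 0 x) as [Hx|Hx].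
  - rewrite ind_true by exact Hx. assert (Hy : 0 < / x) by (apply Rinv_0_lt_compat, Hx).
    rewrite Rabs_pos_eq by (apply Rmult_le_pos; [apply pow_le; lra|left; apply exp_pos]).
    eapply Rle_trans; [apply H; lra|]. apply Rmult_le_compat_l; [lra|].
    rewrite <- exp_0. destruct (Rle_lt_or_eq_dec (- (/ x / 2)) 0 ltac:(lra)) as [h|h]; [left; apply exp_increasing, h|right; f_equal; exact h].
  - rewrite ind_false by exact Hx. rewrite Rabs_R0; lra.
Qed.

Lemma gflat_derive (i : nat) (x : R) : is_derive (gflat i) x (- INR i * gflat (S i) x + gflat (S (S i)) x).
Proof.
  destruct (Rtotal_order x 0) as [Hx|[Hx|Hx]].
  - replace (- INR i * gflat (S i) x + gflat (S (S i)) x) with 0.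
    + apply is_derive_ext_loc with (f := fun _ => 0); [|apply (is_derive_const (V := R_NormedModule))].
      generalize (locally_lt x 0 Hx); apply filter_imp; intros y Hy; unfold gflat.
      destruct (Rlt_dec 0 y); [lra|reflexivity].
    + unfold gflat; destruct (Rlt_dec 0 x); [lra|ring].
  - subst x. replace (- INR i * gflat (S i) 0 + gflat (S (S i)) 0) with 0
      by (unfold gflat; destruct (Rlt_dec 0 0); [lra|ring]).
    destruct (gflat_bd (S (S i))) as (C & HC & Hb).
    apply is_derive_Reals; intros eps He.
    assert (Hd : 0 < eps / (C + 1)) by (apply Rdiv_lt_0_compat; lra).
    exists (mkposreal _ Hd); intros h Hh0 Hh; simpl in Hh.
    replace (gflat i 0) with 0 by (unfold gflat; destruct (Rlt_dec 0 0); [lra|reflexivity]).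
    rewrite Rplus_0_l, !Rminus_0_r.
    (* At the origin the difference quotient becomes [h * gflat (i + 2) h], whose second factor is
       bounded. *)
    replace (gflat i h) with (h * h * gflat (S (S i)) h).
    2: { unfold gflat; destruct (Rlt_dec 0 h); [|ring]. simpl. field; lra. }
    replace (h * h * gflat (S (S i)) h / h) with (h * gflat (S (S i)) h) by (field; exact Hh0).
    rewrite Rabs_mult. specialize (Hb h). assert (Hi := ind_le_1 (0 < h)). assert (Hi' := ind_pos (0 < h)).
    apply Rle_lt_trans with (Rabs h * C).
    + apply Rmult_le_compat_l; [apply Rabs_pos|]. nra.
    + apply Rlt_div_r in Hh; [|lra]. generalize (Rabs_pos h); nra.
  - apply is_derive_ext_loc with (f := fun x => (/ x) ^ i * exp (- / x)).
    + generalize (locally_pos x Hx); apply filter_imp; intros y Hy; unfold gflat.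
      destruct (Rlt_dec 0 y); [reflexivity|contradiction].
    + unfold gflat; destruct (Rlt_dec 0 x); [|contradiction].
      auto_derive; [lra|]. destruct i; [simpl; field; lra|].
      replace (pred (S i)) with i by reflexivity. simpl pow. field; lra.
Qed.

Lemma gflat_smooth1 (n i : nat) : smooth1 n (fun x => ind (0 < x)) (gflat i).
Proof.
  revert i; induction n; intros i; (split; [|split; [apply gflat_bd|]]).
  all: try (intros y; apply (ex_derive_continuous (V := R_NormedModule)); eexists; apply gflat_derive).
  - exact I.
  - exists (fun x => - INR i * gflat (S i) x + gflat (S (S i)) x); split; [apply gflat_derive|].
    apply smooth1_plus; [apply smooth1_scal, IHn|apply IHn].
Qed.

Definition bump (x : R) : R := gflat 0 x * gflat 0 (-1 * x + 1).

Lemma bump_smooth1 (n : nat) : smooth1 n (fun x => ind (0 < x < 1)) bump.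
Proof.
  apply smooth1_weaken with (chi := fun x => ind (0 < x) * ind (0 < -1 * x + 1)).
  - exists 1; split; [lra|]. intros x. destruct (excluded_middle_informative (0 < x < 1)) as [H|H].
    + rewrite !ind_true by lra; lra.
    + rewrite (ind_false _ H). destruct (Rlt_dec 0 x); [rewrite (ind_false (0 < -1 * x + 1)) by lra|rewrite (ind_false (0 < x)) by lra]; lra.
  - apply (smooth1_mult n _ _ (gflat 0) (fun x => gflat 0 (-1 * x + 1))); [apply gflat_smooth1|].
    apply (smooth1_affine n (fun x => ind (0 < x)) (gflat 0) (-1) 1), gflat_smooth1.
Qed.

Lemma bump_cont (x : R) : continuous bump x.
Proof. apply (bump_smooth1 0). Qed.

Lemma bump_ex (a b : R) : ex_RInt bump a b.
Proof. apply (ex_RInt_continuous (V := R_CompleteNormedModule)); intros; apply bump_cont. Qed.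

Lemma bump_zero (x : R) : ~ (0 < x < 1) -> bump x = 0.
Proof.
  intros H; unfold bump, gflat. destruct (Rlt_dec 0 x); [|ring].
  destruct (Rlt_dec 0 (-1 * x + 1)); [exfalso; apply H; lra|ring].
Qed.

Lemma bump_nonneg (x : R) : 0 <= bump x.
Proof.
  unfold bump, gflat. destruct (Rlt_dec 0 x); [|lra]. destruct (Rlt_dec 0 (-1 * x + 1)); [|lra].
  rewrite !pow_O, !Rmult_1_l. apply Rmult_le_pos; left; apply exp_pos.
Qed.

Lemma bump_mass : 0 < RInt bump 0 1.
Proof.
  apply RInt_gt_0; [lra| |intros; apply bump_cont].
  intros x Hx; unfold bump, gflat. destruct (Rlt_dec 0 x); [|lra]. destruct (Rlt_dec 0 (-1 * x + 1)); [|lra].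
  rewrite !pow_O, !Rmult_1_l. apply Rmult_lt_0_compat; apply exp_pos.
Qed.

Lemma RInt_eq_0 (f : R -> R) (a b : R) : (forall x, Rmin a b < x < Rmax a b -> f x = 0) -> RInt f a b = 0.
Proof.
  intros H; rewrite (RInt_ext f (fun _ => 0) a b H), (RInt_const (V := R_CompleteNormedModule)).
  apply Rmult_0_r.
Qed.

Definition step (x : R) : R := / RInt bump 0 1 * RInt bump 0 x.

Lemma step_derive (x : R) : is_derive step x (/ RInt bump 0 1 * bump x).
Proof.
  apply is_derive_scal. apply (is_derive_RInt (V := R_NormedModule) bump) with (a := 0); [|apply bump_cont].
  apply filter_forall; intros y. apply (RInt_correct bump), bump_ex.
Qed.

Lemma step_0 (x : R) : x <= 0 -> step x = 0.
Proof.
  intros H; unfold step. rewrite (RInt_eq_0 bump 0 x); [ring|].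
  intros y Hy; apply bump_zero. rewrite Rmin_right, Rmax_left in Hy by lra. lra.
Qed.

Lemma step_1 (x : R) : 1 <= x -> step x = 1.
Proof.
  intros H; unfold step. assert (Hm := bump_mass).
  assert (E : RInt bump 0 1 + RInt bump 1 x = RInt bump 0 x) by (apply (RInt_Chasles bump); apply bump_ex).
  rewrite (RInt_eq_0 bump 1 x) in E.
  - rewrite <- E; field; lra.
  - intros y Hy; apply bump_zero. rewrite Rmin_left, Rmax_right in Hy by lra. lra.
Qed.

Lemma step_bounds (x : R) : 0 <= step x <= 1.
Proof.
  destruct (Rle_dec x 0) as [H0|H0]; [rewrite step_0 by lra; lra|].
  destruct (Rle_dec 1 x) as [H1|H1]; [rewrite step_1 by lra; lra|].
  assert (Hm := bump_mass). unfold step.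
  assert (Hp : forall a b, a <= b -> 0 <= RInt bump a b) by
    (intros a b Hab; apply RInt_ge_0; [exact Hab|apply bump_ex|intros; apply bump_nonneg]).
  assert (E : RInt bump 0 x + RInt bump x 1 = RInt bump 0 1) by (apply (RInt_Chasles bump); apply bump_ex).
  generalize (Hp 0 x ltac:(lra)) (Hp x 1 ltac:(lra)); intros P1 P2.
  split; [apply Rmult_le_pos; [left; apply Rinv_0_lt_compat, Hm|exact P1]|].
  rewrite Rmult_comm; apply Rle_div_l; lra.
Qed.

Lemma step_smooth1 (n : nat) : smooth1 n (fun x => ind (0 <= x)) step.
Proof.
  assert (Hb : exists C, 0 <= C /\ forall y, Rabs (step y) <= C * ind (0 <= y)).
  { exists 1; split; [lra|]. intros y; destruct (Rle_dec 0 y).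
    - rewrite ind_true by assumption. generalize (step_bounds y); intros; rewrite Rabs_pos_eq; lra.
    - rewrite ind_false by assumption. rewrite step_0, Rabs_R0; lra. }
  assert (Hc : forall y, continuous step y).
  { intros y; apply (ex_derive_continuous (V := R_NormedModule)); eexists; apply step_derive. }
  destruct n; (split; [exact Hc|split; [exact Hb|]]); [exact I|].
  exists (fun x => / RInt bump 0 1 * bump x); split; [apply step_derive|].
  apply smooth1_scal, smooth1_weaken with (2 := bump_smooth1 n). exists 1; split; [lra|]. intros y.
  destruct (excluded_middle_informative (0 < y < 1)) as [H|H]; [rewrite !ind_true by lra; lra|].
  rewrite (ind_false _ H). generalize (ind_pos (0 <= y)); lra.
Qed.

Lemma step_compl_smooth1 (n : nat) : smooth1 n (fun x => ind (x <= 1)) (fun x => 1 - step x).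
Proof.
  assert (Hb : exists C, 0 <= C /\ forall y, Rabs (1 - step y) <= C * ind (y <= 1)).
  { exists 1; split; [lra|]. intros y; destruct (Rle_dec y 1).
    - rewrite ind_true by assumption. generalize (step_bounds y); intros; rewrite Rabs_pos_eq; lra.
    - rewrite ind_false by assumption. rewrite step_1, Rminus_diag, Rabs_R0; lra. }
  assert (Hd : forall y, is_derive (fun x => 1 - step x) y (- / RInt bump 0 1 * bump y)).
  { intros y. evar_last.
    - apply (is_derive_minus (V := R_NormedModule)); [apply (is_derive_const (V := R_NormedModule))|apply step_derive].
    - unfold minus, plus, opp, zero; simpl; ring. }
  assert (Hc : forall y, continuous (fun x => 1 - step x) y).
  { intros y; apply (ex_derive_continuous (V := R_NormedModule)); eexists; apply Hd. }
  destruct n; (split; [exact Hc|split; [exact Hb|]]); [exact I|].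
  exists (fun x => - / RInt bump 0 1 * bump x); split; [apply Hd|].
  apply smooth1_scal, smooth1_weaken with (2 := bump_smooth1 n). exists 1; split; [lra|]. intros y.
  destruct (excluded_middle_informative (0 < y < 1)) as [H|H]; [rewrite !ind_true by lra; lra|].
  rewrite (ind_false _ H). generalize (ind_pos (y <= 1)); lra.
Qed.

(** An even cutoff: 0 for [|p| <= m] and, when [m >= 0], 1 for [|p| >= m + 1]. The sum of two
    one-sided steps avoids the corner of [|p|] at 0. *)
Definition Psi (m p : R) : R := step (1 * p + - m) + step (-1 * p + - m).

Lemma Psi_0 (m p : R) : Rabs p <= m -> Psi m p = 0.
Proof.
  intros H; unfold Psi. rewrite !step_0; [ring| |]; revert H; unfold Rabs; destruct (Rcase_abs p); lra.
Qed.

Lemma Psi_1 (m p : R) : 0 <= m -> m + 1 <= Rabs p -> Psi m p = 1.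
Proof.
  intros Hm H; unfold Psi. revert H; unfold Rabs; destruct (Rcase_abs p); intros H.
  - rewrite (step_0 (1 * p + - m)), (step_1 (-1 * p + - m)) by lra; ring.
  - rewrite (step_1 (1 * p + - m)), (step_0 (-1 * p + - m)) by lra; ring.
Qed.

Lemma Psi_bounds (m p : R) : 0 <= m -> 0 <= Psi m p <= 1.
Proof.
  intros Hm; unfold Psi. destruct (Rle_dec p 0).
  - rewrite (step_0 (1 * p + - m)) by lra. generalize (step_bounds (-1 * p + - m)); lra.
  - rewrite (step_0 (-1 * p + - m)) by lra. generalize (step_bounds (1 * p + - m)); lra.
Qed.

Lemma Psi_even (m p : R) : Psi m (- p) = Psi m p.
Proof. unfold Psi. replace (1 * - p) with (-1 * p) by ring. replace (-1 * - p) with (1 * p) by ring. ring. Qed.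

Lemma Psi_smooth1 (m : R) (n : nat) : smooth1 n (fun p => ind (m <= Rabs p)) (Psi m).
Proof.
  apply smooth1_plus.
  - apply smooth1_weaken with (2 := smooth1_affine n _ _ 1 (- m) (step_smooth1 n)).
    exists 1; split; [lra|]. intros p; destruct (Rle_dec 0 (1 * p + - m)).
    + rewrite !ind_true; [lra| |assumption]. generalize (Rle_abs p); lra.
    + rewrite (ind_false (0 <= 1 * p + - m)) by assumption. generalize (ind_pos (m <= Rabs p)); lra.
  - apply smooth1_weaken with (2 := smooth1_affine n _ _ (-1) (- m) (step_smooth1 n)).
    exists 1; split; [lra|]. intros p; destruct (Rle_dec 0 (-1 * p + - m)).
    + rewrite !ind_true; [lra| |assumption]. generalize (Rle_abs (- p)); rewrite Rabs_Ropp; lra.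
    + rewrite (ind_false (0 <= -1 * p + - m)) by assumption. generalize (ind_pos (m <= Rabs p)); lra.
Qed.

Lemma Psi_compl_smooth1 (m : R) (n : nat) : 0 <= m -> smooth1 n (fun p => ind (Rabs p <= m + 1)) (fun p => 1 - Psi m p).
Proof.
  intros Hm.
  (* For [m >= 0] at most one of the two steps is nonzero, so the complement factorises; the product
     rule for [smooth1] then yields the indicator of a bounded set. *)
  replace (fun p => 1 - Psi m p) with (fun p => (1 - step (1 * p + - m)) * (1 - step (-1 * p + - m))).
  - apply smooth1_weaken with (2 := smooth1_mult n _ _ _ _ (smooth1_affine n _ _ 1 (- m) (step_compl_smooth1 n)) (smooth1_affine n _ _ (-1) (- m) (step_compl_smooth1 n))).
    exists 1; split; [lra|]. intros p. destruct (Rle_dec (Rabs p) (m + 1)) as [H|H].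
    + rewrite (ind_true _ H). generalize (ind_pos (1 * p + - m <= 1)) (ind_le_1 (1 * p + - m <= 1))
       (ind_pos (-1 * p + - m <= 1)) (ind_le_1 (-1 * p + - m <= 1)); nra.
    + rewrite (ind_false (Rabs p <= m + 1)) by exact H. revert H; unfold Rabs; destruct (Rcase_abs p); intros H.
      * rewrite (ind_false (-1 * p + - m <= 1)) by lra; lra.
      * rewrite (ind_false (1 * p + - m <= 1)) by lra; lra.
  - apply functional_extensionality; intros p; unfold Psi. destruct (Rle_dec p 0).
    + rewrite (step_0 (1 * p + - m)) by lra. ring.
    + rewrite (step_0 (-1 * p + - m)) by lra. ring.
Qed.

(** Termwise comparison with the exponential series. *)
Lemma CV_radius_fact (b : nat -> R) : (forall n, Rabs (b n) <= / INR (Factorial.fact n)) ->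
  forall x, Rbar_lt (Rabs x) (CV_radius b) /\ Rabs (PSeries b x) <= exp (Rabs x).
Proof.
  intros Hb.
  assert (Hs : forall r, is_series (fun n => / INR (Factorial.fact n) * Rabs r ^ n) (exp (Rabs r))).
  { intros r; apply is_pseries_R, is_exp_Reals. }
  assert (Hle : forall r n, Rabs (b n * r ^ n) <= / INR (Factorial.fact n) * Rabs r ^ n).
  { intros r n; rewrite Rabs_mult, <- RPow_abs. apply Rmult_le_compat_r; [apply pow_le, Rabs_pos|apply Hb]. }
  assert (Hd : forall r, CV_disk b r).
  { intros r; unfold CV_disk.
    apply (ex_series_le (V := R_CompleteNormedModule)) with (b := fun n => / INR (Factorial.fact n) * Rabs r ^ n).
    - intros n; unfold norm; simpl; unfold abs; simpl; rewrite Rabs_Rabsolu; apply Hle.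
    - eexists; apply Hs. }
  intros x; split.
  - apply Rbar_lt_le_trans with (Finite (Rabs x + 1)); [simpl; lra|].
    unfold CV_radius. apply (Lub_Rbar_correct (CV_disk b)), Hd.
  - unfold PSeries. eapply Rle_trans; [apply Series_Rabs, Hd|].
    rewrite <- (is_series_unique _ _ (Hs x)). apply Series_le.
    + intros n; split; [apply Rabs_pos|apply Hle].
    + eexists; apply Hs.
Qed.

Definition shc_coef (l n : nat) : R :=
  INR (Factorial.fact (n + l)) / INR (Factorial.fact n) / INR (Factorial.fact (2 * (n + l) + 1)).

(** [shc 0 y = sinh (sqrt y) / sqrt y], continued analytically to [y <= 0]; [shc l] is its [l]-th derivative. *)
Definition shc (l : nat) (y : R) : R := PSeries (shc_coef l) y.

Lemma fact_INR_pos n : 0 < INR (Factorial.fact n).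
Proof. apply INR_fact_lt_0. Qed.

Lemma shc_coef_bd (l n : nat) : Rabs (shc_coef l n) <= / INR (Factorial.fact n).
Proof.
  unfold shc_coef. assert (H1 := fact_INR_pos n). assert (H2 := fact_INR_pos (n + l)).
  assert (H3 := fact_INR_pos (2 * (n + l) + 1)).
  rewrite Rabs_pos_eq.
  - assert (H : INR (Factorial.fact (n + l)) <= INR (Factorial.fact (2 * (n + l) + 1))).
    { apply le_INR, Factorial.fact_le; lia. }
    unfold Rdiv. rewrite (Rmult_comm (INR (Factorial.fact (n + l)))), Rmult_assoc.
    rewrite <- (Rmult_1_r (/ INR (Factorial.fact n))) at 2. apply Rmult_le_compat_l; [left; apply Rinv_0_lt_compat, H1|].
    apply Rle_div_l; lra.
  - repeat apply Rdiv_le_0_compat; lra.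
Qed.

Lemma shc_derive (l : nat) (y : R) : is_derive (shc l) y (shc (S l) y).
Proof.
  unfold shc. replace (shc_coef (S l)) with (PS_derive (shc_coef l)).
  - apply is_derive_PSeries, CV_radius_fact, shc_coef_bd.
  - apply functional_extensionality; intros n; unfold PS_derive, shc_coef.
    replace (S n + l)%nat with (n + S l)%nat by lia.
    change (Factorial.fact (S n)) with (S n * Factorial.fact n)%nat. rewrite mult_INR.
    field. repeat split; try (apply Rgt_not_eq, fact_INR_pos). apply not_0_INR; lia.
Qed.

Lemma shc_smooth1 (n l : nat) : smooth1 n (fun y => exp (Rabs y)) (shc l).
Proof.
  revert l; induction n; intros l; (split; [|split]).
  all: try (intros y; apply (ex_derive_continuous (V := R_NormedModule)); eexists; apply shc_derive).
  all: try (exists 1; split; [lra|]; intros y; rewrite Rmult_1_l; apply CV_radius_fact, shc_coef_bd).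
  - exact I.
  - exists (shc (S l)); split; [apply shc_derive|apply IHn].
Qed.

(** The function [cosh (sqrt y)], continued analytically to [y <= 0]. *)
Definition chc (y : R) : R := PSeries (fun n => / INR (Factorial.fact (2 * n))) y.

Lemma chc_coef_bd (n : nat) : Rabs (/ INR (Factorial.fact (2 * n))) <= / INR (Factorial.fact n).
Proof.
  rewrite Rabs_pos_eq by (left; apply Rinv_0_lt_compat, fact_INR_pos).
  apply Rinv_le_contravar; [apply fact_INR_pos|]. apply le_INR, Factorial.fact_le; lia.
Qed.

Lemma chc_derive (y : R) : is_derive chc y (shc 0 y / 2).
Proof.
  unfold chc, shc.
  replace (PSeries (shc_coef 0) y / 2) with (PSeries (PS_derive (fun n => / INR (Factorial.fact (2 * n)))) y).
  - apply is_derive_PSeries, CV_radius_fact, chc_coef_bd.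
  - unfold Rdiv; rewrite Rmult_comm, <- PSeries_scal. apply PSeries_ext; intros n.
    unfold PS_derive, PS_scal, shc_coef. change (scal (/ 2) ?x) with (/ 2 * x).
    rewrite !Nat.add_0_r. replace (2 * S n)%nat with (S (S (2 * n))) by lia.
    replace (2 * n + 1)%nat with (S (2 * n)) by lia.
    change (Factorial.fact (S (S (2 * n)))) with (S (S (2 * n)) * Factorial.fact (S (2 * n)))%nat.
    rewrite mult_INR.
    replace (INR (S (S (2 * n)))) with (2 * INR (S n)) by (rewrite !S_INR, mult_INR; simpl; ring).
    field. repeat split; try (apply Rgt_not_eq, fact_INR_pos). apply not_0_INR; lia.
Qed.

(** With [y = r^2 z] this says that [r * shc 0 (r^2 z)] has the derivative [chc (r^2 z)] in [r]: the
    identity [(sinh (lam r) / lam)' = cosh (lam r)] freed of square roots, so that frequencies with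
    [symb k <= 0] are included. *)
Lemma shc_chc (y : R) : shc 0 y + 2 * y * shc 1 y = chc y.
Proof.
  unfold shc, chc.
  replace (2 * y * PSeries (shc_coef 1) y) with (PSeries (PS_scal 2 (PS_incr_1 (shc_coef 1))) y)
    by (rewrite PSeries_scal, PSeries_incr_1; ring).
  rewrite <- PSeries_plus.
  - apply PSeries_ext; intros n. unfold PS_plus, PS_scal, PS_incr_1, plus, scal, zero; simpl; unfold mult; simpl.
    destruct n as [|n].
    + unfold shc_coef; simpl; field.
    + unfold shc_coef. rewrite !Nat.add_0_r.
      replace (n + 1)%nat with (S n) by lia.
      replace (S n + S n)%nat with (2 * S n)%nat by lia.
      replace (2 * S n + 1)%nat with (S (2 * S n)) by lia.
      change (Factorial.fact (S (2 * S n))) with (S (2 * S n) * Factorial.fact (2 * S n))%nat.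
      change (Factorial.fact (S n)) with (S n * Factorial.fact n)%nat.
      rewrite !mult_INR. rewrite (S_INR (2 * S n)), mult_INR, (S_INR n).
      replace (INR 2) with 2 by (simpl; ring).
      field. repeat split; try (apply Rgt_not_eq, fact_INR_pos); generalize (pos_INR n); intros; lra.
  - apply CV_radius_inside, CV_radius_fact, shc_coef_bd.
  - apply (ex_pseries_scal (V := R_NormedModule)); [apply Rmult_comm|].
    apply ex_pseries_incr_1, CV_radius_inside, CV_radius_fact, shc_coef_bd.
Qed.

Lemma chc_0 : chc 0 = 1.
Proof. unfold chc; rewrite PSeries_0; simpl; field. Qed.

(** * The dispersion relation and the Green's function *)

(** Symbol classes: size [w], and one more factor [rt] with every [k]-derivative. *)
Definition pw {P : UniformSpace} (w rt : R -> P -> R) (j : nat) (k : R) (p : P) : R := w k p * rt k p ^ j.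

Lemma wcompat_pw {P : UniformSpace} (Dm : R -> P -> Prop) (w w' w'' rt : R -> P -> R) :
  (forall k p, Dm k p -> 0 <= rt k p) ->
  wle Dm (fun k p => w k p * w' k p) w'' -> wcompat Dm 0 (pw w rt) (pw w' rt) (pw w'' rt).
Proof.
  intros Hr (C & HC & H) a b; exists C; split; [exact HC|]. intros k p Hkp; unfold pw; simpl.
  rewrite pow_add.
  replace (w k p * rt k p ^ a * (w' k p * rt k p ^ b)) with (w k p * w' k p * (rt k p ^ a * rt k p ^ b)) by ring.
  replace (C * (w'' k p * (rt k p ^ a * rt k p ^ b))) with (C * w'' k p * (rt k p ^ a * rt k p ^ b)) by ring.
  apply Rmult_le_compat_r; [apply Rmult_le_pos; apply pow_le; auto|auto].
Qed.

Lemma wcompat_pw1 {P : UniformSpace} (Dm : R -> P -> Prop) (w rt : R -> P -> R) :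
  wcompat Dm 1 (pw w rt) (pw rt rt) (pw w rt).
Proof.
  intros a b; exists 1; split; [lra|]. intros k p Hkp; unfold pw.
  rewrite Rmult_1_l. simpl. rewrite pow_add. right; ring.
Qed.

Lemma jcont_k {P : UniformSpace} (f : R -> R) (k : R) (p : P) : continuous f k -> jcont (fun k _ => f k) k p.
Proof. intros H; apply (continuous_comp (fun q : R * P => fst q) f); [apply continuous_fst'|exact H]. Qed.

Lemma jcont_p {P : UniformSpace} (f : P -> R) (k : R) (p : P) : continuous f p -> jcont (fun _ p => f p) k p.
Proof. intros H; apply (continuous_comp (fun q : R * P => snd q) f); [apply continuous_snd'|exact H]. Qed.

Lemma jcont_mult {P : UniformSpace} (F G : R -> P -> R) (k : R) (p : P) :
  jcont F k p -> jcont G k p -> jcont (fun k p => F k p * G k p) k p.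
Proof. intros; apply (continuous_mult (K := R_AbsRing)); assumption. Qed.

Lemma jcont_comp {P : UniformSpace} (e : R -> R) (F : R -> P -> R) (k : R) (p : P) :
  jcont F k p -> continuous e (F k p) -> jcont (fun k p => e (F k p)) k p.
Proof. intros H He; apply (continuous_comp (fun q : R * P => F (fst q) (snd q)) e); assumption. Qed.

Lemma continuous_of_derive (f : R -> R) (x l : R) : is_derive f x l -> continuous f x.
Proof. intros H; apply (ex_derive_continuous (V := R_NormedModule)); eexists; exact H. Qed.

Definition symb (k : R) : R := k ^ 4 - k ^ 2.
Definition lam (k : R) : R := sqrt (symb k).
(** Logarithmic derivative of [lam] ([lam_derive]). *)
Definition ell (k : R) : R := / k + / 2 * (/ (k - 1) + / (k - -1)).
(** The coefficient of [exp (- lam |tau - s|)] in the decaying fundamental solution of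
    [w'' = lam^2 w - k^2 N]. *)
Definition amp (k : R) : R := k ^ 2 / (2 * lam k).

Lemma symb_pos (k : R) : 4 < k ^ 2 -> 0 < symb k.
Proof. intros H; unfold symb. replace (k ^ 4) with (k ^ 2 * k ^ 2) by ring. nra. Qed.

Lemma lam_sq (k : R) : 4 < k ^ 2 -> lam k * lam k = symb k.
Proof. intros H; apply sqrt_sqrt; left; apply symb_pos, H. Qed.

(** The condition [k^2 > 4] stays away from the zero of [symb] at [k^2 = 1]: it gives
    [k^4 - k^2 >= k^4 / 4]. *)
Lemma lam_ge (k : R) : 4 < k ^ 2 -> k ^ 2 / 2 <= lam k.
Proof.
  intros H; unfold lam. rewrite <- (sqrt_pow2 (k ^ 2 / 2)) by lra. apply sqrt_le_1_alt.
  unfold symb. replace (k ^ 4) with (k ^ 2 * k ^ 2) by ring. nra.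
Qed.

Lemma lam_le (k : R) : lam k <= k ^ 2.
Proof.
  unfold lam. rewrite <- (sqrt_pow2 (k ^ 2)) by (generalize (pow2_ge_0 k); lra). apply sqrt_le_1_alt.
  unfold symb. generalize (pow2_ge_0 k); intros. replace (k ^ 4) with ((k ^ 2) ^ 2) by ring. lra.
Qed.

Lemma sq_gt_4 (k : R) : 4 < k ^ 2 -> 2 < Rabs k.
Proof.
  intros H. rewrite <- pow2_abs in H. destruct (Rlt_dec 2 (Rabs k)); [assumption|].
  generalize (Rabs_pos k); nra.
Qed.

Lemma lam_derive (k : R) : 4 < k ^ 2 -> is_derive lam k (lam k * ell k).
Proof.
  intros H. assert (Hz := symb_pos k H). assert (Ha := sq_gt_4 k H). assert (Hs := lam_sq k H).
  assert (Hl : 0 < lam k) by (apply sqrt_lt_R0, Hz).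
  assert (Hd : is_derive symb k (4 * k ^ 3 - 2 * k)) by (unfold symb; auto_derive; [exact I|ring]).
  assert (K0 : k <> 0) by (intros ->; simpl in H; lra).
  assert (Hk1 : k - 1 <> 0) by (intros E; replace k with 1 in H by lra; simpl in H; lra).
  assert (Hk2 : k - -1 <> 0) by (intros E; replace k with (-1) in H by lra; simpl in H; lra).
  evar_last; [apply is_derive_sqrt; [exact Hd|exact Hz]|].
  fold (lam k). apply Rmult_eq_reg_r with (2 * lam k); [|lra].
  replace (lam k * ell k * (2 * lam k)) with (2 * (lam k * lam k) * ell k) by ring. rewrite Hs.
  unfold ell, symb. field. lra.
Qed.

Lemma amp_derive (k : R) : 4 < k ^ 2 -> is_derive amp k (amp k * (2 * / (k - 0) + -1 * ell k)).
Proof.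
  intros H. assert (Hl : 0 < lam k) by (apply sqrt_lt_R0, symb_pos, H).
  assert (K0 : k <> 0) by (intros ->; simpl in H; lra).
  evar_last.
  - unfold amp. apply (is_derive_div (fun k => k ^ 2) (fun k => 2 * lam k) k (2 * k) (2 * (lam k * ell k))).
    + auto_derive; [exact I|ring].
    + apply is_derive_scal, lam_derive, H.
    + lra.
  - unfold amp. generalize (ell k); intros e. rewrite Rminus_0_r. field. lra.
Qed.

Section Symbols.
Context {P : UniformSpace}.
Variables (Dm : R -> P -> Prop) (rt : R -> P -> R) (C0 : R).
Hypothesis Dm_large : forall k p, Dm k p -> 4 < k ^ 2.
Hypothesis rt_pos : forall k p, Dm k p -> 0 <= rt k p.
Hypothesis C0_pos : 0 <= C0.
Hypothesis rt_inv : forall k p, Dm k p -> / Rabs k <= C0 * rt k p.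

Lemma inv_symbol (c : R) (n : nat) : Rabs c <= 1 -> ksmooth Dm n (pw rt rt) (fun k (_ : P) => / (k - c)).
Proof.
  intros Hc.
  assert (Hnz : forall k p, Dm k p -> Rabs k / 2 <= Rabs (k - c)).
  { intros k p Hkp. assert (H2 := sq_gt_4 k (Dm_large k p Hkp)). generalize (Rabs_triang_inv k c); lra. }
  assert (Hd : forall k p, Dm k p -> is_derive (fun y => / (y - c)) k (-1 * (/ (k - c) * / (k - c)))).
  { intros k p Hkp. assert (k - c <> 0).
    { intros E. assert (H := Hnz k p Hkp). rewrite E, Rabs_R0 in H. generalize (sq_gt_4 k (Dm_large k p Hkp)); lra. }
    auto_derive; [exact H|field; exact H]. }
  induction n; (split; [|split]).
  all: try (intros k p Hkp; apply jcont_k, (continuous_of_derive _ _ _ (Hd k p Hkp))).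
  all: try (exists (2 * C0); split; [lra|]; intros k p Hkp; unfold pw; rewrite pow_O, Rmult_1_r, Rabs_inv;
    assert (H := Hnz k p Hkp); assert (H2 := sq_gt_4 k (Dm_large k p Hkp)); assert (H3 := rt_inv k p Hkp);
    apply Rle_trans with (/ (Rabs k / 2)); [apply Rinv_le_contravar; lra|];
    replace (/ (Rabs k / 2)) with (2 * / Rabs k) by (field; lra); lra).
  - exact I.
  - exists (fun k _ => -1 * (/ (k - c) * / (k - c))); split; [exact Hd|].
    apply ksmooth_scal, (ksmooth_mult Dm n _ _ _ _ _ IHn IHn).
    intros a b; exists 1; split; [lra|]. intros k p Hkp; unfold pw. simpl. rewrite pow_add. right; ring.
Qed.

Lemma ell_symbol (n : nat) : ksmooth Dm n (pw rt rt) (fun k (_ : P) => ell k).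
Proof.
  apply ksmooth_ext with (F := fun k (_ : P) => / (k - 0) + / 2 * (/ (k - 1) + / (k - -1))).
  { intros k p; unfold ell; rewrite Rminus_0_r; reflexivity. }
  apply ksmooth_plus; [apply inv_symbol; rewrite Rabs_R0; lra|apply ksmooth_scal, ksmooth_plus; apply inv_symbol].
  - rewrite Rabs_R1; lra.
  - rewrite Rabs_left; lra.
Qed.

Lemma amp_symbol (n : nat) : ksmooth Dm n (pw (fun _ _ => 1) rt) (fun k (_ : P) => amp k).
Proof.
  revert n; apply (ksmooth_logder Dm _ (pw rt rt) (fun k _ => amp k) (fun k _ => 2 * / (k - 0) + -1 * ell k)).
  - intros n; apply ksmooth_plus; apply ksmooth_scal; [apply inv_symbol; rewrite Rabs_R0; lra|apply ell_symbol].
  - intros k p Hkp; apply jcont_k, (continuous_of_derive _ _ _ (amp_derive k (Dm_large k p Hkp))).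
  - exists 1; split; [lra|]; intros k p Hkp; unfold pw; rewrite pow_O. assert (H := Dm_large k p Hkp).
    assert (H1 := lam_ge k H). assert (Hl : 0 < lam k) by lra. unfold amp. rewrite Rabs_pos_eq.
    + apply Rle_div_l; lra.
    + apply Rdiv_le_0_compat; lra.
  - intros k p Hkp; apply amp_derive, (Dm_large k p Hkp).
  - apply wcompat_pw1.
Qed.

(** The powers [i] are carried along because a [k]-derivative turns [x^i exp (-x)], with
    [x = lam * len], into [ell] times a combination of the powers [i] and [i + 1]. Half of the
    exponential absorbs any such power, and [lam >= k^2 / 2] turns the other half into the Gaussian
    bound. *)
Lemma exp_symbol (len : P -> R) (w : R -> P -> R) : (forall k p, Dm k p -> continuous len p) ->
  (forall k p, Dm k p -> 0 <= len p) ->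
  (forall k p, Dm k p -> exp (- (k ^ 2 * len p / 4)) <= w k p) ->
  forall n i, ksmooth Dm n (pw w rt) (fun k p => (lam k * len p) ^ i * exp (- (lam k * len p))).
Proof.
  intros Hlc Hl0 Hw.
  assert (Hd : forall i k p, Dm k p -> is_derive (fun y => (lam y * len p) ^ i * exp (- (lam y * len p))) k
     (ell k * (INR i * ((lam k * len p) ^ i * exp (- (lam k * len p))) + -1 * ((lam k * len p) ^ S i * exp (- (lam k * len p)))))).
  { intros i k p Hkp. assert (H := lam_derive k (Dm_large k p Hkp)).
    assert (Hl : is_derive (fun y => lam y * len p) k (lam k * ell k * len p)).
    { evar_last; [apply (is_derive_mult lam (fun _ => len p) k (lam k * ell k) 0);
        [exact H|apply (is_derive_const (V := R_NormedModule))|intros; apply Rmult_comm]|].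
      unfold plus, mult; simpl; unfold mult; simpl; ring. }
    assert (Hx : is_derive (fun y => y ^ i * exp (- y)) (lam k * len p)
      (INR i * (lam k * len p) ^ pred i * exp (- (lam k * len p)) - (lam k * len p) ^ i * exp (- (lam k * len p)))).
    { auto_derive; [exact I|]. ring. }
    evar_last; [apply (is_derive_comp (fun y => y ^ i * exp (- y)) (fun y => lam y * len p) k _ _ Hx Hl)|].
    unfold scal; simpl; unfold mult; simpl. destruct i; [simpl; ring|]. simpl pred. change ((lam k * len p) ^ S i) with ((lam k * len p) * (lam k * len p) ^ i). ring. }
  assert (Hb : forall i, exists C, 0 <= C /\ forall k p, Dm k p ->
     Rabs ((lam k * len p) ^ i * exp (- (lam k * len p))) <= C * pw w rt 0 k p).
  { intros i. destruct (pow_exp_bound i) as (C & HC & H). exists C; split; [lra|]. intros k p Hkp.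
    assert (Hlg := lam_ge k (Dm_large k p Hkp)). assert (Hk := Dm_large k p Hkp). assert (Hl := Hl0 k p Hkp).
    assert (H0 : 0 <= lam k * len p) by (apply Rmult_le_pos; lra).
    rewrite Rabs_pos_eq by (apply Rmult_le_pos; [apply pow_le, H0|left; apply exp_pos]).
    eapply Rle_trans; [apply H, H0|]. apply Rmult_le_compat_l; [lra|]. unfold pw; rewrite pow_O, Rmult_1_r.
    eapply Rle_trans; [|apply Hw, Hkp].
    assert (Hle : - (lam k * len p / 2) <= - (k ^ 2 * len p / 4)) by nra.
    destruct (Rle_lt_or_eq_dec _ _ Hle) as [h|h]; [left; apply exp_increasing, h|rewrite h; right; reflexivity]. }
  assert (Hc : forall i k p, Dm k p -> jcont (fun k p => (lam k * len p) ^ i * exp (- (lam k * len p))) k p).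
  { intros i k p Hkp. apply (jcont_comp (fun y => y ^ i * exp (- y)) (fun k p => lam k * len p)).
    - apply jcont_mult; [apply jcont_k, (continuous_of_derive _ _ _ (lam_derive k (Dm_large k p Hkp)))|apply jcont_p, (Hlc k p Hkp)].
    - apply (ex_derive_continuous (V := R_NormedModule)); auto_derive; exact I. }
  induction n; intros i; (split; [apply Hc|split; [apply Hb|]]); [exact I|].
  eexists; split; [intros k p Hkp; apply (Hd i k p Hkp)|].
  apply (ksmooth_mult Dm n (pw rt rt) (pw w rt) _ (fun k _ => ell k)
    (fun k p => INR i * ((lam k * len p) ^ i * exp (- (lam k * len p))) + -1 * ((lam k * len p) ^ S i * exp (- (lam k * len p))))).
  - apply ell_symbol.
  - apply ksmooth_plus; apply ksmooth_scal, IHn.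
  - intros a b; exists 1; split; [lra|]; intros k p Hkp; unfold pw; simpl; rewrite pow_add; right; ring.
Qed.

Lemma amp_exp_symbol (len : P -> R) (w : R -> P -> R) : (forall k p, Dm k p -> continuous len p) ->
  (forall k p, Dm k p -> 0 <= len p) ->
  (forall k p, Dm k p -> exp (- (k ^ 2 * len p / 4)) <= w k p) ->
  forall n, ksmooth Dm n (pw w rt) (fun k p => amp k * exp (- (lam k * len p))).
Proof.
  intros H1 H2 H3 n.
  apply (ksmooth_mult Dm n (pw (fun _ _ => 1) rt) (pw w rt) (pw w rt) (fun k _ => amp k) (fun k p => exp (- (lam k * len p)))).
  - apply amp_symbol.
  - apply ksmooth_ext with (F := fun k p => (lam k * len p) ^ 0 * exp (- (lam k * len p))); [intros; rewrite pow_O; ring|].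
    apply exp_symbol; assumption.
  - apply wcompat_pw; [exact rt_pos|]. exists 1; split; [lra|]; intros; lra.
Qed.
End Symbols.

Notation RR := (prod_UniformSpace R_UniformSpace R_UniformSpace).

(** A pair [p] is [(tau, sigma)]: the kernel carries the source at [sigma] to the value at [tau]. *)
Definition Dk (T1 : R) (k : R) (p : RR) : Prop := 0 < fst p /\ snd p < 2 * T1.
(** For [T1 >= 1] and [snd p < 2 * T1], the inequality [|AA k p| >= mm T1] forces both [k^2 > 4],
    where [lam] is real and comparable to [k^2], and [k^2 * snd p >= 16], which pays for the change
    of weights in [kap_weight]. Subtracting 1 still leaves [k^2 > 4]. *)
Definition mm (T1 : R) : R := 1 + 3 * T1.
Definition rts (k : R) (p : RR) : R := sqrt (snd p).
Definition AA (k : R) (p : RR) : R := k * sqrt (snd p).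
(** [AA ^ 2 * QQ] is [k^2 (sigma - tau)^+] and [ZZ] is [symb k ((sigma - tau)^+)^2] in the scaling variable [k sqrt sigma]. *)
Definition QQ (p : RR) : R := Rmax (snd p - fst p) 0 / Rmax (snd p) (fst p).
Definition ZZ (k : R) (p : RR) : R := QQ p ^ 2 * (AA k p ^ 4 - (sqrt (snd p) * sqrt (snd p)) * AA k p ^ 2).

Definition green_decay (T1 k : R) (p : RR) : R := Psi (mm T1) (AA k p) * (amp k * exp (- (lam k * Rabs (fst p - snd p)))).
Definition green_volterra (T1 k : R) (p : RR) : R := (1 - Psi (mm T1) (AA k p)) * (AA k p ^ 2 * QQ p * shc 0 (ZZ k p)).

(** Green's function of [w'' = (k^4 - k^2) w - k^2 N]: it decays in [|tau - sigma|] where [k^2 sigma] is large,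
    and is the Volterra kernel where [k^2 sigma] is small, so that it annihilates the singularity of [N] at [sigma = 0]. *)
Definition green (T1 k : R) (p : RR) : R := green_decay T1 k p + -1 * green_volterra T1 k p.

(** The size of [green]: bounded for [tau <= s]; for [s < tau] only the decaying kernel acts, and
    only where its cutoff permits. *)
Definition kap (T1 k : R) (p : RR) : R :=
  ind (fst p <= snd p) + ind (snd p < fst p) * ind (mm T1 <= Rabs (AA k p)) * exp (- (k ^ 2 * (fst p - snd p) / 4)).

Lemma continuous_Rmax {U : UniformSpace} (f g : U -> R) (x : U) : continuous f x -> continuous g x ->
  continuous (fun y => Rmax (f y) (g y)) x.
Proof.
  intros Hf Hg.
  apply continuous_ext with (f := fun y => / 2 * (f y + g y + Rabs (f y - g y))).
  { intros y; unfold Rmax, Rabs; destruct (Rle_dec (f y) (g y)), (Rcase_abs (f y - g y)); lra. }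
  apply (continuous_mult (K := R_AbsRing)); [apply continuous_const|].
  apply (continuous_plus (V := R_NormedModule)); [apply (continuous_plus (V := R_NormedModule)); assumption|].
  apply (continuous_comp (fun y => f y - g y) Rabs); [apply (continuous_minus (V := R_NormedModule)); assumption|apply continuous_Rabs].
Qed.

Lemma continuous_sqrt_snd (p : RR) : continuous (fun p : RR => sqrt (snd p)) p.
Proof. apply (continuous_comp (fun p : RR => snd p) sqrt); [apply continuous_snd'|apply continuous_sqrt]. Qed.

Lemma AA_jcont (k : R) (p : RR) : jcont AA k p.
Proof.
  apply (jcont_mult (fun k _ => k) (fun _ p => sqrt (snd p))); [apply (jcont_k (fun k => k)), continuous_id|apply (jcont_p (fun p : RR => sqrt (snd p))), continuous_sqrt_snd].
Qed.

Lemma locally_AA (k : R) (p : RR) (Q : R -> Prop) : locally (Rabs (AA k p)) Q ->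
  locally (k, p) (fun q : R * RR => Q (Rabs (AA (fst q) (snd q)))).
Proof.
  intros H. assert (Hc : continuous (fun q : R * RR => Rabs (AA (fst q) (snd q))) (k, p)).
  { apply (continuous_comp (fun q : R * RR => AA (fst q) (snd q)) Rabs); [apply AA_jcont|apply continuous_Rabs]. }
  apply Hc; exact H.
Qed.

Lemma locally_Dk (T1 k : R) (p : RR) : Dk T1 k p -> locally (k, p) (fun q : R * RR => Dk T1 (fst q) (snd q)).
Proof.
  intros [H1 H2]; destruct p as [t s]; simpl in *.
  apply (locally_snd (fun p : RR => 0 < fst p /\ snd p < 2 * T1) k (t, s)). apply filter_and.
  - apply (locally_fst (fun y => 0 < y)), locally_pos, H1.
  - apply (locally_snd (fun y => y < 2 * T1)), locally_lt, H2.
Qed.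

Lemma rts_symbol (Dm : R -> RR -> Prop) (n : nat) : ksmooth Dm n (pw rts rts) rts.
Proof.
  apply (ksmooth_const_k Dm n (pw rts rts) (fun p => sqrt (snd p))).
  - intros; apply continuous_sqrt_snd.
  - exists 1; split; [lra|]; intros k p _; unfold pw, rts; rewrite pow_O, Rabs_pos_eq by apply sqrt_pos; lra.
  - intros j k p _; unfold pw, rts; apply Rmult_le_pos; [|apply pow_le]; apply sqrt_pos.
Qed.

Lemma AA_derive (k : R) (p : RR) : is_derive (fun y => AA y p) k (rts k p).
Proof. unfold AA, rts; generalize (sqrt (snd p)); intros c; auto_derive; [exact I|ring]. Qed.

Lemma rts_pos (k : R) (p : RR) : 0 <= rts k p.
Proof. apply sqrt_pos. Qed.

Lemma ge_AA (T1 k : R) (p : RR) : 1 <= T1 -> Dk T1 k p -> mm T1 - 1 < Rabs (AA k p) ->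
  4 < k ^ 2 /\ / Rabs k <= 1 * rts k p.
Proof.
  intros HT [H1 H2] H. unfold mm, AA in H. unfold rts. rewrite Rabs_mult, (Rabs_pos_eq (sqrt _)) in H by apply sqrt_pos.
  assert (Hs := sqrt_pos (snd p)). assert (Hk := Rabs_pos k).
  assert (Hs2 : sqrt (snd p) * sqrt (snd p) < 2 * T1).
  { destruct (Rle_dec 0 (snd p)); [rewrite sqrt_sqrt; lra|]. rewrite (sqrt_neg_0 (snd p)) by lra; lra. }
  assert (Hks : 0 < Rabs k) by (destruct (Rle_lt_or_eq_dec _ _ Hk) as [|E]; [assumption|rewrite <- E in H; nra]).
  split.
  - rewrite <- (pow2_abs k).
    assert (9 * T1 * T1 < (Rabs k * sqrt (snd p)) * (Rabs k * sqrt (snd p))) by nra.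
    replace (Rabs k * sqrt (snd p) * (Rabs k * sqrt (snd p))) with (Rabs k ^ 2 * (sqrt (snd p) * sqrt (snd p))) in H0 by ring.
    assert (0 < Rabs k ^ 2) by (apply pow_lt, Hks). nra.
  - rewrite Rmult_1_l. apply Rmult_le_reg_l with (Rabs k); [exact Hks|]. rewrite Rinv_r by lra. lra.
Qed.

Lemma kap_pos (T1 k : R) (p : RR) : 0 <= kap T1 k p.
Proof.
  unfold kap. apply Rplus_le_le_0_compat; [apply ind_pos|]. repeat apply Rmult_le_pos; try apply ind_pos. left; apply exp_pos.
Qed.

(** A [k]-derivative of the cutoff produces [sqrt s], one of the amplitude or the exponential
    produces [1 / |k|]. On the support of the cutoff [1 / |k| <= sqrt s], so both gains are measured
    by [rts]. *)
Lemma green_decay_symbol (T1 : R) (n : nat) : 1 <= T1 -> ksmooth (Dk T1) n (pw (kap T1) rts) (green_decay T1).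
Proof.
  intros HT.
  apply (ksmooth_cut (Dk T1) (fun k p => mm T1 - 1 < Rabs (AA k p)) (fun k p => Dk T1 k p /\ Rabs (AA k p) < mm T1) n
    (pw (fun k p => ind (mm T1 <= Rabs (AA k p))) rts) (pw (fun k p => exp (- (k ^ 2 * Rabs (fst p - snd p) / 4))) rts)
    (pw (kap T1) rts) (fun k p => Psi (mm T1) (AA k p)) (fun k p => amp k * exp (- (lam k * Rabs (fst p - snd p))))).
  - intros k p [H1 H2]. apply filter_and; [apply locally_Dk, H1|].
    apply (locally_AA k p (fun y => y < mm T1)), locally_lt, H2.
  - intros k p [H _]; exact H.
  - intros k p H. destruct (Rlt_dec (Rabs (AA k p)) (mm T1)); [left; split; assumption|right; lra].
  - intros k p [_ H]. apply Psi_0; lra.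
  - intros j k p _; unfold pw; apply Rmult_le_pos; [apply kap_pos|apply pow_le, rts_pos].
  - apply (ksmooth_chain (Dk T1) _ (pw rts rts) AA rts (fun y => ind (mm T1 <= Rabs y))).
    + intros; apply rts_symbol.
    + intros; apply AA_jcont.
    + intros; apply AA_derive.
    + exists 1; split; [lra|]; intros k p _; unfold pw; rewrite pow_O; lra.
    + apply wcompat_pw1.
    + apply Psi_smooth1.
  - apply (amp_exp_symbol (fun k p => Dk T1 k p /\ mm T1 - 1 < Rabs (AA k p)) rts 1) with (len := fun p : RR => Rabs (fst p - snd p)).
    + intros k p [H1 H2]; apply (ge_AA T1 k p HT H1 H2).
    + intros; apply rts_pos.
    + lra.
    + intros k p [H1 H2]; apply (ge_AA T1 k p HT H1 H2).
    + intros k p _. apply (continuous_comp (fun p : RR => fst p - snd p) Rabs); [|apply continuous_Rabs].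
      apply (continuous_minus (V := R_NormedModule)); [apply continuous_fst'|apply continuous_snd'].
    + intros; apply Rabs_pos.
    + intros; apply Rle_refl.
  - apply wcompat_pw; [intros; apply rts_pos|]. exists 1; split; [lra|]. intros k p _. unfold kap.
    destruct (excluded_middle_informative (mm T1 <= Rabs (AA k p))) as [H|H].
    + rewrite (ind_true _ H). destruct (Rle_dec (fst p) (snd p)).
      * rewrite (ind_true (fst p <= snd p)), (ind_false (snd p < fst p)) by lra.
        rewrite !Rmult_0_l, Rplus_0_r, !Rmult_1_l. rewrite <- exp_0.
        assert (Hx : - (k ^ 2 * Rabs (fst p - snd p) / 4) <= 0).
        { generalize (pow2_ge_0 k) (Rabs_pos (fst p - snd p)); nra. }
        destruct (Rle_lt_or_eq_dec _ _ Hx) as [h|h]; [left; apply exp_increasing, h|rewrite h; right; reflexivity].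
      * rewrite (ind_false (fst p <= snd p)), (ind_true (snd p < fst p)) by lra.
        rewrite (Rabs_pos_eq (fst p - snd p)) by lra. lra.
    + rewrite (ind_false _ H). rewrite !Rmult_0_r, !Rmult_0_l. generalize (ind_pos (fst p <= snd p)); lra.
Qed.

Lemma QQ_cont (T1 k : R) (p : RR) : Dk T1 k p -> continuous QQ p.
Proof.
  intros [H _]; unfold QQ, Rdiv. apply (continuous_mult (K := R_AbsRing)).
  - apply continuous_Rmax; [|apply continuous_const].
    apply (continuous_minus (V := R_NormedModule)); [apply continuous_snd'|apply continuous_fst'].
  - apply (continuous_comp (fun p : RR => Rmax (snd p) (fst p)) Rinv).
    + apply continuous_Rmax; [apply continuous_snd'|apply continuous_fst'].
    + apply continuous_Rinv. generalize (Rmax_r (snd p) (fst p)); lra.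
Qed.

Lemma QQ_bound (p : RR) : 0 < fst p -> 0 <= QQ p <= ind (fst p <= snd p).
Proof.
  intros H; unfold QQ. destruct (Rle_dec (fst p) (snd p)) as [h|h].
  - rewrite ind_true by exact h. rewrite !Rmax_left by lra. split; [apply Rdiv_le_0_compat; lra|apply Rle_div_l; lra].
  - rewrite ind_false by exact h. rewrite (Rmax_right (snd p - fst p)) by lra. unfold Rdiv; lra.
Qed.

(** Where the cutoff is supported, [AA], [QQ] and [sqrt s] are bounded, and the kernel is a
    polynomial in them times an entire function of such a polynomial. Since [k] enters through [AA]
    alone, each derivative produces one factor [sqrt s]. *)
Lemma green_volterra_symbol (T1 : R) (n : nat) : 1 <= T1 -> ksmooth (Dk T1) n (pw (kap T1) rts) (green_volterra T1).
Proof.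
  intros HT. set (D2 := fun (k : R) (p : RR) => Dk T1 k p /\ Rabs (AA k p) < mm T1 + 2).
  assert (Hm : 0 <= mm T1) by (unfold mm; lra).
  set (one := fun (_ : R) (_ : RR) => 1).
  assert (Hcc : forall w, wcompat D2 0 (pw one rts) (pw w rts) (pw w rts)).
  { intros w; apply wcompat_pw; [intros; apply rts_pos|]. exists 1; split; [lra|]; intros; unfold one; lra. }
  assert (Hpos : forall j k p, D2 k p -> 0 <= pw one rts j k p).
  { intros; unfold pw, one; rewrite Rmult_1_l; apply pow_le, rts_pos. }
  assert (HA : forall n, ksmooth D2 n (pw one rts) AA).
  { intros n0. destruct n0; (split; [intros; apply AA_jcont|split]).
    all: try (exists (mm T1 + 2); split; [lra|]; intros k p [_ H]; unfold pw, one; rewrite pow_O; lra).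
    - exact I.
    - exists rts; split; [intros; apply AA_derive|].
      apply ksmooth_weaken with (W := pw rts rts); [apply rts_symbol|].
      intros j; exists 1; split; [lra|]; intros; unfold pw, one; simpl; lra. }
  assert (HQ : forall n, ksmooth D2 n (pw one rts) (fun _ p => QQ p)).
  { intros n0; apply ksmooth_const_k; [intros k p [H _]; apply (QQ_cont T1 k p H)| |exact Hpos].
    exists 1; split; [lra|]. intros k p [[H _] _]; unfold pw, one; rewrite pow_O.
    destruct (QQ_bound p H) as [h1 h2]. rewrite Rabs_pos_eq by exact h1. generalize (ind_le_1 (fst p <= snd p)); lra. }
  assert (HQ' : forall n, ksmooth D2 n (pw (fun _ p => ind (fst p <= snd p)) rts) (fun _ p => QQ p)).
  { intros n0; apply ksmooth_const_k; [intros k p [H _]; apply (QQ_cont T1 k p H)| |].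
    - exists 1; split; [lra|]. intros k p [[H _] _]; unfold pw; rewrite pow_O.
      destruct (QQ_bound p H) as [h1 h2]. rewrite Rabs_pos_eq by exact h1. lra.
    - intros j k p _; unfold pw; apply Rmult_le_pos; [apply ind_pos|apply pow_le, rts_pos]. }
  assert (HSb : forall k p, D2 k p -> 0 <= sqrt (snd p) * sqrt (snd p) <= 2 * T1).
  { intros k p [[_ H] _]. destruct (Rle_dec 0 (snd p)); [rewrite sqrt_sqrt; lra|].
    rewrite (sqrt_neg_0 (snd p)) by lra; lra. }
  assert (HS : forall n, ksmooth D2 n (pw one rts) (fun _ p => sqrt (snd p) * sqrt (snd p))).
  { intros n0; apply (ksmooth_const_k D2 n0 _ (fun p : RR => sqrt (snd p) * sqrt (snd p))); [| |exact Hpos].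
    - intros; apply (continuous_mult (K := R_AbsRing)); apply continuous_sqrt_snd.
    - exists (2 * T1); split; [lra|]. intros k p H; unfold pw, one; rewrite pow_O.
      generalize (HSb k p H); intros; rewrite Rabs_pos_eq; lra. }
  assert (HM : forall n F G, ksmooth D2 n (pw one rts) F -> ksmooth D2 n (pw one rts) G -> ksmooth D2 n (pw one rts) (fun k p => F k p * G k p)).
  { intros n0 F G H1 H2; apply (ksmooth_mult D2 n0 _ _ _ F G H1 H2), Hcc. }
  assert (HZ' : forall n, ksmooth D2 n (pw rts rts)
     (fun k p => (QQ p * QQ p * (4 * (AA k p * (AA k p * AA k p)) + -2 * (sqrt (snd p) * sqrt (snd p) * AA k p))) * rts k p)).
  { intros n0. apply (ksmooth_mult D2 n0 (pw one rts) (pw rts rts) (pw rts rts)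
      (fun k p => QQ p * QQ p * (4 * (AA k p * (AA k p * AA k p)) + -2 * (sqrt (snd p) * sqrt (snd p) * AA k p))) rts);
      [|apply rts_symbol|apply Hcc].
    apply (HM n0 (fun k p => QQ p * QQ p)); [apply HM; apply HQ|].
    apply ksmooth_plus; apply ksmooth_scal.
    - apply HM; [apply HA|apply HM; apply HA].
    - apply (HM n0 (fun _ p => sqrt (snd p) * sqrt (snd p))); [apply HS|apply HA]. }
  assert (HZd : forall k p, is_derive (fun y => ZZ y p) k
     ((QQ p * QQ p * (4 * (AA k p * (AA k p * AA k p)) + -2 * (sqrt (snd p) * sqrt (snd p) * AA k p))) * rts k p)).
  { intros k p. unfold ZZ, AA, rts. generalize (sqrt (snd p)) (QQ p); intros c Q. auto_derive; [exact I|]. ring. }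
  assert (HZc : forall k p, D2 k p -> jcont ZZ k p).
  { intros k p H.
    assert (HG : ksmooth D2 0 (pw one rts) ZZ).
    { apply ksmooth_ext with (F := fun k p => QQ p * QQ p * (AA k p * AA k p * (AA k p * AA k p) + -1 * (sqrt (snd p) * sqrt (snd p) * (AA k p * AA k p)))).
      { intros k0 p0; unfold ZZ; ring. }
      apply (HM O (fun k p => QQ p * QQ p)); [apply HM; apply HQ|].
      apply ksmooth_plus; [|apply ksmooth_scal].
      - apply (HM O (fun k p => AA k p * AA k p)); apply HM; apply HA.
      - apply (HM O (fun _ p => sqrt (snd p) * sqrt (snd p))); [apply HS|apply HM; apply HA]. }
    apply (ksmooth_cont _ _ _ _ HG k p H). }
  assert (HE : forall n, ksmooth D2 n (pw one rts) (fun k p => shc 0 (ZZ k p))).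
  { intros n0. apply (ksmooth_chain D2 (pw one rts) (pw rts rts) ZZ _ (fun y => exp (Rabs y)) HZ' HZc (fun k p _ => HZd k p)).
    - exists (exp ((mm T1 + 2) ^ 4 + 2 * T1 * (mm T1 + 2) ^ 2)); split; [left; apply exp_pos|].
      intros k p H. unfold pw, one; rewrite pow_O, !Rmult_1_r.
      assert (Hle : Rabs (ZZ k p) <= (mm T1 + 2) ^ 4 + 2 * T1 * (mm T1 + 2) ^ 2).
      { unfold ZZ. rewrite Rabs_mult. destruct (QQ_bound p (proj1 (proj1 H))) as [h1 h2].
        assert (h3 := ind_le_1 (fst p <= snd p)).
        assert (Hq : Rabs (QQ p ^ 2) <= 1) by (rewrite Rabs_pos_eq by apply pow2_ge_0; nra).
        assert (Ha : Rabs (AA k p ^ 4 - sqrt (snd p) * sqrt (snd p) * AA k p ^ 2) <= (mm T1 + 2) ^ 4 + 2 * T1 * (mm T1 + 2) ^ 2).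
        { eapply Rle_trans; [apply Rabs_triang|]. rewrite Rabs_Ropp, Rabs_mult, <- !RPow_abs.
          assert (Hb := HSb k p H). destruct H as [_ H]. assert (Hpa := Rabs_pos (AA k p)).
          apply Rplus_le_compat; [apply pow_incr; lra|].
          apply Rmult_le_compat; [apply Rabs_pos|apply pow_le; lra| |apply pow_incr; lra].
          rewrite Rabs_pos_eq; lra. }
        generalize (Rabs_pos (QQ p ^ 2)) (Rabs_pos (AA k p ^ 4 - sqrt (snd p) * sqrt (snd p) * AA k p ^ 2)); nra. }
      destruct (Rle_lt_or_eq_dec _ _ Hle) as [h|h]; [left; apply exp_increasing, h|rewrite h; right; reflexivity].
    - apply wcompat_pw1.
    - apply shc_smooth1. }
  apply (ksmooth_cut (Dk T1) (fun k p => Rabs (AA k p) < mm T1 + 2) (fun k p => Dk T1 k p /\ mm T1 + 1 < Rabs (AA k p)) n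
    (pw (fun k p => ind (Rabs (AA k p) <= mm T1 + 1)) rts) (pw (fun _ p => ind (fst p <= snd p)) rts)
    (pw (kap T1) rts) (fun k p => 1 - Psi (mm T1) (AA k p)) (fun k p => AA k p ^ 2 * QQ p * shc 0 (ZZ k p))).
  - intros k p [H1 H2]. apply filter_and; [apply locally_Dk, H1|].
    apply (locally_AA k p (fun y => mm T1 + 1 < y)). apply (open_gt (mm T1 + 1)), H2.
  - intros k p [H _]; exact H.
  - intros k p H. destruct (Rlt_dec (mm T1 + 1) (Rabs (AA k p))); [left; split; assumption|right; lra].
  - intros k p [_ H]. rewrite Psi_1; lra.
  - intros j k p _; unfold pw; apply Rmult_le_pos; [apply kap_pos|apply pow_le, rts_pos].
  - apply (ksmooth_chain (Dk T1) _ (pw rts rts) AA rts (fun y => ind (Rabs y <= mm T1 + 1))) with (e := fun y => 1 - Psi (mm T1) y).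
    + intros; apply rts_symbol.
    + intros; apply AA_jcont.
    + intros; apply AA_derive.
    + exists 1; split; [lra|]; intros k p _; unfold pw; rewrite pow_O; lra.
    + apply wcompat_pw1.
    + apply Psi_compl_smooth1, Hm.
  - apply ksmooth_ext with (F := fun k p => AA k p * AA k p * shc 0 (ZZ k p) * QQ p); [intros; ring|].
    apply (ksmooth_mult D2 n (pw one rts) (pw (fun _ p => ind (fst p <= snd p)) rts) _ (fun k p => AA k p * AA k p * shc 0 (ZZ k p)) (fun _ p => QQ p));
      [|apply HQ'|apply Hcc].
    apply (HM n (fun k p => AA k p * AA k p)); [apply HM; apply HA|apply HE].
  - apply wcompat_pw; [intros; apply rts_pos|]. exists 1; split; [lra|]. intros k p _. unfold kap.
    assert (0 <= ind (snd p < fst p) * ind (mm T1 <= Rabs (AA k p)) * exp (- (k ^ 2 * (fst p - snd p) / 4))).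
    { repeat apply Rmult_le_pos; try apply ind_pos. left; apply exp_pos. }
    generalize (ind_pos (Rabs (AA k p) <= mm T1 + 1)) (ind_le_1 (Rabs (AA k p) <= mm T1 + 1)) (ind_pos (fst p <= snd p)); nra.
Qed.

Lemma green_symbol (T1 : R) (n : nat) : 1 <= T1 -> ksmooth (Dk T1) n (pw (kap T1) rts) (green T1).
Proof. intros HT; apply ksmooth_plus; [apply green_decay_symbol, HT|apply ksmooth_scal, green_volterra_symbol, HT]. Qed.

Lemma exp_le (x y : R) : x <= y -> exp x <= exp y.
Proof. intros H; destruct (Rle_lt_or_eq_dec _ _ H) as [h|h]; [left; apply exp_increasing, h|rewrite h; right; reflexivity]. Qed.

(** * Weighted spaces and the integral operator *)

(** A weight preserved by convolution must be submultiplicative, which [exp (- sqrt tau |k|)] is by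
    the triangle inequality and a Gaussian in [k] is not. The scale [|k| ~ tau^(-1/2)] is that of
    the Gaussian, and at fixed [tau] the decay still beats all powers of [|k|]. *)
Definition ew (k tau : R) : R := exp (- (sqrt tau * Rabs k)).
Definition wt (eta e k tau : R) : R := Rpower tau (- e) * (rho eta k * ew k tau).
Definition Dp (k tau : R) : Prop := 0 < tau.
Definition in_wt (eta e B : R) (U : R -> R -> R) : Prop :=
  (forall k tau, 0 < tau -> jcont U k tau) /\ (forall k tau, 0 < tau -> Rabs (U k tau) <= B * wt eta e k tau).

Lemma wt_pos (eta e k tau : R) : 0 < wt eta e k tau.
Proof. apply Rmult_lt_0_compat; [apply Rpower_pos|apply Rmult_lt_0_compat; [apply rho_pos|apply exp_pos]]. Qed.

Lemma ew_le_1 (k tau : R) : ew k tau <= 1.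
Proof.
  unfold ew; rewrite <- exp_0; apply exp_le. generalize (sqrt_pos tau) (Rabs_pos k); nra.
Qed.

Lemma wt_le_rho (eta e k tau : R) : wt eta e k tau <= Rpower tau (- e) * rho eta k.
Proof.
  unfold wt; apply Rmult_le_compat_l; [left; apply Rpower_pos|].
  rewrite <- (Rmult_1_r (rho eta k)) at 2. apply Rmult_le_compat_l; [left; apply rho_pos|apply ew_le_1].
Qed.

Lemma in_wt_B (eta e B : R) (U : R -> R -> R) : in_wt eta e B U -> 0 <= B.
Proof.
  intros [_ H]; specialize (H 0 1 Rlt_0_1). generalize (Rabs_pos (U 0 1)) (wt_pos eta e 0 1); intros.
  apply Rmult_le_reg_r with (wt eta e 0 1); lra.
Qed.

Lemma in_wt_adm (eta e B tau : R) (U : R -> R -> R) : in_wt eta e B U -> 0 < tau ->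
  adm eta (B * Rpower tau (- e)) (fun k => U k tau).
Proof.
  intros HU Ht; assert (HB := in_wt_B _ _ _ _ HU); destruct HU as [H1 H2]; split.
  - intros k; apply (continuous_slice_l U k tau), H1, Ht.
  - intros k; eapply Rle_trans; [apply H2, Ht|]. rewrite Rmult_assoc; apply Rmult_le_compat_l; [exact HB|apply wt_le_rho].
Qed.

Definition conv (U Y : R -> R -> R) (k tau : R) : R := IR (fun l => U l tau * Y (k - l) tau).
Definition Crho (eta : R) : R := Rpower 2 (1 + eta) * (4 / eta).

Lemma Crho_pos (eta : R) : 0 < eta -> 0 < Crho eta.
Proof. intros; apply Rmult_lt_0_compat; [apply Rpower_pos|apply Rdiv_lt_0_compat; lra]. Qed.

Lemma rho_adm (eta : R) : adm eta 1 (rho eta).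
Proof. split; [apply continuous_rho|]. intros k; rewrite Rabs_pos_eq by (left; apply rho_pos); lra. Qed.

(** One of [l] and [k - l] is at least half as large as [k]; that factor supplies [rho eta k], the
    other remains integrable. *)
Lemma rho_conv_pt (eta k l : R) : 0 < eta -> rho eta l * rho eta (k - l) <= Rpower 2 (1 + eta) * rho eta k * (rho eta l + rho eta (k - l)).
Proof.
  intros He.
  assert (Hk : Rabs k <= Rabs l + Rabs (k - l)).
  { replace k with (l + (k - l)) at 1 by ring; apply Rabs_triang. }
  assert (Hgen : forall x, 1 + Rabs k <= 2 * (1 + Rabs x) -> rho eta x <= Rpower 2 (1 + eta) * rho eta k).
  { intros x Hx. unfold rho. rewrite !Rpower_Ropp.
    assert (P1 := Rpower_pos (1 + Rabs x) (1 + eta)). assert (P2 := Rpower_pos (1 + Rabs k) (1 + eta)).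
    assert (H : Rpower (1 + Rabs k) (1 + eta) <= Rpower 2 (1 + eta) * Rpower (1 + Rabs x) (1 + eta)).
    { rewrite Rpower_mult_distr by (generalize (Rabs_pos x); lra). apply Rle_Rpower_l; [lra|].
      split; [generalize (Rabs_pos k); lra|exact Hx]. }
    apply Rmult_le_reg_r with (Rpower (1 + Rabs x) (1 + eta)); [exact P1|].
    rewrite Rinv_l by lra.
    apply Rmult_le_reg_r with (Rpower (1 + Rabs k) (1 + eta)); [exact P2|].
    field_simplify; [|lra]. lra. }
  assert (R0 := rho_pos eta l); assert (R1 := rho_pos eta (k - l)); assert (R2 := rho_pos eta k).
  assert (R3 := Rpower_pos 2 (1 + eta)).
  assert (0 < Rpower 2 (1 + eta) * rho eta k) by (apply Rmult_lt_0_compat; assumption).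
  destruct (Rle_dec (Rabs (k - l)) (Rabs l)).
  - assert (H1 := Hgen l ltac:(lra)). nra.
  - assert (H1 := Hgen (k - l) ltac:(lra)). nra.
Qed.

Lemma ew_conv (k l tau : R) : ew l tau * ew (k - l) tau <= ew k tau.
Proof.
  unfold ew. rewrite <- exp_plus. apply exp_le.
  assert (Hk : Rabs k <= Rabs l + Rabs (k - l)).
  { replace k with (l + (k - l)) at 1 by ring; apply Rabs_triang. }
  generalize (sqrt_pos tau); nra.
Qed.

Lemma conv_slice_adm (eta d e A B : R) (U Y : R -> R -> R) (k tau : R) : 0 < eta -> 0 < tau ->
  in_wt eta d A U -> in_wt eta e B Y ->
  adm eta (A * Rpower tau (- d) * (B * Rpower tau (- e))) (fun l => U l tau * Y (k - l) tau).
Proof.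
  intros He Ht HU HY.
  assert (HA := in_wt_adm _ _ _ _ _ HU Ht); assert (HB := in_wt_adm _ _ _ _ _ HY Ht).
  assert (PB := adm_M_pos _ _ _ HB). split.
  - intros l; apply (continuous_mult (K := R_AbsRing)); [apply HA|].
    apply (continuous_comp (fun l => k - l) (fun l => Y l tau)); [|apply HB].
    apply (continuous_minus (V := R_NormedModule)); [apply continuous_const|apply continuous_id].
  - intros l; rewrite Rabs_mult.
    apply Rle_trans with ((A * Rpower tau (- d) * rho eta l) * (B * Rpower tau (- e) * 1)).
    + apply Rmult_le_compat; [apply Rabs_pos|apply Rabs_pos|apply HA|].
      eapply Rle_trans; [apply HB|]. apply Rmult_le_compat_l; [exact PB|apply rho_le_1, He].
    + right; ring.
Qed.

Lemma conv_bound (eta d e A B : R) (U Y : R -> R -> R) (k tau : R) : 0 < eta -> 0 < tau ->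
  in_wt eta d A U -> in_wt eta e B Y -> Rabs (conv U Y k tau) <= Crho eta * A * B * wt eta (d + e) k tau.
Proof.
  intros He Ht HU HY. assert (HA := in_wt_B _ _ _ _ HU). assert (HB := in_wt_B _ _ _ _ HY).
  set (c := A * B * Rpower tau (- (d + e)) * ew k tau * (Rpower 2 (1 + eta) * rho eta k)).
  assert (Hc : 0 <= c).
  { unfold c. repeat apply Rmult_le_pos; try assumption; left; try apply Rpower_pos; try apply rho_pos; apply exp_pos. }
  assert (Hsh : adm eta (1 * Rpower (1 + Rabs (- k)) (1 + eta)) (fun l => rho eta (l + - k))) by (apply adm_shift, rho_adm; assumption).
  assert (Hg := adm_scal eta _ c _ (adm_plus _ _ _ _ _ (rho_adm eta) Hsh)).
  assert (Hle : Rabs (conv U Y k tau) <= IR (fun l => c * (rho eta l + rho eta (l + - k)))).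
  { unfold conv. eapply IR_abs_le; [exact He|apply (conv_slice_adm eta d e A B); assumption|exact Hg|].
    intros l; rewrite Rabs_mult.
    apply Rle_trans with ((A * wt eta d l tau) * (B * wt eta e (k - l) tau)).
    { apply Rmult_le_compat; [apply Rabs_pos|apply Rabs_pos|apply HU, Ht|apply HY, Ht]. }
    unfold wt. replace (rho eta (l + - k)) with (rho eta (k - l)) by (rewrite <- rho_even; f_equal; ring).
    replace (A * (Rpower tau (- d) * (rho eta l * ew l tau)) * (B * (Rpower tau (- e) * (rho eta (k - l) * ew (k - l) tau))))
     with (A * B * (Rpower tau (- d) * Rpower tau (- e)) * (ew l tau * ew (k - l) tau) * (rho eta l * rho eta (k - l))) by ring.
    rewrite <- Rpower_plus. replace (- d + - e) with (- (d + e)) by ring.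
    unfold c. rewrite (Rmult_assoc _ (Rpower 2 (1 + eta) * rho eta k)).
    assert (PP := Rpower_pos tau (- (d + e))).
    apply Rmult_le_compat.
    - repeat apply Rmult_le_pos; try assumption; left; try assumption; apply exp_pos.
    - apply Rmult_le_pos; left; apply rho_pos.
    - apply Rmult_le_compat_l; [|apply ew_conv]. repeat apply Rmult_le_pos; try assumption; left; assumption.
    - apply rho_conv_pt, He. }
  eapply Rle_trans; [exact Hle|].
  rewrite (IR_scal eta _ c _ He (adm_plus _ _ _ _ _ (rho_adm eta) Hsh)).
  rewrite (IR_plus eta _ _ _ _ He (rho_adm eta) Hsh).
  rewrite (IR_shift eta 1 (- k) (rho eta) He (rho_adm eta)).
  assert (Hr := IR_bound eta 1 _ He (rho_adm eta)).
  assert (Hr' := Rle_abs (IR (rho eta))).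
  apply Rle_trans with (c * (4 / eta)).
  - apply Rmult_le_compat_l; [exact Hc|]. replace (4 / eta) with (1 * (2 / eta) + 1 * (2 / eta)) by (field; lra). lra.
  - unfold c, Crho, wt. right; ring.
Qed.

Lemma conv_jcont (eta d e A B : R) (U Y : R -> R -> R) (k tau : R) : 0 < eta -> 0 < tau ->
  in_wt eta d A U -> in_wt eta e B Y -> jcont (conv U Y) k tau.
Proof.
  intros He Ht HU HY. assert (HA := in_wt_B _ _ _ _ HU). assert (HB := in_wt_B _ _ _ _ HY).
  assert (Hcd : forall c, locally tau (fun t => Rpower t c <= Rpower tau c + 1)).
  { intros c. generalize (proj1 (continuous_R_eps _ _) (continuous_Rpower c tau Ht) 1 Rlt_0_1).
    apply filter_imp; intros t H. apply Rabs_def2 in H; lra. }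
  set (M := A * (Rpower tau (- d) + 1) * (B * (Rpower tau (- e) + 1))).
  apply (IR_continuous eta M (fun (q : R * R) l => U l (snd q) * Y (fst q - l) (snd q)) (k, tau) He).
  - assert (Hl : locally tau (fun t => forall k', adm eta M (fun l => U l t * Y (k' - l) t))).
    { generalize (filter_and _ _ (locally_pos tau Ht) (filter_and _ _ (Hcd (- d)) (Hcd (- e)))).
      apply filter_imp; intros t [H1 [H2 H3]] k'.
      destruct (conv_slice_adm eta d e A B U Y k' t He H1 HU HY) as [h1 h2]. split; [exact h1|].
      intros l; eapply Rle_trans; [apply h2|]. apply Rmult_le_compat_r; [left; apply rho_pos|]. unfold M.
      assert (P1 := Rpower_pos t (- d)). assert (P2 := Rpower_pos t (- e)).
      apply Rmult_le_compat; try (apply Rmult_le_pos; lra); apply Rmult_le_compat_l; assumption. }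
    generalize (locally_snd (U := R_UniformSpace) _ k tau Hl). apply filter_imp; intros q Hq; apply Hq.
  - intros l. apply (continuous_mult (K := R_AbsRing)).
    + apply (continuous_comp_2 (fun z : R * R * R => snd z) (fun z => snd (fst z)) U).
      * apply continuous_snd'.
      * apply (continuous_comp (fun z : R * R * R => fst z) (fun q : R * R => snd q)); [apply continuous_fst'|apply continuous_snd'].
      * apply HU, Ht.
    + apply (continuous_comp_2 (fun z : R * R * R => fst (fst z) - snd z) (fun z => snd (fst z)) Y).
      * apply (continuous_minus (V := R_NormedModule)); [|apply continuous_snd'].
        apply (continuous_comp (fun z : R * R * R => fst z) (fun q : R * R => fst q)); [apply continuous_fst'|apply continuous_fst'].
      * apply (continuous_comp (fun z : R * R * R => fst z) (fun q : R * R => snd q)); [apply continuous_fst'|apply continuous_snd'].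
      * apply HY, Ht.
Qed.

Lemma conv_in_wt (eta d e A B : R) (U Y : R -> R -> R) : 0 < eta -> in_wt eta d A U -> in_wt eta e B Y ->
  in_wt eta (d + e) (Crho eta * A * B) (conv U Y).
Proof.
  intros He HU HY; split; intros k tau Ht.
  - apply (conv_jcont eta d e A B); assumption.
  - apply conv_bound; assumption.
Qed.

Lemma ksmooth_in_wt (eta e : R) (n : nat) (W : nat -> R -> R -> R) (U : R -> R -> R) :
  (forall k tau, W O k tau = wt eta e k tau) -> ksmooth Dp n W U -> exists B, in_wt eta e B U.
Proof.
  intros HW H. destruct (ksmooth_bd _ _ _ _ H) as (C & HC & Hb). exists C; split; [intros; apply (ksmooth_cont _ _ _ _ H); assumption|].
  intros k tau Ht; rewrite <- HW; apply Hb, Ht.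
Qed.

(** By translation the derivative falls entirely on the second factor. Applied to [U * U], this
    leads to equations that are linear in the differentiated factor. *)
Lemma conv_derive (eta d e e1 A B B1 : R) (U Y Y1 : R -> R -> R) (k tau : R) : 0 < eta -> 0 < tau ->
  in_wt eta d A U -> in_wt eta e B Y -> in_wt eta e1 B1 Y1 ->
  (forall k tau, 0 < tau -> is_derive (fun y => Y y tau) k (Y1 k tau)) ->
  is_derive (fun y => conv U Y y tau) k (conv U Y1 k tau).
Proof.
  intros He Ht HU HB HB1 Hd.
  set (M := A * Rpower tau (- d) * (B * Rpower tau (- e)) + A * Rpower tau (- d) * (B1 * Rpower tau (- e1))).
  assert (Q1 : forall u, adm eta (A * Rpower tau (- d) * (B * Rpower tau (- e))) (fun l => U l tau * Y (u - l) tau)) by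
    (intros u; apply conv_slice_adm; assumption).
  assert (Q2 : forall u, adm eta (A * Rpower tau (- d) * (B1 * Rpower tau (- e1))) (fun l => U l tau * Y1 (u - l) tau)) by
    (intros u; apply conv_slice_adm; assumption).
  assert (P1 := adm_M_pos _ _ _ (Q1 0)). assert (P2 := adm_M_pos _ _ _ (Q2 0)).
  apply (IR_is_derive eta M (fun k l => U l tau * Y (k - l) tau) (fun k l => U l tau * Y1 (k - l) tau) k He).
  + apply filter_forall; intros u l. apply is_derive_scal.
    evar_last; [apply (is_derive_comp (fun y => Y y tau) (fun u => u - l) u (Y1 (u - l) tau) 1)|].
    * apply Hd, Ht.
    * auto_derive; [exact I|ring].
    * unfold scal; simpl; unfold mult; simpl; ring.
  + apply filter_forall; intros u; split; [apply Q1|]. intros l; eapply Rle_trans; [apply Q1|].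
    apply Rmult_le_compat_r; [left; apply rho_pos|unfold M; lra].
  + apply filter_forall; intros u; split; [apply Q2|]. intros l; eapply Rle_trans; [apply Q2|].
    apply Rmult_le_compat_r; [left; apply rho_pos|unfold M; lra].
  + intros l. apply (continuous_mult (K := R_AbsRing)).
    * apply (continuous_comp (fun z : R * R => snd z) (fun l => U l tau)); [apply continuous_snd'|].
      apply (continuous_slice_l U), HU, Ht.
    * apply (continuous_comp (fun z : R * R => fst z - snd z) (fun l => Y1 l tau)).
      -- apply (continuous_minus (V := R_NormedModule)); [apply continuous_fst'|apply continuous_snd'].
      -- apply (continuous_slice_l Y1), HB1, Ht.
Qed.

Lemma conv_ksmooth (eta d A : R) (E : nat -> R) (n : nat) (U Y : R -> R -> R) : 0 < eta -> in_wt eta d A U ->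
  ksmooth Dp n (fun j => wt eta (E j)) Y -> ksmooth Dp n (fun j => wt eta (d + E j)) (conv U Y).
Proof.
  intros He HU. revert E Y; induction n; intros E Y HY.
  all: destruct (ksmooth_in_wt eta (E O) _ _ _ (fun k tau => eq_refl) HY) as [B HB].
  all: assert (HC := conv_in_wt eta d (E O) A B U Y He HU HB).
  all: split; [intros k tau Ht; apply HC, Ht|split;
     [exists (Crho eta * A * B); split; [apply (in_wt_B _ _ _ _ HC)|intros k tau Ht; apply HC, Ht]|]].
  - exact I.
  - destruct HY as (_ & _ & Y1 & Hd & HY1). exists (conv U Y1); split; [|apply (IHn (fun j => E (S j)) Y1 HY1)].
    intros k tau Ht. destruct (ksmooth_in_wt eta (E 1%nat) _ _ _ (fun k tau => eq_refl) HY1) as [B1 HB1].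
    apply (conv_derive eta d (E O) (E 1%nat) A B B1); assumption.
Qed.

Lemma Rpower_div_eq (s t e : R) : 0 < s -> 0 < t -> Rpower s e * Rpower t (- e) = Rpower (s / t) e.
Proof.
  intros Hs Ht. unfold Rpower, Rdiv. rewrite <- exp_plus. f_equal.
  rewrite ln_mult, ln_Rinv by (try apply Rinv_0_lt_compat; assumption). ring.
Qed.

(** The gain [(s / tau)^e] makes a source of size [s^(-y)] integrable at 0 once [y - e < 1]. For
    [s >= tau] this factor is at least 1 and the exponential weight is monotone. For [s < tau] the
    kernel acts only where [k^2 s >= 16], and its decay pays both for the power and for moving the
    exponential weight from [s] to [tau]. *)
Lemma kap_weight (T1 k tau s e : R) : 1 <= T1 -> 0 < tau -> 0 < s -> 0 <= e <= 2 ->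
  kap T1 k (tau, s) * ew k s <= exp 2 * (Rpower s e * Rpower tau (- e)) * ew k tau.
Proof.
  intros HT Ht Hs He. rewrite (Rpower_div_eq s tau e Hs Ht). unfold kap; simpl fst; simpl snd.
  assert (Hkp := Rabs_pos k).
  assert (E2 : 1 <= exp 2) by (rewrite <- exp_0; apply exp_le; lra).
  destruct (Rle_dec tau s) as [h|h].
  - rewrite (ind_true (tau <= s)), (ind_false (s < tau)) by lra. rewrite !Rmult_0_l, Rplus_0_r, Rmult_1_l.
    assert (H1 : ew k s <= ew k tau).
    { unfold ew; apply exp_le. generalize (sqrt_le_1_alt tau s h); nra. }
    assert (H2 : 1 <= Rpower (s / tau) e).
    { rewrite <- (Rpower_O (s / tau)) by (apply Rdiv_lt_0_compat; assumption). apply Rle_Rpower; [|lra].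
      apply Rle_div_r; lra. }
    assert (0 < ew k tau) by apply exp_pos.
    assert (1 <= exp 2 * Rpower (s / tau) e) by nra. nra.
  - rewrite (ind_false (tau <= s)), (ind_true (s < tau)) by lra. rewrite Rplus_0_l, Rmult_1_l.
    assert (Hr0 : 0 < s / tau) by (apply Rdiv_lt_0_compat; assumption).
    assert (Hr1 : s / tau < 1) by (apply Rlt_div_l; lra).
    assert (P0 : 0 <= exp 2 * Rpower (s / tau) e * ew k tau).
    { repeat apply Rmult_le_pos; left; try apply exp_pos; apply Rpower_pos. }
    destruct (excluded_middle_informative (mm T1 <= Rabs (AA k (tau, s)))) as [Hm|Hm].
    2: { rewrite (ind_false _ Hm), !Rmult_0_l; exact P0. }
    rewrite (ind_true _ Hm), Rmult_1_l.
    assert (Hk16 : 16 <= k ^ 2 * s).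
    { unfold AA, mm in Hm; simpl in Hm. rewrite Rabs_mult, (Rabs_pos_eq (sqrt s)) in Hm by apply sqrt_pos.
      rewrite <- (pow2_abs k). rewrite <- (sqrt_sqrt s) by lra. generalize (sqrt_pos s); nra. }
    set (x := (tau - s) / s).
    assert (Hx : 0 < x) by (apply Rdiv_lt_0_compat; lra).
    assert (Hxs : x * s = tau - s) by (unfold x; field; lra).
    (* The decay is split in halves: one covers [sqrt tau - sqrt s <= sqrt (tau - s)] by completing
       a square, at the cost of the constant 2; the other is at least [2 x] because
       [k^2 s >= 16]. *)
    assert (Hexp : - (k ^ 2 * (tau - s) / 4) + - (sqrt s * Rabs k) <= 2 + - (2 * x) + - (sqrt tau * Rabs k)).
    { set (D := sqrt (tau - s)). assert (HD : D * D = tau - s) by (apply sqrt_sqrt; lra).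
      assert (HD0 : 0 <= D) by apply sqrt_pos.
      assert (Hst : sqrt tau <= sqrt s + D).
      { rewrite <- (sqrt_pow2 (sqrt s + D)) by (generalize (sqrt_pos s); lra). apply sqrt_le_1_alt.
        assert (sqrt s * sqrt s = s) by (apply sqrt_sqrt; lra). generalize (sqrt_pos s); nra. }
      assert (H1 : (sqrt tau - sqrt s) * Rabs k <= D * Rabs k) by (apply Rmult_le_compat_r; lra).
      assert (H2 : D * Rabs k <= k ^ 2 * (tau - s) / 8 + 2).
      { rewrite <- HD, <- (pow2_abs k). assert (0 <= (D * Rabs k - 4) ^ 2) by apply pow2_ge_0. nra. }
      assert (H3 : 2 * x <= k ^ 2 * (tau - s) / 8).
      { rewrite <- Hxs. nra. }
      lra. }
    (* Here [exp (- 2 x) <= (1 + x)^(-2)] and [1 + x = tau / s]; this is the origin of the upper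
       limit 2 for [e]. *)
    assert (Hsq : exp (- (2 * x)) <= Rpower (s / tau) 2).
    { replace (s / tau) with (/ (1 + x)) by (unfold x; field; lra).
      unfold Rpower. rewrite ln_Rinv by lra. apply exp_le.
      assert (ln (1 + x) <= x); [|lra].
      rewrite <- (ln_exp x) at 2.
      left; apply ln_increasing; [lra|apply exp_ineq1; lra]. }
    assert (Hle2 : Rpower (s / tau) 2 <= Rpower (s / tau) e).
    { unfold Rpower; apply exp_le. assert (ln (s / tau) < 0) by (rewrite <- ln_1; apply ln_increasing; lra). nra. }
    unfold ew. rewrite <- exp_plus.
    eapply Rle_trans; [apply exp_le, Hexp|]. rewrite !exp_plus.
    apply Rmult_le_compat_r; [left; apply exp_pos|]. apply Rmult_le_compat_l; [left; apply exp_pos|]. lra.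
Qed.

Lemma is_RInt_Rpower (b x y : R) : b <> -1 -> 0 < x <= y ->
  is_RInt (fun s => Rpower s b) x y ((Rpower y (b + 1) - Rpower x (b + 1)) / (b + 1)).
Proof.
  intros Hb Hxy.
  replace ((Rpower y (b + 1) - Rpower x (b + 1)) / (b + 1)) with
   (minus ((fun s => / (b + 1) * Rpower s (b + 1)) y) ((fun s => / (b + 1) * Rpower s (b + 1)) x))
   by (unfold minus, plus, opp; simpl; field; lra).
  apply (is_RInt_derive (V := R_CompleteNormedModule) (fun s => / (b + 1) * Rpower s (b + 1))).
  - intros s Hs; rewrite Rmin_left, Rmax_right in Hs by lra.
    evar_last; [apply is_derive_scal, is_derive_Rpower; lra|].
    simpl. replace (b + 1 - 1) with b by ring. field; lra.
  - intros s Hs; rewrite Rmin_left, Rmax_right in Hs by lra. apply continuous_Rpower; lra.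
Qed.

(** Continuity at 0 makes the integral over a short initial interval arbitrarily small; only on the
    rest is the power integrated, so the singular majorant is never integrated from 0. *)
Lemma RInt_power_bound (f : R -> R) (T1 A beta : R) : 0 < T1 -> 0 <= A -> beta < 1 ->
  (forall s, 0 <= s <= T1 -> continuous f s) ->
  (forall s, 0 < s <= T1 -> Rabs (f s) <= A * Rpower s (- beta)) ->
  Rabs (RInt f 0 T1) <= A * (Rpower T1 (1 - beta) / (1 - beta)).
Proof.
  intros HT HA Hb Hc Hf. apply le_epsilon; intros eps He.
  assert (H0 := proj1 (continuous_R_eps _ _) (Hc 0 ltac:(lra)) 1 Rlt_0_1). destruct H0 as [d Hd].
  set (M := Rabs (f 0) + 1). assert (HM : 0 < M) by (unfold M; generalize (Rabs_pos (f 0)); lra).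
  set (x := Rmin (Rmin (d / 2) T1) (eps / M)).
  assert (Hx0 : 0 < x) by (unfold x; repeat apply Rmin_glb_lt; [generalize (cond_pos d); lra|lra|apply Rdiv_lt_0_compat; lra]).
  assert (Hx1 : x <= d / 2) by (unfold x; eapply Rle_trans; [apply Rmin_l|apply Rmin_l]).
  assert (Hx2 : x <= T1) by (unfold x; eapply Rle_trans; [apply Rmin_l|apply Rmin_r]).
  assert (Hx3 : x <= eps / M) by (unfold x; apply Rmin_r).
  assert (E1 : ex_RInt f 0 x) by (apply ex_RInt_cont; [lra|]; intros; apply Hc; lra).
  assert (E2 : ex_RInt f x T1) by (apply ex_RInt_cont; [lra|]; intros; apply Hc; lra).
  assert (EC : RInt f 0 x + RInt f x T1 = RInt f 0 T1) by (apply (RInt_Chasles f); assumption).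
  rewrite <- EC. eapply Rle_trans; [apply Rabs_triang|].
  assert (B1 : Rabs (RInt f 0 x) <= (x - 0) * M).
  { apply abs_RInt_le_const; [lra|exact E1|]. intros t Ht.
    assert (Hdt : Rabs (f t - f 0) < 1).
    { apply Hd. change (Rabs (t - 0) < d). rewrite Rminus_0_r, Rabs_pos_eq by lra. generalize (cond_pos d); lra. }
    unfold M. replace (f t) with ((f t - f 0) + f 0) by ring. eapply Rle_trans; [apply Rabs_triang|lra]. }
  assert (B2 : Rabs (RInt f x T1) <= A * ((Rpower T1 (- beta + 1) - Rpower x (- beta + 1)) / (- beta + 1))).
  { apply abs_RInt_le_is with (g := fun s => A * Rpower s (- beta)); [lra|exact E2|intros; apply Hf; lra|].
    apply (is_RInt_scal (V := R_NormedModule)), is_RInt_Rpower; lra. }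
  assert (B3 : (x - 0) * M <= eps).
  { rewrite Rminus_0_r. apply Rle_div_r in Hx3; lra. }
  assert (B4 : A * ((Rpower T1 (- beta + 1) - Rpower x (- beta + 1)) / (- beta + 1)) <= A * (Rpower T1 (1 - beta) / (1 - beta))).
  { apply Rmult_le_compat_l; [exact HA|]. replace (- beta + 1) with (1 - beta) by ring.
    apply Rmult_le_compat_r; [left; apply Rinv_0_lt_compat; lra|]. generalize (Rpower_pos x (1 - beta)); lra. }
  lra.
Qed.

Definition kernel_op (T1 : R) (K : R -> RR -> R) (N : R -> R -> R) (k tau : R) : R :=
  RInt (fun s => K k (tau, s) * N k s) 0 T1.

Definition kern (T1 : R) (h : nat) (C : R) (K : R -> RR -> R) : Prop :=
  (forall k p, Dk T1 k p -> jcont K k p) /\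
  (forall k p, Dk T1 k p -> Rabs (K k p) <= C * pw (kap T1) rts h k p).

Lemma kern_zero (T1 C : R) (h : nat) (K : R -> RR -> R) (k tau s : R) : 0 < T1 -> kern T1 h C K -> 0 < tau -> s < 2 * T1 ->
  s < tau -> Rabs (AA k (tau, s)) < mm T1 -> K k (tau, s) = 0.
Proof.
  intros HT [_ HK] Ht Hs Hst HA. specialize (HK k (tau, s) (conj Ht Hs)).
  assert (E : kap T1 k (tau, s) = 0).
  { unfold kap; simpl fst; simpl snd. rewrite (ind_false (tau <= s)), (ind_false (mm T1 <= _)) by lra. ring. }
  unfold pw in HK. rewrite E, Rmult_0_l, Rmult_0_r in HK.
  destruct (Req_dec (K k (tau, s)) 0) as [|Hn]; [assumption|]. apply Rabs_pos_lt in Hn; lra.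
Qed.

(** The source is continuous only for [s > 0]. Near a point with [s <= 0 < tau] the kernel vanishes
    identically, since [AA] is small there ([sqrt] is 0 on negative numbers); the product thus
    extends by zero across [s = 0] and [kernel_op] is a proper integral. As [Dk] reaches up to
    [2 * T1], the endpoint [T1] is interior as well. *)
Lemma kern_mult_cont (T1 C : R) (h : nat) (K : R -> RR -> R) (N : R -> R -> R) (k tau s : R) : 0 < T1 -> kern T1 h C K ->
  (forall k s, 0 < s -> jcont N k s) -> 0 < tau -> s < 2 * T1 ->
  jcont (fun k (p : RR) => K k p * N k (snd p)) k (tau, s).
Proof.
  intros HT HK HN Ht Hs. destruct (Rlt_dec 0 s) as [Hp|Hp].
  - apply jcont_mult; [apply HK; split; assumption|].
    apply (continuous_comp_2 (fun q : R * RR => fst q) (fun q : R * RR => snd (snd q)) N (k, (tau, s))).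
    + apply continuous_fst'.
    + apply (continuous_comp (fun q : R * RR => snd q) (fun p : RR => snd p)); apply continuous_snd'.
    + apply HN, Hp.
  - apply continuous_ext_loc with (g := fun _ => 0); [|apply continuous_const].
    assert (H0 : Rabs (AA k (tau, s)) < mm T1).
    { unfold AA; simpl. rewrite sqrt_neg_0, Rmult_0_r, Rabs_R0 by lra. unfold mm; lra. }
    assert (L1 := locally_AA k (tau, s) (fun y => y < mm T1) (locally_lt _ _ H0)).
    assert (L2 := locally_Dk T1 k (tau, s) (conj Ht Hs)).
    assert (L3 : locally (k, (tau, s)) (fun q : R * RR => fst (snd q) > tau / 2 /\ snd (snd q) < tau / 2)).
    { apply (locally_snd (fun p : RR => fst p > tau / 2 /\ snd p < tau / 2)). apply filter_and.
      - apply (locally_fst (fun y => y > tau / 2)). apply (open_gt (tau / 2)). lra.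
      - apply (locally_snd (fun y => y < tau / 2)), locally_lt. lra. }
    generalize (filter_and _ _ L1 (filter_and _ _ L2 L3)). apply filter_imp.
    intros [k' [t' s']]; simpl. intros [A1 [[A2 A3] [A4 A5]]]. simpl in *.
    rewrite (kern_zero T1 C h K k' t' s'); [ring|assumption|assumption|assumption|assumption|lra|exact A1].
Qed.

Lemma kernel_op_integrand (T1 C : R) (h : nat) (K : R -> RR -> R) (N : R -> R -> R) (k tau s : R) : 0 < T1 -> kern T1 h C K ->
  (forall k s, 0 < s -> jcont N k s) -> 0 < tau -> s < 2 * T1 -> continuous (fun s => K k (tau, s) * N k s) s.
Proof.
  intros HT HK HN Ht Hs.
  apply (continuous_comp (fun s => (k, (tau, s))) (fun q : R * RR => K (fst q) (snd q) * N (fst q) (snd (snd q)))).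
  - apply continuous_pair; [apply continuous_const|]. apply continuous_pair; [apply continuous_const|apply continuous_id].
  - apply (kern_mult_cont T1 C h K N k tau s); assumption.
Qed.

Lemma kernel_op_jcont (T1 C : R) (h : nat) (K : R -> RR -> R) (N : R -> R -> R) (k tau : R) : 0 < T1 -> kern T1 h C K ->
  (forall k s, 0 < s -> jcont N k s) -> 0 < tau -> jcont (kernel_op T1 K N) k tau.
Proof.
  intros HT HK HN Ht.
  apply (continuous_RInt_param (fun (q : R * R) s => K (fst q) (snd q, s) * N (fst q) s) 0 T1 (k, tau)).
  - lra.
  - generalize (locally_snd (U := R_UniformSpace) _ k tau (locally_pos tau Ht)).
    apply filter_imp; intros q Hq s Hs. apply (kernel_op_integrand T1 C h); try assumption. lra.
  - intros s Hs.
    apply (continuous_comp (fun z : R * R * R => (fst (fst z), (snd (fst z), snd z)))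
      (fun q : R * RR => K (fst q) (snd q) * N (fst q) (snd (snd q)))).
    + apply continuous_pair.
      * apply (continuous_comp (fun z : R * R * R => fst z) (fun q : R * R => fst q)); apply continuous_fst'.
      * apply continuous_pair; [|apply continuous_snd'].
        apply (continuous_comp (fun z : R * R * R => fst z) (fun q : R * R => snd q)); [apply continuous_fst'|apply continuous_snd'].
    + apply (kern_mult_cont T1 C h K N k tau s); try assumption. lra.
Qed.

Lemma rts_Rpower (h : nat) (k tau s : R) : 0 < s -> rts k (tau, s) ^ h = Rpower s (INR h / 2).
Proof.
  intros Hs; unfold rts; simpl snd. rewrite <- Rpower_pow by (apply sqrt_lt_R0, Hs).
  rewrite <- Rpower_sqrt, Rpower_mult by exact Hs. f_equal; field.
Qed.

Definition CT (T1 beta : R) : R := exp 2 * (Rpower T1 (1 - beta) / (1 - beta)).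

Lemma CT_pos (T1 beta : R) : beta < 1 -> 0 < CT T1 beta.
Proof. intros; unfold CT. apply Rmult_lt_0_compat; [apply exp_pos|apply Rdiv_lt_0_compat; [apply Rpower_pos|lra]]. Qed.

(** Every factor [sqrt s] in the kernel lowers the singularity of the source by 1/2, and
    [kap_weight] lowers it by [e]; what remains is [s^(-beta)] with [beta < 1]. *)
Lemma kernel_op_bound (T1 C eta y e B : R) (h : nat) (K : R -> RR -> R) (N : R -> R -> R) (k tau : R) : 1 <= T1 ->
  0 <= C -> kern T1 h C K -> in_wt eta y B N -> 0 < tau -> 0 <= e <= 2 -> y - INR h / 2 - e < 1 ->
  Rabs (kernel_op T1 K N k tau) <= C * B * CT T1 (y - INR h / 2 - e) * wt eta e k tau.
Proof.
  intros HT HC HK HN Ht He Hb. assert (HB := in_wt_B _ _ _ _ HN).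
  set (beta := y - INR h / 2 - e). fold beta in Hb.
  set (A := C * B * exp 2 * wt eta e k tau).
  assert (HA : 0 <= A).
  { unfold A. apply Rmult_le_pos; [|left; apply wt_pos].
    repeat apply Rmult_le_pos; try assumption. left; apply exp_pos. }
  apply Rle_trans with (A * (Rpower T1 (1 - beta) / (1 - beta))).
  - apply RInt_power_bound; [lra|exact HA|exact Hb| |].
    + intros s Hs. apply (kernel_op_integrand T1 C h); try assumption; try lra. apply HN.
    + intros s Hs. rewrite Rabs_mult.
      apply Rle_trans with ((C * pw (kap T1) rts h k (tau, s)) * (B * wt eta y k s)).
      { apply Rmult_le_compat; [apply Rabs_pos|apply Rabs_pos| |apply HN; lra].
        apply HK; split; simpl; lra. }
      unfold pw, wt, A. rewrite rts_Rpower by lra.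
      assert (Hw := kap_weight T1 k tau s e HT Ht ltac:(lra) He).
      replace (Rpower s (- beta)) with (Rpower s (INR h / 2) * Rpower s (- y) * Rpower s e)
        by (rewrite <- !Rpower_plus; f_equal; unfold beta; ring).
      unfold wt.
      replace (C * (kap T1 k (tau, s) * Rpower s (INR h / 2)) * (B * (Rpower s (- y) * (rho eta k * ew k s)))) with
       (C * B * rho eta k * (Rpower s (INR h / 2) * Rpower s (- y)) * (kap T1 k (tau, s) * ew k s)) by ring.
      replace (C * B * exp 2 * (Rpower tau (- e) * (rho eta k * ew k tau)) * (Rpower s (INR h / 2) * Rpower s (- y) * Rpower s e)) with
       (C * B * rho eta k * (Rpower s (INR h / 2) * Rpower s (- y)) * (exp 2 * (Rpower s e * Rpower tau (- e)) * ew k tau)) by ring.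
      apply Rmult_le_compat_l; [|exact Hw].
      repeat apply Rmult_le_pos; try assumption; left; try apply rho_pos; apply Rpower_pos.
  - unfold A, CT. right; ring.
Qed.

Lemma kernel_op_in_wt (T1 C eta y e B : R) (h : nat) (K : R -> RR -> R) (N : R -> R -> R) : 1 <= T1 ->
  0 <= C -> kern T1 h C K -> in_wt eta y B N -> 0 <= e <= 2 -> y - INR h / 2 - e < 1 ->
  in_wt eta e (C * B * CT T1 (y - INR h / 2 - e)) (kernel_op T1 K N).
Proof.
  intros HT HC HK HN He Hb; split; intros k tau Ht.
  - apply (kernel_op_jcont T1 C h); try assumption; [lra|apply HN].
  - apply kernel_op_bound; assumption.
Qed.

Lemma kernel_op_derive (T1 C Cd : R) (h hd : nat) (K Kd : R -> RR -> R) (N Nd : R -> R -> R) (k tau : R) : 0 < T1 ->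
  kern T1 h C K -> kern T1 hd Cd Kd ->
  (forall k p, Dk T1 k p -> is_derive (fun y => K y p) k (Kd k p)) ->
  (forall k s, 0 < s -> jcont N k s) -> (forall k s, 0 < s -> jcont Nd k s) ->
  (forall k s, 0 < s -> is_derive (fun y => N y s) k (Nd k s)) -> 0 < tau ->
  is_derive (fun y => kernel_op T1 K N y tau) k (kernel_op T1 Kd N k tau + kernel_op T1 K Nd k tau).
Proof.
  intros HT Hkern Hkernd HKd HNc HNdc HNd Ht.
  assert (Hint : forall k', kernel_op T1 Kd N k' tau + kernel_op T1 K Nd k' tau =
      RInt (fun s => Kd k' (tau, s) * N k' s + K k' (tau, s) * Nd k' s) 0 T1).
  { intros k'. unfold kernel_op. rewrite RInt_plusR; [reflexivity| |].
    - apply ex_RInt_cont; [lra|]; intros s Hs; apply (kernel_op_integrand T1 Cd hd); try assumption; lra.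
    - apply ex_RInt_cont; [lra|]; intros s Hs; apply (kernel_op_integrand T1 C h); try assumption; lra. }
  rewrite Hint.
  apply (is_derive_RInt_par (fun k s => K k (tau, s) * N k s) (fun k s => Kd k (tau, s) * N k s + K k (tau, s) * Nd k s)).
  + lra.
  + apply filter_forall; intros u s Hs. destruct (Rlt_dec 0 s) as [Hp|Hp].
    * apply (is_derive_mult (fun u => K u (tau, s)) (fun u => N u s) u (Kd u (tau, s)) (Nd u s)).
      -- apply HKd; split; simpl; lra.
      -- apply HNd, Hp.
      -- intros; apply Rmult_comm.
    (* At [s = 0] nothing is known about the source, but the kernel and its derivative vanish
       there. *)
    * assert (E0 : s = 0) by lra. subst s.
      assert (HAA : forall u, Rabs (AA u (tau, 0)) < mm T1).
      { intros v; unfold AA; simpl. rewrite sqrt_0, Rmult_0_r, Rabs_R0. unfold mm; lra. }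
      assert (Z : forall v, K v (tau, 0) = 0).
      { intros v; apply (kern_zero T1 C h K v tau 0); [lra|assumption|assumption|lra|assumption|apply HAA]. }
      assert (Z' : Kd u (tau, 0) = 0).
      { apply (kern_zero T1 Cd hd Kd u tau 0); [lra|assumption|assumption|lra|assumption|apply HAA]. }
      evar_last.
      -- apply is_derive_ext with (f := fun _ : R => 0); [|apply (is_derive_const (V := R_NormedModule))].
         intros v. symmetry; apply Rmult_eq_0_compat_r, Z.
      -- symmetry; transitivity (0 + 0); [|apply Rplus_0_l].
         apply f_equal2; [apply Rmult_eq_0_compat_r, Z'|apply Rmult_eq_0_compat_r, Z].
  + apply filter_forall; intros u s Hs. apply (kernel_op_integrand T1 C h); try assumption; lra.
  + intros s Hs. apply (continuous_plus (V := R_NormedModule)).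
    * apply (continuous_comp (fun z : R * R => (fst z, (tau, snd z))) (fun q : R * RR => Kd (fst q) (snd q) * N (fst q) (snd (snd q)))).
      -- apply continuous_pair; [apply continuous_fst'|]. apply continuous_pair; [apply continuous_const|apply continuous_snd'].
      -- apply (kern_mult_cont T1 Cd hd Kd N k tau s); try assumption; lra.
    * apply (continuous_comp (fun z : R * R => (fst z, (tau, snd z))) (fun q : R * RR => K (fst q) (snd q) * Nd (fst q) (snd (snd q)))).
      -- apply continuous_pair; [apply continuous_fst'|]. apply continuous_pair; [apply continuous_const|apply continuous_snd'].
      -- apply (kern_mult_cont T1 C h K Nd k tau s); try assumption; lra.
Qed.

(** Leibniz' rule: a derivative on the kernel raises [h], one on the source shifts [Ey]. The
    exponent condition is imposed for every distribution [a + b] of the derivatives, which makes it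
    stable under the induction. *)
Lemma kernel_op_ksmooth (T1 eta : R) (Ey E : nat -> R) (n h : nat) (K : R -> RR -> R) (N : R -> R -> R) : 1 <= T1 ->
  ksmooth (Dk T1) n (fun j => pw (kap T1) rts (h + j)) K -> ksmooth Dp n (fun j => wt eta (Ey j)) N ->
  (forall j, 0 <= E j <= 2) -> (forall a b, Ey b - INR (h + a) / 2 - E (a + b)%nat < 1) ->
  ksmooth Dp n (fun j => wt eta (E j)) (kernel_op T1 K N).
Proof.
  intros HT. revert h Ey E K N; induction n; intros h Ey E K N HK HN HE Hc.
  all: destruct (ksmooth_in_wt eta (Ey O) _ _ _ (fun k tau => eq_refl) HN) as [B HB].
  all: destruct (ksmooth_bd _ _ _ _ HK) as (C & HC & HKb).
  all: assert (Hkern : kern T1 h C K) by (split; [apply (ksmooth_cont _ _ _ _ HK)|intros k p Hkp; rewrite <- (Nat.add_0_r h); apply HKb, Hkp]).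
  all: assert (HX : in_wt eta (E O) (C * B * CT T1 (Ey O - INR h / 2 - E O)) (kernel_op T1 K N)) by
    (apply kernel_op_in_wt; try assumption; [apply HE|]; generalize (Hc O O); rewrite Nat.add_0_r; auto).
  all: split; [intros k tau Ht; apply HX, Ht|split; [eexists; split; [apply (in_wt_B _ _ _ _ HX)|intros k tau Ht; apply HX, Ht]|]].
  - exact I.
  - assert (HK' := ksmooth_pred _ _ _ _ HK). assert (HN' := ksmooth_pred _ _ _ _ HN).
    destruct HK as (_ & _ & Kd & HKd & HK1). destruct HN as (_ & _ & Nd & HNd & HN1).
    assert (HK1' : ksmooth (Dk T1) n (fun j => pw (kap T1) rts (S h + j)) Kd).
    { replace (fun j => pw (kap T1) rts (S h + j)) with (fun j => pw (kap T1) rts (h + S j)); [exact HK1|].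
      apply functional_extensionality; intros j; f_equal; lia. }
    assert (G1 : ksmooth Dp n (fun j => wt eta (E (S j))) (kernel_op T1 Kd N)).
    { apply (IHn (S h) Ey (fun j => E (S j)) Kd N HK1' HN'); [intros; apply HE|].
      intros a b. generalize (Hc (S a) b). replace (h + S a)%nat with (S h + a)%nat by lia.
      replace (S a + b)%nat with (S (a + b)) by lia; auto. }
    assert (G2 : ksmooth Dp n (fun j => wt eta (E (S j))) (kernel_op T1 K Nd)).
    { apply (IHn h (fun j => Ey (S j)) (fun j => E (S j)) K Nd HK' HN1); [intros; apply HE|].
      intros a b. generalize (Hc a (S b)). replace (a + S b)%nat with (S (a + b)) by lia; auto. }
    exists (fun k tau => kernel_op T1 Kd N k tau + kernel_op T1 K Nd k tau); split; [|apply ksmooth_plus; assumption].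
    intros k tau Ht. unfold Dp in Ht.
    destruct (ksmooth_bd _ _ _ _ HK1') as (Cd & HCd & HKdb).
    assert (Hkernd : kern T1 (S h) Cd Kd) by (split; [apply (ksmooth_cont _ _ _ _ HK1')|intros k' p Hkp; rewrite <- (Nat.add_0_r (S h)); apply HKdb, Hkp]).
    apply (kernel_op_derive T1 C Cd h (S h)); try assumption; [lra|apply (ksmooth_cont _ _ _ _ HN')|apply (ksmooth_cont _ _ _ _ HN1)].
Qed.

(** * Contraction and the nonlinear fixed point *)

Lemma geom_small (c th eps : R) : 0 <= c -> 0 <= th < 1 -> 0 < eps -> exists N, forall n, (N <= n)%nat -> c * th ^ n <= eps.
Proof.
  intros Hc Ht He.
  destruct (pow_lt_1_zero th ltac:(rewrite Rabs_pos_eq; lra) (eps / (c + 1)) ltac:(apply Rdiv_lt_0_compat; lra)) as [N HN].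
  exists N; intros n Hn. specialize (HN n Hn). rewrite Rabs_pos_eq in HN by (apply pow_le; lra).
  apply Rlt_div_r in HN; [|lra]. assert (0 <= th ^ n) by (apply pow_le; lra). nra.
Qed.

(** The contraction principle in a weighted sup norm, with pointwise limits in place of a complete
    function space: [Inv] only has to be closed under geometric convergence. The index set is
    abstract so that it can also label a function together with its derivative. *)
Lemma picard {A : Type} (Dom : A -> Prop) (W : A -> R) (Inv : (A -> R) -> Prop) (Phi : (A -> R) -> A -> R)
  (f0 : A -> R) (th C0 : R) :
  0 <= th < 1 -> 0 <= C0 -> (forall a, Dom a -> 0 <= W a) -> Inv f0 -> (forall f, Inv f -> Inv (Phi f)) ->
  (forall a, Dom a -> Rabs (Phi f0 a - f0 a) <= C0 * W a) ->
  (forall f g c, 0 <= c -> Inv f -> Inv g -> (forall a, Dom a -> Rabs (f a - g a) <= c * W a) ->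
     forall a, Dom a -> Rabs (Phi f a - Phi g a) <= th * c * W a) ->
  (forall fn f, (forall n, Inv (fn n)) ->
     (forall n a, Dom a -> Rabs (fn n a - f a) <= C0 / (1 - th) * th ^ n * W a) -> Inv f) ->
  exists f, Inv f /\ forall a, Dom a -> Phi f a = f a.
Proof.
  intros Hth HC0 HW Hi0 HiP H0 Hc Hcl.
  set (fn := fun n => Nat.iter n Phi f0).
  assert (Hi : forall n, Inv (fn n)) by (induction n; [exact Hi0|apply HiP, IHn]).
  assert (Hs : forall n a, Dom a -> Rabs (fn (S n) a - fn n a) <= C0 * th ^ n * W a).
  { induction n; intros a Ha.
    - simpl. rewrite Rmult_1_r. apply H0, Ha.
    - replace (C0 * th ^ S n * W a) with (th * (C0 * th ^ n) * W a) by (simpl; ring).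
      apply (Hc (fn (S n)) (fn n) (C0 * th ^ n)); try apply Hi; try assumption.
      apply Rmult_le_pos; [assumption|apply pow_le; lra]. }
  set (c := C0 / (1 - th)).
  assert (Hc0 : 0 <= c) by (apply Rdiv_le_0_compat; lra).
  assert (Hd : forall m n a, Dom a -> Rabs (fn (n + m)%nat a - fn n a) <= c * (th ^ n - th ^ (n + m)) * W a).
  { induction m; intros n a Ha.
    - rewrite Nat.add_0_r, !Rminus_diag, Rabs_R0. lra.
    - replace (n + S m)%nat with (S (n + m)) by lia.
      replace (fn (S (n + m)) a - fn n a) with ((fn (S (n + m)) a - fn (n + m)%nat a) + (fn (n + m)%nat a - fn n a)) by ring.
      eapply Rle_trans; [apply Rabs_triang|].
      assert (h1 := Hs (n + m)%nat a Ha). assert (h2 := IHm n a Ha).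
      replace (c * (th ^ n - th ^ S (n + m)) * W a) with (C0 * th ^ (n + m) * W a + c * (th ^ n - th ^ (n + m)) * W a)
        by (unfold c; simpl; field; lra). lra. }
  assert (Hd' : forall m n a, Dom a -> (n <= m)%nat -> Rabs (fn m a - fn n a) <= c * th ^ n * W a).
  { intros m n a Ha Hnm. replace m with (n + (m - n))%nat by lia.
    eapply Rle_trans; [apply Hd, Ha|]. apply Rmult_le_compat_r; [apply HW, Ha|].
    apply Rmult_le_compat_l; [exact Hc0|]. assert (0 <= th ^ (n + (m - n))) by (apply pow_le; lra). lra. }
  assert (Hex : forall a, Dom a -> ex_finite_lim_seq (fun n => fn n a)).
  { intros a Ha. apply ex_lim_seq_cauchy_corr. intros eps.
    destruct (geom_small (c * W a) th (eps / 4)) as [N HN]; [apply Rmult_le_pos; auto|exact Hth|generalize (cond_pos eps); lra|].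
    exists N; intros n m Hn Hm.
    assert (h1 := Hd' n N a Ha Hn). assert (h2 := Hd' m N a Ha Hm). specialize (HN N (le_n N)).
    replace (fn n a - fn m a) with ((fn n a - fn N a) - (fn m a - fn N a)) by ring.
    eapply Rle_lt_trans; [apply Rabs_triang|]. rewrite Rabs_Ropp. generalize (cond_pos eps). lra. }
  set (f := fun a => real (Lim_seq (fun n => fn n a))).
  assert (Hlim : forall a, Dom a -> is_lim_seq (fun n => fn n a) (f a)).
  { intros a Ha; apply Lim_seq_correct', Hex, Ha. }
  assert (Hf : forall n a, Dom a -> Rabs (fn n a - f a) <= c * th ^ n * W a).
  { intros n a Ha.
    apply (is_lim_seq_le_loc (fun m => Rabs (fn n a - fn m a)) (fun _ => c * th ^ n * W a) (Rabs (fn n a - f a)) (c * th ^ n * W a)).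
    - exists n; intros m Hm. rewrite Rabs_minus_sym. apply Hd'; assumption.
    - apply (is_lim_seq_abs _ (Finite (fn n a - f a))). apply is_lim_seq_minus'; [apply is_lim_seq_const|apply Hlim, Ha].
    - apply is_lim_seq_const. }
  exists f. assert (Hif : Inv f) by (apply (Hcl fn f Hi); exact Hf). split; [exact Hif|].
  intros a Ha. apply eq_of_small; intros eps He.
  destruct (geom_small (c * W a) th (eps / 2)) as [N HN]; [apply Rmult_le_pos; auto|exact Hth|lra|].
  assert (hN := HN N (le_n N)). assert (hSN := HN (S N) (le_S _ _ (le_n N))).
  assert (h1 : Rabs (Phi f a - Phi (fn N) a) <= th * (c * th ^ N) * W a).
  { apply Hc; [apply Rmult_le_pos; [assumption|apply pow_le; lra]|assumption|apply Hi| |assumption].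
    intros b Hb; rewrite Rabs_minus_sym; apply Hf, Hb. }
  assert (h2 := Hf (S N) a Ha). change (fn (S N) a) with (Phi (fn N) a) in h2. simpl pow in h2, hSN.
  replace (Phi f a - f a) with ((Phi f a - Phi (fn N) a) + (Phi (fn N) a - f a)) by ring.
  eapply Rle_trans; [apply Rabs_triang|].
  lra.
Qed.

Lemma locally_wt (eta e k tau : R) : 0 < eta -> 0 < tau ->
  locally tau (fun t => 0 < t /\ forall k, wt eta e k t <= Rpower tau (- e) + 1).
Proof.
  intros He Ht.
  generalize (filter_and _ _ (locally_pos tau Ht) (proj1 (continuous_R_eps _ _) (continuous_Rpower (- e) tau Ht) 1 Rlt_0_1)).
  apply filter_imp; intros t [H0 H]; split; [exact H0|]. intros k'. apply Rabs_def2 in H.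
  eapply Rle_trans; [apply wt_le_rho|]. assert (h := rho_le_1 eta k' He). assert (h' := rho_pos eta k').
  assert (h'' := Rpower_pos t (- e)). nra.
Qed.

Lemma jcont_lim (eta e c th : R) (Un : nat -> R -> R -> R) (U : R -> R -> R) : 0 < eta -> 0 <= c -> 0 <= th < 1 ->
  (forall n k tau, 0 < tau -> jcont (Un n) k tau) ->
  (forall n k tau, 0 < tau -> Rabs (Un n k tau - U k tau) <= c * th ^ n * wt eta e k tau) ->
  forall k tau, 0 < tau -> jcont U k tau.
Proof.
  intros He Hc Hth Hcont Hb k tau Ht. apply continuous_R_eps; intros eps Hp; simpl.
  set (M := Rpower tau (- e) + 1). assert (HM : 0 < M) by (unfold M; generalize (Rpower_pos tau (- e)); lra).
  destruct (geom_small (c * M) th (eps / 4)) as [N HN]; [apply Rmult_le_pos; lra|exact Hth|lra|].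
  specialize (HN N (le_n N)).
  assert (L := locally_snd (U := R_UniformSpace) _ k tau (locally_wt eta e k tau He Ht)).
  assert (L2 := proj1 (continuous_R_eps _ _) (Hcont N k tau Ht) (eps / 4) ltac:(lra)).
  assert (Hk : forall q : R * R, 0 < snd q /\ (forall k, wt eta e k (snd q) <= M) -> Rabs (Un N (fst q) (snd q) - U (fst q) (snd q)) <= eps / 4).
  { intros q [h1 h2]. eapply Rle_trans; [apply Hb, h1|]. eapply Rle_trans; [|exact HN].
    rewrite (Rmult_comm c M), (Rmult_comm (c * th ^ N)), Rmult_assoc. apply Rmult_le_compat_r; [|apply h2].
    apply Rmult_le_pos; [lra|apply pow_le; lra]. }
  assert (H0 := Hk (k, tau) (locally_singleton _ _ L)).
  generalize (filter_and _ _ L L2); apply filter_imp; intros q [h1 h2].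
  assert (h3 := Hk q h1). simpl in h2, H0.
  set (a := Un N (fst q) (snd q) - Un N k tau) in *. set (b := Un N (fst q) (snd q) - U (fst q) (snd q)) in *.
  set (c' := Un N k tau - U k tau) in *.
  assert (Eq : U (fst q) (snd q) - U k tau = a + - b + c') by (unfold a, b, c'; ring).
  assert (t1 := Rabs_triang (a + - b) c'). assert (t2 := Rabs_triang a (- b)). rewrite Rabs_Ropp in t2.
  simpl in h2, H0. change (Rabs a < eps / 4) in h2. change (Rabs c' <= eps / 4) in H0. change (Rabs b <= eps / 4) in h3.
  change (Rabs (U (fst q) (snd q) - U k tau) < eps). rewrite Eq. lra.
Qed.

Lemma lim_bound (x M : R) (c th w : R) (xn : nat -> R) : 0 <= c * w -> 0 <= th < 1 -> (forall n, Rabs (xn n) <= M) ->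
  (forall n, Rabs (xn n - x) <= c * th ^ n * w) -> Rabs x <= M.
Proof.
  intros Hc Hth H1 H2. apply le_epsilon; intros eps He.
  destruct (geom_small (c * w) th eps Hc Hth He) as [N HN]. specialize (HN N (le_n N)).
  replace x with (xn N - (xn N - x)) by ring. eapply Rle_trans; [apply Rabs_triang|]. rewrite Rabs_Ropp.
  specialize (H1 N); specialize (H2 N). lra.
Qed.

Lemma in_wt_lim (eta e B c th : R) (Un : nat -> R -> R -> R) (U : R -> R -> R) : 0 < eta -> 0 <= c -> 0 <= th < 1 ->
  (forall n, in_wt eta e B (Un n)) ->
  (forall n k tau, 0 < tau -> Rabs (Un n k tau - U k tau) <= c * th ^ n * wt eta e k tau) -> in_wt eta e B U.
Proof.
  intros He Hc Hth Hn Hb; split; intros k tau Ht.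
  - apply (jcont_lim eta e c th Un); try assumption. intros n k' t' Ht'; apply (Hn n), Ht'.
  - apply (lim_bound _ _ c th (wt eta e k tau) (fun n => Un n k tau)); [apply Rmult_le_pos; [assumption|left; apply wt_pos]|assumption| |].
    + intros n; apply (Hn n), Ht.
    + intros n; apply Hb, Ht.
Qed.

Lemma in_wt_plus (eta e A B : R) (U V : R -> R -> R) : in_wt eta e A U -> in_wt eta e B V -> in_wt eta e (A + B) (fun k t => U k t + V k t).
Proof.
  intros [H1 H2] [H3 H4]; split; intros k tau Ht.
  - apply (continuous_plus (V := R_NormedModule)); [apply H1, Ht|apply H3, Ht].
  - eapply Rle_trans; [apply Rabs_triang|]. rewrite Rmult_plus_distr_r. apply Rplus_le_compat; auto.
Qed.

Lemma in_wt_diff (eta e A B c : R) (U V : R -> R -> R) : in_wt eta e A U -> in_wt eta e B V ->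
  (forall k tau, 0 < tau -> Rabs (U k tau - V k tau) <= c * wt eta e k tau) -> in_wt eta e c (fun k t => U k t - V k t).
Proof.
  intros [H1 _] [H3 _] H; split; [|exact H]. intros k tau Ht.
  apply (continuous_minus (V := R_NormedModule)); [apply H1, Ht|apply H3, Ht].
Qed.

Lemma in_wt_weaken (eta e A B : R) (U : R -> R -> R) : A <= B -> in_wt eta e A U -> in_wt eta e B U.
Proof.
  intros HAB [H1 H2]; split; [exact H1|]. intros k tau Ht; eapply Rle_trans; [apply H2, Ht|].
  apply Rmult_le_compat_r; [left; apply wt_pos|exact HAB].
Qed.

Lemma conv_minus_r (eta d e A B B' : R) (U Y Y' : R -> R -> R) (k tau : R) : 0 < eta -> 0 < tau ->
  in_wt eta d A U -> in_wt eta e B Y -> in_wt eta e B' Y' ->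
  conv U Y k tau - conv U Y' k tau = conv U (fun k t => Y k t - Y' k t) k tau.
Proof.
  intros He Ht HU HY HY'. unfold conv.
  rewrite <- (IR_minus eta _ _ _ _ He (conv_slice_adm eta d e A B U Y k tau He Ht HU HY) (conv_slice_adm eta d e A B' U Y' k tau He Ht HU HY')).
  apply IR_ext; intros; ring.
Qed.

Lemma conv_minus_l (eta d e A B B' : R) (U Y Y' : R -> R -> R) (k tau : R) : 0 < eta -> 0 < tau ->
  in_wt eta d A U -> in_wt eta e B Y -> in_wt eta e B' Y' ->
  conv Y U k tau - conv Y' U k tau = conv (fun k t => Y k t - Y' k t) U k tau.
Proof.
  intros He Ht HU HY HY'. unfold conv.
  rewrite <- (IR_minus eta _ _ _ _ He (conv_slice_adm eta e d B A Y U k tau He Ht HY HU) (conv_slice_adm eta e d B' A Y' U k tau He Ht HY' HU)).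
  apply IR_ext; intros; ring.
Qed.

Lemma kernel_op_minus (T1 C eta y B B' : R) (h : nat) (K : R -> RR -> R) (N N' : R -> R -> R) (k tau : R) : 1 <= T1 ->
  kern T1 h C K -> in_wt eta y B N -> in_wt eta y B' N' -> 0 < tau ->
  kernel_op T1 K N k tau - kernel_op T1 K N' k tau = kernel_op T1 K (fun k t => N k t - N' k t) k tau.
Proof.
  intros HT HK HN HN' Ht. unfold kernel_op. rewrite <- RInt_minusR.
  - apply RInt_ext; intros s _; symmetry; apply Rmult_minus_distr_l.
  - apply ex_RInt_cont; [lra|]; intros s Hs; apply (kernel_op_integrand T1 C h); try assumption; try lra; apply HN.
  - apply ex_RInt_cont; [lra|]; intros s Hs; apply (kernel_op_integrand T1 C h); try assumption; try lra; apply HN'.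
Qed.

Lemma kernel_op_ext (T1 : R) (K : R -> RR -> R) (N N' : R -> R -> R) (k tau : R) : 0 < T1 ->
  (forall s, 0 < s -> N k s = N' k s) -> kernel_op T1 K N k tau = kernel_op T1 K N' k tau.
Proof.
  intros HT H; unfold kernel_op; apply RInt_ext; intros s Hs. rewrite Rmin_left, Rmax_right in Hs by lra.
  rewrite H by lra; reflexivity.
Qed.

Lemma green_even (T1 k : R) (p : RR) : green T1 (- k) p = green T1 k p.
Proof.
  assert (HA : AA (- k) p = - AA k p) by (unfold AA; ring).
  assert (Hz : symb (- k) = symb k) by (unfold symb; ring).
  assert (HZ : ZZ (- k) p = ZZ k p) by (unfold ZZ; rewrite HA; ring).
  unfold green, green_decay, green_volterra. rewrite HA, Psi_even, HZ. unfold amp, lam. rewrite Hz.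
  replace ((- k) ^ 2) with (k ^ 2) by ring. replace ((- AA k p) ^ 2) with (AA k p ^ 2) by ring. reflexivity.
Qed.

Lemma conv_even (eta d A : R) (U : R -> R -> R) (k tau : R) : 0 < eta -> 0 < tau -> in_wt eta d A U ->
  (forall k tau, 0 < tau -> U (- k) tau = U k tau) -> conv U U (- k) tau = conv U U k tau.
Proof.
  intros He Ht HU Hev. unfold conv.
  rewrite <- (IR_opp (fun l => U l tau * U (k - l) tau)).
  - apply IR_ext; intros l. rewrite (Hev l tau Ht), <- (Hev (- k - l) tau Ht). f_equal; f_equal; ring.
  - apply (conv_slice_adm eta d d A A U U k tau He Ht HU HU).
Qed.

(** With [Q] the constant of the quadratic term, the ball of radius [2 eps] is mapped into itself
    because [4 Q eps^2 <= eps / 2], and the Lipschitz constant there is [4 Q eps <= 1/2]. The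
    operator takes the exponent [2 d] back to [d] because [2 d - d = d < 1]. Evenness, required by
    the cosine transform, is part of the invariant. *)
Lemma nonlinear_solution (T1 eta d CK eps : R) (v : R -> R -> R) : 1 <= T1 -> 0 < eta -> 0 < d < 1 -> 0 <= CK -> 0 <= eps ->
  kern T1 0 CK (green T1) -> in_wt eta d eps v -> (forall k tau, 0 < tau -> v (- k) tau = v k tau) ->
  8 * (CK * Crho eta * CT T1 d) * eps <= 1 ->
  exists U, in_wt eta d (2 * eps) U /\ (forall k tau, 0 < tau -> U (- k) tau = U k tau) /\
    forall k tau, 0 < tau -> U k tau = v k tau + kernel_op T1 (green T1) (conv U U) k tau.
Proof.
  intros HT He Hd HCK Hp HK Hv Hev Hsm.
  set (Q := CK * Crho eta * CT T1 d) in *.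
  assert (HQ : 0 <= Q).
  { unfold Q. apply Rmult_le_pos; [apply Rmult_le_pos; [assumption|left; apply Crho_pos, He]|left; apply CT_pos; lra]. }
  assert (Ebeta : d + d - INR 0 / 2 - d = d) by (simpl; field).
  assert (HTK : forall N B, in_wt eta (d + d) B N -> in_wt eta d (CK * B * CT T1 d) (kernel_op T1 (green T1) N)).
  { intros N B HN. replace (CT T1 d) with (CT T1 (d + d - INR 0 / 2 - d)) by (rewrite Ebeta; reflexivity).
    apply kernel_op_in_wt with (y := d + d); try assumption; lra. }
  assert (HPhi : forall U, in_wt eta d (2 * eps) U -> in_wt eta d (2 * eps) (fun k tau => v k tau + kernel_op T1 (green T1) (conv U U) k tau)).
  { intros U HU. apply in_wt_weaken with (A := eps + CK * (Crho eta * (2 * eps) * (2 * eps)) * CT T1 d).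
    - replace (CK * (Crho eta * (2 * eps) * (2 * eps)) * CT T1 d) with (eps * (4 * Q * eps)) by (unfold Q; ring). nra.
    - apply in_wt_plus; [exact Hv|apply HTK]. apply conv_in_wt; assumption. }
  destruct (picard (A := R * R) (fun a => 0 < snd a) (fun a => wt eta d (fst a) (snd a))
    (fun f => in_wt eta d (2 * eps) (fun k t => f (k, t)) /\ forall k tau, 0 < tau -> f (- k, tau) = f (k, tau))
    (fun f a => v (fst a) (snd a) + kernel_op T1 (green T1) (conv (fun k t => f (k, t)) (fun k t => f (k, t))) (fst a) (snd a))
    (fun _ => 0) (1 / 2) (2 * eps)) as (f & [Hf1 Hf2] & Hfix).
  - lra.
  - lra.
  - intros a _; left; apply wt_pos.
  - split; [|reflexivity]. split; [intros; apply continuous_const|]. intros k tau _; rewrite Rabs_R0.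
    apply Rmult_le_pos; [lra|left; apply wt_pos].
  - intros f [H1 H2]; split; [apply (HPhi _ H1)|]. intros k tau Ht; simpl. rewrite (Hev k tau Ht). f_equal.
    unfold kernel_op. apply RInt_ext; intros s Hs. rewrite Rmin_left, Rmax_right in Hs by lra.
    rewrite green_even. f_equal. apply (conv_even eta d (2 * eps)); [assumption|lra|assumption|exact H2].
  - intros [k tau] Ht; simpl in *. rewrite Rminus_0_r.
    assert (H0 : in_wt eta d (2 * eps) (fun _ _ => 0)).
    { split; [intros; apply continuous_const|]. intros k' tau' _; rewrite Rabs_R0. apply Rmult_le_pos; [lra|left; apply wt_pos]. }
    apply (proj2 (HPhi _ H0)), Ht.
  - intros f g c Hc [Hf _] [Hg _] Hfg [k tau] Ht; simpl in Ht; simpl fst; simpl snd.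
    set (F := fun k t => f (k, t)) in *. set (G := fun k t => g (k, t)) in *.
    assert (HD : in_wt eta d c (fun k t => F k t - G k t)).
    { apply (in_wt_diff eta d (2 * eps) (2 * eps)); try assumption. intros k' t' Ht'; apply (Hfg (k', t') Ht'). }
    assert (HFF := conv_in_wt eta d d _ _ F F He Hf Hf). assert (HGG := conv_in_wt eta d d _ _ G G He Hg Hg).
    replace (v k tau + kernel_op T1 (green T1) (conv F F) k tau - (v k tau + kernel_op T1 (green T1) (conv G G) k tau)) with
      (kernel_op T1 (green T1) (conv F F) k tau - kernel_op T1 (green T1) (conv G G) k tau) by ring.
    rewrite (kernel_op_minus T1 CK eta (d + d) _ _ 0 (green T1) _ _ k tau HT HK HFF HGG Ht).
    assert (HE : in_wt eta (d + d) (Crho eta * c * (2 * eps) + Crho eta * (2 * eps) * c) (fun k t => conv F F k t - conv G G k t)).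
    { assert (HS := in_wt_plus _ _ _ _ _ _ (conv_in_wt eta d d _ _ _ _ He HD Hf) (conv_in_wt eta d d _ _ _ _ He Hg HD)).
      split.
      - intros k' t' Ht'; apply (continuous_minus (V := R_NormedModule)); [apply HFF, Ht'|apply HGG, Ht'].
      - intros k' t' Ht'. replace (conv F F k' t' - conv G G k' t') with
          ((conv F F k' t' - conv G F k' t') + (conv G F k' t' - conv G G k' t')) by ring.
        rewrite (conv_minus_l eta d d (2 * eps) (2 * eps) (2 * eps)) by assumption.
        rewrite (conv_minus_r eta d d (2 * eps) (2 * eps) (2 * eps)) by assumption.
        apply HS, Ht'. }
    eapply Rle_trans; [apply (proj2 (HTK _ _ HE)), Ht|]. apply Rmult_le_compat_r; [left; apply wt_pos|].
    replace (CK * (Crho eta * c * (2 * eps) + Crho eta * (2 * eps) * c) * CT T1 d) with (c * (4 * Q * eps)) by (unfold Q; ring). nra.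
  - intros fn f Hn Hlim; split.
    + apply (in_wt_lim eta d (2 * eps) (2 * eps / (1 - 1 / 2)) (1 / 2) (fun n k t => fn n (k, t))); try assumption; try lra.
      * intros n; apply Hn.
      * intros n k tau Ht; apply (Hlim n (k, tau) Ht).
    + intros k tau Ht. apply eq_of_small; intros e0 He0.
      set (w := wt eta d (- k) tau + wt eta d k tau). assert (Hw : 0 < w) by (apply Rplus_lt_0_compat; apply wt_pos).
      destruct (geom_small (2 * eps / (1 - 1 / 2) * w) (1 / 2) e0) as [N HN]; [apply Rmult_le_pos; lra|lra|assumption|].
      specialize (HN N (le_n N)). assert (h1 := Hlim N (- k, tau) Ht). assert (h2 := Hlim N (k, tau) Ht). simpl in h1, h2.
      rewrite (proj2 (Hn N) k tau Ht) in h1.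
      replace (f (- k, tau) - f (k, tau)) with ((fn N (k, tau) - f (k, tau)) - (fn N (k, tau) - f (- k, tau))) by ring.
      eapply Rle_trans; [apply Rabs_triang|]. rewrite Rabs_Ropp. unfold w in HN. lra.
  - exists (fun k t => f (k, t)); split; [exact Hf1|split; [exact Hf2|]].
    intros k tau Ht; symmetry; apply (Hfix (k, tau) Ht).
Qed.

Lemma derive_unif_lim (fn gn : nat -> R -> R) (f g : R -> R) (c c' th x : R) : 0 <= c -> 0 <= c' -> 0 <= th < 1 ->
  (forall n y, is_derive (fn n) y (gn n y)) ->
  (forall n y, Rabs (fn n y - f y) <= c * th ^ n) -> (forall n y, Rabs (gn n y - g y) <= c' * th ^ n) ->
  continuous g x -> is_derive f x (g x).
Proof.
  intros Hc Hc' Hth Hd Hf Hg Hcg. apply is_derive_Reals; intros eps He.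
  destruct (proj1 (continuous_R_eps _ _) Hcg (eps / 4) ltac:(lra)) as [d Hdl].
  exists d; intros h Hh0 Hh. assert (Hhp : 0 < Rabs h) by (apply Rabs_pos_lt, Hh0).
  destruct (geom_small c' th (eps / 4) Hc' Hth ltac:(lra)) as [N1 HN1].
  destruct (geom_small (2 * c) th (Rabs h * (eps / 4)) ltac:(lra) Hth ltac:(apply Rmult_lt_0_compat; lra)) as [N2 HN2].
  set (n := (N1 + N2)%nat). specialize (HN1 n ltac:(unfold n; lia)). specialize (HN2 n ltac:(unfold n; lia)).
  destruct (MVT_gen (fn n) x (x + h) (gn n)) as [z [Hz Hm]].
  - intros; apply Hd.
  - intros y _; apply continuity_pt_filterlim, (continuous_of_derive _ _ _ (Hd n y)).
  - assert (Hbz : ball x d z).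
    { change (Rabs (z - x) < d). revert Hz Hh.
      unfold Rmin, Rmax, Rabs; destruct (Rle_dec x (x+h)), (Rcase_abs h), (Rcase_abs (z - x)); lra. }
    assert (H1 := Hdl z Hbz). assert (H2 := Hg n z). assert (H3 := Hf n x). assert (H4 := Hf n (x + h)).
    replace (x + h - x) with h in Hm by ring.
    assert (E : (f (x + h) - f x) / h - g x = (gn n z - g z) + (g z - g x) + ((fn n x - f x) - (fn n (x + h) - f (x + h))) / h).
    { apply Rmult_eq_reg_r with h; [|exact Hh0]. field_simplify; [|exact Hh0|exact Hh0]. lra. }
    rewrite E.
    assert (H5 : Rabs (((fn n x - f x) - (fn n (x + h) - f (x + h))) / h) <= eps / 4).
    { unfold Rdiv; rewrite Rabs_mult, Rabs_inv. apply Rle_div_l; [exact Hhp|].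
      eapply Rle_trans; [apply Rabs_triang|]. rewrite Rabs_Ropp. lra. }
    assert (t1 := Rabs_triang (gn n z - g z + (g z - g x)) (((fn n x - f x) - (fn n (x + h) - f (x + h))) / h)).
    assert (t2 := Rabs_triang (gn n z - g z) (g z - g x)). lra.
Qed.

Lemma in_wt_uniform (eta e B : R) (U : R -> R -> R) (tau : R) : 0 < eta -> 0 <= B -> 0 < tau ->
  forall k, B * wt eta e k tau <= B * Rpower tau (- e).
Proof.
  intros He HB Ht k. apply Rmult_le_compat_l; [exact HB|]. eapply Rle_trans; [apply wt_le_rho|].
  assert (h := rho_le_1 eta k He). assert (h' := Rpower_pos tau (- e)). nra.
Qed.

(** * Frequency derivatives of the solution *)

Section Linear.
Variables (T1 eta d CK A : R) (U : R -> R -> R).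
Hypotheses (HT : 1 <= T1) (He : 0 < eta) (Hd : 0 < d < 1) (HCK : 0 <= CK) (HK : kern T1 0 CK (green T1)) (HU : in_wt eta d A U).
Let Q := CK * Crho eta * CT T1 d.
Hypothesis HQA : Q * A <= 1 / 4.

Lemma QU_in_wt (e B : R) (Y : R -> R -> R) : 0 <= e <= 2 -> in_wt eta e B Y ->
  in_wt eta e (Q * A * B) (kernel_op T1 (green T1) (conv U Y)).
Proof using HT He Hd HCK HK HU.
  intros H0 HY. assert (Eb : d + e - INR 0 / 2 - e = d) by (simpl; field).
  replace (Q * A * B) with (CK * (Crho eta * A * B) * CT T1 (d + e - INR 0 / 2 - e)) by (rewrite Eb; unfold Q; ring).
  apply kernel_op_in_wt with (y := d + e); try assumption; [apply conv_in_wt; assumption|rewrite Eb; lra].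
Qed.

Lemma QU_minus (e B B' : R) (Y Y' : R -> R -> R) (k tau : R) (h : nat) (C : R) (K : R -> RR -> R) :
  kern T1 h C K -> in_wt eta e B Y -> in_wt eta e B' Y' -> 0 < tau ->
  kernel_op T1 K (conv U Y) k tau - kernel_op T1 K (conv U Y') k tau = kernel_op T1 K (conv U (fun k t => Y k t - Y' k t)) k tau.
Proof using HT He HU.
  intros HKh HY HY' Ht.
  rewrite (kernel_op_minus T1 C eta (d + e) _ _ h K _ _ k tau HT HKh (conv_in_wt eta d e A B U Y He HU HY) (conv_in_wt eta d e A B' U Y' He HU HY') Ht).
  apply kernel_op_ext; [lra|]. intros s Hs. apply (conv_minus_r eta d e A B B'); assumption.
Qed.

(** The operator has norm at most 1/4, so substituting the equation into itself improves the bound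
    geometrically. *)
Lemma QU_unique (e B : R) (Y : R -> R -> R) : 0 <= e <= 2 -> in_wt eta e B Y ->
  (forall k tau, 0 < tau -> Y k tau = kernel_op T1 (green T1) (conv U Y) k tau) -> forall k tau, 0 < tau -> Y k tau = 0.
Proof using HT He Hd HCK HK HU HQA.
  intros H0 HY Hfix.
  assert (Hn : forall n, in_wt eta e (B * (1 / 4) ^ n) Y).
  { induction n; [rewrite pow_O, Rmult_1_r; exact HY|]. assert (HB := in_wt_B _ _ _ _ IHn).
    assert (H := QU_in_wt e _ Y H0 IHn). split; [apply HY|]. intros k tau Ht. rewrite (Hfix k tau Ht).
    eapply Rle_trans; [apply H, Ht|]. apply Rmult_le_compat_r; [left; apply wt_pos|]. simpl pow. nra. }
  intros k tau Ht. apply eq_of_small; intros eps Hp. rewrite Rminus_0_r.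
  destruct (geom_small (B * wt eta e k tau) (1 / 4) eps) as [N HN]; [apply Rmult_le_pos; [apply (in_wt_B _ _ _ _ HY)|left; apply wt_pos]|lra|exact Hp|].
  specialize (HN N (le_n N)). eapply Rle_trans; [apply (Hn N), Ht|]. lra.
Qed.

(** The differentiated equation is a candidate for the derivative, but differentiability of [Y]
    cannot be read off its own equation. So [Y] and [Z] are constructed together by iteration, with
    [Z] the derivative of [Y] as an invariant that survives the limit; uniqueness then identifies
    the limit with the given [Y]. *)
Lemma linear_step (e0 e1 C1 g0 g1 B : R) (Kd : R -> RR -> R) (G G1 Y : R -> R -> R) :
  0 <= e0 <= 2 -> 0 <= e1 <= 2 -> d + e0 - INR 1 / 2 - e1 < 1 -> 0 <= C1 -> kern T1 1 C1 Kd ->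
  (forall k p, Dk T1 k p -> is_derive (fun y => green T1 y p) k (Kd k p)) ->
  in_wt eta e0 g0 G -> in_wt eta e1 g1 G1 -> (forall k tau, 0 < tau -> is_derive (fun y => G y tau) k (G1 k tau)) ->
  in_wt eta e0 B Y -> (forall k tau, 0 < tau -> Y k tau = G k tau + kernel_op T1 (green T1) (conv U Y) k tau) ->
  exists M Z, in_wt eta e1 M Z /\ (forall k tau, 0 < tau -> is_derive (fun y => Y y tau) k (Z k tau)) /\
    forall k tau, 0 < tau -> Z k tau = (G1 k tau + kernel_op T1 Kd (conv U Y) k tau) + kernel_op T1 (green T1) (conv U Z) k tau.
Proof using HT He Hd HCK HK HU HQA.
  intros H0 H1 Hlt HC1 HKd HKder HG HG1 HGd HY HYfix.
  assert (Pg0 := in_wt_B _ _ _ _ HG). assert (Pg1 := in_wt_B _ _ _ _ HG1). assert (PA := in_wt_B _ _ _ _ HU).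
  set (C2 := C1 * (Crho eta * A) * CT T1 (d + e0 - INR 1 / 2 - e1)).
  assert (HC2 : 0 <= C2).
  { unfold C2. apply Rmult_le_pos; [apply Rmult_le_pos; [assumption|apply Rmult_le_pos; [left; apply Crho_pos, He|exact PA]]|left; apply CT_pos; exact Hlt]. }
  assert (HPQ : 0 <= Q * A).
  { unfold Q. apply Rmult_le_pos; [|exact PA]. apply Rmult_le_pos; [apply Rmult_le_pos; [assumption|left; apply Crho_pos, He]|left; apply CT_pos; lra]. }
  assert (HKdX : forall B' Y', in_wt eta e0 B' Y' -> in_wt eta e1 (C2 * B') (kernel_op T1 Kd (conv U Y'))).
  { intros B' Y' HY'. replace (C2 * B') with (C1 * (Crho eta * A * B') * CT T1 (d + e0 - INR 1 / 2 - e1)) by (unfold C2; ring).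
    apply kernel_op_in_wt with (y := d + e0); try assumption. apply conv_in_wt; assumption. }
  (* Twice the forcing gives invariant balls, since the linear operator has norm at most 1/4. *)
  set (M0 := 2 * g0). set (M1 := 2 * (g1 + C2 * M0)).
  assert (PM0 : 0 <= M0) by (unfold M0; lra).
  assert (PM1 : 0 <= M1) by (unfold M1; assert (0 <= C2 * M0) by (apply Rmult_le_pos; assumption); lra).
  (* The norm of the derivative component is scaled by [bz]: the coupling through [Kd] then counts
     as [C2 / bz <= 1/4], and with the diagonal term the contraction constant is 1/2. *)
  set (bz := 4 * C2 + 1). assert (Hbz : 0 < bz) by (unfold bz; lra).
  (* The label [true] marks the solution, [false] its derivative. *)
  set (Yp := fun (f : bool * (R * R) -> R) k t => f (true, (k, t))).
  set (Zp := fun (f : bool * (R * R) -> R) k t => f (false, (k, t))).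
  set (Phi := fun (f : bool * (R * R) -> R) (a : bool * (R * R)) =>
     let k := fst (snd a) in let t := snd (snd a) in
     if fst a then G k t + kernel_op T1 (green T1) (conv U (Yp f)) k t
     else (G1 k t + kernel_op T1 Kd (conv U (Yp f)) k t) + kernel_op T1 (green T1) (conv U (Zp f)) k t).
  set (Inv := fun f => in_wt eta e0 M0 (Yp f) /\ in_wt eta e1 M1 (Zp f) /\
     forall k tau, 0 < tau -> is_derive (fun y => Yp f y tau) k (Zp f k tau)).
  assert (HInv : forall f, Inv f -> Inv (Phi f)).
  { intros f (I1 & I2 & I3). split; [|split].
    - apply in_wt_weaken with (A := g0 + Q * A * M0); [unfold M0; nra|].
      apply (in_wt_plus eta e0 g0 _ G (kernel_op T1 (green T1) (conv U (Yp f)))); [exact HG|apply QU_in_wt; assumption].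
    - apply in_wt_weaken with (A := (g1 + C2 * M0) + Q * A * M1).
      { assert (E1 : M1 = 2 * (g1 + C2 * M0)) by reflexivity.
        assert (Q * A * M1 <= 1 / 4 * M1) by (apply Rmult_le_compat_r; assumption). lra. }
      apply (in_wt_plus eta e1 (g1 + C2 * M0) _ (fun k t => G1 k t + kernel_op T1 Kd (conv U (Yp f)) k t) (kernel_op T1 (green T1) (conv U (Zp f)))).
      + apply (in_wt_plus eta e1 g1 _ G1 (kernel_op T1 Kd (conv U (Yp f)))); [exact HG1|apply HKdX, I1].
      + apply QU_in_wt; assumption.
    - intros k tau Ht. unfold Yp, Zp, Phi; simpl.
      rewrite Rplus_assoc. apply (is_derive_plus (V := R_NormedModule)); [apply HGd, Ht|].
      apply (kernel_op_derive T1 CK C1 0 1); try assumption; try lra.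
      + apply (conv_in_wt eta d e0 A M0 U (Yp f)); assumption.
      + apply (conv_in_wt eta d e1 A M1 U (Zp f)); assumption.
      + intros k' s Hs. apply (conv_derive eta d e0 e1 A M0 M1); assumption. }
  destruct (picard (A := bool * (R * R)) (fun a => 0 < snd (snd a))
     (fun a => if fst a then wt eta e0 (fst (snd a)) (snd (snd a)) else bz * wt eta e1 (fst (snd a)) (snd (snd a)))
     Inv Phi (fun _ => 0) (1 / 2) (M0 + M1)) as (f & Hf & Hfix).
  - lra.
  - lra.
  - intros [b [k t]] _; simpl; destruct b; [left; apply wt_pos|]. apply Rmult_le_pos; [lra|left; apply wt_pos].
  - split; [|split].
    + split; [intros; apply continuous_const|]. intros k t _; unfold Yp; rewrite Rabs_R0. apply Rmult_le_pos; [exact PM0|left; apply wt_pos].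
    + split; [intros; apply continuous_const|]. intros k t _; unfold Zp; rewrite Rabs_R0. apply Rmult_le_pos; [exact PM1|left; apply wt_pos].
    + intros k t _; unfold Yp, Zp. apply (is_derive_const (V := R_NormedModule)).
  - exact HInv.
  - assert (I0 : Inv (Phi (fun _ => 0))).
    { apply HInv. split; [|split].
      + split; [intros; apply continuous_const|]. intros k t _; unfold Yp; rewrite Rabs_R0. apply Rmult_le_pos; [exact PM0|left; apply wt_pos].
      + split; [intros; apply continuous_const|]. intros k t _; unfold Zp; rewrite Rabs_R0. apply Rmult_le_pos; [exact PM1|left; apply wt_pos].
      + intros k t _; unfold Yp, Zp. apply (is_derive_const (V := R_NormedModule)). }
    destruct I0 as (I1 & I2 & _).
    intros [b [k t]] Ht; simpl in Ht. rewrite Rminus_0_r. destruct b; simpl fst; simpl snd.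
    + eapply Rle_trans; [apply (proj2 I1 k t Ht)|]. apply Rmult_le_compat_r; [left; apply wt_pos|lra].
    + eapply Rle_trans; [apply (proj2 I2 k t Ht)|]. rewrite <- Rmult_assoc. apply Rmult_le_compat_r; [left; apply wt_pos|].
      unfold bz. nra.
  - intros f g c Hc (F1 & F2 & _) (G1' & G2 & _) Hfg [b [k t]] Ht; simpl in Ht.
    assert (DY : in_wt eta e0 c (fun k t => Yp f k t - Yp g k t)).
    { apply (in_wt_diff eta e0 M0 M0); try assumption. intros k' t' Ht'; apply (Hfg (true, (k', t')) Ht'). }
    assert (DZ : in_wt eta e1 (c * bz) (fun k t => Zp f k t - Zp g k t)).
    { apply (in_wt_diff eta e1 M1 M1); try assumption. intros k' t' Ht'. rewrite Rmult_assoc. apply (Hfg (false, (k', t')) Ht'). }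
    destruct b; unfold Phi; simpl fst; simpl snd; cbv iota.
    + replace (G k t + kernel_op T1 (green T1) (conv U (Yp f)) k t - (G k t + kernel_op T1 (green T1) (conv U (Yp g)) k t)) with
        (kernel_op T1 (green T1) (conv U (Yp f)) k t - kernel_op T1 (green T1) (conv U (Yp g)) k t) by ring.
      rewrite (QU_minus e0 M0 M0 _ _ k t 0 CK) by assumption.
      eapply Rle_trans; [apply (proj2 (QU_in_wt e0 c _ H0 DY)), Ht|]. apply Rmult_le_compat_r; [left; apply wt_pos|]. nra.
    + replace (G1 k t + kernel_op T1 Kd (conv U (Yp f)) k t + kernel_op T1 (green T1) (conv U (Zp f)) k t -
        (G1 k t + kernel_op T1 Kd (conv U (Yp g)) k t + kernel_op T1 (green T1) (conv U (Zp g)) k t)) with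
        ((kernel_op T1 Kd (conv U (Yp f)) k t - kernel_op T1 Kd (conv U (Yp g)) k t) +
         (kernel_op T1 (green T1) (conv U (Zp f)) k t - kernel_op T1 (green T1) (conv U (Zp g)) k t)) by ring.
      rewrite (QU_minus e0 M0 M0 _ _ k t 1 C1) by assumption.
      rewrite (QU_minus e1 M1 M1 _ _ k t 0 CK) by assumption.
      eapply Rle_trans; [apply Rabs_triang|].
      assert (h1 := proj2 (HKdX c _ DY) k t Ht). assert (h2 := proj2 (QU_in_wt e1 (c * bz) _ H1 DZ) k t Ht).
      eapply Rle_trans; [apply Rplus_le_compat; [exact h1|exact h2]|].
      rewrite <- Rmult_plus_distr_r. rewrite <- (Rmult_assoc _ bz). apply Rmult_le_compat_r; [left; apply wt_pos|].
      assert (Q * A * (c * bz) <= 1 / 4 * (c * bz)) by (apply Rmult_le_compat_r; [apply Rmult_le_pos; lra|exact HQA]).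
      unfold bz in *. nra.
  - intros fn f Hn Hlim. assert (Hc : 0 <= (M0 + M1) / (1 - 1 / 2)) by (apply Rdiv_le_0_compat; lra).
    assert (LY : forall n k t, 0 < t -> Rabs (Yp (fn n) k t - Yp f k t) <= (M0 + M1) / (1 - 1 / 2) * (1 / 2) ^ n * wt eta e0 k t).
    { intros n k t Ht; apply (Hlim n (true, (k, t)) Ht). }
    assert (LZ : forall n k t, 0 < t -> Rabs (Zp (fn n) k t - Zp f k t) <= (M0 + M1) / (1 - 1 / 2) * bz * (1 / 2) ^ n * wt eta e1 k t).
    { intros n k t Ht; eapply Rle_trans; [apply (Hlim n (false, (k, t)) Ht)|]. simpl; right; ring. }
    assert (Hcb : 0 <= (M0 + M1) / (1 - 1 / 2) * bz) by (apply Rmult_le_pos; lra).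
    assert (XZ : in_wt eta e1 M1 (Zp f)).
    { apply (in_wt_lim eta e1 M1 ((M0 + M1) / (1 - 1 / 2) * bz) (1 / 2) (fun n => Zp (fn n))); try assumption; try lra. intros n; apply Hn. }
    split; [|split; [exact XZ|]].
    + apply (in_wt_lim eta e0 M0 ((M0 + M1) / (1 - 1 / 2)) (1 / 2) (fun n => Yp (fn n))); try assumption; try lra. intros n; apply Hn.
    + intros k t Ht.
      apply (derive_unif_lim (fun n y => Yp (fn n) y t) (fun n y => Zp (fn n) y t) (fun y => Yp f y t) (fun y => Zp f y t)
        ((M0 + M1) / (1 - 1 / 2) * Rpower t (- e0)) ((M0 + M1) / (1 - 1 / 2) * bz * Rpower t (- e1)) (1 / 2) k).
      * apply Rmult_le_pos; [exact Hc|left; apply Rpower_pos].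
      * apply Rmult_le_pos; [exact Hcb|left; apply Rpower_pos].
      * lra.
      * intros n y; apply (Hn n), Ht.
      * intros n y; eapply Rle_trans; [apply LY, Ht|].
        replace ((M0 + M1) / (1 - 1 / 2) * Rpower t (- e0) * (1 / 2) ^ n) with ((M0 + M1) / (1 - 1 / 2) * (1 / 2) ^ n * Rpower t (- e0)) by ring.
        apply in_wt_uniform; try assumption. apply Rmult_le_pos; [exact Hc|apply pow_le; lra].
      * intros n y; eapply Rle_trans; [apply LZ, Ht|].
        replace ((M0 + M1) / (1 - 1 / 2) * bz * Rpower t (- e1) * (1 / 2) ^ n) with ((M0 + M1) / (1 - 1 / 2) * bz * (1 / 2) ^ n * Rpower t (- e1)) by ring.
        apply in_wt_uniform; try assumption. apply Rmult_le_pos; [exact Hcb|apply pow_le; lra].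
      * apply (continuous_slice_l (Zp f)), XZ, Ht.
  - destruct Hf as (F1 & F2 & F3).
    assert (FY : forall k t, 0 < t -> Yp f k t = G k t + kernel_op T1 (green T1) (conv U (Yp f)) k t).
    { intros k t Ht; symmetry; apply (Hfix (true, (k, t)) Ht). }
    assert (FZ : forall k t, 0 < t -> Zp f k t = (G1 k t + kernel_op T1 Kd (conv U (Yp f)) k t) + kernel_op T1 (green T1) (conv U (Zp f)) k t).
    { intros k t Ht; symmetry; apply (Hfix (false, (k, t)) Ht). }
    (* The difference of the given solution and the iterated one solves the homogeneous equation. *)
    assert (EY : forall k t, 0 < t -> Y k t = Yp f k t).
    { assert (HD : in_wt eta e0 (B + M0) (fun k t => Y k t - Yp f k t)).
      { apply (in_wt_diff eta e0 B M0); try assumption. intros k t Ht.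
        eapply Rle_trans; [apply Rabs_triang|]. rewrite Rabs_Ropp, Rmult_plus_distr_r. apply Rplus_le_compat; [apply HY, Ht|apply F1, Ht]. }
      intros k t Ht. apply Rminus_diag_uniq.
      apply (QU_unique e0 (B + M0) (fun k t => Y k t - Yp f k t) H0 HD); [|exact Ht].
      intros k' t' Ht'. rewrite <- (QU_minus e0 B M0 _ _ k' t' 0 CK) by assumption.
      rewrite (HYfix k' t' Ht') at 1. rewrite (FY k' t' Ht') at 1. ring. }
    exists M1, (Zp f); split; [exact F2|split].
    + intros k t Ht. apply is_derive_ext with (f := fun y => Yp f y t); [|apply F3, Ht].
      intros y; symmetry; apply EY, Ht.
    + intros k t Ht. rewrite (FZ k t Ht) at 1. f_equal. f_equal. apply kernel_op_ext; [lra|]. intros s Hs.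
      unfold conv; apply IR_ext; intros l. rewrite (EY (k - l) s Hs). reflexivity.
Qed.

(** The derivative of [Y] solves an equation of the same form, with the exponents shifted by one and
    the forcing [G1] plus the image of [U * Y] under the differentiated kernel. That forcing
    involves [Y] itself, one order lower, so the induction hypothesis is used twice. The nonlinear
    solution is the case [Y = U]. *)
Lemma linear_smooth (m : nat) : (forall n, ksmooth (Dk T1) n (pw (kap T1) rts) (green T1)) ->
  forall (E : nat -> R) (B : R) (G Y : R -> R -> R),
  (forall j, 0 <= E j <= 2) -> (forall a b, d + E b - INR (1 + a) / 2 - E (1 + a + b)%nat < 1) ->
  ksmooth Dp m (fun j => wt eta (E j)) G -> in_wt eta (E O) B Y ->
  (forall k tau, 0 < tau -> Y k tau = G k tau + kernel_op T1 (green T1) (conv U Y) k tau) ->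
  ksmooth Dp m (fun j => wt eta (E j)) Y.
Proof using HT He Hd HCK HK HU HQA.
  intros HKs; induction m; intros E B G Y HE Hadm HG HY Hfix.
  all: assert (HB := in_wt_B _ _ _ _ HY).
  all: split; [intros k t Ht; apply HY, Ht|split; [exists B; split; [exact HB|intros k t Ht; apply HY, Ht]|]].
  - exact I.
  - assert (HYm : ksmooth Dp m (fun j => wt eta (E j)) Y) by (apply (IHm E B G Y HE Hadm (ksmooth_pred _ _ _ _ HG) HY Hfix)).
    destruct (HKs (S m)) as (_ & _ & Kd & HKder & HKd).
    destruct (ksmooth_bd _ _ _ _ HKd) as (C1 & HC1 & HKdb).
    assert (Hkd : kern T1 1 C1 Kd) by (split; [apply (ksmooth_cont _ _ _ _ HKd)|exact HKdb]).
    destruct (ksmooth_in_wt eta (E O) _ _ _ (fun k tau => eq_refl) HG) as [g0 Hg0].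
    destruct HG as (_ & _ & G1 & HGd & HG1).
    destruct (ksmooth_in_wt eta (E 1%nat) _ _ _ (fun k tau => eq_refl) HG1) as [g1 Hg1].
    destruct (linear_step (E O) (E 1%nat) C1 g0 g1 B Kd G G1 Y) as (M & Z & HZ & HYd & HZfix); try assumption; try apply HE.
    { generalize (Hadm O O); simpl; auto. }
    exists Z; split; [exact HYd|].
    apply (IHm (fun j => E (S j)) M (fun k t => G1 k t + kernel_op T1 Kd (conv U Y) k t) Z); [intros; apply HE| | |exact HZ|exact HZfix].
    + intros a b. generalize (Hadm a (S b)). replace (1 + a + S b)%nat with (S (1 + a + b)) by lia; auto.
    + apply ksmooth_plus; [exact HG1|].
      apply (kernel_op_ksmooth T1 eta (fun j => d + E j) (fun j => E (S j)) m 1 Kd (conv U Y) HT HKd); [|intros; apply HE|].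
      * apply (conv_ksmooth eta d A E m U Y He HU HYm).
      * intros a b. generalize (Hadm a b). replace (1 + a + b)%nat with (S (a + b)) by lia; auto.
Qed.
End Linear.

(** * The differential equation solved by the integral operator *)

Lemma leibniz_lower (phi phi1 g : R -> R) (b x : R) : 0 < x < b ->
  (forall y, is_derive phi y (phi1 y)) -> (forall y, continuous phi1 y) -> (forall y, 0 < y -> continuous g y) ->
  is_derive (fun u => RInt (fun t => phi (t - u) * g t) u b) x (- RInt (fun t => phi1 (t - x) * g t) x b - phi 0 * g x).
Proof.
  intros Hx Hd Hc1 Hg.
  assert (Hdu : forall u t, is_derive (fun u => phi (t - u) * g t) u (- phi1 (t - u) * g t)).
  { intros u t. evar_last.
    - apply is_derive_ext with (f := fun u => g t * phi (t - u)); [intros; apply Rmult_comm|].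
      apply is_derive_scal. apply (is_derive_comp phi (fun u => t - u) u (phi1 (t - u)) (-1)); [apply Hd|].
      auto_derive; [exact I|ring].
    - unfold scal; simpl; unfold mult; simpl; ring. }
  assert (Hphi : forall y, continuous phi y) by (intros y; apply (continuous_of_derive _ _ _ (Hd y))).
  assert (Hint : forall u t, 0 < t -> continuous (fun t => phi (t - u) * g t) t).
  { intros u t Ht; apply (continuous_mult (K := R_AbsRing)); [|apply Hg, Ht].
    apply (continuous_comp (fun t => t - u) phi); [|apply Hphi].
    apply (continuous_minus (V := R_NormedModule)); [apply continuous_id|apply continuous_const]. }
  assert (H2 : forall u t, 0 < t -> continuity_2d_pt (fun u v => Derive (fun z => phi (v - z) * g v) u) u t).
  { intros u t Ht. apply continuity_2d_pt_filterlim.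
    apply (continuous_ext (T := RR) (U := R_UniformSpace) (fun z : R * R => - phi1 (snd z - fst z) * g (snd z))).
    - intros z; symmetry; apply is_derive_unique, Hdu.
    - apply (continuous_mult (K := R_AbsRing)).
      + apply (continuous_opp (V := R_NormedModule)). apply (continuous_comp (fun z : R * R => snd z - fst z) phi1); [|apply Hc1].
        apply (continuous_minus (V := R_NormedModule)); [apply continuous_snd'|apply continuous_fst'].
      + apply (continuous_comp (fun z : R * R => snd z) g); [apply continuous_snd'|apply Hg, Ht]. }
  assert (Heps : 0 < x / 2) by lra.
  evar_last.
  - apply (is_derive_RInt_param_bound_comp_aux2 (fun u t => phi (t - u) * g t) (fun u => u) b x 1).
    + apply filter_forall; intros u. apply ex_RInt_cont; [lra|]. intros; apply Hint; lra.
    + exists (mkposreal _ Heps); simpl. apply filter_forall; intros u. apply ex_RInt_cont; [lra|]. intros; apply Hint; lra.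
    + apply (is_derive_id (K := R_AbsRing)).
    + exists (mkposreal _ Heps); simpl. apply filter_forall; intros u t _. eexists; apply Hdu.
    + intros t Ht; rewrite Rmin_left in Ht by lra. apply H2; lra.
    + exists (mkposreal _ Heps); simpl. intros u v _ Hv. apply H2. apply Rabs_def2 in Hv; lra.
    + apply continuity_pt_filterlim, Hint; lra.
  - simpl. replace (x - x) with 0 by ring. rewrite Rmult_1_r. unfold Rminus. rewrite Ropp_mult_distr_l. f_equal.
    rewrite <- (RInt_opp (V := R_CompleteNormedModule)).
    + apply RInt_ext; intros t _. transitivity (- phi1 (t - x) * g t); [apply is_derive_unique, Hdu|].
      symmetry; apply Ropp_mult_distr_l.
    + apply ex_RInt_cont; [lra|]. intros t Ht. apply (continuous_mult (K := R_AbsRing)); [|apply Hg; lra].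
      apply (continuous_comp (fun t => t + - x) phi1); [|apply Hc1].
      apply (continuous_plus (V := R_NormedModule)); [apply continuous_id|apply continuous_const].
Qed.

(** In the unscaled variables the kernel is, up to the cutoff, [k^2 phi (s - tau)] for
    [s > tau > 0], where [phi r = sinh (lam r) / lam] solves [phi'' = symb k * phi] with [phi 0 = 0]
    and derivative 1 at 0. These values make the boundary term vanish in the first derivative and
    produce the source in the second. *)
Lemma volterra_part (T1 k : R) (N : R -> R -> R) : 1 <= T1 -> (forall s, 0 < s -> continuous (N k) s) ->
  exists W1 : R -> R, forall tau, 0 < tau < T1 ->
    is_derive (fun t => RInt (fun s => green_volterra T1 k (t, s) * N k s) 0 T1) tau (W1 tau) /\
    is_derive W1 tau (symb k * RInt (fun s => green_volterra T1 k (tau, s) * N k s) 0 T1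
                      + k ^ 2 * ((1 - Psi (mm T1) (k * sqrt tau)) * N k tau)).
Proof.
  intros HT HN.
  set (g := fun s => (1 - Psi (mm T1) (k * sqrt s)) * N k s).
  assert (Hg : forall s, 0 < s -> continuous g s).
  { intros s Hs; apply (continuous_mult (K := R_AbsRing)); [|apply HN, Hs].
    apply (continuous_minus (V := R_NormedModule)); [apply continuous_const|].
    apply (continuous_comp (fun s => k * sqrt s) (Psi (mm T1))); [|apply (Psi_smooth1 (mm T1) 0)].
    apply (continuous_mult (K := R_AbsRing)); [apply continuous_const|apply continuous_sqrt]. }
  set (phi := fun r => r * shc 0 (r ^ 2 * symb k)). set (phi1 := fun r => chc (r ^ 2 * symb k)).
  assert (Hr : forall r, is_derive (fun r => r ^ 2 * symb k) r (2 * r * symb k)) by (intros r; auto_derive; [exact I|ring]).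
  assert (D1 : forall r, is_derive phi r (phi1 r)).
  { intros r; unfold phi, phi1. evar_last.
    - apply (is_derive_mult (fun r => r) (fun r => shc 0 (r ^ 2 * symb k)) r 1 (2 * r * symb k * shc 1 (r ^ 2 * symb k))).
      + apply (is_derive_id (K := R_AbsRing)).
      + apply (is_derive_comp (shc 0) (fun r => r ^ 2 * symb k) r _ _ (shc_derive 0 _) (Hr r)).
      + intros; apply Rmult_comm.
    - unfold plus, mult; simpl. change (mult ?a ?b) with (a * b).
      rewrite <- shc_chc. simpl. ring. }
  assert (D2 : forall r, is_derive phi1 r (symb k * phi r)).
  { intros r; unfold phi, phi1. evar_last.
    - apply (is_derive_comp chc (fun r => r ^ 2 * symb k) r _ _ (chc_derive _) (Hr r)).
    - unfold scal; simpl; unfold mult; simpl. field. }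
  assert (C1 : forall r, continuous phi1 r) by (intros r; apply (continuous_of_derive _ _ _ (D2 r))).
  assert (C2 : forall r, continuous (fun r => symb k * phi r) r).
  { intros r; apply (continuous_mult (K := R_AbsRing)); [apply continuous_const|apply (continuous_of_derive _ _ _ (D1 r))]. }
  assert (EB : forall tau, 0 < tau < T1 -> RInt (fun s => green_volterra T1 k (tau, s) * N k s) 0 T1 = k ^ 2 * RInt (fun s => phi (s - tau) * g s) tau T1).
  { intros tau Ht.
    assert (Hex2 : ex_RInt (fun s => phi (s - tau) * g s) tau T1).
    { apply ex_RInt_cont; [lra|]. intros s Hs. apply (continuous_mult (K := R_AbsRing)); [|apply Hg; lra].
      apply (continuous_comp (fun s => s - tau) phi); [|apply (continuous_of_derive _ _ _ (D1 _))].
      apply (continuous_minus (V := R_NormedModule)); [apply continuous_id|apply continuous_const]. }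
    assert (Z1 : forall s, s <= tau -> green_volterra T1 k (tau, s) * N k s = 0).
    { intros s Hs. unfold green_volterra, QQ; simpl fst; simpl snd. rewrite (Rmax_right (s - tau) 0) by lra. unfold Rdiv; ring. }
    assert (Z2 : forall s, tau <= s -> green_volterra T1 k (tau, s) * N k s = k ^ 2 * (phi (s - tau) * g s)).
    { intros s Hs.
      assert (Hss : sqrt s * sqrt s = s) by (apply sqrt_sqrt; lra).
      assert (EQ : QQ (tau, s) = (s - tau) / s) by (unfold QQ; simpl fst; simpl snd; rewrite !Rmax_left by lra; reflexivity).
      assert (EA2 : AA k (tau, s) ^ 2 = k ^ 2 * s) by (unfold AA; simpl snd; rewrite Rpow_mult_distr; simpl; rewrite <- Hss at 3; ring).
      assert (EA4 : AA k (tau, s) ^ 4 = k ^ 4 * s ^ 2).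
      { replace (AA k (tau, s) ^ 4) with ((AA k (tau, s) ^ 2) ^ 2) by ring. rewrite EA2; ring. }
      assert (EZ : ZZ k (tau, s) = (s - tau) ^ 2 * symb k).
      { unfold ZZ. rewrite EQ, EA2, EA4. simpl snd. rewrite Hss. unfold symb. field; lra. }
      unfold green_volterra. rewrite EZ, EA2, EQ. unfold phi, g, AA; simpl snd. field; lra. }
    assert (I1 : is_RInt (fun s => green_volterra T1 k (tau, s) * N k s) 0 tau 0).
    { apply is_RInt_ext with (f := fun _ => 0).
      - intros s Hs. rewrite Rmin_left, Rmax_right in Hs by lra. symmetry; apply Z1; lra.
      - evar_last; [apply (is_RInt_const (V := R_NormedModule))|]. apply Rmult_0_r. }
    assert (I2 : is_RInt (fun s => green_volterra T1 k (tau, s) * N k s) tau T1 (k ^ 2 * RInt (fun s => phi (s - tau) * g s) tau T1)).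
    { apply is_RInt_ext with (f := fun s => k ^ 2 * (phi (s - tau) * g s)).
      - intros s Hs. rewrite Rmin_left, Rmax_right in Hs by lra. symmetry; apply Z2; lra.
      - apply (is_RInt_scal (V := R_NormedModule)), (RInt_correct (V := R_CompleteNormedModule)), Hex2. }
    apply (is_RInt_unique (V := R_CompleteNormedModule)). evar_last; [apply (is_RInt_Chasles (V := R_NormedModule) _ _ _ _ _ _ I1 I2)|].
    apply Rplus_0_l. }
  assert (Hop : forall tau, 0 < tau < T1 -> locally tau (fun t => 0 < t < T1)).
  { intros tau Ht; apply filter_and; [apply locally_pos|apply locally_lt]; lra. }
  exists (fun tau => k ^ 2 * (- RInt (fun t => phi1 (t - tau) * g t) tau T1)). intros tau Ht. split.
  - apply is_derive_ext_loc with (f := fun t => k ^ 2 * RInt (fun s => phi (s - t) * g s) t T1).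
    + generalize (Hop tau Ht); apply filter_imp; intros t Ht'; symmetry; apply EB, Ht'.
    + apply is_derive_scal. evar_last; [apply (leibniz_lower phi phi1 g T1 tau Ht D1 C1 Hg)|].
      unfold phi at 1. ring.
  - rewrite (EB tau Ht). evar_last.
    + apply is_derive_scal. apply (is_derive_opp (V := R_NormedModule)).
      apply (leibniz_lower phi1 (fun r => symb k * phi r) g T1 tau Ht D2 C2 Hg).
    + unfold opp; simpl.
      assert (P0 : phi1 0 = 1) by (unfold phi1; replace (0 ^ 2 * symb k) with 0 by ring; apply chc_0). rewrite P0.
      assert (E : RInt (fun t => symb k * phi (t - tau) * g t) tau T1 = symb k * RInt (fun s => phi (s - tau) * g s) tau T1).
      { rewrite <- RInt_scalR.
        - apply RInt_ext; intros t _. apply Rmult_assoc.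
        - apply ex_RInt_cont; [lra|]. intros s Hs. apply (continuous_mult (K := R_AbsRing)); [|apply Hg; lra].
          apply (continuous_comp (fun s => s - tau) phi); [|apply (continuous_of_derive _ _ _ (D1 _))].
          apply (continuous_minus (V := R_NormedModule)); [apply continuous_id|apply continuous_const]. }
      rewrite E. fold (g tau). simpl. ring.
Qed.

(** Splitting at [s = t] separates the variables into [exp (- l t) P t + exp (l t) M t]; the jump of
    the slope of the kernel at [s = t] produces [- 2 l g]. *)
Lemma exp_convolution (l b : R) (g : R -> R) : (forall s, continuous g s) -> 0 < b ->
  exists W1 : R -> R, forall tau, 0 < tau < b ->
    is_derive (fun t => RInt (fun s => exp (- (l * Rabs (t - s))) * g s) 0 b) tau (W1 tau) /\
    is_derive W1 tau (l ^ 2 * RInt (fun s => exp (- (l * Rabs (tau - s))) * g s) 0 b - 2 * l * g tau).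
Proof.
  intros Hg Hb.
  set (gp := fun s => exp (l * s) * g s). set (gm := fun s => exp (- (l * s)) * g s).
  assert (Cp : forall s, continuous gp s).
  { intros s; apply (continuous_mult (K := R_AbsRing)); [|apply Hg].
    apply (ex_derive_continuous (V := R_NormedModule)); auto_derive; exact I. }
  assert (Cm : forall s, continuous gm s).
  { intros s; apply (continuous_mult (K := R_AbsRing)); [|apply Hg].
    apply (ex_derive_continuous (V := R_NormedModule)); auto_derive; exact I. }
  assert (Ep : forall x y, ex_RInt gp x y) by (intros; apply (ex_RInt_continuous (V := R_CompleteNormedModule)); auto).
  assert (Em : forall x y, ex_RInt gm x y) by (intros; apply (ex_RInt_continuous (V := R_CompleteNormedModule)); auto).
  set (P := fun t => RInt gp 0 t). set (M := fun t => RInt gm t b).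
  assert (DP : forall t, is_derive P t (gp t)).
  { intros t; apply (is_derive_RInt (V := R_NormedModule) gp) with (a := 0); [|apply Cp].
    apply filter_forall; intros y. apply (RInt_correct gp), Ep. }
  assert (DM : forall t, is_derive M t (- gm t)).
  { intros t; apply (is_derive_RInt' (V := R_NormedModule) gm M t b); [|apply Cm].
    apply filter_forall; intros y. apply (RInt_correct gm), Em. }
  assert (Dep : forall t, is_derive (fun t => exp (l * t)) t (l * exp (l * t))) by (intros; auto_derive; [exact I|ring]).
  assert (Dem : forall t, is_derive (fun t => exp (- (l * t))) t (- l * exp (- (l * t)))) by (intros; auto_derive; [exact I|ring]).
  assert (Egg : forall t, exp (- (l * t)) * gp t = g t /\ exp (l * t) * gm t = g t).
  { intros t; unfold gp, gm. rewrite <- !Rmult_assoc, <- !exp_plus.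
    replace (- (l * t) + l * t) with 0 by ring. replace (l * t + - (l * t)) with 0 by ring. rewrite exp_0. split; ring. }
  (* The case [c = 1] is the integral itself and [c = -1] is, up to the factor [- l], its
     derivative; one computation serves both. *)
  assert (DF : forall c t, is_derive (fun t => exp (- (l * t)) * P t + c * (exp (l * t) * M t)) t
     ((- l * exp (- (l * t)) * P t + g t) + c * (l * exp (l * t) * M t - g t))).
  { intros c t. destruct (Egg t) as [E1 E2].
    evar_last.
    - apply (is_derive_plus (V := R_NormedModule)).
      + apply (is_derive_mult (fun t => exp (- (l * t))) P t _ _ (Dem t) (DP t)); intros; apply Rmult_comm.
      + apply is_derive_scal. apply (is_derive_mult (fun t => exp (l * t)) M t _ _ (Dep t) (DM t)); intros; apply Rmult_comm.
    - unfold plus, mult; simpl. change (mult ?a ?b) with (a * b).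
      rewrite <- E1 at 1. rewrite <- E2. ring. }
  assert (EW : forall t, 0 < t < b -> RInt (fun s => exp (- (l * Rabs (t - s))) * g s) 0 b = exp (- (l * t)) * P t + 1 * (exp (l * t) * M t)).
  { intros t Ht. rewrite Rmult_1_l.
    assert (I1 : is_RInt (fun s => exp (- (l * Rabs (t - s))) * g s) 0 t (exp (- (l * t)) * P t)).
    { apply is_RInt_ext with (f := fun s => exp (- (l * t)) * gp s).
      - intros s Hs. rewrite Rmin_left, Rmax_right in Hs by lra. unfold gp.
        rewrite Rabs_pos_eq by lra. rewrite <- Rmult_assoc, <- exp_plus. f_equal; f_equal; ring.
      - apply (is_RInt_scal (V := R_NormedModule)), (RInt_correct gp), Ep. }
    assert (I2 : is_RInt (fun s => exp (- (l * Rabs (t - s))) * g s) t b (exp (l * t) * M t)).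
    { apply is_RInt_ext with (f := fun s => exp (l * t) * gm s).
      - intros s Hs. rewrite Rmin_left, Rmax_right in Hs by lra. unfold gm.
        rewrite Rabs_left by lra. rewrite <- Rmult_assoc, <- exp_plus. f_equal; f_equal; ring.
      - apply (is_RInt_scal (V := R_NormedModule)), (RInt_correct gm), Em. }
    apply (is_RInt_unique (V := R_CompleteNormedModule)), (is_RInt_Chasles (V := R_NormedModule) _ _ _ _ _ _ I1 I2). }
  assert (Hop : forall tau, 0 < tau < b -> locally tau (fun t => 0 < t < b)).
  { intros tau Ht; apply filter_and; [apply locally_pos|apply locally_lt]; lra. }
  exists (fun t => - l * (exp (- (l * t)) * P t + -1 * (exp (l * t) * M t))). intros tau Ht; split.
  - apply is_derive_ext_loc with (f := fun t => exp (- (l * t)) * P t + 1 * (exp (l * t) * M t)).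
    + generalize (Hop tau Ht); apply filter_imp; intros t Ht'; symmetry; apply EW, Ht'.
    + evar_last; [apply (DF 1 tau)|]. simpl; ring.
  - rewrite (EW tau Ht). evar_last; [apply is_derive_scal, (DF (-1) tau)|]. simpl; ring.
Qed.

(** The decaying part contributes [Psi] times the source and the Volterra part [1 - Psi] times it.
    The cutoff depends on [s] and not on [tau], so it can be treated as a factor of the source. *)
Lemma kernel_op_ode (T1 k : R) (N : R -> R -> R) : 1 <= T1 -> (forall s, 0 < s -> continuous (N k) s) ->
  exists W1 : R -> R, forall tau, 0 < tau < T1 ->
    is_derive (fun t => kernel_op T1 (green T1) N k t) tau (W1 tau) /\
    is_derive W1 tau (symb k * kernel_op T1 (green T1) N k tau - k ^ 2 * N k tau).
Proof.
  intros HT HN. destruct (volterra_part T1 k N HT HN) as [B1 HB].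
  set (g := fun s => Psi (mm T1) (k * sqrt s) * N k s).
  assert (CPsi : forall s, continuous (fun s => Psi (mm T1) (k * sqrt s)) s).
  { intros s; apply (continuous_comp (fun s => k * sqrt s) (Psi (mm T1))); [|apply (Psi_smooth1 (mm T1) 0)].
    apply (continuous_mult (K := R_AbsRing)); [apply continuous_const|apply continuous_sqrt]. }
  (* The cutoff continues the source by zero through [s = 0]. *)
  assert (Hg : forall s, continuous g s).
  { intros s. destruct (Rlt_dec 0 s) as [Hs|Hs]; [apply (continuous_mult (K := R_AbsRing)); [apply CPsi|apply HN, Hs]|].
    apply continuous_ext_loc with (g := fun _ => 0); [|apply continuous_const].
    assert (Hc : continuous (fun s => Rabs (k * sqrt s)) s).
    { apply (continuous_comp (fun s => k * sqrt s) Rabs); [|apply continuous_Rabs].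
      apply (continuous_mult (K := R_AbsRing)); [apply continuous_const|apply continuous_sqrt]. }
    assert (H0 : Rabs (k * sqrt s) < mm T1) by (rewrite sqrt_neg_0, Rmult_0_r, Rabs_R0 by lra; unfold mm; lra).
    assert (L0 : locally s (fun y => Rabs (k * sqrt y) < mm T1)) by exact (Hc (fun y => y < mm T1) (locally_lt _ _ H0)).
    generalize L0. apply filter_imp; intros y Hy.
    unfold g. rewrite Psi_0; [symmetry; apply Rmult_0_l|left; exact Hy]. }
  set (Av := fun t => RInt (fun s => green_decay T1 k (t, s) * N k s) 0 T1).
  assert (HA : exists A1 : R -> R, forall tau, 0 < tau < T1 -> is_derive Av tau (A1 tau) /\
     is_derive A1 tau (symb k * Av tau - k ^ 2 * g tau)).
  { destruct (Rlt_dec 4 (k ^ 2)) as [Hk|Hk].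
    - destruct (exp_convolution (lam k) T1 g Hg ltac:(lra)) as [W1 HW].
      assert (Hl : 0 < lam k) by (generalize (lam_ge k Hk); lra).
      assert (Hs := lam_sq k Hk).
      assert (E : forall t, Av t = amp k * RInt (fun s => exp (- (lam k * Rabs (t - s))) * g s) 0 T1).
      { intros t; unfold Av. rewrite <- RInt_scalR.
        - apply RInt_ext; intros s _. unfold green_decay, g, AA; simpl fst; simpl snd.
          Req; ring.
        - apply (ex_RInt_continuous (V := R_CompleteNormedModule)); intros s _. apply (continuous_mult (K := R_AbsRing)); [|apply Hg].
          apply (continuous_comp (fun s => - (lam k * Rabs (t - s))) exp).
          + apply (continuous_opp (V := R_NormedModule)). apply (continuous_mult (K := R_AbsRing)); [apply continuous_const|].
            apply (continuous_comp (fun s => t - s) Rabs); [|apply continuous_Rabs].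
            apply (continuous_minus (V := R_NormedModule)); [apply continuous_const|apply continuous_id].
          + apply (ex_derive_continuous (V := R_NormedModule)); auto_derive; exact I. }
      exists (fun t => amp k * W1 t). intros tau Ht; split.
      + apply is_derive_ext with (f := fun t => amp k * RInt (fun s => exp (- (lam k * Rabs (t - s))) * g s) 0 T1); [intros; symmetry; apply E|].
        apply is_derive_scal, HW, Ht.
      + rewrite E. evar_last; [apply is_derive_scal, HW, Ht|]. simpl. rewrite <- Hs. unfold amp. simpl. field. lra.
    (* For [k^2 <= 4], where [lam] may degenerate, [|k| sqrt s] stays below [mm T1] up to [s = T1],
       so the decaying part is absent. *)
    - assert (Z : forall s, s <= T1 -> Psi (mm T1) (k * sqrt s) = 0).
      { intros s Hs. apply Psi_0. rewrite Rabs_mult, (Rabs_pos_eq (sqrt s)) by apply sqrt_pos.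
        assert (Hk2 : Rabs k <= 2).
        { rewrite <- pow2_abs in Hk. generalize (Rabs_pos k); nra. }
        assert (Hss : sqrt s <= T1).
        { destruct (Rle_dec 0 s); [|rewrite sqrt_neg_0; lra]. rewrite <- (sqrt_pow2 T1) by lra. apply sqrt_le_1_alt. simpl; nra. }
        unfold mm. generalize (Rabs_pos k) (sqrt_pos s); nra. }
      assert (E : forall t, Av t = 0).
      { intros t; unfold Av. apply RInt_eq_0. intros s Hs. rewrite Rmin_left, Rmax_right in Hs by lra.
        unfold green_decay, AA; simpl fst; simpl snd. rewrite Z by lra. ring. }
      exists (fun _ => 0). intros tau Ht; split.
      + apply is_derive_ext with (f := fun _ => 0); [intros; symmetry; apply E|apply (is_derive_const (V := R_NormedModule))].
      + rewrite E. unfold g. rewrite Z by lra. evar_last; [apply (is_derive_const (V := R_NormedModule))|]. unfold zero; simpl; ring. }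
  destruct HA as [A1 HA].
  set (Bv := fun t => RInt (fun s => green_volterra T1 k (t, s) * N k s) 0 T1).
  assert (C1 : forall t s, 0 < t -> s <= T1 -> continuous (fun s => green_decay T1 k (t, s) * N k s) s).
  { intros t s Ht Hs.
    assert (HK := green_decay_symbol T1 0 HT). destruct HK as (Hc & (C & HC & Hb) & _).
    destruct (Rlt_dec 0 s) as [Hp|Hp].
    - apply (continuous_mult (K := R_AbsRing)); [|apply HN, Hp].
      apply (continuous_comp (fun s => (k, (t, s))) (fun q : R * RR => green_decay T1 (fst q) (snd q))).
      + apply continuous_pair; [apply continuous_const|apply continuous_pair; [apply continuous_const|apply continuous_id]].
      + apply Hc; split; simpl; lra.
    - apply continuous_ext with (f := fun s => amp k * exp (- (lam k * Rabs (t - s))) * g s).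
      { intros y; unfold green_decay, g, AA; simpl fst; simpl snd. Req; ring. }
      apply (continuous_mult (K := R_AbsRing)); [|apply Hg]. apply (continuous_mult (K := R_AbsRing)); [apply continuous_const|].
      apply (continuous_comp (fun s => - (lam k * Rabs (t - s))) exp).
      + apply (continuous_opp (V := R_NormedModule)). apply (continuous_mult (K := R_AbsRing)); [apply continuous_const|].
        apply (continuous_comp (fun s => t - s) Rabs); [|apply continuous_Rabs].
        apply (continuous_minus (V := R_NormedModule)); [apply continuous_const|apply continuous_id].
      + apply (ex_derive_continuous (V := R_NormedModule)); auto_derive; exact I. }
  assert (C2 : forall t s, 0 < t -> s <= T1 -> continuous (fun s => green_volterra T1 k (t, s) * N k s) s).
  { intros t s Ht Hs.
    destruct (green_volterra_symbol T1 0 HT) as (Hc & _ & _).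
    destruct (Rlt_dec 0 s) as [Hp|Hp].
    - apply (continuous_mult (K := R_AbsRing)); [|apply HN, Hp].
      apply (continuous_comp (fun s => (k, (t, s))) (fun q : R * RR => green_volterra T1 (fst q) (snd q))).
      + apply continuous_pair; [apply continuous_const|apply continuous_pair; [apply continuous_const|apply continuous_id]].
      + apply Hc; split; simpl; lra.
    - apply continuous_ext_loc with (g := fun _ => 0); [|apply continuous_const].
      generalize (locally_lt s t ltac:(lra)); apply filter_imp; intros y Hy.
      unfold green_volterra, QQ; simpl fst; simpl snd. rewrite (Rmax_right (y - t) 0) by lra. unfold Rdiv; Req; ring. }
  assert (EW : forall t, 0 < t -> kernel_op T1 (green T1) N k t = Av t - Bv t).
  { intros t Ht; unfold kernel_op, Av, Bv. rewrite <- RInt_minusR.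
    - apply RInt_ext; intros s _.
      assert (Hr : forall a b n : R, (a + -1 * b) * n = a * n - b * n) by (intros; ring).
      exact (Hr (green_decay T1 k (t, s)) (green_volterra T1 k (t, s)) (N k s)).
    - apply ex_RInt_cont; [lra|]. intros s Hs; apply C1; lra.
    - apply ex_RInt_cont; [lra|]. intros s Hs; apply C2; lra. }
  exists (fun t => A1 t - B1 t). intros tau Ht. destruct (HA tau Ht) as [a1 a2]. destruct (HB tau Ht) as [b1 b2]. split.
  - apply is_derive_ext_loc with (f := fun t => Av t - Bv t).
    + generalize (locally_pos tau ltac:(lra)); apply filter_imp; intros t Ht'; symmetry; apply EW, Ht'.
    + apply (is_derive_minus (V := R_NormedModule)); assumption.
  - change (is_derive B1 tau (symb k * Bv tau + k ^ 2 * ((1 - Psi (mm T1) (k * sqrt tau)) * N k tau))) in b2.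
    rewrite EW by lra. evar_last; [apply (is_derive_minus (V := R_NormedModule)); [exact a2|exact b2]|].
    unfold minus, plus, opp, g; simpl. ring.
Qed.

(** * Smoothness in time *)

(** Uniformity is asked only on [[a, T1)] with [a > 0], the solution being singular at [tau = 0]; a
    neighbourhood of each positive time is enough for differentiating under the integral. *)
Definition rapid_even (T1 : R) (F : R -> R -> R) : Prop :=
  (forall k tau, 0 < tau < T1 -> jcont F k tau) /\
  (forall a n, 0 < a -> exists M, 0 <= M /\ forall k tau, a <= tau < T1 -> (1 + Rabs k) ^ n * Rabs (F k tau) <= M) /\
  (forall k tau, 0 < tau < T1 -> F (- k) tau = F k tau).

Fixpoint tsmooth (T1 : R) (m : nat) (F : R -> R -> R) : Prop :=
  rapid_even T1 F /\
  match m with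
  | O => True
  | S n => exists F1, (forall k tau, 0 < tau < T1 -> is_derive (F k) tau (F1 k tau)) /\ tsmooth T1 n F1
  end.

Lemma tsmooth_rapid_even T1 m F : tsmooth T1 m F -> rapid_even T1 F.
Proof. destruct m; intros H; apply H. Qed.

Lemma tsmooth_pred T1 m F : tsmooth T1 (S m) F -> tsmooth T1 m F.
Proof.
  revert F; induction m; intros F (H1 & F1 & H2 & H3); [split; [exact H1|exact I]|].
  split; [exact H1|]. exists F1; split; [exact H2|apply IHm, H3].
Qed.

Lemma locally_dom (T1 tau : R) : 0 < tau < T1 -> locally tau (fun t => 0 < t < T1).
Proof. intros H; apply filter_and; [apply locally_pos|apply locally_lt]; lra. Qed.

Lemma rapid_even_ext T1 F G : (forall k tau, 0 < tau < T1 -> F k tau = G k tau) -> rapid_even T1 F -> rapid_even T1 G.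
Proof.
  intros E (H1 & H2 & H3); split; [|split].
  - intros k tau Ht. apply continuous_ext_loc with (g := fun q : R * R => F (fst q) (snd q)); [|apply H1, Ht].
    generalize (locally_snd (U := R_UniformSpace) _ k tau (locally_dom T1 tau Ht)). apply filter_imp; intros q Hq. apply E, Hq.
  - intros a n Ha; destruct (H2 a n Ha) as (M & HM & Hb). exists M; split; [exact HM|]. intros k tau Ht. rewrite <- E by lra. apply Hb, Ht.
  - intros k tau Ht. rewrite <- !E by lra. apply H3, Ht.
Qed.

Lemma tsmooth_ext T1 m F G : (forall k tau, 0 < tau < T1 -> F k tau = G k tau) -> tsmooth T1 m F -> tsmooth T1 m G.
Proof.
  intros E HF; destruct m; (split; [apply (rapid_even_ext T1 F G E), (tsmooth_rapid_even _ _ _ HF)|]); [exact I|].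
  destruct HF as (_ & F1 & H1 & H2). exists F1; split; [|exact H2]. intros k tau Ht.
  apply is_derive_ext_loc with (f := F k); [|apply H1, Ht].
  generalize (locally_dom T1 tau Ht). apply filter_imp; intros t Ht'. apply E, Ht'.
Qed.

Lemma tsmooth_Derive T1 m F : tsmooth T1 (S m) F -> tsmooth T1 m (fun k tau => Derive (F k) tau) /\
  (forall k tau, 0 < tau < T1 -> is_derive (F k) tau (Derive (F k) tau)).
Proof.
  intros (_ & F1 & H1 & H2). split.
  - apply (tsmooth_ext T1 m F1); [|exact H2]. intros k tau Ht; symmetry; apply is_derive_unique, H1, Ht.
  - intros k tau Ht. apply Derive_correct. eexists; apply H1, Ht.
Qed.

Lemma rapid_even_plus T1 F G : rapid_even T1 F -> rapid_even T1 G -> rapid_even T1 (fun k t => F k t + G k t).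
Proof.
  intros (H1 & H2 & H3) (H4 & H5 & H6); split; [|split].
  - intros k tau Ht; apply (continuous_plus (V := R_NormedModule)); [apply H1, Ht|apply H4, Ht].
  - intros a n Ha; destruct (H2 a n Ha) as (M & HM & Hb); destruct (H5 a n Ha) as (M' & HM' & Hb').
    exists (M + M'); split; [lra|]. intros k tau Ht. assert (h1 := Hb k tau Ht). assert (h2 := Hb' k tau Ht).
    assert (P : 0 <= (1 + Rabs k) ^ n) by (apply pow_le; generalize (Rabs_pos k); lra).
    generalize (Rabs_triang (F k tau) (G k tau)); nra.
  - intros k tau Ht. rewrite (H3 k tau Ht), (H6 k tau Ht); reflexivity.
Qed.

Lemma rapid_even_poly T1 F (p : R -> R) (r : nat) : (forall k, continuous p k) -> (forall k, p (- k) = p k) ->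
  (exists C, 0 <= C /\ forall k, Rabs (p k) <= C * (1 + Rabs k) ^ r) -> rapid_even T1 F -> rapid_even T1 (fun k t => p k * F k t).
Proof.
  intros Hc He (C & HC & Hp) (H1 & H2 & H3); split; [|split].
  - intros k tau Ht; apply jcont_mult; [apply jcont_k, Hc|apply H1, Ht].
  - intros a n Ha; destruct (H2 a (n + r)%nat Ha) as (M & HM & Hb). exists (C * M); split; [apply Rmult_le_pos; assumption|].
    intros k tau Ht. specialize (Hb k tau Ht). rewrite pow_add in Hb. rewrite Rabs_mult.
    assert (P : 0 <= (1 + Rabs k) ^ n) by (apply pow_le; generalize (Rabs_pos k); lra).
    specialize (Hp k). generalize (Rabs_pos (F k tau)); intros PF.
    apply Rle_trans with (C * ((1 + Rabs k) ^ n * (1 + Rabs k) ^ r * Rabs (F k tau))); [|apply Rmult_le_compat_l; assumption].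
    replace ((1 + Rabs k) ^ n * (Rabs (p k) * Rabs (F k tau))) with (Rabs (p k) * ((1 + Rabs k) ^ n * Rabs (F k tau))) by ring.
    replace (C * ((1 + Rabs k) ^ n * (1 + Rabs k) ^ r * Rabs (F k tau))) with (C * (1 + Rabs k) ^ r * ((1 + Rabs k) ^ n * Rabs (F k tau))) by ring.
    apply Rmult_le_compat_r; [apply Rmult_le_pos; assumption|exact Hp].
  - intros k tau Ht. rewrite He, (H3 k tau Ht); reflexivity.
Qed.

Lemma tsmooth_plus T1 m F G : tsmooth T1 m F -> tsmooth T1 m G -> tsmooth T1 m (fun k t => F k t + G k t).
Proof.
  revert F G; induction m; intros F G HF HG; (split; [apply rapid_even_plus; [apply (tsmooth_rapid_even _ _ _ HF)|apply (tsmooth_rapid_even _ _ _ HG)]|]); [exact I|].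
  destruct HF as (_ & F1 & H1 & H2). destruct HG as (_ & G1 & H3 & H4).
  exists (fun k t => F1 k t + G1 k t); split; [|apply IHm; assumption].
  intros k tau Ht; apply (is_derive_plus (V := R_NormedModule)); auto.
Qed.

Lemma tsmooth_poly T1 m F (p : R -> R) (r : nat) : (forall k, continuous p k) -> (forall k, p (- k) = p k) ->
  (exists C, 0 <= C /\ forall k, Rabs (p k) <= C * (1 + Rabs k) ^ r) -> tsmooth T1 m F -> tsmooth T1 m (fun k t => p k * F k t).
Proof.
  intros Hc He Hp; revert F; induction m; intros F HF; (split; [apply (rapid_even_poly T1 F p r Hc He Hp), (tsmooth_rapid_even _ _ _ HF)|]); [exact I|].
  destruct HF as (_ & F1 & H1 & H2). exists (fun k t => p k * F1 k t); split; [|apply IHm, H2].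
  intros k tau Ht; apply is_derive_scal; auto.
Qed.

Lemma rho_1 (k : R) : rho 1 k = / (1 + Rabs k) ^ 2.
Proof.
  assert (H := Rabs_pos k). unfold rho. rewrite Rpower_Ropp. f_equal. replace (1 + 1) with (INR 2) by (simpl; ring).
  apply Rpower_pow; lra.
Qed.

Lemma weight_le_rho (n : nat) (k x M : R) : (1 + Rabs k) ^ (S (S n)) * Rabs x <= M -> (1 + Rabs k) ^ n * Rabs x <= M * rho 1 k.
Proof.
  intros H. rewrite rho_1. assert (P : 0 < (1 + Rabs k) ^ 2) by (apply pow_lt; generalize (Rabs_pos k); lra).
  replace (S (S n)) with (n + 2)%nat in H by lia. rewrite pow_add in H.
  apply Rmult_le_reg_r with ((1 + Rabs k) ^ 2); [exact P|]. rewrite (Rmult_assoc M), Rinv_l by lra. lra.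
Qed.

Lemma one_plus_sub (k l : R) : 1 + Rabs k <= (1 + Rabs l) * (1 + Rabs (k - l)).
Proof.
  assert (Rabs k <= Rabs l + Rabs (k - l)) by (replace k with (l + (k - l)) at 1 by ring; apply Rabs_triang).
  generalize (Rabs_pos l) (Rabs_pos (k - l)); nra.
Qed.

(** The weight [1 + |k|] is submultiplicative, and two extra powers on the first factor leave the
    integrable [rho 1]. *)
Lemma rapid_even_conv_slice T1 F G (a : R) (n : nat) : rapid_even T1 F -> rapid_even T1 G -> 0 < a ->
  exists M, 0 <= M /\ forall k tau, a <= tau < T1 ->
    (forall l, continuous (fun l => F l tau * G (k - l) tau) l) /\
    (forall l, (1 + Rabs k) ^ n * Rabs (F l tau * G (k - l) tau) <= M * rho 1 l).
Proof.
  intros (H1 & H2 & _) (H4 & H5 & _) Ha.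
  destruct (H2 a (S (S n)) Ha) as (M & HM & Hb). destruct (H5 a n Ha) as (M' & HM' & Hb').
  exists (M * M'); split; [apply Rmult_le_pos; assumption|]. intros k tau Ht; split.
  - intros l; apply (continuous_mult (K := R_AbsRing)); [apply (continuous_slice_l F), H1; lra|].
    apply (continuous_comp (fun l => k - l) (fun l => G l tau)); [|apply (continuous_slice_l G), H4; lra].
    apply (continuous_minus (V := R_NormedModule)); [apply continuous_const|apply continuous_id].
  - intros l. rewrite Rabs_mult.
    assert (h1 := weight_le_rho n l _ M (Hb l tau Ht)). assert (h2 := Hb' (k - l) tau Ht).
    assert (h3 := one_plus_sub k l). assert (P := Rabs_pos k). assert (P1 := Rabs_pos l). assert (P2 := Rabs_pos (k - l)).
    assert (h4 : (1 + Rabs k) ^ n <= (1 + Rabs l) ^ n * (1 + Rabs (k - l)) ^ n).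
    { rewrite <- Rpow_mult_distr. apply pow_incr; lra. }
    apply Rle_trans with (((1 + Rabs l) ^ n * Rabs (F l tau)) * ((1 + Rabs (k - l)) ^ n * Rabs (G (k - l) tau))).
    + replace ((1 + Rabs l) ^ n * Rabs (F l tau) * ((1 + Rabs (k - l)) ^ n * Rabs (G (k - l) tau))) with
        ((1 + Rabs l) ^ n * (1 + Rabs (k - l)) ^ n * (Rabs (F l tau) * Rabs (G (k - l) tau))) by ring.
      apply Rmult_le_compat_r; [apply Rmult_le_pos; apply Rabs_pos|exact h4].
    + apply Rle_trans with ((M * rho 1 l) * M'); [|right; ring].
      apply Rmult_le_compat; try assumption; apply Rmult_le_pos; try apply Rabs_pos; apply pow_le; lra.
Qed.

Lemma rapid_even_conv_adm T1 F G (a : R) : rapid_even T1 F -> rapid_even T1 G -> 0 < a ->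
  exists M, 0 <= M /\ forall k tau, a <= tau < T1 -> adm 1 M (fun l => F l tau * G (k - l) tau).
Proof.
  intros HF HG Ha. destruct (rapid_even_conv_slice T1 F G a 0 HF HG Ha) as (M & HM & H). exists M; split; [exact HM|].
  intros k tau Ht; destruct (H k tau Ht) as [h1 h2]; split; [exact h1|]. intros l. generalize (h2 l). rewrite pow_O, Rmult_1_l; auto.
Qed.

Lemma locally_window (T1 tau : R) : 0 < tau < T1 -> locally tau (fun t => tau / 2 <= t < T1).
Proof.
  intros H.
  assert (H1 : locally tau (fun t => tau / 2 < t)) by (apply (open_gt (tau / 2)); lra).
  generalize (filter_and _ _ H1 (locally_lt tau T1 ltac:(lra))). apply filter_imp; intros t [h1 h2]; lra.
Qed.

Lemma conv_integrand_cont T1 F G (k tau l : R) : rapid_even T1 F -> rapid_even T1 G -> 0 < tau < T1 ->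
  continuous (fun z : R * R * R => F (snd z) (snd (fst z)) * G (fst (fst z) - snd z) (snd (fst z))) (k, tau, l).
Proof.
  intros HF HG Ht. apply (continuous_mult (K := R_AbsRing)).
  - apply (continuous_comp_2 (fun z : R * R * R => snd z) (fun z => snd (fst z)) F).
    + apply continuous_snd'.
    + apply (continuous_comp (fun z : R * R * R => fst z) (fun q : R * R => snd q)); [apply continuous_fst'|apply continuous_snd'].
    + apply HF, Ht.
  - apply (continuous_comp_2 (fun z : R * R * R => fst (fst z) - snd z) (fun z => snd (fst z)) G).
    + apply (continuous_minus (V := R_NormedModule)); [|apply continuous_snd'].
      apply (continuous_comp (fun z : R * R * R => fst z) (fun q : R * R => fst q)); [apply continuous_fst'|apply continuous_fst'].
    + apply (continuous_comp (fun z : R * R * R => fst z) (fun q : R * R => snd q)); [apply continuous_fst'|apply continuous_snd'].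
    + apply HG, Ht.
Qed.

Lemma rapid_even_conv T1 F G : rapid_even T1 F -> rapid_even T1 G -> rapid_even T1 (conv F G).
Proof.
  intros HF HG; split; [|split].
  - intros k tau Ht. destruct (rapid_even_conv_adm T1 F G (tau / 2) HF HG ltac:(lra)) as (M & HM & Ha).
    apply (IR_continuous 1 M (fun (q : R * R) l => F l (snd q) * G (fst q - l) (snd q)) (k, tau) Rlt_0_1).
    + generalize (locally_snd (U := R_UniformSpace) _ k tau (locally_window T1 tau Ht)).
      apply filter_imp; intros q Hq; apply Ha, Hq.
    + intros l. apply (conv_integrand_cont T1); assumption.
  - intros a n Ha. destruct (rapid_even_conv_slice T1 F G a n HF HG Ha) as (M & HM & H).
    exists (M * (2 / 1)); split; [lra|]. intros k tau Ht. destruct (H k tau Ht) as [h1 h2].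
    assert (P : 0 < (1 + Rabs k) ^ n) by (apply pow_lt; generalize (Rabs_pos k); lra).
    assert (h3 : adm 1 (M / (1 + Rabs k) ^ n) (fun l => F l tau * G (k - l) tau)).
    { split; [exact h1|]. intros l. apply Rmult_le_reg_l with ((1 + Rabs k) ^ n); [exact P|].
      eapply Rle_trans; [apply h2|]. right; field; lra. }
    apply (IR_bound 1 _ _ Rlt_0_1) in h3. unfold conv.
    apply Rle_trans with ((1 + Rabs k) ^ n * (M / (1 + Rabs k) ^ n * (2 / 1))); [apply Rmult_le_compat_l; [lra|exact h3]|].
    right; field; lra.
  - intros k tau Ht. destruct (rapid_even_conv_adm T1 F G tau HF HG ltac:(lra)) as (M & HM & Ha).
    unfold conv. rewrite <- (IR_opp (fun l => F l tau * G (k - l) tau)); [|apply (Ha k tau); lra].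
    destruct HF as (_ & _ & EF). destruct HG as (_ & _ & EG).
    apply IR_ext; intros l. rewrite (EF l tau Ht), <- (EG (- k - l) tau Ht). f_equal; f_equal; ring.
Qed.

Lemma conv_dtau T1 F F1 G G1 (k tau : R) : rapid_even T1 F -> rapid_even T1 F1 -> rapid_even T1 G -> rapid_even T1 G1 -> 0 < tau < T1 ->
  (forall k tau, 0 < tau < T1 -> is_derive (F k) tau (F1 k tau)) ->
  (forall k tau, 0 < tau < T1 -> is_derive (G k) tau (G1 k tau)) ->
  is_derive (conv F G k) tau (conv F1 G k tau + conv F G1 k tau).
Proof.
  intros HF HF1 HG HG1 Ht DF DG.
  destruct (rapid_even_conv_adm T1 F G (tau / 2) HF HG ltac:(lra)) as (M0 & HM0 & A0).
  destruct (rapid_even_conv_adm T1 F1 G (tau / 2) HF1 HG ltac:(lra)) as (M1 & HM1 & A1).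
  destruct (rapid_even_conv_adm T1 F G1 (tau / 2) HF HG1 ltac:(lra)) as (M2 & HM2 & A2).
  set (M := M0 + (M1 + M2)).
  assert (E : conv F1 G k tau + conv F G1 k tau = IR (fun l => F1 l tau * G (k - l) tau + F l tau * G1 (k - l) tau)).
  { unfold conv. rewrite <- (IR_plus 1 M1 M2); [reflexivity|lra|apply A1; lra|apply A2; lra]. }
  rewrite E.
  apply (IR_is_derive 1 M (fun t l => F l t * G (k - l) t) (fun t l => F1 l t * G (k - l) t + F l t * G1 (k - l) t) tau Rlt_0_1).
  - generalize (locally_dom T1 tau Ht); apply filter_imp; intros t Ht' l.
    apply (is_derive_mult (F l) (G (k - l)) t (F1 l t) (G1 (k - l) t)); [apply DF, Ht'|apply DG, Ht'|intros; apply Rmult_comm].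
  - generalize (locally_window T1 tau Ht); apply filter_imp; intros t Ht'. destruct (A0 k t Ht') as [h1 h2]; split; [exact h1|].
    intros l; eapply Rle_trans; [apply h2|]. apply Rmult_le_compat_r; [left; apply rho_pos|unfold M; lra].
  - generalize (locally_window T1 tau Ht); apply filter_imp; intros t Ht'.
    destruct (adm_plus 1 M1 M2 _ _ (A1 k t Ht') (A2 k t Ht')) as [h1 h2]; split; [exact h1|].
    intros l; eapply Rle_trans; [apply h2|]. apply Rmult_le_compat_r; [left; apply rho_pos|unfold M; lra].
  - intros l.
    assert (HS : forall A B : R -> R -> R, rapid_even T1 A -> rapid_even T1 B -> continuous (fun z : R * R => A (snd z) (fst z) * B (k - snd z) (fst z)) (tau, l)).
    { intros A B HA HB.
      apply (continuous_comp (fun z : R * R => (k, fst z, snd z)) (fun z : R * R * R => A (snd z) (snd (fst z)) * B (fst (fst z) - snd z) (snd (fst z)))).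
      - apply continuous_pair; [apply continuous_pair; [apply continuous_const|apply continuous_fst']|apply continuous_snd'].
      - apply (conv_integrand_cont T1); assumption. }
    apply (continuous_plus (V := R_NormedModule)); [apply HS; assumption|apply HS; assumption].
Qed.

Lemma tsmooth_conv T1 m F G : tsmooth T1 m F -> tsmooth T1 m G -> tsmooth T1 m (conv F G).
Proof.
  revert F G; induction m; intros F G HF HG; (split; [apply rapid_even_conv; [apply (tsmooth_rapid_even _ _ _ HF)|apply (tsmooth_rapid_even _ _ _ HG)]|]); [exact I|].
  assert (HF' := tsmooth_pred _ _ _ HF). assert (HG' := tsmooth_pred _ _ _ HG).
  destruct HF as (GF & F1 & H1 & H2). destruct HG as (GG & G1 & H3 & H4).
  exists (fun k t => conv F1 G k t + conv F G1 k t); split; [|apply tsmooth_plus; apply IHm; assumption].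
  intros k tau Ht. apply (conv_dtau T1); try assumption; [apply (tsmooth_rapid_even _ _ _ H2)|apply (tsmooth_rapid_even _ _ _ H4)].
Qed.

Lemma ew_rapid (a : R) (n : nat) : 0 < a -> exists M, 0 <= M /\ forall k tau, a <= tau -> (1 + Rabs k) ^ n * ew k tau <= M.
Proof.
  intros Ha. set (b := sqrt a). assert (Hb : 0 < b) by (apply sqrt_lt_R0, Ha).
  destruct (pow_exp_bound n) as (C & HC & H).
  exists (/ b ^ n * C * exp b); split.
  { apply Rmult_le_pos; [apply Rmult_le_pos; [left; apply Rinv_0_lt_compat, pow_lt, Hb|lra]|left; apply exp_pos]. }
  intros k tau Ht. assert (P := Rabs_pos k).
  set (y := b * (1 + Rabs k)). assert (Hy : 0 <= y) by (unfold y; apply Rmult_le_pos; lra).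
  assert (h1 : ew k tau <= exp b * exp (- y)).
  { unfold ew, y. rewrite <- exp_plus. apply exp_le. assert (b <= sqrt tau) by (apply sqrt_le_1_alt, Ht). nra. }
  assert (h2 : y ^ n * exp (- y) <= C).
  { eapply Rle_trans; [apply H, Hy|]. assert (exp (- (y / 2)) <= 1) by (rewrite <- exp_0; apply exp_le; lra). nra. }
  assert (E : (1 + Rabs k) ^ n = / b ^ n * y ^ n).
  { unfold y. rewrite Rpow_mult_distr. field. apply Rgt_not_eq, pow_lt, Hb. }
  rewrite E. assert (Pb : 0 < / b ^ n) by (apply Rinv_0_lt_compat, pow_lt, Hb).
  apply Rle_trans with (/ b ^ n * y ^ n * (exp b * exp (- y))).
  - apply Rmult_le_compat_l; [apply Rmult_le_pos; [lra|apply pow_le, Hy]|exact h1].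
  - replace (/ b ^ n * y ^ n * (exp b * exp (- y))) with (/ b ^ n * (y ^ n * exp (- y)) * exp b) by ring.
    apply Rmult_le_compat_r; [left; apply exp_pos|]. apply Rmult_le_compat_l; [lra|exact h2].
Qed.

Lemma wt_rapid (eta e a : R) (n : nat) : 0 < eta -> 0 <= e -> 0 < a -> exists M, 0 <= M /\ forall k tau, a <= tau -> (1 + Rabs k) ^ n * wt eta e k tau <= M.
Proof.
  intros He H0 Ha. destruct (ew_rapid a n Ha) as (M & HM & H). exists (Rpower a (- e) * M); split.
  { apply Rmult_le_pos; [left; apply Rpower_pos|exact HM]. }
  intros k tau Ht. unfold wt. specialize (H k tau Ht).
  assert (h1 : Rpower tau (- e) <= Rpower a (- e)).
  { rewrite !Rpower_Ropp. apply Rinv_le_contravar; [apply Rpower_pos|]. apply Rle_Rpower_l; lra. }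
  assert (h2 := rho_le_1 eta k He). assert (h3 := rho_pos eta k). assert (h4 := Rpower_pos tau (- e)).
  assert (h5 : 0 <= (1 + Rabs k) ^ n * ew k tau).
  { apply Rmult_le_pos; [apply pow_le; generalize (Rabs_pos k); lra|left; apply exp_pos]. }
  replace ((1 + Rabs k) ^ n * (Rpower tau (- e) * (rho eta k * ew k tau))) with
    (Rpower tau (- e) * (rho eta k * ((1 + Rabs k) ^ n * ew k tau))) by ring.
  apply Rmult_le_compat; [lra|apply Rmult_le_pos; lra|exact h1|nra].
Qed.

Lemma in_wt_rapid_even (T1 eta e B : R) (U : R -> R -> R) : 0 < eta -> 0 <= e -> in_wt eta e B U ->
  (forall k tau, 0 < tau -> U (- k) tau = U k tau) -> rapid_even T1 U.
Proof.
  intros He H0 HU Hev; assert (HB := in_wt_B _ _ _ _ HU); split; [|split].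
  - intros k tau Ht; apply HU; lra.
  - intros a n Ha. destruct (wt_rapid eta e a n He H0 Ha) as (M & HM & H). exists (B * M); split; [apply Rmult_le_pos; assumption|].
    intros k tau Ht. specialize (H k tau ltac:(lra)).
    apply Rle_trans with ((1 + Rabs k) ^ n * (B * wt eta e k tau)).
    + apply Rmult_le_compat_l; [apply pow_le; generalize (Rabs_pos k); lra|apply HU; lra].
    + replace ((1 + Rabs k) ^ n * (B * wt eta e k tau)) with (B * ((1 + Rabs k) ^ n * wt eta e k tau)) by ring.
      apply Rmult_le_compat_l; assumption.
  - intros k tau Ht; apply Hev; lra.
Qed.

(** Taylor's formula recovers the first derivative from [U] and [G = U'']. *)
Definition taylorV (U G : R -> R -> R) (k tau : R) : R :=
  2 / tau * (U k tau - U k (tau / 2)) + tau / 2 * RInt (fun r => r * G k (tau * (1 + r) / 2)) 0 1.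

Lemma taylorV_eq (T1 k tau : R) (U G : R -> R -> R) (U1 : R -> R) : 0 < tau < T1 ->
  (forall t, 0 < t < T1 -> is_derive (U k) t (U1 t) /\ is_derive U1 t (G k t)) ->
  (forall t, 0 < t < T1 -> continuous (G k) t) -> U1 tau = taylorV U G k tau.
Proof.
  intros Ht HD Hc. set (phi := fun r => r * (tau / 2) * U1 (tau * (1 + r) / 2) - U k (tau * (1 + r) / 2)).
  (* The derivative of [phi] contains only [G], so integrating it over [[0, 1]] is Taylor's formula
     with integral remainder on [[tau / 2, tau]], an interval away from the singularity. *)
  assert (Hin : forall r, 0 <= r <= 1 -> 0 < tau * (1 + r) / 2 < T1) by (intros r Hr; split; nra).
  assert (Haff : forall r, is_derive (fun r => tau * (1 + r) / 2) r (tau / 2)) by (intros r; auto_derive; [exact I|field]).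
  assert (Hphi : forall r, 0 <= r <= 1 -> is_derive phi r ((tau / 2) ^ 2 * (r * G k (tau * (1 + r) / 2)))).
  { intros r Hr. destruct (HD _ (Hin r Hr)) as [h1 h2]. unfold phi. evar_last.
    - apply (is_derive_minus (V := R_NormedModule)).
      + apply (is_derive_mult (fun r => r * (tau / 2)) (fun r => U1 (tau * (1 + r) / 2)) r (tau / 2) (tau / 2 * G k (tau * (1 + r) / 2))).
        * auto_derive; [exact I|ring].
        * apply (is_derive_comp U1 (fun r => tau * (1 + r) / 2) r _ _ h2 (Haff r)).
        * intros; apply Rmult_comm.
      + apply (is_derive_comp (U k) (fun r => tau * (1 + r) / 2) r _ _ h1 (Haff r)).
    - unfold minus, plus, opp, scal, mult; simpl. change (mult ?a ?b) with (a * b). ring. }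
  assert (Hcr : forall r, 0 <= r <= 1 -> continuous (fun r => r * G k (tau * (1 + r) / 2)) r).
  { intros r Hr; apply (continuous_mult (K := R_AbsRing)); [apply continuous_id|].
    apply (continuous_comp (fun r => tau * (1 + r) / 2) (G k)); [apply (continuous_of_derive _ _ _ (Haff r))|apply Hc, Hin, Hr]. }
  assert (E : RInt (fun r => (tau / 2) ^ 2 * (r * G k (tau * (1 + r) / 2))) 0 1 = phi 1 - phi 0).
  { apply (is_RInt_unique (V := R_CompleteNormedModule)), (is_RInt_derive (V := R_CompleteNormedModule) phi).
    - intros r Hr; rewrite Rmin_left, Rmax_right in Hr by lra. apply Hphi, Hr.
    - intros r Hr; rewrite Rmin_left, Rmax_right in Hr by lra. apply (continuous_mult (K := R_AbsRing)); [apply continuous_const|apply Hcr, Hr]. }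
  rewrite RInt_scalR in E by (apply ex_RInt_cont; [lra|exact Hcr]).
  unfold phi in E. replace (tau * (1 + 1) / 2) with tau in E by field. replace (tau * (1 + 0) / 2) with (tau / 2) in E by field.
  unfold taylorV. apply Rmult_eq_reg_l with (tau / 2); [|lra].
  rewrite Rmult_plus_distr_l. replace (tau / 2 * (tau / 2 * RInt (fun r => r * G k (tau * (1 + r) / 2)) 0 1)) with
    ((tau / 2) ^ 2 * RInt (fun r => r * G k (tau * (1 + r) / 2)) 0 1) by ring.
  rewrite E. field. lra.
Qed.

(** The time derivative is known for each frequency separately, without joint continuity or decay in
    [k]. Written through [U] and [U''] it inherits both from them. *)
Lemma taylorV_rapid_even (T1 : R) (U G : R -> R -> R) : rapid_even T1 U -> rapid_even T1 G -> rapid_even T1 (taylorV U G).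
Proof.
  intros HU HG. destruct HU as (CU & BU & EU). destruct HG as (CG & BG & EG).
  assert (Hin : forall t r, 0 < t < T1 -> 0 <= r <= 1 -> 0 < t * (1 + r) / 2 < T1) by (intros t r Ht Hr; split; nra).
  assert (Hs : forall k t r, 0 < t < T1 -> 0 <= r <= 1 ->
     continuous (fun z : R * R * R => snd z * G (fst (fst z)) (snd (fst z) * (1 + snd z) / 2)) (k, t, r)).
  { intros k t r Ht Hr. apply (continuous_mult (K := R_AbsRing)); [apply continuous_snd'|].
    apply (continuous_comp_2 (fun z : R * R * R => fst (fst z)) (fun z => snd (fst z) * (1 + snd z) / 2) G).
    - apply (continuous_comp (fun z : R * R * R => fst z) (fun q : R * R => fst q)); apply continuous_fst'.
    - unfold Rdiv. apply (continuous_mult (K := R_AbsRing)); [|apply continuous_const].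
      apply (continuous_mult (K := R_AbsRing)).
      + apply (continuous_comp (fun z : R * R * R => fst z) (fun q : R * R => snd q)); [apply continuous_fst'|apply continuous_snd'].
      + apply (continuous_plus (V := R_NormedModule)); [apply continuous_const|apply continuous_snd'].
    - apply CG, Hin; assumption. }
  assert (Hs1 : forall k t r, 0 < t < T1 -> 0 <= r <= 1 -> continuous (fun r => r * G k (t * (1 + r) / 2)) r).
  { intros k t r Ht Hr.
    apply (continuous_comp (fun r => (k, t, r)) (fun z : R * R * R => snd z * G (fst (fst z)) (snd (fst z) * (1 + snd z) / 2))).
    - apply continuous_pair; [apply continuous_const|apply continuous_id].
    - apply Hs; assumption. }
  split; [|split].
  - intros k tau Ht. unfold taylorV. apply (continuous_plus (V := R_NormedModule)).
    + apply (jcont_mult (fun _ t => 2 / t) (fun k t => U k t - U k (t / 2))).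
      * apply (jcont_p (fun t => 2 / t)). apply (ex_derive_continuous (V := R_NormedModule)); auto_derive; lra.
      * apply (continuous_minus (V := R_NormedModule)); [apply CU, Ht|].
        apply (continuous_comp_2 (fun q : R * R => fst q) (fun q : R * R => snd q / 2) U (k, tau)).
        -- apply continuous_fst'.
        -- unfold Rdiv; apply (continuous_mult (K := R_AbsRing)); [apply continuous_snd'|apply continuous_const].
        -- apply CU; simpl; lra.
    + apply (jcont_mult (fun _ t => t / 2) (fun k t => RInt (fun r => r * G k (t * (1 + r) / 2)) 0 1)).
      * apply (jcont_p (fun t => t / 2)). apply (ex_derive_continuous (V := R_NormedModule)); auto_derive; exact I.
      * apply (continuous_RInt_param (fun (q : R * R) r => r * G (fst q) (snd q * (1 + r) / 2)) 0 1 (k, tau)); [lra| |].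
        -- generalize (locally_snd (U := R_UniformSpace) _ k tau (locally_dom T1 tau Ht)). apply filter_imp; intros q Hq r Hr.
           apply Hs1; assumption.
        -- intros r Hr. apply Hs; assumption.
  - intros a n Ha. destruct (BU (a / 2) n ltac:(lra)) as (M & HM & Hb). destruct (BG (a / 2) n ltac:(lra)) as (M' & HM' & Hb').
    assert (P4 : 0 <= 4 / a * M) by (apply Rmult_le_pos; [apply Rdiv_le_0_compat; lra|exact HM]).
    destruct (Rlt_dec a T1) as [HaT|HaT].
    2: { exists 0; split; [lra|]. intros k tau Ht; lra. }
    exists (4 / a * M + T1 * M'). split.
    { apply Rplus_le_le_0_compat; [exact P4|apply Rmult_le_pos; lra]. }
    intros k tau Ht. set (w := (1 + Rabs k) ^ n). assert (Pw : 0 < w) by (apply pow_lt; generalize (Rabs_pos k); lra).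
    assert (h1 := Hb k tau ltac:(lra)). assert (h2 := Hb k (tau / 2) ltac:(lra)). fold w in h1, h2.
    assert (h3 : Rabs (RInt (fun r => r * G k (tau * (1 + r) / 2)) 0 1) <= (1 - 0) * (M' / w)).
    { apply abs_RInt_le_const; [lra|apply ex_RInt_cont; [lra|]; intros r Hr; apply Hs1; lra|].
      intros r Hr. rewrite Rabs_mult. assert (hg := Hb' k (tau * (1 + r) / 2) ltac:(split; [nra|apply Hin; lra])). fold w in hg.
      assert (Rabs r <= 1) by (rewrite Rabs_pos_eq; lra). assert (Pg := Rabs_pos (G k (tau * (1 + r) / 2))).
      assert (Rabs (G k (tau * (1 + r) / 2)) <= M' / w) by (apply Rle_div_r; lra).
      generalize (Rabs_pos r); nra. }
    unfold taylorV. apply Rle_trans with (w * (2 / tau * (Rabs (U k tau) + Rabs (U k (tau / 2))) + tau / 2 * (M' / w))).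
    + apply Rmult_le_compat_l; [lra|]. eapply Rle_trans; [apply Rabs_triang|]. apply Rplus_le_compat.
      * rewrite Rabs_mult, (Rabs_pos_eq (2 / tau)) by (apply Rdiv_le_0_compat; lra).
        apply Rmult_le_compat_l; [apply Rdiv_le_0_compat; lra|]. eapply Rle_trans; [apply Rabs_triang|]. rewrite Rabs_Ropp; lra.
      * rewrite Rabs_mult, (Rabs_pos_eq (tau / 2)) by lra. apply Rmult_le_compat_l; [lra|]. lra.
    + replace (w * (2 / tau * (Rabs (U k tau) + Rabs (U k (tau / 2))) + tau / 2 * (M' / w))) with
        (2 / tau * (w * Rabs (U k tau) + w * Rabs (U k (tau / 2))) + tau / 2 * M') by (field; lra).
      apply Rplus_le_compat.
      * apply Rle_trans with (2 / a * (M + M)); [|right; field; lra].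
        apply Rmult_le_compat; [apply Rdiv_le_0_compat; lra|apply Rplus_le_le_0_compat; apply Rmult_le_pos; try apply Rabs_pos; lra| |lra].
        apply Rmult_le_compat_l; [lra|]. apply Rinv_le_contravar; lra.
      * apply Rmult_le_compat_r; lra.
  - intros k tau Ht. unfold taylorV. rewrite (EU k tau Ht), (EU k (tau / 2)) by lra. f_equal. f_equal.
    apply RInt_ext; intros r Hr. rewrite Rmin_left, Rmax_right in Hr by lra. rewrite EG; [reflexivity|apply Hin; lra].
Qed.

(** A bootstrap on the pair formed by [U] and its time derivative: the equation expresses [U'']
    through [U], so each member of the pair gains one order from the current order of the other. *)
Lemma solution_tsmooth (T1 : R) (U : R -> R -> R) : rapid_even T1 U ->
  (forall k, exists U1 : R -> R, forall tau, 0 < tau < T1 ->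
     is_derive (U k) tau (U1 tau) /\ is_derive U1 tau (symb k * U k tau - k ^ 2 * conv U U k tau)) ->
  (forall m, tsmooth T1 m U) /\
  (forall k tau, 0 < tau < T1 -> Derive (fun t => Derive (U k) t) tau = symb k * U k tau - k ^ 2 * conv U U k tau).
Proof.
  intros HU HD. set (G := fun k t => symb k * U k t + (-1 * k ^ 2) * conv U U k t).
  assert (Hpz : exists C, 0 <= C /\ forall k, Rabs (symb k) <= C * (1 + Rabs k) ^ 4).
  { exists 2; split; [lra|]. intros k. unfold symb. eapply Rle_trans; [apply Rabs_triang|]. rewrite Rabs_Ropp, <- !RPow_abs.
    assert (P := Rabs_pos k).
    assert (Rabs k ^ 4 <= (1 + Rabs k) ^ 4) by (apply pow_incr; lra).
    assert (Rabs k ^ 2 <= (1 + Rabs k) ^ 2) by (apply pow_incr; lra).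
    assert ((1 + Rabs k) ^ 2 <= (1 + Rabs k) ^ 4) by (apply Rle_pow; [lra|lia]). lra. }
  assert (Hpk : exists C, 0 <= C /\ forall k, Rabs (-1 * k ^ 2) <= C * (1 + Rabs k) ^ 2).
  { exists 1; split; [lra|]. intros k. rewrite Rabs_mult, <- RPow_abs, Rabs_left by lra. assert (P := Rabs_pos k).
    assert (Rabs k ^ 2 <= (1 + Rabs k) ^ 2) by (apply pow_incr; lra). lra. }
  assert (Cz : forall k, continuous symb k) by (intros; apply (ex_derive_continuous (V := R_NormedModule)); unfold symb; auto_derive; exact I).
  assert (Ck : forall k, continuous (fun k => -1 * k ^ 2) k) by (intros; apply (ex_derive_continuous (V := R_NormedModule)); auto_derive; exact I).
  assert (Ez : forall k, symb (- k) = symb k) by (intros; unfold symb; ring).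
  assert (Ek : forall k, -1 * (- k) ^ 2 = -1 * k ^ 2) by (intros; ring).
  assert (HTG : forall m, tsmooth T1 m U -> tsmooth T1 m G).
  { intros m Hm. apply (tsmooth_plus T1 m (fun k t => symb k * U k t) (fun k t => (-1 * k ^ 2) * conv U U k t)).
    - apply (tsmooth_poly T1 m U symb 4 Cz Ez Hpz Hm).
    - apply (tsmooth_poly T1 m (conv U U) (fun k => -1 * k ^ 2) 2 Ck Ek Hpk), tsmooth_conv; assumption. }
  assert (HG : rapid_even T1 G) by (apply (tsmooth_rapid_even T1 0), HTG; split; [exact HU|exact I]).
  assert (HV := taylorV_rapid_even T1 U G HU HG).
  assert (CG : forall k t, 0 < t < T1 -> continuous (G k) t) by (intros k t Ht; apply (continuous_slice G), HG, Ht).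
  assert (EG : forall k t, symb k * U k t - k ^ 2 * conv U U k t = G k t) by (intros; unfold G; ring).
  assert (D1 : forall k tau, 0 < tau < T1 -> is_derive (U k) tau (taylorV U G k tau)).
  { intros k tau Ht. destruct (HD k) as [U1 H1].
    rewrite <- (taylorV_eq T1 k tau U G U1 Ht); [apply H1, Ht| |apply CG].
    intros t Ht'. rewrite <- EG. apply H1, Ht'. }
  assert (D2 : forall k tau, 0 < tau < T1 -> is_derive (taylorV U G k) tau (G k tau)).
  { intros k tau Ht. destruct (HD k) as [U1 H1].
    apply is_derive_ext_loc with (f := U1); [|rewrite <- EG; apply H1, Ht].
    generalize (locally_dom T1 tau Ht); apply filter_imp; intros t Ht'.
    apply (taylorV_eq T1 k t U G U1 Ht'); [|apply CG]. intros t0 Ht0. rewrite <- EG. apply H1, Ht0. }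
  split.
  - assert (H : forall m, tsmooth T1 m U /\ tsmooth T1 m (taylorV U G)).
    { induction m as [|m [IH1 IH2]]; [split; (split; [assumption|exact I])|]. split.
      - split; [exact HU|]. exists (taylorV U G); split; [exact D1|exact IH2].
      - split; [exact HV|]. exists G; split; [exact D2|apply HTG, IH1]. }
    intros m; apply H.
  - intros k tau Ht. rewrite EG. rewrite <- (is_derive_unique _ _ _ (D2 k tau Ht)). apply Derive_ext_loc.
    generalize (locally_dom T1 tau Ht); apply filter_imp; intros t Ht'. apply is_derive_unique, D1, Ht'.
Qed.

(** The [i]-th [x]-derivative of the function whose (even) Fourier transform is [F]. *)
Definition phys (i : nat) (F : R -> R -> R) (x tau : R) : R :=
  IR (fun k => k ^ i * F k tau * cos (k * x + INR i * (PI / 2))).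

Lemma phys_adm (T1 a : R) (i : nat) (F : R -> R -> R) : rapid_even T1 F -> 0 < a ->
  exists M, 0 <= M /\ forall tau x phi, a <= tau < T1 -> adm 1 M (fun k => k ^ i * F k tau * cos (k * x + phi)).
Proof.
  intros HF Ha. destruct HF as (C1 & B1 & _). destruct (B1 a (S (S i)) Ha) as (M & HM & Hb).
  exists M; split; [exact HM|]. intros tau x phi Ht; split.
  - intros k. apply (continuous_mult (K := R_AbsRing)); [apply (continuous_mult (K := R_AbsRing))|].
    + apply (ex_derive_continuous (V := R_NormedModule)); auto_derive; exact I.
    + apply (continuous_slice_l F), C1; lra.
    + apply (ex_derive_continuous (V := R_NormedModule)); auto_derive; exact I.
  - intros k. rewrite !Rabs_mult, <- RPow_abs. assert (P := Rabs_pos k).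
    assert (h := weight_le_rho i k _ M (Hb k tau Ht)).
    assert (hc : Rabs (cos (k * x + phi)) <= 1) by (apply Rabs_le; generalize (COS_bound (k * x + phi)); lra).
    assert (hp : Rabs k ^ i <= (1 + Rabs k) ^ i) by (apply pow_incr; lra).
    assert (PF := Rabs_pos (F k tau)). assert (P0 : 0 <= Rabs k ^ i) by (apply pow_le; exact P).
    apply Rle_trans with (Rabs k ^ i * Rabs (F k tau) * 1); [apply Rmult_le_compat_l; [apply Rmult_le_pos; assumption|exact hc]|].
    rewrite Rmult_1_r. eapply Rle_trans; [|exact h]. apply Rmult_le_compat_r; assumption.
Qed.

Lemma phys_integrand_cont (T1 : R) (i : nat) (F : R -> R -> R) (x tau k phi : R) : rapid_even T1 F -> 0 < tau < T1 ->
  continuous (fun z : R * R * R => snd z ^ i * F (snd z) (snd (fst z)) * cos (snd z * fst (fst z) + phi)) (x, tau, k).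
Proof.
  intros HF Ht. apply (continuous_mult (K := R_AbsRing)); [apply (continuous_mult (K := R_AbsRing))|].
  - apply (continuous_comp (fun z : R * R * R => snd z) (fun k => k ^ i)); [apply continuous_snd'|].
    apply (ex_derive_continuous (V := R_NormedModule)); auto_derive; exact I.
  - apply (continuous_comp_2 (fun z : R * R * R => snd z) (fun z => snd (fst z)) F).
    + apply continuous_snd'.
    + apply (continuous_comp (fun z : R * R * R => fst z) (fun q : R * R => snd q)); [apply continuous_fst'|apply continuous_snd'].
    + apply HF, Ht.
  - apply (continuous_comp (fun z : R * R * R => snd z * fst (fst z) + phi) cos).
    + apply (continuous_plus (V := R_NormedModule)); [|apply continuous_const]. apply (continuous_mult (K := R_AbsRing)); [apply continuous_snd'|].
      apply (continuous_comp (fun z : R * R * R => fst z) (fun q : R * R => fst q)); apply continuous_fst'.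
    + apply (ex_derive_continuous (V := R_NormedModule)); auto_derive; exact I.
Qed.

Lemma phys_cont (T1 : R) (i : nat) (F : R -> R -> R) (x tau : R) : rapid_even T1 F -> 0 < tau < T1 ->
  continuous (fun q : R * R => phys i F (fst q) (snd q)) (x, tau).
Proof.
  intros HF Ht. destruct (phys_adm T1 (tau / 2) i F HF ltac:(lra)) as (M & HM & Ha).
  apply (IR_continuous 1 M (fun (q : R * R) k => k ^ i * F k (snd q) * cos (k * fst q + INR i * (PI / 2))) (x, tau) Rlt_0_1).
  - generalize (locally_snd (U := R_UniformSpace) _ x tau (locally_window T1 tau Ht)). apply filter_imp; intros q Hq; apply Ha, Hq.
  - intros k. apply (phys_integrand_cont T1); assumption.
Qed.

Lemma phys_dx (T1 : R) (i : nat) (F : R -> R -> R) (x tau : R) : rapid_even T1 F -> 0 < tau < T1 ->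
  is_derive (fun y => phys i F y tau) x (phys (S i) F x tau).
Proof.
  intros HF Ht. destruct (phys_adm T1 (tau / 2) i F HF ltac:(lra)) as (M & HM & Ha).
  destruct (phys_adm T1 (tau / 2) (S i) F HF ltac:(lra)) as (M' & HM' & Ha').
  apply (IR_is_derive 1 (M + M') (fun x k => k ^ i * F k tau * cos (k * x + INR i * (PI / 2)))
     (fun x k => k ^ S i * F k tau * cos (k * x + INR (S i) * (PI / 2))) x Rlt_0_1).
  - apply filter_forall; intros y k. replace (k * y + INR (S i) * (PI / 2)) with (PI / 2 + (k * y + INR i * (PI / 2))) by (rewrite S_INR; ring).
    assert (Ec : cos (PI / 2 + (k * y + INR i * (PI / 2))) = - sin (k * y + INR i * (PI / 2))) by (rewrite sin_cos; ring).
    rewrite Ec. generalize (INR i * (PI / 2)) (F k tau); intros c f. auto_derive; [exact I|]. simpl; ring.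
  - apply filter_forall; intros y. destruct (Ha tau y (INR i * (PI / 2)) ltac:(lra)) as [h1 h2]; split; [exact h1|].
    intros k; eapply Rle_trans; [apply h2|]. apply Rmult_le_compat_r; [left; apply rho_pos|lra].
  - apply filter_forall; intros y. destruct (Ha' tau y (INR (S i) * (PI / 2)) ltac:(lra)) as [h1 h2]; split; [exact h1|].
    intros k; eapply Rle_trans; [apply h2|]. apply Rmult_le_compat_r; [left; apply rho_pos|lra].
  - intros k.
    apply (continuous_comp (fun z : R * R => (fst z, tau, snd z)) (fun z : R * R * R => snd z ^ S i * F (snd z) (snd (fst z)) * cos (snd z * fst (fst z) + INR (S i) * (PI / 2)))).
    + apply continuous_pair; [apply continuous_pair; [apply continuous_fst'|apply continuous_const]|apply continuous_snd'].
    + apply (phys_integrand_cont T1); assumption.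
Qed.


Lemma phys_dtau (T1 : R) (i : nat) (F F1 : R -> R -> R) (x tau : R) : rapid_even T1 F -> rapid_even T1 F1 -> 0 < tau < T1 ->
  (forall k tau, 0 < tau < T1 -> is_derive (F k) tau (F1 k tau)) ->
  is_derive (fun t => phys i F x t) tau (phys i F1 x tau).
Proof.
  intros HF HF1 Ht HD. destruct (phys_adm T1 (tau / 2) i F HF ltac:(lra)) as (M & HM & Ha).
  destruct (phys_adm T1 (tau / 2) i F1 HF1 ltac:(lra)) as (M' & HM' & Ha').
  apply (IR_is_derive 1 (M + M') (fun t k => k ^ i * F k t * cos (k * x + INR i * (PI / 2)))
     (fun t k => k ^ i * F1 k t * cos (k * x + INR i * (PI / 2))) tau Rlt_0_1).
  - generalize (locally_dom T1 tau Ht); apply filter_imp; intros t Ht' k.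
    apply is_derive_ext with (f := fun t => (k ^ i * cos (k * x + INR i * (PI / 2))) * F k t); [intros; Req; ring|].
    evar_last; [apply is_derive_scal, HD, Ht'|]. simpl; ring.
  - generalize (locally_window T1 tau Ht); apply filter_imp; intros t Ht'.
    destruct (Ha t x (INR i * (PI / 2)) Ht') as [h1 h2]; split; [exact h1|].
    intros k; eapply Rle_trans; [apply h2|]. apply Rmult_le_compat_r; [left; apply rho_pos|lra].
  - generalize (locally_window T1 tau Ht); apply filter_imp; intros t Ht'.
    destruct (Ha' t x (INR i * (PI / 2)) Ht') as [h1 h2]; split; [exact h1|].
    intros k; eapply Rle_trans; [apply h2|]. apply Rmult_le_compat_r; [left; apply rho_pos|lra].
  - intros k.
    apply (continuous_comp (fun z : R * R => (x, fst z, snd z)) (fun z : R * R * R => snd z ^ i * F1 (snd z) (snd (fst z)) * cos (snd z * fst (fst z) + INR i * (PI / 2)))).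
    + apply continuous_pair; [apply continuous_pair; [apply continuous_const|apply continuous_fst']|apply continuous_snd'].
    + apply (phys_integrand_cont T1); assumption.
Qed.

Lemma phys_0 (F : R -> R -> R) (x tau : R) : phys 0 F x tau = IR (fun k => F k tau * cos (k * x)).
Proof. unfold phys; apply IR_ext; intros k. simpl. rewrite Rmult_1_l, Rmult_0_l, Rplus_0_r. reflexivity. Qed.

(** The addition formula gives [u cos (k x)] as the integral of [f l * cos ((k + l) x)] over [l],
    the sine part vanishing by evenness; replacing [l] by [l - k] and exchanging the integrals
    produces the convolution. No factor [2 pi] appears because [phys] is an unnormalised
    integral. *)
Lemma phys_square (T1 : R) (F : R -> R -> R) (x tau : R) : rapid_even T1 F -> 0 < tau < T1 ->
  phys 0 F x tau ^ 2 = phys 0 (conv F F) x tau.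
Proof.
  intros HF Ht. destruct (phys_adm T1 tau 0 F HF ltac:(lra)) as (M & HM & Ha).
  set (f := fun k => F k tau).
  assert (Cf : forall k, continuous f k) by (intros k; apply (continuous_slice_l F), HF, Ht).
  assert (Acos : adm 1 M (fun k => f k * cos (k * x))).
  { destruct (Ha tau x 0 ltac:(lra)) as [h1 h2]. split.
    - intros k. eapply continuous_ext; [|apply h1]. intros y; simpl. unfold f. rewrite Rmult_1_l, Rplus_0_r; reflexivity.
    - intros k. generalize (h2 k). rewrite pow_O, Rmult_1_l, Rplus_0_r; auto. }
  assert (Asin : adm 1 M (fun k => f k * sin (k * x))).
  { destruct (Ha tau x (- (PI / 2)) ltac:(lra)) as [h1 h2].
    assert (E : forall y, cos (y * x + - (PI / 2)) = sin (y * x)).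
    { intros y. rewrite <- cos_neg. replace (- (y * x + - (PI / 2))) with (PI / 2 - y * x) by ring. apply cos_shift. }
    split.
    - intros k. eapply continuous_ext; [|apply h1]. intros y; simpl. unfold f. rewrite E, Rmult_1_l; reflexivity.
    - intros k. generalize (h2 k). rewrite pow_O, Rmult_1_l, E; auto. }
  assert (S0 : IR (fun k => f k * sin (k * x)) = 0).
  { assert (E := IR_opp (fun k => f k * sin (k * x)) (proj1 Asin)).
    assert (E2 : IR (fun k => f (- k) * sin (- k * x)) = -1 * IR (fun k => f k * sin (k * x))).
    { rewrite <- (IR_scal 1 M (-1) _ Rlt_0_1 Asin). apply IR_ext; intros k.
      unfold f. rewrite (proj2 (proj2 HF) k tau Ht). replace (- k * x) with (- (k * x)) by ring. rewrite sin_neg. ring. }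
    lra. }
  set (u := IR (fun k => f k * cos (k * x))).
  assert (I1 : forall k, IR (fun l => f k * (f l * cos ((k + l) * x))) = f k * cos (k * x) * u).
  { intros k. transitivity (IR (fun l => (f k * cos (k * x)) * (f l * cos (l * x)) + (- (f k * sin (k * x))) * (f l * sin (l * x)))).
    - apply IR_ext; intros l. replace ((k + l) * x) with (k * x + l * x) by ring. rewrite cos_plus. ring.
    - rewrite (IR_plus 1 (Rabs (f k * cos (k * x)) * M) (Rabs (- (f k * sin (k * x))) * M)); [|lra|apply adm_scal, Acos|apply adm_scal, Asin].
      rewrite (IR_scal 1 M _ _ Rlt_0_1 Acos), (IR_scal 1 M _ _ Rlt_0_1 Asin), S0. fold u. ring. }
  destruct HF as (CF & BF & EF).
  destruct (BF tau 4%nat ltac:(lra)) as (M4 & HM4 & H4). destruct (BF tau 2%nat ltac:(lra)) as (M2 & HM2 & H2).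
  (* Fubini requires a majorant that is a product in [k] and [l] after the substitution: two powers
     on each factor combine to [(1 + |l|)^2], and two more on [f k] give [rho 1 k]. *)
  assert (Bd : forall k l, Rabs (f k * f (l - k) * cos (l * x)) <= M4 * M2 * (rho 1 k * rho 1 l)).
  { intros k l. rewrite !Rabs_mult.
    assert (hc : Rabs (cos (l * x)) <= 1) by (apply Rabs_le; generalize (COS_bound (l * x)); lra).
    assert (h4 := weight_le_rho 2 k _ M4 (H4 k tau ltac:(lra))).
    assert (h2 := H2 (l - k) tau ltac:(lra)). fold (f k) in h4. fold (f (l - k)) in h2.
    assert (h3 := one_plus_sub l k). assert (P := Rabs_pos l). assert (P1 := Rabs_pos k). assert (P2 := Rabs_pos (l - k)).
    assert (h5 : (1 + Rabs l) ^ 2 <= (1 + Rabs k) ^ 2 * (1 + Rabs (l - k)) ^ 2) by (rewrite <- Rpow_mult_distr; apply pow_incr; lra).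
    assert (Pl : 0 < (1 + Rabs l) ^ 2) by (apply pow_lt; lra).
    assert (Pf : 0 <= Rabs (f k) * Rabs (f (l - k))) by (apply Rmult_le_pos; apply Rabs_pos).
    apply Rle_trans with (Rabs (f k) * Rabs (f (l - k)) * 1); [apply Rmult_le_compat_l; assumption|]. rewrite Rmult_1_r.
    rewrite (rho_1 l). apply Rmult_le_reg_r with ((1 + Rabs l) ^ 2); [exact Pl|].
    replace (M4 * M2 * (rho 1 k * / (1 + Rabs l) ^ 2) * (1 + Rabs l) ^ 2) with ((M4 * rho 1 k) * M2) by (field; lra).
    apply Rle_trans with (Rabs (f k) * Rabs (f (l - k)) * ((1 + Rabs k) ^ 2 * (1 + Rabs (l - k)) ^ 2)); [apply Rmult_le_compat_l; assumption|].
    replace (Rabs (f k) * Rabs (f (l - k)) * ((1 + Rabs k) ^ 2 * (1 + Rabs (l - k)) ^ 2)) with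
      (((1 + Rabs k) ^ 2 * Rabs (f k)) * ((1 + Rabs (l - k)) ^ 2 * Rabs (f (l - k)))) by ring.
    apply Rmult_le_compat; [| |exact h4|exact h2]; apply Rmult_le_pos; try apply Rabs_pos; apply pow_le; lra. }
  assert (Cd : forall k l, continuous (fun q : R * R => f (fst q) * f (snd q - fst q) * cos (snd q * x)) (k, l)).
  { intros k l. apply (continuous_mult (K := R_AbsRing)); [apply (continuous_mult (K := R_AbsRing))|].
    - apply (continuous_comp (fun q : R * R => fst q) f); [apply continuous_fst'|apply Cf].
    - apply (continuous_comp (fun q : R * R => snd q - fst q) f); [|apply Cf].
      apply (continuous_minus (V := R_NormedModule)); [apply continuous_snd'|apply continuous_fst'].
    - apply (continuous_comp (fun q : R * R => snd q) (fun l => cos (l * x))); [apply continuous_snd'|].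
      apply (ex_derive_continuous (V := R_NormedModule)); auto_derive; exact I. }
  rewrite !phys_0. fold u. change (IR (fun k => F k tau * cos (k * x))) with u.
  transitivity (IR (fun k => f k * cos (k * x) * u)).
  { transitivity (u * IR (fun k => f k * cos (k * x))); [fold u; simpl; ring|].
    rewrite <- (IR_scal 1 M u _ Rlt_0_1 Acos). apply IR_ext; intros; ring. }
  transitivity (IR (fun k => IR (fun l => f k * f (l - k) * cos (l * x)))).
  { apply IR_ext; intros k. rewrite <- I1.
    assert (Ak : adm 1 (Rabs (f k) * M2) (fun l => f k * (f l * cos ((k + l) * x)))).
    { apply adm_scal. split.
      - intros l; apply (continuous_mult (K := R_AbsRing)); [apply Cf|]. apply (ex_derive_continuous (V := R_NormedModule)); auto_derive; exact I.
      - intros l. assert (h := weight_le_rho 0 l _ M2 (H2 l tau ltac:(lra))). rewrite pow_O, Rmult_1_l in h. fold (f l) in h.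
        rewrite Rabs_mult. assert (hc : Rabs (cos ((k + l) * x)) <= 1) by (apply Rabs_le; generalize (COS_bound ((k + l) * x)); lra).
        generalize (Rabs_pos (f l)); nra. }
    rewrite <- (IR_shift 1 _ (- k) _ Rlt_0_1 Ak). apply IR_ext; intros l.
    replace (l + - k) with (l - k) by ring. replace (k + (l - k)) with l by ring. ring. }
  rewrite (IR_fubini 1 (M4 * M2) (fun k l => f k * f (l - k) * cos (l * x)) Rlt_0_1 Cd Bd).
  apply IR_ext; intros l. unfold conv. fold (f l).
  assert (Al : adm 1 (M4 * M2) (fun k => f k * f (l - k))).
  { split.
    - intros k; apply (continuous_mult (K := R_AbsRing)); [apply Cf|].
      apply (continuous_comp (fun k => l - k) f); [|apply Cf].
      apply (continuous_minus (V := R_NormedModule)); [apply continuous_const|apply continuous_id].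
    - intros k. rewrite Rabs_mult.
      assert (h4 := weight_le_rho 2 k _ M4 (H4 k tau ltac:(lra))). assert (h2 := H2 (l - k) tau ltac:(lra)).
      fold (f k) in h4. fold (f (l - k)) in h2.
      assert (q1 : 1 <= (1 + Rabs k) ^ 2) by (apply pow_R1_Rle; generalize (Rabs_pos k); lra).
      assert (q2 : 1 <= (1 + Rabs (l - k)) ^ 2) by (apply pow_R1_Rle; generalize (Rabs_pos (l - k)); lra).
      assert (p1 := Rabs_pos (f k)). assert (p2 := Rabs_pos (f (l - k))).
      replace (M4 * M2 * rho 1 k) with ((M4 * rho 1 k) * M2) by ring. apply Rmult_le_compat; nra. }
  transitivity (IR (fun k => cos (l * x) * (f k * f (l - k)))); [apply IR_ext; intros; ring|].
  rewrite (IR_scal 1 (M4 * M2) (cos (l * x)) _ Rlt_0_1 Al). apply Rmult_comm.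
Qed.

(** * Integration by parts and decay in space *)

Definition rapid (W : nat -> R -> R -> R) : Prop :=
  forall j a n, 0 < a -> exists M, 0 <= M /\ forall k tau, a <= tau -> (1 + Rabs k) ^ n * W j k tau <= M.

Lemma ksmooth_adm (W : nat -> R -> R -> R) (m : nat) (F : R -> R -> R) (a : R) : rapid W -> ksmooth Dp m W F -> 0 < a ->
  exists M, 0 <= M /\ forall tau x phi, a <= tau -> adm 1 M (fun k => F k tau * cos (k * x + phi)) /\ forall k, Rabs (F k tau) <= M * rho 1 k.
Proof.
  intros HW HF Ha. destruct (ksmooth_bd _ _ _ _ HF) as (C & HC & Hb). destruct (HW O a 2%nat Ha) as (M & HM & HMb).
  exists (C * M); split; [apply Rmult_le_pos; assumption|]. intros tau x phi Ht.
  assert (HtP : 0 < tau) by lra.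
  assert (HFb : forall k, Rabs (F k tau) <= C * M * rho 1 k).
  { intros k. assert (h1 := Hb k tau HtP). assert (h2 := HMb k tau Ht).
    assert (P : 0 < (1 + Rabs k) ^ 2) by (apply pow_lt; generalize (Rabs_pos k); lra).
    rewrite rho_1. eapply Rle_trans; [exact h1|]. rewrite Rmult_assoc. apply Rmult_le_compat_l; [exact HC|].
    apply Rmult_le_reg_r with ((1 + Rabs k) ^ 2); [exact P|]. rewrite Rmult_assoc, Rinv_l by lra. lra. }
  split; [|exact HFb]. split.
  - intros k. apply (continuous_mult (K := R_AbsRing)); [apply (continuous_slice_l F), (ksmooth_cont _ _ _ _ HF), HtP|].
    apply (ex_derive_continuous (V := R_NormedModule)); auto_derive; exact I.
  - intros k. rewrite Rabs_mult. assert (hc : Rabs (cos (k * x + phi)) <= 1) by (apply Rabs_le; generalize (COS_bound (k * x + phi)); lra).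
    generalize (HFb k) (Rabs_pos (F k tau)); nra.
Qed.

(** The free phase absorbs the change from cosine to sine as a shift by [PI / 2], so the identity
    can be iterated in one and the same form. *)
Lemma ibp_cos (M M' x phi : R) (f f1 : R -> R) : (forall k, is_derive f k (f1 k)) ->
  (forall k, Rabs (f k) <= M' * rho 1 k) ->
  adm 1 M (fun k => f k * cos (k * x + phi)) -> adm 1 M (fun k => f1 k * cos (k * x + (phi - PI / 2))) ->
  x * IR (fun k => f k * cos (k * x + phi)) = - IR (fun k => f1 k * cos (k * x + (phi - PI / 2))).
Proof.
  intros Hd Hb A1 A2.
  assert (E : forall k, cos (k * x + (phi - PI / 2)) = sin (k * x + phi)).
  { intros k. rewrite <- cos_neg. replace (- (k * x + (phi - PI / 2))) with (PI / 2 - (k * x + phi)) by ring. apply cos_shift. }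
  assert (Hz : IR (fun k => f1 k * cos (k * x + (phi - PI / 2)) + x * (f k * cos (k * x + phi))) = 0).
  { apply (IR_derivative 1 (M + Rabs x * M) M' (fun k => f k * sin (k * x + phi)) _ Rlt_0_1).
    - intros k. rewrite E. evar_last.
      + apply (is_derive_mult f (fun k => sin (k * x + phi)) k (f1 k) (x * cos (k * x + phi)) (Hd k)); [|intros; apply Rmult_comm].
        auto_derive; [exact I|ring].
      + unfold plus, mult; simpl. change (mult ?a ?b) with (a * b). ring.
    - apply adm_plus; [exact A2|apply adm_scal, A1].
    - intros k. rewrite Rabs_mult. assert (hc : Rabs (sin (k * x + phi)) <= 1) by (apply Rabs_le; generalize (SIN_bound (k * x + phi)); lra).
      generalize (Hb k) (Rabs_pos (f k)); nra. }
  rewrite (IR_plus 1 M (Rabs x * M)) in Hz; [|lra|exact A2|apply adm_scal, A1].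
  rewrite (IR_scal 1 M x _ Rlt_0_1 A1) in Hz. lra.
Qed.

Lemma ksmooth_ibp (W : nat -> R -> R -> R) (m : nat) (F : R -> R -> R) (a : R) : rapid W -> ksmooth Dp (S m) W F -> 0 < a ->
  forall F1, (forall k p, Dp k p -> is_derive (fun y => F y p) k (F1 k p)) -> ksmooth Dp m (fun j => W (S j)) F1 ->
  forall x phi tau, a <= tau ->
  x * IR (fun k => F k tau * cos (k * x + phi)) = - IR (fun k => F1 k tau * cos (k * x + (phi - PI / 2))).
Proof.
  intros HW HF Ha F1 HD HF1 x phi tau Ht.
  destruct (ksmooth_adm W (S m) F a HW HF Ha) as (M & HM & H1).
  destruct (ksmooth_adm (fun j => W (S j)) m F1 a (fun j => HW (S j)) HF1 Ha) as (M' & HM' & H2).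
  destruct (H1 tau x phi Ht) as [A1 B1]. destruct (H2 tau x (phi - PI / 2) Ht) as [A2 _].
  apply (ibp_cos (M + M') M x phi (fun k => F k tau) (fun k => F1 k tau)).
  - intros k; apply HD. unfold Dp; lra.
  - exact B1.
  - destruct A1 as [c b]; split; [exact c|]. intros k; eapply Rle_trans; [apply b|]. apply Rmult_le_compat_r; [left; apply rho_pos|lra].
  - destruct A2 as [c b]; split; [exact c|]. intros k; eapply Rle_trans; [apply b|]. apply Rmult_le_compat_r; [left; apply rho_pos|lra].
Qed.

Lemma ksmooth_decay (m : nat) : forall (W : nat -> R -> R -> R) (F : R -> R -> R) (a : R), rapid W -> ksmooth Dp m W F -> 0 < a ->
  exists M, 0 <= M /\ forall x phi tau, a <= tau -> Rabs x ^ m * Rabs (IR (fun k => F k tau * cos (k * x + phi))) <= M.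
Proof.
  induction m; intros W F a HW HF Ha.
  - destruct (ksmooth_adm W 0 F a HW HF Ha) as (M & HM & H1). exists (M * (2 / 1)); split; [lra|]. intros x phi tau Ht.
    simpl. rewrite Rmult_1_l. apply (IR_bound 1 M _ Rlt_0_1), H1, Ht.
  - assert (HF' := HF). destruct HF' as (_ & _ & F1 & HD & HF1).
    destruct (IHm (fun j => W (S j)) F1 a (fun j => HW (S j)) HF1 Ha) as (M & HM & H). exists M; split; [exact HM|].
    intros x phi tau Ht. simpl pow.
    replace (Rabs x * Rabs x ^ m * Rabs (IR (fun k => F k tau * cos (k * x + phi)))) with
      (Rabs x ^ m * Rabs (x * IR (fun k => F k tau * cos (k * x + phi)))) by (rewrite Rabs_mult; ring).
    rewrite (ksmooth_ibp W m F a HW HF Ha F1 HD HF1 x phi tau Ht), Rabs_Ropp. apply H, Ht.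
Qed.

Lemma ksmooth_pow (n i : nat) : ksmooth Dp n (fun _ k _ => (1 + Rabs k) ^ i) (fun k (_ : R) => k ^ i).
Proof.
  assert (H : forall n j, (j <= i)%nat -> ksmooth Dp n (fun _ k _ => (1 + Rabs k) ^ i) (fun k (_ : R) => k ^ j)).
  { induction n0; intros j Hj; (split; [|split]).
    all: try (intros k p _; apply (jcont_k (fun k => k ^ j)), (ex_derive_continuous (V := R_NormedModule)); auto_derive; exact I).
    all: try (exists 1; split; [lra|]; intros k p _; rewrite <- RPow_abs, Rmult_1_l; assert (P := Rabs_pos k);
      apply Rle_trans with ((1 + Rabs k) ^ j); [apply pow_incr; lra|apply Rle_pow; [lra|exact Hj]]).
    - exact I.
    - exists (fun k _ => INR j * k ^ pred j); split.
      + intros k p _; auto_derive; [exact I|ring].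
      + apply ksmooth_scal, IHn0. lia. }
  apply H; lia.
Qed.

Lemma wt_seq_rapid (eta : R) (E : nat -> R) (i : nat) : 0 < eta -> (forall j, 0 <= E j) ->
  rapid (fun j k tau => (1 + Rabs k) ^ i * wt eta (E j) k tau).
Proof.
  intros He HE j a n Ha. destruct (wt_rapid eta (E j) a (n + i) He (HE j) Ha) as (M & HM & H). exists M; split; [exact HM|].
  intros k tau Ht. specialize (H k tau Ht). rewrite pow_add in H. rewrite <- Rmult_assoc. exact H.
Qed.

(** * Iterated logarithms and the linear profile *)

(** The threshold beyond which the first [r] iterated logarithms are defined and at least 1; there
    the powers [a j >= 0] of logarithms are monotone and reciprocals are bounded. *)
Fixpoint tower (r : nat) : R := match r with O => 1 | S n => exp (tower n) end.

Lemma tower_ge_1 (r : nat) : 1 <= tower r.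
Proof. induction r; simpl; [lra|]. generalize (exp_ineq1_le (tower r)); lra. Qed.

Lemma tower_le (r r' : nat) : (r <= r')%nat -> tower r <= tower r'.
Proof.
  induction 1 as [|n _ IH]; [lra|]. simpl. generalize (exp_ineq1_le (tower n)); lra.
Qed.

Lemma logn_S (r : nat) (s : R) : logn (S r) s = ln (logn r s).
Proof. reflexivity. Qed.

Lemma logn_S_r (r : nat) (s : R) : logn (S r) s = logn r (ln s).
Proof. unfold logn. apply Nat.iter_succ_r. Qed.

Lemma logn_ge_1 (r : nat) (s : R) : tower r <= s -> 1 <= logn r s.
Proof.
  revert s; induction r; intros s Hs; [exact Hs|]. rewrite logn_S_r. apply IHr. simpl in Hs.
  rewrite <- (ln_exp (tower r)). destruct (Rle_lt_or_eq_dec _ _ Hs) as [h|h]; [left; apply ln_increasing; [apply exp_pos|exact h]|rewrite h; right; reflexivity].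
Qed.

Lemma logn_mono (r : nat) (s s' : R) : tower r <= s -> s <= s' -> logn r s <= logn r s'.
Proof.
  revert s s'; induction r; intros s s' Hs H; [exact H|]. rewrite !logn_S_r. simpl in Hs.
  assert (P := exp_pos (tower r)). apply IHr; [|apply ln_le; lra].
  rewrite <- (ln_exp (tower r)). apply ln_le; assumption.
Qed.

Lemma ln_le_sub (x : R) : 0 < x -> ln x <= x - 1.
Proof.
  intros Hx. rewrite <- (ln_exp (x - 1)). apply ln_le; [exact Hx|]. generalize (exp_ineq1_le (x - 1)); lra.
Qed.

(** By induction from [ln y <= y - 1] and [logn (S r) s >= 1]. This crude form of slow variation
    suffices, since the loss is a power of [y] that later meets an exponential in [y]. *)
Lemma logn_slow (r : nat) (s y : R) : tower r <= s -> 1 <= y -> logn r (s * y) <= y * logn r s.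
Proof.
  intros Hs Hy; induction r; [unfold logn; simpl; lra|]. rewrite !logn_S.
  assert (Hr : tower r <= s) by (eapply Rle_trans; [apply (tower_le r (S r)); lia|exact Hs]).
  assert (H1 := logn_ge_1 r s Hr). assert (H2 := logn_ge_1 (S r) s Hs). rewrite logn_S in H2.
  assert (H3 : 1 <= logn r (s * y)).
  { apply logn_ge_1. eapply Rle_trans; [exact Hr|]. generalize (tower_ge_1 r); nra. }
  apply Rle_trans with (ln (y * logn r s)); [apply ln_le; [lra|apply IHr, Hr]|].
  rewrite ln_mult by lra. assert (H4 := ln_le_sub y ltac:(lra)). nra.
Qed.

Lemma logn_le_ln (r : nat) (s : R) : (1 <= r)%nat -> tower r <= s -> logn r s <= ln s.
Proof.
  intros Hr Hs; induction Hr as [|r Hr IH]; [right; reflexivity|]. rewrite logn_S.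
  assert (Hr' : tower r <= s) by (eapply Rle_trans; [apply (tower_le r (S r)); lia|exact Hs]).
  assert (H1 := logn_ge_1 r s Hr'). generalize (ln_le_sub (logn r s) ltac:(lra)) (IH Hr'); lra.
Qed.

(** Logarithmic derivative of [k |-> logn r (k^2)]. *)
Fixpoint ld (r : nat) (k : R) : R :=
  match r with O => 2 * / (k - 0) | S n => ld n k * / logn (S n) (k ^ 2) end.

(** For [|k|] beyond it, [k^2 > 4] and all iterated logarithms of [k^2] up to order [Rm] are at
    least 1. *)
Definition K0 (Rm : nat) : R := 2 + tower Rm.
Definition Dv (Rm : nat) (k tau : R) : Prop := 0 < tau /\ K0 Rm < Rabs k.
Definition rtv (k tau : R) : R := / Rabs k.

Lemma Dv_facts (Rm : nat) (k tau : R) : Dv Rm k tau -> 4 < k ^ 2 /\ k <> 0 /\ tower Rm <= k ^ 2 /\ 0 < tau /\ 2 < Rabs k.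
Proof.
  intros [H1 H2]; unfold K0 in H2. assert (T := tower_ge_1 Rm). rewrite <- pow2_abs.
  repeat split; try nra. intros ->; rewrite Rabs_R0 in H2; lra.
Qed.

Lemma ld_derive (Rm r : nat) (k tau : R) : (r <= Rm)%nat -> Dv Rm k tau ->
  is_derive (fun k => logn r (k ^ 2)) k (logn r (k ^ 2) * ld r k).
Proof.
  intros Hr HD. destruct (Dv_facts Rm k tau HD) as (F1 & F2 & F3 & _).
  induction r.
  - unfold logn; simpl. rewrite Rminus_0_r. auto_derive; [exact I|]. field; exact F2.
  - assert (Hge := logn_ge_1 r (k ^ 2) ltac:(eapply Rle_trans; [apply (tower_le r Rm); lia|exact F3])).
    assert (Hge' := logn_ge_1 (S r) (k ^ 2) ltac:(eapply Rle_trans; [apply (tower_le (S r) Rm); lia|exact F3])).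
    evar_last.
    + apply (is_derive_comp ln (fun k => logn r (k ^ 2)) k (/ logn r (k ^ 2))); [apply is_derive_Reals, derivable_pt_lim_ln; lra|apply IHr; lia].
    + change (logn r (k ^ 2) * ld r k * / logn r (k ^ 2) = logn (S r) (k ^ 2) * (ld r k * / logn (S r) (k ^ 2))).
      field. split; lra.
Qed.

Section LogSymbols.
Variable Rm : nat.

Lemma rtv_pos (k tau : R) : Dv Rm k tau -> 0 <= rtv k tau.
Proof. intros H; destruct (Dv_facts Rm k tau H) as (_ & _ & _ & _ & F). unfold rtv; left; apply Rinv_0_lt_compat; lra. Qed.

Lemma ld_symbol (r n : nat) : (r <= Rm)%nat -> ksmooth (Dv Rm) n (pw rtv rtv) (fun k (_ : R) => ld r k).
Proof.
  intros Hr; revert n; induction r; intros n.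
  - apply ksmooth_scal. apply (inv_symbol (P := R_UniformSpace) (Dv Rm) rtv 1).
    + intros k p H; apply (Dv_facts Rm k p H).
    + lra.
    + intros k p _; unfold rtv; lra.
    + rewrite Rabs_R0; lra.
  - assert (IH : forall n, ksmooth (Dv Rm) n (pw rtv rtv) (fun k (_ : R) => ld r k)) by (intros; apply IHr; lia).
    assert (Hge : forall k tau, Dv Rm k tau -> 1 <= logn (S r) (k ^ 2)).
    { intros k tau H. apply logn_ge_1. eapply Rle_trans; [apply (tower_le (S r) Rm Hr)|apply (Dv_facts Rm k tau H)]. }
    assert (Hd : forall k tau, Dv Rm k tau -> is_derive (fun k => / logn (S r) (k ^ 2)) k
       (-1 * (/ logn (S r) (k ^ 2) * (/ logn (S r) (k ^ 2) * ld r k)))).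
    { intros k tau H. assert (Hg := Hge k tau H). assert (HD := ld_derive Rm (S r) k tau Hr H).
      evar_last; [apply (is_derive_inv (fun k => logn (S r) (k ^ 2)) k _ HD); lra|].
      change (ld (S r) k) with (ld r k * / logn (S r) (k ^ 2)). revert Hg; generalize (logn (S r) (k ^ 2)); intros y Hy; field; lra. }
    (* The derivative of the reciprocal logarithm is a product of that reciprocal, twice, with the
       symbol [ld r]; its bounds of order [n] therefore give those of order [n + 1]. *)
    assert (Hone : forall n, ksmooth (Dv Rm) n (pw (fun _ _ => 1) rtv) (fun k (_ : R) => / logn (S r) (k ^ 2))).
    { induction n0; (split; [|split]).
      all: try (intros k tau H; apply (jcont_k (fun k => / logn (S r) (k ^ 2))), (continuous_of_derive _ _ _ (Hd k tau H))).
      all: try (exists 1; split; [lra|]; intros k tau H; unfold pw; rewrite pow_O; assert (Hg := Hge k tau H);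
        rewrite Rabs_inv, Rabs_pos_eq, !Rmult_1_r by lra; rewrite <- Rinv_1; apply Rinv_le_contravar; lra).
      - exact I.
      - eexists; split; [intros k tau H; apply (Hd k tau H)|]. apply ksmooth_scal.
        apply (ksmooth_mult (Dv Rm) n0 (pw (fun _ _ => 1) rtv) (pw rtv rtv) _ (fun k _ => / logn (S r) (k ^ 2)) (fun k _ => / logn (S r) (k ^ 2) * ld r k)).
        + exact IHn0.
        + apply (ksmooth_mult (Dv Rm) n0 (pw (fun _ _ => 1) rtv) (pw rtv rtv) _ (fun k _ => / logn (S r) (k ^ 2)) (fun k _ => ld r k)); [exact IHn0|apply IH|].
          apply wcompat_pw; [apply rtv_pos|]. exists 1; split; [lra|]; intros; lra.
        + intros a b; exists 1; split; [lra|]; intros k tau H; unfold pw; simpl; rewrite pow_add; right; ring. }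
    apply (ksmooth_mult (Dv Rm) n (pw rtv rtv) (pw (fun _ _ => 1) rtv) _ (fun k _ => ld r k) (fun k _ => / logn (S r) (k ^ 2))); [apply IH|apply Hone|].
    apply wcompat_pw; [apply rtv_pos|]. exists 1; split; [lra|]; intros; lra.
Qed.
End LogSymbols.

Definition logprod (p : nat) (r : nat -> nat) (a : nat -> R) (s : R) : R := prodR p (fun j => Rpower (logn (r j) s) (a j)).
Fixpoint sumA (p : nat) (a : nat -> R) : R := match p with O => 0 | S q => sumA q a + a q end.
Fixpoint ldP (p : nat) (r : nat -> nat) (a : nat -> R) (k : R) : R :=
  match p with O => 0 | S q => ldP q r a k + a q * ld (r q) k end.

(** Over [|k| <= tau^(-1/2)] the power [|k|^(2 delta - 1)] integrates to a multiple of
    [tau^(-delta)], dominated by the upper end, where the logarithms of [k^2] are those of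
    [1 / tau]. *)
Definition amplF (p : nat) (r : nat -> nat) (a : nat -> R) (delta k : R) : R := Rpower (k ^ 2) (delta - 1 / 2) * logprod p r a (k ^ 2).

Lemma sumA_pos (p : nat) (a : nat -> R) : nonneg_vec p a -> 0 <= sumA p a.
Proof. induction p; intros H; simpl; [lra|]. assert (0 <= a p) by (apply H; lia). assert (nonneg_vec p a) by (intros j Hj; apply H; lia). specialize (IHp H1); lra. Qed.

Lemma logprod_pos (p : nat) (r : nat -> nat) (a : nat -> R) (s : R) : 0 < logprod p r a s.
Proof. unfold logprod; induction p; simpl; [lra|]. apply Rmult_lt_0_compat; [exact IHp|apply Rpower_pos]. Qed.

Lemma Rpower_ge_1 (x a : R) : 1 <= x -> 0 <= a -> 1 <= Rpower x a.
Proof. intros Hx Ha. rewrite <- (Rpower_O x) by lra. apply Rle_Rpower; assumption. Qed.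

Lemma logprod_ge_1 (p Rm : nat) (r : nat -> nat) (a : nat -> R) (s : R) : (forall j, (j < p)%nat -> (r j <= Rm)%nat) -> nonneg_vec p a ->
  tower Rm <= s -> 1 <= logprod p r a s.
Proof.
  unfold logprod; induction p; intros Hr Ha Hs; simpl; [lra|].
  assert (1 <= Rpower (logn (r p) s) (a p)).
  { apply Rpower_ge_1; [|apply Ha; lia]. apply logn_ge_1. eapply Rle_trans; [apply (tower_le _ Rm), Hr; lia|exact Hs]. }
  assert (1 <= prodR p (fun j => Rpower (logn (r j) s) (a j))) by (apply IHp; [intros; apply Hr; lia|intros j Hj; apply Ha; lia|exact Hs]). nra.
Qed.

Lemma logprod_mono (p Rm : nat) (r : nat -> nat) (a : nat -> R) (s s' : R) : (forall j, (j < p)%nat -> (r j <= Rm)%nat) -> nonneg_vec p a ->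
  tower Rm <= s -> s <= s' -> logprod p r a s <= logprod p r a s'.
Proof.
  unfold logprod; induction p; intros Hr Ha Hs H; simpl; [lra|].
  apply Rmult_le_compat; [left; apply (logprod_pos p r a s)|left; apply Rpower_pos| |].
  - apply IHp; [intros; apply Hr; lia|intros j Hj; apply Ha; lia|exact Hs|exact H].
  - assert (Ht : tower (r p) <= s) by (eapply Rle_trans; [apply (tower_le _ Rm), Hr; lia|exact Hs]).
    apply Rle_Rpower_l; [apply Ha; lia|]. assert (h := logn_ge_1 _ _ Ht). split; [lra|apply logn_mono; assumption].
Qed.

Lemma logprod_slow (p Rm : nat) (r : nat -> nat) (a : nat -> R) (s y : R) : (forall j, (j < p)%nat -> (r j <= Rm)%nat) -> nonneg_vec p a ->
  tower Rm <= s -> 1 <= y -> logprod p r a (s * y) <= Rpower y (sumA p a) * logprod p r a s.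
Proof.
  unfold logprod; induction p; intros Hr Ha Hs Hy; simpl; [rewrite Rpower_O; lra|].
  assert (Ht : tower (r p) <= s) by (eapply Rle_trans; [apply (tower_le _ Rm), Hr; lia|exact Hs]).
  assert (h := logn_ge_1 _ _ Ht). assert (h' := logn_slow (r p) s y Ht Hy).
  assert (h'' : 1 <= logn (r p) (s * y)) by (apply logn_ge_1; generalize (tower_ge_1 (r p)); nra).
  rewrite Rpower_plus.
  replace (Rpower y (sumA p a) * Rpower y (a p) * (prodR p (fun j => Rpower (logn (r j) s) (a j)) * Rpower (logn (r p) s) (a p))) with
    ((Rpower y (sumA p a) * prodR p (fun j => Rpower (logn (r j) s) (a j))) * (Rpower y (a p) * Rpower (logn (r p) s) (a p))) by ring.
  apply Rmult_le_compat; [left; apply (logprod_pos p r a (s * y))|left; apply Rpower_pos| |].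
  - apply IHp; [intros; apply Hr; lia|intros j Hj; apply Ha; lia|exact Hs|exact Hy].
  - rewrite Rpower_mult_distr by lra. apply Rle_Rpower_l; [apply Ha; lia|]. lra.
Qed.

Lemma logprod_le_ln (p Rm : nat) (r : nat -> nat) (a : nat -> R) (s : R) : (forall j, (j < p)%nat -> (1 <= r j <= Rm)%nat) -> nonneg_vec p a ->
  tower Rm <= s -> logprod p r a s <= Rpower (ln s) (sumA p a) \/ p = O.
Proof.
  unfold logprod. destruct p as [|p]; [intros; right; reflexivity|intros Hr Ha Hs; left].
  assert (Hl : 1 <= ln s).
  { assert (tower 1 <= s) by (eapply Rle_trans; [apply (tower_le 1 Rm); generalize (Hr O ltac:(lia)); lia|exact Hs]). apply (logn_ge_1 1 s H). }
  revert Hr Ha. generalize (S p); intros q; induction q; intros Hr Ha; simpl; [rewrite Rpower_O; lra|].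
  rewrite Rpower_plus. apply Rmult_le_compat; [left; apply (logprod_pos q r a s)|left; apply Rpower_pos| |].
  - apply IHq; [intros; apply Hr; lia|intros j Hj; apply Ha; lia].
  - assert (Ht : tower (r q) <= s) by (eapply Rle_trans; [apply (tower_le _ Rm), Hr; lia|exact Hs]).
    assert (h := logn_ge_1 _ _ Ht). apply Rle_Rpower_l; [apply Ha; lia|]. split; [lra|]. apply logn_le_ln; [apply Hr; lia|exact Ht].
Qed.

Lemma ln_pow_bound (A eta : R) : 0 <= A -> 0 < eta -> exists C, 0 < C /\ forall s, 1 < ln s -> 0 < s -> Rpower (ln s) A <= C * Rpower s eta.
Proof.
  intros HA He. destruct (Req_dec A 0) as [E|E].
  - exists 1; split; [lra|]. intros s Hs Hp. subst A. rewrite Rpower_O by lra. rewrite Rmult_1_l. unfold Rpower. rewrite <- exp_0. apply exp_le. nra.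
  - set (c := eta / A). assert (Hc : 0 < c) by (apply Rdiv_lt_0_compat; lra).
    exists (exp (- A * ln c)); split; [apply exp_pos|]. intros s Hs Hp. unfold Rpower. rewrite <- exp_plus. apply exp_le.
    (* With [c = eta / A], the inequality [ln x <= x - 1] at [x = c ln s] gives exactly the exponent
       [eta] after multiplication by [A]. *)
    assert (H := ln_le_sub (c * ln s) ltac:(nra)). rewrite ln_mult in H by lra.
    assert (A * (ln c + ln (ln s)) <= A * (c * ln s - 1)) by (apply Rmult_le_compat_l; lra).
    replace (A * (c * ln s - 1)) with (eta * ln s - A) in H0 by (unfold c; field; lra). lra.
Qed.

Lemma Rpower_minus_1 (x a : R) : 0 < x -> x * Rpower x (a - 1) = Rpower x a.
Proof. intros Hx. rewrite <- (Rpower_1 x) at 1 by exact Hx. rewrite <- Rpower_plus. f_equal; ring. Qed.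

Lemma logprod_derive (p Rm : nat) (r : nat -> nat) (a : nat -> R) (k tau : R) : (forall j, (j < p)%nat -> (r j <= Rm)%nat) -> Dv Rm k tau ->
  is_derive (fun k => logprod p r a (k ^ 2)) k (logprod p r a (k ^ 2) * ldP p r a k).
Proof.
  unfold logprod; intros Hr HD; induction p; simpl prodR; simpl ldP.
  - rewrite Rmult_0_r. apply (is_derive_const (V := R_NormedModule)).
  - destruct (Dv_facts Rm k tau HD) as (_ & _ & F3 & _).
    assert (Hx := logn_ge_1 (r p) (k ^ 2) ltac:(eapply Rle_trans; [apply (tower_le _ Rm), Hr; lia|exact F3])).
    assert (Hd : is_derive (fun k => Rpower (logn (r p) (k ^ 2)) (a p)) k (Rpower (logn (r p) (k ^ 2)) (a p) * (a p * ld (r p) k))).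
    { evar_last.
      - apply (is_derive_comp (fun y => Rpower y (a p)) (fun k => logn (r p) (k ^ 2)) k _ _ (is_derive_Rpower (a p) _ (Rlt_le_trans 0 1 _ Rlt_0_1 Hx))
          (ld_derive Rm (r p) k tau ltac:(apply Hr; lia) HD)).
      - rewrite <- (Rpower_minus_1 (logn (r p) (k ^ 2)) (a p)) by lra. unfold scal; simpl; unfold mult; simpl. ring. }
    evar_last; [apply (is_derive_mult (fun k => prodR p (fun j => Rpower (logn (r j) (k ^ 2)) (a j))) _ k _ _ (IHp ltac:(intros; apply Hr; lia)) Hd); intros; apply Rmult_comm|].
    unfold plus, mult; simpl. change (mult ?a ?b) with (a * b). ring.
Qed.

Lemma ldP_symbol (p Rm n : nat) (r : nat -> nat) (a : nat -> R) : (forall j, (j < p)%nat -> (r j <= Rm)%nat) ->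
  ksmooth (Dv Rm) n (pw rtv rtv) (fun k (_ : R) => ldP p r a k).
Proof.
  intros Hr; induction p; simpl ldP.
  - apply ksmooth_zero. intros j k t H; unfold pw; apply Rmult_le_pos; [|apply pow_le]; apply (rtv_pos Rm k t H).
  - apply ksmooth_plus; [apply IHp; intros; apply Hr; lia|]. apply ksmooth_scal, ld_symbol, Hr; lia.
Qed.

(** The logarithms cost the factor [|k|^eta] over [|k|^(2 delta - 1)]. *)
Definition wF (delta eta k tau : R) : R := Rpower (k ^ 2) (delta - 1 / 2 + eta / 2).

Lemma ampl_symbol (p Rm : nat) (r : nat -> nat) (a : nat -> R) (delta eta : R) : (forall j, (j < p)%nat -> (1 <= r j <= Rm)%nat) ->
  nonneg_vec p a -> 0 < eta -> forall n, ksmooth (Dv Rm) n (pw (wF delta eta) rtv) (fun k (_ : R) => amplF p r a delta k).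
Proof.
  intros Hr Ha He.
  assert (Hd : forall k tau, Dv Rm k tau -> is_derive (fun y => amplF p r a delta y) k
    (amplF p r a delta k * ((2 * delta - 1) * / (k - 0) + ldP p r a k))).
  { intros k tau H. destruct (Dv_facts Rm k tau H) as (F1 & F2 & F3 & _).
    assert (Hk : is_derive (fun k => Rpower (k ^ 2) (delta - 1 / 2)) k (Rpower (k ^ 2) (delta - 1 / 2) * ((2 * delta - 1) * / (k - 0)))).
    { assert (H0 : 0 < k ^ 2) by lra. evar_last.
      - apply (is_derive_comp (fun y => Rpower y (delta - 1 / 2)) (fun k => k ^ 2) k _ (2 * k) (is_derive_Rpower (delta - 1 / 2) _ H0)).
        auto_derive; [exact I|ring].
      - rewrite <- (Rpower_minus_1 (k ^ 2) (delta - 1 / 2)) by lra. change (scal ?a ?b) with (a * b). rewrite Rminus_0_r. field. exact F2. }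
    unfold amplF. evar_last; [apply (is_derive_mult _ _ k _ _ Hk (logprod_derive p Rm r a k tau ltac:(intros; apply Hr; assumption) H)); intros; apply Rmult_comm|].
    unfold plus, mult; simpl plus. change (mult ?a ?b) with (a * b). simpl. ring. }
  apply (ksmooth_logder (Dv Rm) _ (pw rtv rtv) (fun k _ => amplF p r a delta k) (fun k _ => (2 * delta - 1) * / (k - 0) + ldP p r a k)).
  - intros n; apply ksmooth_plus; [apply ksmooth_scal|apply ldP_symbol; intros; apply Hr; assumption].
    apply (inv_symbol (P := R_UniformSpace) (Dv Rm) rtv 1).
    + intros k t H; apply (Dv_facts Rm k t H).
    + lra.
    + intros k t _; unfold rtv; lra.
    + rewrite Rabs_R0; lra.
  - intros k tau H; apply (jcont_k (fun k => amplF p r a delta k)), (continuous_of_derive _ _ _ (Hd k tau H)).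
  - destruct (ln_pow_bound (sumA p a) (eta / 2) (sumA_pos p a Ha) ltac:(lra)) as (C & HC & Hb).
    exists (C + 1); split; [lra|]. intros k tau H. destruct (Dv_facts Rm k tau H) as (F1 & F2 & F3 & _).
    unfold pw, wF, amplF. rewrite pow_O, Rmult_1_r, Rpower_plus.
    rewrite Rabs_pos_eq by (apply Rmult_le_pos; left; [apply Rpower_pos|apply logprod_pos]).
    replace ((C + 1) * (Rpower (k ^ 2) (delta - 1 / 2) * Rpower (k ^ 2) (eta / 2))) with
      (Rpower (k ^ 2) (delta - 1 / 2) * ((C + 1) * Rpower (k ^ 2) (eta / 2))) by ring.
    apply Rmult_le_compat_l; [left; apply Rpower_pos|].
    assert (P1 : 1 <= Rpower (k ^ 2) (eta / 2)) by (apply Rpower_ge_1; lra).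
    destruct (logprod_le_ln p Rm r a (k ^ 2) Hr Ha F3) as [h|h].
    + assert (Hl : 1 < ln (k ^ 2)).
      { rewrite <- (ln_exp 1). apply ln_increasing; [apply exp_pos|]. generalize exp_le_3; lra. }
      specialize (Hb (k ^ 2) Hl ltac:(lra)). nra.
    + subst p. unfold logprod; simpl prodR. nra.
  - exact Hd.
  - apply wcompat_pw1.
Qed.

(** The cutoff keeps the frequencies at which [lam] and the logarithms are regular; the growth as
    [tau] tends to 0 comes from [k^2] near [1 / tau] and is unaffected. *)
Definition vfun (p : nat) (r : nat -> nat) (a : nat -> R) (Rm : nat) (delta k tau : R) : R :=
  Psi (K0 Rm + 1) k * (amplF p r a delta k * exp (- (lam k * tau))).

(** The hypothesis on [e] is [|k|^(2 delta - 1 + eta - n) <= |k|^(2 e) |k|^(- 1 - eta)]. The last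
    power is [rho] up to a constant; half of the Gaussian turns [|k|^(2 e)] into [tau^(-e)], and the
    other half is at most [exp 2] times [ew], by completing a square. *)
Lemma v_weight (delta eta e k tau : R) (n : nat) : 0 < eta -> 0 < tau -> 2 < Rabs k -> 0 <= e <= 1 ->
  2 * delta + 2 * eta - INR n <= 2 * e ->
  wF delta eta k tau * exp (- (k ^ 2 * tau / 4)) * rtv k tau ^ n <= (8 * exp 2 * Rpower 2 (1 + eta)) * wt eta e k tau.
Proof.
  intros Heta Ht Hk He Hc. set (b := Rabs k) in *.
  assert (E1 : wF delta eta k tau = Rpower b (2 * delta - 1 + eta)).
  { unfold wF. rewrite <- pow2_abs. fold b. rewrite <- Rpower_pow, Rpower_mult by lra. f_equal. simpl; field. }
  assert (E2 : rtv k tau ^ n = Rpower b (- INR n)).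
  { unfold rtv. fold b. rewrite Rpower_Ropp, Rpower_pow by lra. apply pow_inv. }
  set (y := k ^ 2 * tau). assert (Hy : 0 < y) by (unfold y; rewrite <- pow2_abs; fold b; apply Rmult_lt_0_compat; [apply pow_lt; lra|lra]).
  assert (Sy : (sqrt tau * b) * (sqrt tau * b) = y).
  { unfold y. rewrite <- (pow2_abs k). fold b. replace (sqrt tau * b * (sqrt tau * b)) with (sqrt tau * sqrt tau * b ^ 2) by ring. rewrite sqrt_sqrt by lra. ring. }
  assert (Sp : 0 <= sqrt tau * b) by (apply Rmult_le_pos; [apply sqrt_pos|lra]).
  assert (Hexp : exp (- (k ^ 2 * tau / 4)) <= exp 2 * exp (- (y / 8)) * ew k tau).
  { unfold ew. fold b. rewrite <- !exp_plus. apply exp_le. fold y. assert (0 <= (sqrt tau * b - 4) ^ 2) by apply pow2_ge_0. nra. }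
  assert (Hpow : Rpower b (2 * delta - 1 + eta) * Rpower b (- INR n) <= Rpower b (2 * e) * Rpower b (- (1 + eta))).
  { rewrite <- !Rpower_plus. apply Rle_Rpower; lra. }
  assert (Hrho : Rpower b (- (1 + eta)) <= Rpower 2 (1 + eta) * rho eta k).
  { unfold rho. fold b. rewrite !Rpower_Ropp.
    assert (P1 := Rpower_pos b (1 + eta)). assert (P2 := Rpower_pos (1 + b) (1 + eta)).
    assert (H : Rpower (1 + b) (1 + eta) <= Rpower 2 (1 + eta) * Rpower b (1 + eta)).
    { rewrite Rpower_mult_distr by lra. apply Rle_Rpower_l; lra. }
    apply Rmult_le_reg_r with (Rpower b (1 + eta) * Rpower (1 + b) (1 + eta)); [apply Rmult_lt_0_compat; assumption|].
    replace (/ Rpower b (1 + eta) * (Rpower b (1 + eta) * Rpower (1 + b) (1 + eta))) with (Rpower (1 + b) (1 + eta)) by (field; lra).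
    replace (Rpower 2 (1 + eta) * / Rpower (1 + b) (1 + eta) * (Rpower b (1 + eta) * Rpower (1 + b) (1 + eta))) with
      (Rpower 2 (1 + eta) * Rpower b (1 + eta)) by (field; lra). exact H. }
  assert (Hye : Rpower b (2 * e) * exp (- (y / 8)) <= 8 * Rpower tau (- e)).
  { assert (E3 : Rpower b (2 * e) = Rpower y e * Rpower tau (- e)).
    { unfold y. rewrite <- (pow2_abs k). fold b. rewrite <- Rpower_mult_distr by (try apply pow_lt; lra).
      rewrite Rmult_assoc, <- Rpower_plus. replace (e + - e) with 0 by ring. rewrite Rpower_O by lra. rewrite Rmult_1_r.
      rewrite <- Rpower_pow, Rpower_mult by lra. f_equal. }
    rewrite E3. replace (Rpower y e * Rpower tau (- e) * exp (- (y / 8))) with (Rpower y e * exp (- (y / 8)) * Rpower tau (- e)) by ring.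
    apply Rmult_le_compat_r; [left; apply Rpower_pos|].
    assert (Hp1 : Rpower y e <= 1 + y).
    { destruct (Rle_dec y 1) as [h|h].
      - apply Rle_trans with 1; [|lra]. rewrite <- (Rpower_O y) by exact Hy. unfold Rpower. apply exp_le.
        assert (ln y <= 0) by (rewrite <- ln_1; apply ln_le; lra). nra.
      - apply Rle_trans with (Rpower y 1); [apply Rle_Rpower; lra|]. rewrite Rpower_1; lra. }
    assert (Hp2 : 1 + y <= 8 * exp (y / 8)) by (generalize (exp_ineq1_le (y / 8)); lra).
    rewrite exp_Ropp. apply Rle_div_l; [apply exp_pos|]. lra. }
  rewrite E1, E2. unfold wt.
  apply Rle_trans with ((Rpower b (2 * delta - 1 + eta) * Rpower b (- INR n)) * (exp 2 * exp (- (y / 8)) * ew k tau)).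
  { fold y in Hexp. replace (Rpower b (2 * delta - 1 + eta) * exp (- (y / 4)) * Rpower b (- INR n)) with
     ((Rpower b (2 * delta - 1 + eta) * Rpower b (- INR n)) * exp (- (y / 4))) by ring.
    apply Rmult_le_compat_l; [apply Rmult_le_pos; left; apply Rpower_pos|exact Hexp]. }
  assert (PW : 0 < exp 2 * exp (- (y / 8)) * ew k tau) by (repeat apply Rmult_lt_0_compat; apply exp_pos).
  apply Rle_trans with ((Rpower b (2 * e) * Rpower b (- (1 + eta))) * (exp 2 * exp (- (y / 8)) * ew k tau)).
  { apply Rmult_le_compat_r; [lra|exact Hpow]. }
  apply Rle_trans with ((Rpower b (2 * e) * exp (- (y / 8))) * (exp 2 * ew k tau) * (Rpower 2 (1 + eta) * rho eta k)).
  { replace (Rpower b (2 * e) * Rpower b (- (1 + eta)) * (exp 2 * exp (- (y / 8)) * ew k tau)) with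
      ((Rpower b (2 * e) * exp (- (y / 8))) * (exp 2 * ew k tau) * Rpower b (- (1 + eta))) by ring.
    apply Rmult_le_compat_l; [|exact Hrho].
    repeat apply Rmult_le_pos; left; try apply exp_pos; apply Rpower_pos. }
  replace (8 * exp 2 * Rpower 2 (1 + eta) * (Rpower tau (- e) * (rho eta k * ew k tau))) with
    ((8 * Rpower tau (- e)) * (exp 2 * ew k tau) * (Rpower 2 (1 + eta) * rho eta k)) by ring.
  apply Rmult_le_compat_r; [apply Rmult_le_pos; left; [apply Rpower_pos|apply rho_pos]|].
  apply Rmult_le_compat_r; [apply Rmult_le_pos; left; apply exp_pos|exact Hye].
Qed.

(** Derivatives of the cutoff live on bounded [|k|], where factors [1 / |k|] may be inserted at the
    cost of a constant; the cutoff itself does not decay. *)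
Definition wcut (m : R) (j : nat) (k tau : R) : R := match j with O => 1 | S _ => ind (Rabs k <= m + 1) end.

Lemma cut_symbol (m : R) (n : nat) : 0 <= m -> ksmooth Dp n (wcut m) (fun k (_ : R) => Psi m k).
Proof.
  intros Hm.
  assert (Hb : exists C, 0 <= C /\ forall k (p : R), Dp k p -> Rabs (Psi m k) <= C * 1).
  { exists 1; split; [lra|]. intros k p _. generalize (Psi_bounds m k Hm); intros; rewrite Rabs_pos_eq; lra. }
  assert (Hcc := Psi_smooth1 m 1). destruct Hcc as (Hc & _ & _).
  destruct n; (split; [intros k p _; apply jcont_k, Hc|split; [exact Hb|]]); [exact I|].
  destruct (Psi_compl_smooth1 m (S n) Hm) as (_ & _ & e1 & He1 & HS).
  exists (fun k _ => -1 * e1 k); split.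
  - intros k p _. apply is_derive_ext with (f := fun y => 1 - (1 - Psi m y)); [intros; Req; ring|].
    evar_last; [apply (is_derive_minus (V := R_NormedModule)); [apply (is_derive_const (V := R_NormedModule))|apply He1]|].
    unfold minus, plus, opp, zero; simpl; ring.
  - apply ksmooth_scal. apply (ksmooth_chain Dp (fun j => wcut m (S j)) (fun _ _ _ => 1) (fun k _ => k) (fun _ _ => 1) (fun y => ind (Rabs y <= m + 1))).
    + intros n0. apply (ksmooth_const_k Dp n0 _ (fun _ => 1)); [intros; apply continuous_const| |intros; lra].
      exists 1; split; [lra|]; intros; rewrite Rabs_R1; lra.
    + intros k p _; apply (jcont_k (fun k => k)), continuous_id.
    + intros k p _; apply (is_derive_id (K := R_AbsRing)).
    + exists 1; split; [lra|]; intros k p _; simpl; lra.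
    + intros a b; exists 1; split; [lra|]; intros k p _; simpl; lra.
    + exact HS.
Qed.

Lemma v_ksmooth (p Rm : nat) (r : nat -> nat) (a : nat -> R) (delta eta : R) (E : nat -> R) (n : nat) :
  (forall j, (j < p)%nat -> (1 <= r j <= Rm)%nat) -> nonneg_vec p a -> 0 < eta ->
  (forall j, 0 <= E j <= 1) -> (forall j, 2 * delta + 2 * eta - INR j <= 2 * E j) ->
  ksmooth Dp n (fun j => wt eta (E j)) (vfun p r a Rm delta).
Proof.
  intros Hr Ha He HE Hc. assert (HT := tower_ge_1 Rm).
  apply (ksmooth_cut Dp (fun k _ => K0 Rm < Rabs k) (fun k tau => 0 < tau /\ Rabs k < K0 Rm + 1) n (wcut (K0 Rm + 1))
    (pw (fun k tau => wF delta eta k tau * exp (- (k ^ 2 * tau / 4))) rtv) (fun j => wt eta (E j))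
    (fun k _ => Psi (K0 Rm + 1) k) (fun k tau => amplF p r a delta k * exp (- (lam k * tau)))).
  - intros k tau [H1 H2]. apply filter_and.
    + apply (locally_snd (fun t => 0 < t)), locally_pos, H1.
    + apply (locally_fst (fun y => Rabs y < K0 Rm + 1)). apply (continuous_Rabs k (fun y => y < K0 Rm + 1)), locally_lt, H2.
  - intros k tau [H _]; exact H.
  - intros k tau H. destruct (Rlt_dec (Rabs k) (K0 Rm + 1)); [left; split; assumption|right; lra].
  - intros k tau [_ H]. apply Psi_0; lra.
  - intros j k tau _; left; apply wt_pos.
  - apply cut_symbol. unfold K0; lra.
  - apply ksmooth_dom with (Dm := Dv Rm); [|intros k tau [H1 H2]; split; assumption].
    apply (ksmooth_mult (Dv Rm) n (pw (wF delta eta) rtv) (pw (fun k tau => exp (- (k ^ 2 * tau / 4))) rtv) _ (fun k _ => amplF p r a delta k) (fun k tau => exp (- (lam k * tau)))).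
    + apply ampl_symbol; assumption.
    + apply ksmooth_ext with (F := fun k tau => (lam k * tau) ^ 0 * exp (- (lam k * tau))); [intros; rewrite pow_O; ring|].
      apply (exp_symbol (P := R_UniformSpace) (Dv Rm) rtv 1) with (len := fun t : R => t).
      * intros k t H; apply (Dv_facts Rm k t H).
      * lra.
      * intros k t _; unfold rtv; lra.
      * intros; apply continuous_id.
      * intros k t [H _]; lra.
      * intros; apply Rle_refl.
    + apply wcompat_pw; [apply rtv_pos|]. exists 1; split; [lra|]; intros; lra.
  - intros x y.
    (* The power of [K0 Rm + 2] supplies the [x] factors [1 / |k|] that the differentiated cutoff
       lacks: on its support [|k| <= K0 Rm + 2]. *)
    exists ((8 * exp 2 * Rpower 2 (1 + eta)) * (K0 Rm + 2) ^ x). 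
    assert (PC : 0 < 8 * exp 2 * Rpower 2 (1 + eta)) by (apply Rmult_lt_0_compat; [apply Rmult_lt_0_compat; [lra|apply exp_pos]|apply Rpower_pos]).
    assert (PK : 1 <= (K0 Rm + 2) ^ x) by (apply pow_R1_Rle; unfold K0; lra).
    split; [apply Rmult_le_pos; lra|].
    intros k tau [H1 H2]. assert (Hk : 2 < Rabs k) by (unfold K0 in H2; lra). unfold Dp in H1.
    assert (h := v_weight delta eta (E (x + y)%nat) k tau (x + y) He H1 Hk (HE _) (Hc _)).
    unfold pw. simpl plus. set (w := wF delta eta k tau * exp (- (k ^ 2 * tau / 4))) in *.
    assert (Pw : 0 < w) by (apply Rmult_lt_0_compat; [apply Rpower_pos|apply exp_pos]).
    assert (Pr : 0 < rtv k tau) by (unfold rtv; apply Rinv_0_lt_compat; lra).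
    assert (Hcut : wcut (K0 Rm + 1) x k tau <= (K0 Rm + 2) ^ x * rtv k tau ^ x).
    { destruct x; [simpl; lra|]. unfold wcut. destruct (Rle_dec (Rabs k) (K0 Rm + 1 + 1)) as [hk|hk].
      - rewrite ind_true by exact hk. rewrite <- Rpow_mult_distr. apply pow_R1_Rle. unfold rtv.
        apply Rle_div_r; [lra|]. lra.
      - rewrite ind_false by exact hk. apply Rmult_le_pos; apply pow_le; [unfold K0; lra|lra]. }
    apply Rle_trans with ((K0 Rm + 2) ^ x * rtv k tau ^ x * (w * rtv k tau ^ y)).
    + apply Rmult_le_compat_r; [apply Rmult_le_pos; [lra|apply pow_le; lra]|exact Hcut].
    + rewrite pow_add in h.
      replace ((K0 Rm + 2) ^ x * rtv k tau ^ x * (w * rtv k tau ^ y)) with ((K0 Rm + 2) ^ x * (w * (rtv k tau ^ x * rtv k tau ^ y))) by ring.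
      eapply Rle_trans; [apply Rmult_le_compat_l; [|exact h]; lra|].
      right; simpl; ring.
Qed.

(** * Size of the linear profile at the singular point *)

Lemma IR_power_split (eta M C1 C2 b al be : R) (f : R -> R) : 0 < eta -> adm eta M f -> 1 <= b -> 0 < al -> 0 < be ->
  0 <= C1 -> 0 <= C2 -> (forall k, f (- k) = f k) -> (forall k, Rabs k <= 1 -> f k = 0) ->
  (forall k, 1 <= k <= b -> Rabs (f k) <= C1 * Rpower k (al - 1)) ->
  (forall k, b <= k -> Rabs (f k) <= C2 * Rpower k (- be - 1)) ->
  Rabs (IR f) <= 2 * (C1 * Rpower b al / al + C2 * Rpower b (- be) / be).
Proof.
  intros He Hf Hb Hal Hbe HC1 HC2 Hev H0 H1 H2. assert (Hex := fun x y => adm_ex eta M f x y Hf).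
  assert (Hn : forall n, b <= INR n -> Rabs (RInt f (- INR n) (INR n)) <= 2 * (C1 * Rpower b al / al + C2 * Rpower b (- be) / be)).
  { intros n Hn. assert (Ez : RInt f 0 1 = 0).
    { rewrite (RInt_ext f (fun _ => 0)); [rewrite RInt_const; unfold scal; simpl; unfold mult; simpl; ring|].
      intros x Hx; rewrite Rmin_left, Rmax_right in Hx by lra. apply H0; rewrite Rabs_pos_eq; lra. }
    assert (Eh : RInt f (- INR n) 0 = RInt f 0 (INR n)).
    { apply is_RInt_unique. assert (h := RInt_correct f 0 (INR n) (Hex _ _)).
      apply is_RInt_swap in h. rewrite <- Ropp_0, <- (Ropp_involutive (INR n)) in h.
      apply is_RInt_comp_opp, (is_RInt_opp (V := R_NormedModule)) in h. rewrite opp_opp in h. rewrite Ropp_involutive, Ropp_0 in h.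
      revert h; apply is_RInt_ext. intros x _. rewrite Hev. unfold opp; simpl; ring. }
    rewrite <- (RInt_Chasles f _ 0 _ (Hex _ _) (Hex _ _)), Eh.
    rewrite <- (RInt_Chasles f 0 1 _ (Hex _ _) (Hex _ _)), Ez.
    rewrite <- (RInt_Chasles f 1 b _ (Hex _ _) (Hex _ _)).
    unfold plus; simpl.
    assert (B1 : Rabs (RInt f 1 b) <= C1 * Rpower b al / al).
    { eapply Rle_trans.
      - apply abs_RInt_le_is with (g := fun k => C1 * Rpower k (al - 1)); [exact Hb|apply Hex|exact H1|].
        apply (is_RInt_scal (V := R_NormedModule)), is_RInt_Rpower; lra.
      - unfold scal; simpl; unfold mult; simpl. replace (al - 1 + 1) with al by ring. unfold Rdiv. rewrite Rmult_assoc.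
        apply Rmult_le_compat_l; [exact HC1|]. apply Rmult_le_compat_r; [left; apply Rinv_0_lt_compat, Hal|].
        generalize (Rpower_pos 1 al); lra. }
    assert (B2 : Rabs (RInt f b (INR n)) <= C2 * Rpower b (- be) / be).
    { eapply Rle_trans.
      - apply abs_RInt_le_is with (g := fun k => C2 * Rpower k (- be - 1)); [exact Hn|apply Hex|intros x Hx; apply H2; lra|].
        apply (is_RInt_scal (V := R_NormedModule)), is_RInt_Rpower; lra.
      - unfold scal; simpl; unfold mult; simpl. replace (- be - 1 + 1) with (- be) by ring. unfold Rdiv. rewrite Rmult_assoc.
        apply Rmult_le_compat_l; [exact HC2|].
        replace ((Rpower (INR n) (- be) - Rpower b (- be)) * / - be) with ((Rpower b (- be) - Rpower (INR n) (- be)) * / be) by (field; lra).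
        apply Rmult_le_compat_r; [left; apply Rinv_0_lt_compat, Hbe|].
        generalize (Rpower_pos (INR n) (- be)); lra. }
    revert B1 B2; generalize (RInt f 1 b) (RInt f b (INR n)); intros X Y B1 B2.
    apply Rabs_le_between in B1; apply Rabs_le_between in B2; apply Rabs_le; lra. }
  assert (Hl := IR_is_lim eta M f He Hf). apply is_lim_seq_abs in Hl.
  apply (is_lim_seq_le_loc (fun n => Rabs (RInt f (- INR n) (INR n))) (fun _ => 2 * (C1 * Rpower b al / al + C2 * Rpower b (- be) / be)) (Rabs (IR f)) (2 * (C1 * Rpower b al / al + C2 * Rpower b (- be) / be)));
    [|exact Hl|apply is_lim_seq_const].
  destruct (INR_unbounded b) as (N & HN). exists N; intros n Hge. apply Hn. apply Rle_trans with (INR N); [lra|apply le_INR, Hge].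
Qed.

Lemma IR_ge_RInt (eta M x y : R) (f : R -> R) : 0 < eta -> adm eta M f -> (forall k, 0 <= f k) -> 0 <= x <= y -> RInt f x y <= IR f.
Proof.
  intros He Hf Hp Hxy. assert (Hex := fun x y => adm_ex eta M f x y Hf).
  apply (is_lim_seq_le_loc (fun _ => RInt f x y) (fun n => RInt f (- INR n) (INR n)) (RInt f x y) (IR f)); [|apply is_lim_seq_const|exact (IR_is_lim eta M f He Hf)].
  destruct (INR_unbounded y) as (N & HN). exists N; intros n Hge. assert (Hn : y <= INR n) by (apply Rle_trans with (INR N); [lra|apply le_INR, Hge]).
  rewrite <- (RInt_Chasles f (- INR n) x (INR n) (Hex _ _) (Hex _ _)), <- (RInt_Chasles f x y (INR n) (Hex _ _) (Hex _ _)).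
  change (RInt f x y <= RInt f (- INR n) x + (RInt f x y + RInt f y (INR n))). assert (0 <= RInt f (- INR n) x) by (apply RInt_ge_0; [lra|apply Hex|intros; apply Hp]).
  assert (0 <= RInt f y (INR n)) by (apply RInt_ge_0; [lra|apply Hex|intros; apply Hp]). lra.
Qed.

Lemma power_exp_decay (A : R) : 0 <= A -> exists C, 0 < C /\ forall y, 1 <= y -> Rpower y A * exp (- (y / 2)) <= C / y.
Proof.
  intros HA. destruct (INR_unbounded (A + 1)) as (n & Hn). destruct (pow_exp_bound n) as (C & HC & H).
  assert (P2 : 0 < 2 ^ n) by (apply pow_lt; lra).
  exists (C * 2 ^ n + 1); split; [generalize (Rmult_lt_0_compat C (2 ^ n) HC P2); lra|]. intros y Hy.
  assert (Py : y > 0) by lra; apply (Rle_div_r (Rpower y A * exp (- (y / 2))) (C * 2 ^ n + 1) y Py). assert (h := H (y / 2) ltac:(lra)).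
  assert (h1 : exp (- (y / 2 / 2)) <= 1) by (rewrite <- exp_0; apply exp_le; lra).
  assert (h2 : Rpower y A * y <= y ^ n).
  { rewrite <- (Rpower_1 y) at 2 by lra. rewrite <- Rpower_plus, <- Rpower_pow by lra. apply Rle_Rpower; lra. }
  replace (y ^ n) with (2 ^ n * (y / 2) ^ n) in h2 by (rewrite <- Rpow_mult_distr; f_equal; field).
  assert (Pe := exp_pos (- (y / 2))). 
  apply Rle_trans with (2 ^ n * ((y / 2) ^ n * exp (- (y / 2)))); [nra|].
  assert (C * exp (- (y / 2 / 2)) <= C) by nra. nra.
Qed.

Section LinearProfile.
Variables (p Rm : nat) (r : nat -> nat) (a : nat -> R) (delta : R).
Hypothesis Hr : forall j, (j < p)%nat -> (1 <= r j <= Rm)%nat.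
Hypothesis Ha : nonneg_vec p a.
Hypothesis Hdelta : 0 < delta < 1.

Let Hr' : forall j, (j < p)%nat -> (r j <= Rm)%nat.
Proof. intros j Hj; apply Hr, Hj. Qed.

Lemma vfun_even (k tau : R) : vfun p r a Rm delta (- k) tau = vfun p r a Rm delta k tau.
Proof.
  unfold vfun, amplF, lam, symb. rewrite Psi_even. replace ((- k) ^ 2) with (k ^ 2) by ring. replace ((- k) ^ 4) with (k ^ 4) by ring. reflexivity.
Qed.

Lemma vfun_pos (k tau : R) : 0 <= vfun p r a Rm delta k tau.
Proof.
  unfold vfun, amplF. assert (T := tower_ge_1 Rm). apply Rmult_le_pos; [apply Psi_bounds; unfold K0; lra|].
  apply Rmult_le_pos; [apply Rmult_le_pos; left; [apply Rpower_pos|apply logprod_pos]|left; apply exp_pos].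
Qed.

Lemma vfun_zero (k tau : R) : Rabs k <= K0 Rm + 1 -> vfun p r a Rm delta k tau = 0.
Proof. intros H; unfold vfun; rewrite Psi_0 by exact H; ring. Qed.

Lemma vfun_le (k tau : R) : 0 < k -> vfun p r a Rm delta k tau <= Rpower k (2 * delta - 1) * (logprod p r a (k ^ 2) * exp (- (k ^ 2 * tau / 2))) \/ tau <= 0.
Proof.
  intros Hk. destruct (Rle_dec tau 0) as [ht|ht]; [right; exact ht|left].
  assert (HT := tower_ge_1 Rm).
  assert (Pp : 0 <= Rpower k (2 * delta - 1) * (logprod p r a (k ^ 2) * exp (- (k ^ 2 * tau / 2)))).
  { apply Rmult_le_pos; [left; apply Rpower_pos|apply Rmult_le_pos; left; [apply logprod_pos|apply exp_pos]]. }
  destruct (Rle_dec (Rabs k) (K0 Rm + 1)) as [h|h]; [rewrite vfun_zero by exact h; exact Pp|].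
  assert (Hk4 : 4 < k ^ 2).
  { apply (Dv_facts Rm k 1). split; [lra|]. lra. }
  assert (E : Rpower (k ^ 2) (delta - 1 / 2) = Rpower k (2 * delta - 1)).
  { rewrite <- Rpower_pow, Rpower_mult by exact Hk. f_equal. simpl; field. }
  unfold vfun, amplF. rewrite E.
  assert (He : exp (- (lam k * tau)) <= exp (- (k ^ 2 * tau / 2))).
  { apply exp_le. generalize (lam_ge k Hk4); nra. }
  assert (Hp := Psi_bounds (K0 Rm + 1) k ltac:(unfold K0; lra)).
  assert (P1 := Rpower_pos k (2 * delta - 1)). assert (P2 := logprod_pos p r a (k ^ 2)). assert (P3 := exp_pos (- (lam k * tau))).
  apply Rle_trans with (1 * (Rpower k (2 * delta - 1) * logprod p r a (k ^ 2) * exp (- (lam k * tau)))).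
  - apply Rmult_le_compat_r; [|lra]. apply Rmult_le_pos; [apply Rmult_le_pos|]; lra.
  - rewrite Rmult_1_l, Rmult_assoc. apply Rmult_le_compat_l; [lra|]. apply Rmult_le_compat_l; lra.
Qed.

(** The integral is split at [b = tau^(-1/2)]. Below, monotonicity replaces the logarithms by their
    values at [1 / tau]. Above, slow variation costs a power of [y = k^2 tau], which together with
    the exponential is [O(1 / y)] and leaves the integrable power [k^(2 delta - 3)]. *)
Lemma vfun_upper (eta : R) : 0 < eta -> exists C, 0 < C /\ forall M tau, 0 < tau -> tower Rm <= 1 / tau -> adm eta M (fun k => vfun p r a Rm delta k tau) ->
  Rabs (IR (fun k => vfun p r a Rm delta k tau)) <= C * (logprod p r a (1 / tau) * Rpower tau (- delta)).
Proof.
  intros He. destruct (power_exp_decay (sumA p a) (sumA_pos p a Ha)) as (C & HC & Hdec).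
  exists (2 * (1 / (2 * delta) + C / (2 - 2 * delta))). split.
  { assert (0 < 1 / (2 * delta)) by (apply Rdiv_lt_0_compat; lra). assert (0 < C / (2 - 2 * delta)) by (apply Rdiv_lt_0_compat; lra). lra. }
  intros M tau Ht Hs Had. assert (HT := tower_ge_1 Rm).
  set (P := logprod p r a (1 / tau)). assert (PP : 0 < P) by apply logprod_pos.
  set (b := Rpower tau (- (1 / 2))).
  assert (Hb2 : b ^ 2 = 1 / tau).
  { unfold b. rewrite <- Rpower_pow, Rpower_mult by apply Rpower_pos. replace (- (1 / 2) * INR 2) with (-(1)) by (simpl; field). rewrite Rpower_Ropp, Rpower_1 by exact Ht. field; lra. }
  assert (Pb : 0 < b) by apply Rpower_pos.
  assert (Hb : 1 <= b) by nra.
  assert (Eb : forall x, Rpower b x = Rpower tau (- x / 2)).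
  { intros x; unfold b. rewrite Rpower_mult. f_equal; field. }
  eapply Rle_trans.
  - apply (IR_power_split eta _ P (C * P / tau) b (2 * delta) (2 - 2 * delta) _ He Had Hb); try lra.
    + apply Rdiv_le_0_compat; [apply Rmult_le_pos; lra|exact Ht].
    + intros k; apply vfun_even.
    + intros k Hk; apply vfun_zero; unfold K0; lra.
    + intros k Hk. rewrite Rabs_pos_eq by apply vfun_pos.
      destruct (Rle_dec (Rabs k) (K0 Rm + 1)) as [h|h].
      { rewrite vfun_zero by exact h. apply Rmult_le_pos; [lra|left; apply Rpower_pos]. }
      destruct (vfun_le k tau ltac:(lra)) as [Hv|]; [|lra].
      eapply Rle_trans; [exact Hv|]. rewrite (Rmult_comm P). apply Rmult_le_compat_l; [left; apply Rpower_pos|].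
      assert (Hm : logprod p r a (k ^ 2) <= P).
      { apply (logprod_mono p Rm); try assumption.
        - apply (Dv_facts Rm k tau). split; [exact Ht|lra].
        - rewrite <- Hb2. apply pow_incr; lra. }
      assert (Hx : exp (- (k ^ 2 * tau / 2)) <= 1) by (rewrite <- exp_0; apply exp_le; generalize (pow2_ge_0 k); nra).
      generalize (exp_pos (- (k ^ 2 * tau / 2))) (logprod_pos p r a (k ^ 2)); nra.
    + intros k Hk. rewrite Rabs_pos_eq by apply vfun_pos.
      destruct (vfun_le k tau ltac:(lra)) as [Hv|]; [|lra].
      eapply Rle_trans; [exact Hv|].
      set (y := k ^ 2 * tau). assert (Hy : 1 <= y).
      { unfold y. apply Rle_div_l; [exact Ht|]. change (1 / tau <= k ^ 2). rewrite <- Hb2. apply pow_incr; lra. }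
      assert (Hsl : logprod p r a (k ^ 2) <= Rpower y (sumA p a) * P).
      { replace (k ^ 2) with (1 / tau * y) by (unfold y; field; lra). apply (logprod_slow p Rm); assumption. }
      assert (Hd := Hdec y Hy).
      replace (- (2 - 2 * delta) - 1) with ((2 * delta - 1) + - 2) by ring. rewrite Rpower_plus.
      replace (C * P / tau * (Rpower k (2 * delta - 1) * Rpower k (-2))) with (Rpower k (2 * delta - 1) * (P * (C / y))).
      2:{ unfold y. replace (Rpower k (-2)) with (/ k ^ 2); [field; lra|]. rewrite <- Rpower_pow, <- Rpower_Ropp by lra. f_equal; simpl; ring. }
      apply Rmult_le_compat_l; [left; apply Rpower_pos|].
      apply Rle_trans with (Rpower y (sumA p a) * P * exp (- (y / 2))).
      * apply Rmult_le_compat_r; [left; apply exp_pos|exact Hsl].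
      * replace (Rpower y (sumA p a) * P * exp (- (y / 2))) with (P * (Rpower y (sumA p a) * exp (- (y / 2)))) by ring.
        apply Rmult_le_compat_l; [lra|exact Hd].
  - rewrite !Eb. replace (- (2 * delta) / 2) with (- delta) by field.
    replace (- - (2 - 2 * delta) / 2) with (1 + - delta) by field. rewrite Rpower_plus, Rpower_1 by exact Ht.
    right; field; lra.
Qed.

(** The window [[b, 2 b]] alone gives the right size: there [lam k * tau <= k^2 tau <= 4], whence
    [exp (- 4)], the logarithms are at least those at [1 / tau], and the factor 1/2 bounds the
    change of [k^(2 delta - 1)] for either sign of the exponent. *)
Lemma vfun_lower (eta M tau : R) : 0 < eta -> 0 < tau -> K0 Rm + 2 <= Rpower tau (- (1 / 2)) -> adm eta M (fun k => vfun p r a Rm delta k tau) ->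
  exp (- 4) / 2 * (logprod p r a (1 / tau) * Rpower tau (- delta)) <= IR (fun k => vfun p r a Rm delta k tau).
Proof.
  intros He Ht Hb Had. assert (HT := tower_ge_1 Rm). unfold K0 in Hb.
  set (P := logprod p r a (1 / tau)). assert (PP : 0 < P) by apply logprod_pos.
  set (b := Rpower tau (- (1 / 2))) in *.
  assert (Hb2 : b ^ 2 = 1 / tau).
  { unfold b. rewrite <- Rpower_pow, Rpower_mult by apply Rpower_pos. replace (- (1 / 2) * INR 2) with (-(1)) by (simpl; field). rewrite Rpower_Ropp, Rpower_1 by exact Ht. field; lra. }
  assert (Eb : forall x, Rpower b x = Rpower tau (- x / 2)).
  { intros x; unfold b. rewrite Rpower_mult. f_equal; field. }
  eapply Rle_trans; [|apply (IR_ge_RInt eta M b (2 * b) _ He Had); [intros; apply vfun_pos|lra]].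
  set (c := Rpower b (2 * delta - 1) / 2 * (P * exp (- 4))).
  apply Rle_trans with (RInt (fun _ => c) b (2 * b)).
  - rewrite RInt_const. unfold scal; simpl; unfold mult; simpl. unfold c.
    replace (Rpower tau (- delta)) with (b * Rpower b (2 * delta - 1)); [right; field|].
    rewrite Rpower_minus_1 by lra. rewrite Eb. f_equal; field.
  - apply RInt_le; [lra|apply ex_RInt_const|apply (adm_ex eta M _ _ _ Had)|].
    intros k Hk.
    assert (Hk4 : 4 < k ^ 2) by nra.
    assert (E : Rpower (k ^ 2) (delta - 1 / 2) = Rpower k (2 * delta - 1)).
    { rewrite <- Rpower_pow, Rpower_mult by lra. f_equal. simpl; field. }
    unfold vfun, amplF. rewrite E. rewrite Psi_1 by (unfold K0; try rewrite Rabs_pos_eq; lra). rewrite Rmult_1_l, Rmult_assoc.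
    unfold c. assert (0 < exp (- 4)) by apply exp_pos. assert (P1 := Rpower_pos b (2 * delta - 1)).
    apply Rmult_le_compat; [lra|apply Rmult_le_pos; lra| |].
    + destruct (Rle_dec (1 / 2) delta) as [h|h].
      * apply Rle_trans with (Rpower b (2 * delta - 1)); [lra|]. apply Rle_Rpower_l; lra.
      * apply Rle_trans with (Rpower (2 * b) (2 * delta - 1)).
        -- rewrite <- Rpower_mult_distr by lra. unfold Rdiv. rewrite (Rmult_comm (Rpower 2 _)). apply Rmult_le_compat_l; [lra|].
           replace (/ 2) with (Rpower 2 (-(1))) by (rewrite Rpower_Ropp, Rpower_1; lra). apply Rle_Rpower; lra.
        -- replace (2 * delta - 1) with (- (1 - 2 * delta)) by ring. rewrite !Rpower_Ropp. apply Rinv_le_contravar; [apply Rpower_pos|]. apply Rle_Rpower_l; lra.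
    + apply Rmult_le_compat; [lra|lra| |].
      * apply (logprod_mono p Rm); try assumption; rewrite <- Hb2; nra.
      * apply exp_le. assert (Hl := lam_le k). assert (k ^ 2 * tau <= 4); [|nra].
        apply Rle_trans with ((4 * b ^ 2) * tau); [apply Rmult_le_compat_r; nra|]. rewrite Hb2. right; field; lra.
Qed.

(** For [0 < k^2 < 1] the value of [lam] is 0 and not a root of [symb], so [lam^2 = symb] is stated
    after multiplication by the profile, which vanishes at such frequencies. *)
Lemma vfun_ode (k tau : R) : is_derive (vfun p r a Rm delta k) tau (- lam k * vfun p r a Rm delta k tau) /\
  (lam k * lam k) * vfun p r a Rm delta k tau = symb k * vfun p r a Rm delta k tau.
Proof.
  split.
  - unfold vfun. set (A := Psi (K0 Rm + 1) k). set (B := amplF p r a delta k). set (l := lam k). clearbody A B l. auto_derive; [exact I|]. ring.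
  - destruct (Rle_dec (Rabs k) (K0 Rm + 1)) as [h|h]; [rewrite vfun_zero by exact h; ring|].
    rewrite lam_sq; [reflexivity|]. apply (Dv_facts Rm k 1). split; lra.
Qed.
End LinearProfile.

(** Singularity in [tau] of the [j]-th [k]-derivative of the solution. *)
Definition expo (delta : R) (j : nat) : R :=
  match j with
  | O => (1 + delta ^ 2) / 2
  | 1%nat => if Rlt_dec delta (1 / 2) then 0 else delta ^ 2 / 2
  | _ => 0
  end.

Lemma expo_range (delta : R) (j : nat) : 0 < delta < 1 -> 0 <= expo delta j <= 1.
Proof.
  intros Hd. assert (0 < delta ^ 2 < 1) by nra. destruct j as [|[|j]]; simpl expo; try destruct (Rlt_dec delta (1 / 2)); lra.
Qed.

(** The integrability condition of the kernel operator when [1 + a] derivatives fall on the kernel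
    and [b] on the solution. For [a = b = 0] it reads [delta^2 - 1/2 < expo delta 1], and for
    [a = 1], [b = 0] it is [delta^2 < 1]. *)
Lemma expo_decay (delta : R) (a b : nat) : 0 < delta < 1 ->
  expo delta 0 + expo delta b - INR (1 + a) / 2 - expo delta (1 + a + b) < 1.
Proof.
  intros Hd. assert (Hq : 0 < delta ^ 2 < 1) by nra. assert (Ha := pos_INR a).
  rewrite plus_INR. change (INR 1) with 1.
  assert (Hr := expo_range delta (1 + a + b) Hd). destruct b as [|[|b]].
  - destruct a as [|a].
    + simpl expo. simpl INR. destruct (Rlt_dec delta (1 / 2)); nra.
    + rewrite S_INR in *. generalize (pos_INR a); intros. simpl expo in *. lra.
  - simpl expo in *. destruct (Rlt_dec delta (1 / 2)); lra.
  - simpl expo in *. lra.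
Qed.

(** The condition of [v_weight] on the linear profile. At [j = 0] it is exactly
    [2 eta <= (1 - delta)^2]; the second bound on [eta] permits the exponent 0 at [j = 1] when
    [delta < 1/2]. *)
Lemma expo_growth (delta eta : R) (j : nat) : 0 < delta < 1 -> 2 * eta <= (1 - delta) ^ 2 -> (delta < 1 / 2 -> 2 * eta <= 1 - 2 * delta) ->
  2 * delta + 2 * eta - INR j <= 2 * expo delta j.
Proof.
  intros Hd He Hs. destruct j as [|[|j]].
  - simpl; lra.
  - simpl. destruct (Rlt_dec delta (1 / 2)); [specialize (Hs r); lra|nra].
  - rewrite !S_INR. generalize (pos_INR j); intros. simpl expo. nra.
Qed.

Lemma in_wt_scal (eta e B c : R) (U : R -> R -> R) : in_wt eta e B U -> in_wt eta e (Rabs c * B) (fun k tau => c * U k tau).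
Proof.
  intros [H1 H2]; split; intros k tau Ht.
  - apply (continuous_mult (K := R_AbsRing)); [apply continuous_const|apply H1, Ht].
  - rewrite Rabs_mult, Rmult_assoc. apply Rmult_le_compat_l; [apply Rabs_pos|apply H2, Ht].
Qed.

(** The sign [s] multiplies the linear profile and not the solution, because the quadratic equation
    is not invariant under [u -> -u]. The correction has no definite sign, but its singularity is
    weaker than that of the profile. *)
Lemma blowup_profile (p Rm : nat) (r : nat -> nat) (a : nat -> R) (delta T1 s : R) :
  (forall j, (j < p)%nat -> (1 <= r j <= Rm)%nat) -> nonneg_vec p a -> 0 < delta < 1 -> 1 <= T1 -> s = 1 \/ s = -1 ->
  exists (eta : R) (U : R -> R -> R), 0 < eta /\
    (forall m, ksmooth Dp m (fun j => wt eta (expo delta j)) U) /\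
    (forall k tau, 0 < tau -> U (- k) tau = U k tau) /\
    (forall k, exists U1 : R -> R, forall tau, 0 < tau < T1 ->
       is_derive (U k) tau (U1 tau) /\ is_derive U1 tau (symb k * U k tau - k ^ 2 * conv U U k tau)) /\
    exists tau0 c1 c2, 0 < tau0 /\ 0 < c1 /\ 0 < c2 /\ forall tau, 0 < tau <= tau0 ->
      c1 * (logprod p r a (1 / tau) * Rpower tau (- delta)) <= s * IR (fun k => U k tau) <= c2 * (logprod p r a (1 / tau) * Rpower tau (- delta)).
Proof.
  intros Hr Ha Hd HT Hs. assert (Hq : 0 < delta ^ 2 < delta) by nra.
  assert (Hsa : Rabs s = 1) by (destruct Hs; subst s; [apply Rabs_R1|rewrite Rabs_left; lra]).
  assert (Hss : s * s = 1) by (destruct Hs; subst s; ring).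
  assert (Heta : exists eta, 0 < eta /\ 2 * eta <= (1 - delta) ^ 2 /\ (delta < 1 / 2 -> 2 * eta <= 1 - 2 * delta)).
  { destruct (Rlt_dec delta (1 / 2)) as [h|h].
    - exists (Rmin ((1 - delta) ^ 2 / 2) ((1 - 2 * delta) / 2)). split; [apply Rmin_glb_lt; nra|].
      generalize (Rmin_l ((1 - delta) ^ 2 / 2) ((1 - 2 * delta) / 2)) (Rmin_r ((1 - delta) ^ 2 / 2) ((1 - 2 * delta) / 2)); lra.
    - exists ((1 - delta) ^ 2 / 2). split; [nra|]. split; [lra|]. intros; lra. }
  destruct Heta as (eta & He & He1 & He2). exists eta.
  set (v0 := vfun p r a Rm delta).
  assert (Hv0 : forall m, ksmooth Dp m (fun j => wt eta (expo delta j)) v0).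
  { intros m; apply v_ksmooth; try assumption; intros j; [apply expo_range, Hd|apply expo_growth; assumption]. }
  destruct (ksmooth_in_wt eta (expo delta 0) _ _ _ (fun k tau => eq_refl) (Hv0 O)) as [Cv HCv]. assert (PCv := in_wt_B _ _ _ _ HCv).
  set (d := expo delta 0) in *. assert (Hd1 : 0 < d < 1) by (unfold d; simpl; nra).
  destruct (ksmooth_bd _ _ _ _ (green_symbol T1 0 HT)) as (CK & HCK & HKb).
  assert (HK : kern T1 0 CK (green T1)) by (split; [apply (ksmooth_cont _ _ _ _ (green_symbol T1 0 HT))|exact HKb]).
  set (Q := CK * Crho eta * CT T1 d).
  assert (HQ : 0 <= Q).
  { unfold Q. apply Rmult_le_pos; [apply Rmult_le_pos; [assumption|left; apply Crho_pos, He]|left; apply CT_pos; lra]. }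
  (* The profile then has norm [ep * Cv] with [8 Q (ep Cv) <= 1], which is the smallness for the
     nonlinear fixed point and, for a solution of norm [2 ep Cv], the constant 1/4 of the linear
     equations. *)
  set (ep := / (8 * Q * Cv + 1)). assert (PQ : 0 <= Q * Cv) by (apply Rmult_le_pos; assumption).
  assert (Hep : 0 < ep) by (apply Rinv_0_lt_compat; lra).
  assert (Hsm : 8 * Q * (ep * Cv) <= 1).
  { replace (8 * Q * (ep * Cv)) with (ep * (8 * Q * Cv)) by ring. unfold ep. apply Rmult_le_reg_l with (8 * Q * Cv + 1); [lra|].
    rewrite <- Rmult_assoc, Rinv_r by lra. lra. }
  set (v := fun k tau => (s * ep) * v0 k tau).
  assert (Hv : in_wt eta d (ep * Cv) v).
  { replace (ep * Cv) with (Rabs (s * ep) * Cv) by (rewrite Rabs_mult, Hsa, (Rabs_pos_eq ep) by lra; ring). apply in_wt_scal, HCv. }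
  assert (Hvev : forall k tau, 0 < tau -> v (- k) tau = v k tau) by (intros; unfold v, v0; rewrite vfun_even; reflexivity).
  destruct (nonlinear_solution T1 eta d CK (ep * Cv) v HT He Hd1 HCK ltac:(apply Rmult_le_pos; lra) HK Hv Hvev Hsm) as (U & HU & Uev & Ufix).
  exists U. split; [exact He|]. split; [|split; [exact Uev|split]].
  - intros m. apply (linear_smooth T1 eta d CK (2 * (ep * Cv)) U HT He Hd1 HCK HK HU) with (B := 2 * (ep * Cv)) (G := v); try assumption.
    + fold Q. lra.
    + intros n; apply green_symbol, HT.
    + intros j; generalize (expo_range delta j Hd); lra.
    + intros; apply expo_decay, Hd.
    + apply ksmooth_scal, Hv0.
  - intros k. 
    assert (Hcc : forall t, 0 < t -> continuous (conv U U k) t).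
    { intros t Ht. apply (continuous_slice (conv U U)). apply (conv_jcont eta d d _ _ U U k t He Ht HU HU). }
    destruct (kernel_op_ode T1 k (conv U U) HT Hcc) as (W1 & HW).
    exists (fun t => - lam k * v k t + W1 t). intros tau Ht. destruct (HW tau Ht) as [D1 D2].
    destruct (vfun_ode p Rm r a delta k tau) as [D3 E3]. fold v0 in D3, E3.
    assert (Dv : is_derive (v k) tau (- lam k * v k tau)).
    { unfold v. evar_last; [apply is_derive_scal, D3|]. ring. }
    split.
    + apply is_derive_ext_loc with (f := fun t => v k t + kernel_op T1 (green T1) (conv U U) k t).
      * generalize (locally_pos tau (proj1 Ht)); apply filter_imp; intros t Ht'. symmetry; apply Ufix, Ht'.
      * apply (is_derive_plus (V := R_NormedModule)); assumption.
    + evar_last; [apply (is_derive_plus (V := R_NormedModule)); [apply is_derive_scal, Dv|exact D2]|].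
      unfold plus; simpl. rewrite (Ufix k tau (proj1 Ht)). unfold v.
      replace (symb k * (s * ep * v0 k tau + kernel_op T1 (green T1) (conv U U) k tau)) with (s * ep * (symb k * v0 k tau) + symb k * kernel_op T1 (green T1) (conv U U) k tau) by ring.
      rewrite <- E3. ring.
  (* The exponent [q'] is the midpoint of [delta^2] and [delta]: above [2 d - 1 = delta^2], so that
     the kernel bound applies, and below [delta], so that the correction is of lower order. *)
  - set (w := kernel_op T1 (green T1) (conv U U)). set (q' := (delta ^ 2 + delta) / 2).
    set (Aw := CK * (Crho eta * (2 * (ep * Cv)) * (2 * (ep * Cv))) * CT T1 (d + d - INR 0 / 2 - q')).
    assert (Hw : in_wt eta q' Aw w).
    { apply kernel_op_in_wt; try assumption; [apply conv_in_wt; assumption|unfold q'; lra|unfold d, q'; simpl; lra]. }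
    assert (PAw := in_wt_B _ _ _ _ Hw).
    destruct (vfun_upper p Rm r a delta Hr Ha Hd eta He) as (C2 & HC2 & Hup).
    set (C1 := exp (- 4) / 2). assert (HC1 : 0 < C1) by (unfold C1; generalize (exp_pos (- 4)); lra).
    (* Once [tau^(delta - q') <= m], the correction is at most half of the lower bound [ep * C1]
       times the profile. *)
    set (m := (ep * C1 / 2) / (Aw * (2 / eta) + 1)).
    assert (P2e : 0 < 2 / eta) by (apply Rdiv_lt_0_compat; lra).
    assert (PAe : 0 <= Aw * (2 / eta)) by (apply Rmult_le_pos; lra).
    assert (Pm : 0 < m) by (unfold m; apply Rdiv_lt_0_compat; [|lra]; generalize (Rmult_lt_0_compat _ _ Hep HC1); lra).
    assert (PT := tower_ge_1 Rm).
    (* The first bound puts [tau^(-1/2)] beyond the transition of the frequency cutoff, the second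
       yields [tau^(delta - q') <= m]. *)
    set (tau0 := Rmin (Rpower (K0 Rm + 2) (-2)) (Rpower m (/ (delta - q')))).
    assert (Hdq : 0 < delta - q') by (unfold q'; lra).
    exists tau0, (ep * C1 / 2), (ep * C2 + ep * C1 / 2).
    split; [apply Rmin_glb_lt; apply Rpower_pos|]. split; [generalize (Rmult_lt_0_compat _ _ Hep HC1); lra|].
    split; [generalize (Rmult_lt_0_compat _ _ Hep HC1) (Rmult_lt_0_compat _ _ Hep HC2); lra|].
    intros tau [Ht Ht0].
    assert (Ht1 : tau <= Rpower (K0 Rm + 2) (-2)) by (eapply Rle_trans; [exact Ht0|apply Rmin_l]).
    assert (Ht2 : tau <= Rpower m (/ (delta - q'))) by (eapply Rle_trans; [exact Ht0|apply Rmin_r]).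
    assert (Hb : K0 Rm + 2 <= Rpower tau (- (1 / 2))).
    { rewrite Rpower_Ropp. replace (K0 Rm + 2) with (/ Rpower (Rpower (K0 Rm + 2) (-2)) (1 / 2)).
      - apply Rinv_le_contravar; [apply Rpower_pos|]. apply Rle_Rpower_l; lra.
      - rewrite Rpower_mult. replace (-2 * (1 / 2)) with (-(1)) by field. rewrite Rpower_Ropp, Rpower_1 by (unfold K0; lra). apply Rinv_inv. }
    assert (Hpt : Rpower tau (delta - q') <= m).
    { eapply Rle_trans; [apply Rle_Rpower_l; [left; exact Hdq|split; [exact Ht|exact Ht2]]|]. rewrite Rpower_mult, Rinv_l, Rpower_1 by lra. lra. }
    assert (Htw : tower Rm <= 1 / tau).
    { replace (1 / tau) with (Rpower tau (- (1 / 2)) ^ 2); [unfold K0 in Hb; nra|].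
      rewrite <- Rpower_pow, Rpower_mult by apply Rpower_pos. replace (- (1 / 2) * INR 2) with (-(1)) by (simpl; field).
      rewrite Rpower_Ropp, Rpower_1 by exact Ht. field; lra. }
    assert (A0 := in_wt_adm _ _ _ tau _ HCv Ht). assert (Aww := in_wt_adm _ _ _ tau _ Hw Ht).
    assert (L1 := Hup _ tau Ht Htw A0). assert (L2 := vfun_lower p Rm r a delta Hr Ha Hd eta _ tau He Ht Hb A0).
    fold v0 in L1, L2. fold C1 in L2.
    assert (L3 := IR_bound _ _ _ He Aww).
    assert (EU : IR (fun k => U k tau) = s * ep * IR (fun k => v0 k tau) + IR (fun k => w k tau)).
    { rewrite <- (IR_scal _ _ _ _ He A0), <- (IR_plus _ _ _ _ _ He (adm_scal _ _ (s * ep) _ A0) Aww). apply IR_ext; intros k. apply Ufix, Ht. }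
    set (g := logprod p r a (1 / tau) * Rpower tau (- delta)) in *.
    assert (L4 : Rabs (IR (fun k => w k tau)) <= ep * C1 / 2 * g).
    { eapply Rle_trans; [exact L3|].
      replace (- q') with ((delta - q') + - delta) by ring. rewrite Rpower_plus.
      assert (P1 := logprod_ge_1 p Rm r a (1 / tau) (fun j Hj => proj2 (Hr j Hj)) Ha Htw).
      assert (P2 := Rpower_pos tau (- delta)). assert (P3 := Rpower_pos tau (delta - q')).
      apply Rle_trans with ((Aw * (2 / eta)) * m * Rpower tau (- delta)).
      - replace (Aw * (Rpower tau (delta - q') * Rpower tau (- delta)) * (2 / eta)) with (Aw * (2 / eta) * Rpower tau (delta - q') * Rpower tau (- delta)) by ring.
        apply Rmult_le_compat_r; [lra|]. apply Rmult_le_compat_l; lra.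
      - assert (Hm : Aw * (2 / eta) * m <= ep * C1 / 2).
        { replace (ep * C1 / 2) with ((Aw * (2 / eta) + 1) * m) by (unfold m; field; lra). lra. }
        apply Rle_trans with (ep * C1 / 2 * Rpower tau (- delta)); [apply Rmult_le_compat_r; lra|].
        apply Rmult_le_compat_l; [generalize (Rmult_lt_0_compat _ _ Hep HC1); lra|]. unfold g. nra. }
    rewrite EU. replace (s * (s * ep * IR (fun k => v0 k tau) + IR (fun k => w k tau))) with
      (s * s * (ep * IR (fun k => v0 k tau)) + s * IR (fun k => w k tau)) by ring.
    rewrite Hss, Rmult_1_l.
    assert (L5 : Rabs (s * IR (fun k => w k tau)) <= ep * C1 / 2 * g) by (rewrite Rabs_mult, Hsa, Rmult_1_l; exact L4).
    apply Rabs_le_between in L5. apply Rabs_le_between in L1.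
    assert (L6 : ep * (C1 * g) <= ep * IR (fun k => v0 k tau)) by (apply Rmult_le_compat_l; lra).
    assert (L7 : ep * IR (fun k => v0 k tau) <= ep * (C2 * g)) by (apply Rmult_le_compat_l; lra).
    lra.
Qed.

(** * Back to physical space *)

Lemma is_derive_quotient (f : R -> R) (t l : R) (Q : R -> Prop) : is_derive f t l ->
  filterlim (fun s => (f s - f t) / (s - t)) (within (fun s => Q s /\ s <> t) (locally t)) (locally l).
Proof.
  intros Hd; apply is_derive_Reals in Hd. apply filterlim_locally; intros eps.
  destruct (Hd eps (cond_pos eps)) as (dl & H). exists dl; intros s Hs [_ Hne].
  specialize (H (s - t) (Rminus_eq_contra _ _ Hne) Hs). rewrite Rplus_minus in H. exact H.
Qed.

Lemma sum_f_R0_bounded (N : nat) (f : nat -> R -> R -> R) (Q : R -> Prop) :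
  (forall i, exists M, forall x t, Q t -> f i x t <= M) ->
  exists M, forall x t, Q t -> sum_f_R0 (fun i => f i x t) N <= M.
Proof.
  intros H. induction N as [|N [M IH]].
  - destruct (H O) as [M HM]; exists M; exact HM.
  - destruct (H (S N)) as [M' HM]. exists (M + M'); intros x t Ht. simpl. specialize (IH x t Ht); specialize (HM x t Ht); lra.
Qed.

Section Solution.
Variables (T x0 : R) (U : R -> R -> R).
Hypothesis HT : 0 < T.
Hypothesis HU : rapid_even (T + 1) U.
Hypothesis Hode : forall k, exists U1 : R -> R, forall tau, 0 < tau < T + 1 ->
  is_derive (U k) tau (U1 tau) /\ is_derive U1 tau (symb k * U k tau - k ^ 2 * conv U U k tau).

Definition tder (F : R -> R -> R) : R -> R -> R := fun k tau => Derive (F k) tau.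
Definition uder (i j : nat) (x t : R) : R := (-1) ^ j * phys i (Nat.iter j tder U) (x - x0) (T - t).

Lemma iter_tsmooth (j : nat) : forall m, tsmooth (T + 1) m (Nat.iter j tder U).
Proof using HU Hode.
  induction j; intros m; [apply (solution_tsmooth (T + 1) U HU Hode)|]. simpl. apply (tsmooth_Derive (T + 1) m), IHj.
Qed.

(** The frequency solution extends to [tau < T + 1], so the initial time [t = 0], that is [tau = T],
    is an interior point: the one-sided derivatives there are restrictions of ordinary ones. *)
Lemma uder_family : smooth_family T (fun x t => phys 0 U (x - x0) (T - t)) uder.
Proof using HT HU Hode.
  split.
  - apply functional_extensionality; intros x; apply functional_extensionality; intros t. unfold uder; simpl; ring.
  - intros i j x t Ht. assert (Ht' : 0 < T - t < T + 1) by lra. assert (HG := tsmooth_rapid_even _ _ _ (iter_tsmooth j 0)).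
    split; [|split].
    + unfold uder. apply is_derive_scal. evar_last.
      * apply (is_derive_comp (fun y => phys i (Nat.iter j tder U) y (T - t)) (fun y => y - x0) x _ 1 (phys_dx (T + 1) i _ _ _ HG Ht')).
        auto_derive; [exact I|ring].
      * apply (scal_one (V := R_ModuleSpace)).
    + apply (is_derive_quotient (fun s => uder i j x s) t). unfold uder.
      destruct (tsmooth_Derive (T + 1) 0 _ (iter_tsmooth j 1)) as [HG1 HD]. evar_last.
      * apply is_derive_scal. apply (is_derive_comp (fun y => phys i (Nat.iter j tder U) (x - x0) y) (fun s => T - s) t (phys i (tder (Nat.iter j tder U)) (x - x0) (T - t)) (-1)).
        -- apply (phys_dtau (T + 1) i _ _ _ _ HG (tsmooth_rapid_even _ _ _ HG1) Ht' HD).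
        -- auto_derive; [exact I|ring].
      * change (scal ?a ?b) with (a * b). simpl. ring.
    + apply (filterlim_filter_le_1 _ (filter_le_within (F := locally (x, t)) (in_dom T))).
      change (continuous (fun q : R * R => uder i j (fst q) (snd q)) (x, t)). unfold uder.
      apply (continuous_mult (K := R_AbsRing)); [apply continuous_const|].
      apply (continuous_comp (fun q : R * R => (fst q - x0, T - snd q)) (fun q : R * R => phys i (Nat.iter j tder U) (fst q) (snd q))).
      * apply continuous_pair; apply (continuous_minus (V := R_NormedModule));
          first [apply continuous_const|apply continuous_fst'|apply continuous_snd'].
      * apply (phys_cont (T + 1) i _ _ _ HG Ht').
Qed.

Lemma cos_shift_2 (y : R) : cos (y + INR 2 * (PI / 2)) = - cos y.
Proof. replace (y + INR 2 * (PI / 2)) with (y + PI) by (simpl; field). apply neg_cos. Qed.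

Lemma cos_shift_4 (y : R) : cos (y + INR 4 * (PI / 2)) = cos y.
Proof. replace (y + INR 4 * (PI / 2)) with (y + 2 * PI) by (simpl; field). rewrite cos_plus, cos_2PI, sin_2PI. ring. Qed.

(** Two space derivatives reverse the sign of the cosine and four restore it, so the equation holds
    already between the integrands; the square enters through [phys_square]. *)
Lemma uder_pde (x t : R) : 0 <= t < T ->
  uder 0 2 x t = uder 2 0 x t + Derive_n (fun y => (phys 0 U (y - x0) (T - t)) ^ 2) 2 x + uder 4 0 x t.
Proof using HT HU Hode.
  intros Ht. assert (Ht' : 0 < T - t < T + 1) by lra. set (tau := T - t) in *.
  destruct (solution_tsmooth (T + 1) U HU Hode) as [HTT H2].
  assert (HC : rapid_even (T + 1) (conv U U)) by apply (tsmooth_rapid_even _ _ _ (tsmooth_conv (T + 1) 0 U U (HTT O) (HTT O))).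
  assert (E2 : Derive_n (fun y => (phys 0 U (y - x0) tau) ^ 2) 2 x = phys 2 (conv U U) (x - x0) tau).
  { assert (Hsh : forall i y, is_derive (fun y => phys i (conv U U) (y - x0) tau) y (phys (S i) (conv U U) (y - x0) tau)).
    { intros i y. evar_last.
      - apply (is_derive_comp (fun y => phys i (conv U U) y tau) (fun y => y - x0) y _ 1 (phys_dx (T + 1) i _ _ _ HC Ht')).
        auto_derive; [exact I|ring].
      - apply (scal_one (V := R_ModuleSpace)). }
    rewrite (Derive_n_ext _ (fun y => phys 0 (conv U U) (y - x0) tau)) by (intros y; apply (phys_square (T + 1) U _ _ HU Ht')).
    change (Derive (fun y => Derive (fun y => phys 0 (conv U U) (y - x0) tau) y) x = phys 2 (conv U U) (x - x0) tau).
    rewrite (Derive_ext _ (fun y => phys 1 (conv U U) (y - x0) tau)) by (intros y; apply is_derive_unique, Hsh).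
    apply is_derive_unique, Hsh. }
  rewrite E2. unfold uder. fold tau. simpl Nat.iter. set (X := x - x0).
  destruct (phys_adm (T + 1) tau 2 U HU ltac:(lra)) as (M2 & _ & A2).
  destruct (phys_adm (T + 1) tau 4 U HU ltac:(lra)) as (M4 & _ & A4).
  destruct (phys_adm (T + 1) tau 2 (conv U U) HC ltac:(lra)) as (Mc & _ & Ac).
  specialize (A2 tau X (INR 2 * (PI / 2)) ltac:(lra)). specialize (A4 tau X (INR 4 * (PI / 2)) ltac:(lra)). specialize (Ac tau X (INR 2 * (PI / 2)) ltac:(lra)).
  replace ((-1) ^ 0) with 1 by (simpl; ring). replace ((-1) ^ 2) with 1 by (simpl; ring). rewrite !Rmult_1_l.
  unfold phys at 2 3 4.
  rewrite <- (IR_plus 1 _ _ _ _ Rlt_0_1 A2 Ac), <- (IR_plus 1 _ _ _ _ Rlt_0_1 (adm_plus _ _ _ _ _ A2 Ac) A4).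
  rewrite phys_0. apply IR_ext; intros k. unfold tder. rewrite (H2 k tau Ht'). rewrite cos_shift_2, cos_shift_4. unfold symb. ring.
Qed.

End Solution.

Lemma one_plus_pow_le (y : R) (N : nat) : 0 <= y -> (1 + y) ^ N <= 2 ^ N * (1 + y ^ N).
Proof.
  intros Hy. assert (P2 : 0 < 2 ^ N) by (apply pow_lt; lra). assert (Py : 0 <= y ^ N) by (apply pow_le, Hy).
  destruct (Rle_dec y 1) as [h|h].
  - apply Rle_trans with (2 ^ N); [apply pow_incr; lra|]. nra.
  - apply Rle_trans with ((2 * y) ^ N); [apply pow_incr; lra|]. rewrite Rpow_mult_distr. nra.
Qed.

Lemma phys_schwartz (eta a x0 : R) (E : nat -> R) (N i : nat) (U : R -> R -> R) : 0 < eta -> 0 < a -> (forall j, 0 <= E j <= 1) ->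
  (forall m, ksmooth Dp m (fun j => wt eta (E j)) U) ->
  exists M, forall x tau, a <= tau -> (1 + Rabs x) ^ N * Rabs (phys i U (x - x0) tau) <= M.
Proof.
  intros He Ha HE HU.
  (* One weight for all orders: since the exponents lie in [[0, 1]], each power [tau^(- E j)] is at
     most [1 + 1 / tau]. *)
  set (W := fun (_ : nat) k tau => (1 + Rabs k) ^ i * wt eta 0 k tau + (1 + Rabs k) ^ i * wt eta 1 k tau).
  assert (HW : rapid W).
  { intros j b n Hb. destruct (wt_seq_rapid eta (fun _ => 0) i He ltac:(intros; lra) O b n Hb) as (M1 & P1 & H1).
    destruct (wt_seq_rapid eta (fun _ => 1) i He ltac:(intros; lra) O b n Hb) as (M2 & P2 & H2).
    exists (M1 + M2); split; [lra|]. intros k tau Ht. unfold W. specialize (H1 k tau Ht); specialize (H2 k tau Ht). lra. }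
  assert (HG : forall m, ksmooth Dp m W (fun k tau => k ^ i * U k tau)).
  { intros m. apply (ksmooth_mult Dp m (fun _ k _ => (1 + Rabs k) ^ i) (fun j => wt eta (E j)) W (fun k _ => k ^ i) U (ksmooth_pow m i) (HU m)).
    intros b c. exists 1; split; [lra|]. intros k tau Ht. unfold W. rewrite Rmult_1_l, <- Rmult_plus_distr_l.
    apply Rmult_le_compat_l; [apply pow_le; generalize (Rabs_pos k); lra|]. unfold wt. rewrite <- Rmult_plus_distr_r.
    apply Rmult_le_compat_r; [apply Rmult_le_pos; left; [apply rho_pos|apply exp_pos]|]. unfold Dp in Ht. specialize (HE c).
    assert (P0 := Rpower_pos tau (- 0)). assert (P1 := Rpower_pos tau (-(1))).
    destruct (Rle_dec tau 1) as [h|h].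
    - apply Rle_trans with (Rpower tau (-(1))); [|lra]. rewrite !Rpower_Ropp. apply Rinv_le_contravar; [apply Rpower_pos|].
      unfold Rpower. apply exp_le. assert (ln tau <= 0) by (rewrite <- ln_1; apply ln_le; lra). nra.
    - apply Rle_trans with (Rpower tau (- 0)); [|lra]. apply Rle_Rpower; lra. }
  destruct (ksmooth_decay 0 W _ a HW (HG O) Ha) as (M0 & P0 & H0).
  destruct (ksmooth_decay N W _ a HW (HG N) Ha) as (M1 & P1 & H1).
  exists ((1 + Rabs x0) ^ N * (2 ^ N * (M0 + M1))). intros x tau Ht. set (X := x - x0).
  specialize (H0 X (INR i * (PI / 2)) tau Ht). specialize (H1 X (INR i * (PI / 2)) tau Ht).
  change (IR (fun k => k ^ i * U k tau * cos (k * X + INR i * (PI / 2)))) with (phys i U X tau) in H0, H1.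
  set (I := Rabs (phys i U X tau)) in *. assert (PI' : 0 <= I) by apply Rabs_pos. simpl in H0.
  assert (PX := Rabs_pos X). assert (Px0 := Rabs_pos x0).
  assert (h : (1 + Rabs x) ^ N <= (1 + Rabs x0) ^ N * (2 ^ N * (1 + Rabs X ^ N))).
  { apply Rle_trans with (((1 + Rabs x0) * (1 + Rabs X)) ^ N).
    - apply pow_incr. split; [generalize (Rabs_pos x); lra|]. assert (Rabs x <= Rabs X + Rabs x0); [|nra].
      replace x with (X + x0) at 1 by (unfold X; ring). apply Rabs_triang.
    - rewrite Rpow_mult_distr. apply Rmult_le_compat_l; [apply pow_le; lra|apply one_plus_pow_le, PX]. }
  eapply Rle_trans; [apply Rmult_le_compat_r; [exact PI'|exact h]|].
  rewrite !Rmult_assoc. apply Rmult_le_compat_l; [apply pow_le; lra|]. apply Rmult_le_compat_l; [apply pow_le; lra|]. lra.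
Qed.

Lemma rapid_wt (eta : R) (E : nat -> R) : 0 < eta -> (forall j, 0 <= E j) -> rapid (fun j => wt eta (E j)).
Proof. intros He HE j a n Ha. apply (wt_rapid eta (E j) a n He (HE j) Ha). Qed.

Lemma IR_cos_bound (eta : R) (n : nat) (W : nat -> R -> R -> R) (F : R -> R -> R) : 0 < eta -> (forall k tau, W O k tau = wt eta 0 k tau) ->
  ksmooth Dp n W F -> exists M, 0 <= M /\ forall x phi tau, 0 < tau -> Rabs (IR (fun k => F k tau * cos (k * x + phi))) <= M.
Proof.
  intros He HW HF. destruct (ksmooth_bd _ _ _ _ HF) as (C & HC & Hb). exists (C * (2 / eta)).
  split; [apply Rmult_le_pos; [exact HC|left; apply Rdiv_lt_0_compat; lra]|]. intros x phi tau Ht.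
  apply (IR_bound eta C _ He). split.
  - intros k. apply (continuous_mult (K := R_AbsRing)); [apply (continuous_slice_l F), (ksmooth_cont _ _ _ _ HF), Ht|].
    apply (ex_derive_continuous (V := R_NormedModule)); auto_derive; exact I.
  - intros k. rewrite Rabs_mult. assert (hc : Rabs (cos (k * x + phi)) <= 1) by (apply Rabs_le; generalize (COS_bound (k * x + phi)); lra).
    apply Rle_trans with (Rabs (F k tau)); [generalize (Rabs_pos (F k tau)); nra|].
    eapply Rle_trans; [apply Hb, Ht|]. rewrite HW. apply Rmult_le_compat_l; [exact HC|].
    eapply Rle_trans; [apply wt_le_rho|]. rewrite Ropp_0, Rpower_O by exact Ht. lra.
Qed.

Lemma phys_shift_0 (F : R -> R -> R) (x tau : R) : phys 0 F x tau = IR (fun k => F k tau * cos (k * x + 0)).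
Proof. rewrite phys_0; apply IR_ext; intros k; rewrite Rplus_0_r; reflexivity. Qed.

(** The exponent 0 at [j = 1] bounds the first [k]-derivative by a multiple of [rho], uniformly in
    [tau], so one integration by parts bounds [x u] up to the singular time; with the exponent 0 at
    [j = 2] two of them bound [x^2 u]. *)
Lemma phys_decay_1 (eta : R) (E : nat -> R) (U : R -> R -> R) : 0 < eta -> (forall j, 0 <= E j) -> E 1%nat = 0 ->
  ksmooth Dp 1 (fun j => wt eta (E j)) U ->
  exists M, 0 <= M /\ forall x tau, 0 < tau -> Rabs x * Rabs (phys 0 U x tau) <= M.
Proof.
  intros He HE E1 HU. assert (HU' := HU). destruct HU' as (_ & _ & U1 & D1 & H1).
  destruct (IR_cos_bound eta 0 (fun j => wt eta (E (S j))) U1 He ltac:(intros; cbv beta; rewrite E1; reflexivity) H1) as (M & PM & HM).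
  exists M; split; [exact PM|]. intros x tau Ht. rewrite <- Rabs_mult, phys_shift_0.
  rewrite (ksmooth_ibp _ 0 U tau (rapid_wt eta E He HE) HU Ht U1 D1 H1 x 0 tau (Rle_refl _)), Rabs_Ropp. apply HM, Ht.
Qed.

Lemma phys_decay_2 (eta : R) (E : nat -> R) (U : R -> R -> R) : 0 < eta -> (forall j, 0 <= E j) -> E 2%nat = 0 ->
  ksmooth Dp 2 (fun j => wt eta (E j)) U ->
  exists M, 0 <= M /\ forall x tau, 0 < tau -> x ^ 2 * Rabs (phys 0 U x tau) <= M.
Proof.
  intros He HE E2 HU. assert (HU' := HU). destruct HU' as (_ & _ & U1 & D1 & H1).
  assert (H1' := H1). destruct H1' as (_ & _ & U2 & D2 & H2).
  destruct (IR_cos_bound eta 0 (fun j => wt eta (E (S (S j)))) U2 He ltac:(intros; cbv beta; rewrite E2; reflexivity) H2) as (M & PM & HM).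
  exists M; split; [exact PM|]. intros x tau Ht.
  rewrite <- (Rabs_pos_eq (x ^ 2)) by apply pow2_ge_0. rewrite <- Rabs_mult, phys_shift_0.
  replace (x ^ 2 * IR (fun k => U k tau * cos (k * x + 0))) with (x * (x * IR (fun k => U k tau * cos (k * x + 0)))) by ring.
  rewrite (ksmooth_ibp _ 1 U tau (rapid_wt eta E He HE) HU Ht U1 D1 H1 x 0 tau (Rle_refl _)).
  rewrite Ropp_mult_distr_r_reverse, Rabs_Ropp.
  rewrite (ksmooth_ibp _ 0 U1 tau (rapid_wt eta (fun j => E (S j)) He (fun j => HE (S j))) H1 Ht U2 D2 H2 x _ tau (Rle_refl _)), Rabs_Ropp. apply HM, Ht.
Qed.

Lemma max_index (p : nat) (r : nat -> nat) : exists Rm, forall j, (j < p)%nat -> (r j <= Rm)%nat.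
Proof.
  induction p as [|p [Rm H]]; [exists O; intros; lia|]. exists (Nat.max Rm (r p)); intros j Hj.
  destruct (Nat.eq_dec j p) as [->|Hne]; [lia|]. assert (j < p)%nat by lia. specialize (H j H0). lia.
Qed.

Theorem theorem2p1 (p : nat) (r : nat -> nat) (a : nat -> R) (sigma : nat)
  (T x0 delta : R) :
  ord_vec p r -> nonneg_vec p a -> (sigma <= 1)%nat ->
  0 < T -> 0 < delta < 1 ->
  exists u : R -> R -> R,
    schwartz_boussinesq T u /\
    asymp_at T (fun t => u x0 t)
      (fun t => LOG p r a sigma (1 / (T - t)) / Rpower (T - t) delta) /\
    (exists C, 0 < C /\ forall x t, x <> x0 -> 0 <= t < T ->
        Rabs (u x t) <= C * (1 + x ^ 2) / (x - x0) ^ 2) /\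
    (delta < 1 / 2 ->
      exists C, 0 < C /\ forall x t, x <> x0 -> 0 <= t < T ->
        Rabs (u x t) <= C * (1 + Rabs x) / Rabs (x - x0)).
Proof.
  intros Hord Ha Hsig HT Hd. destruct (max_index p r) as [Rm HRm].
  assert (Hs : (-1) ^ sigma = 1 \/ (-1) ^ sigma = -1) by (destruct sigma as [|[|n]]; [left; simpl; ring|right; simpl; ring|lia]).
  destruct (blowup_profile p Rm r a delta (T + 1) ((-1) ^ sigma)) as (eta & U & He & HG & Uev & Hode & tau0 & c1 & c2 & Ht0 & Hc1 & Hc2 & Has);
    [intros j Hj; split; [apply Hord, Hj|apply HRm, Hj]|exact Ha|exact Hd|lra|exact Hs|].
  assert (HE := fun j => expo_range delta j Hd). assert (HE0 := fun j => proj1 (HE j)).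
  destruct (ksmooth_in_wt eta (expo delta 0) _ _ _ (fun k tau => eq_refl) (HG O)) as [B HB].
  assert (HU : rapid_even (T + 1) U) by apply (in_wt_rapid_even _ _ _ _ _ He (HE0 O) HB Uev).
  exists (fun x t => phys 0 U (x - x0) (T - t)). split; [|split; [|split]].
  - exists (uder T x0 U). split; [apply uder_family; assumption|split; [intros x t Ht; apply uder_pde; assumption|]].
    intros N tau HN Ht. apply (sum_f_R0_bounded N (fun i x t => (1 + Rabs x) ^ N * Rabs (uder T x0 U i 0 x t)) (fun t => 0 <= t <= tau)).
    intros i. destruct (phys_schwartz eta (T - tau) x0 (expo delta) N i U He ltac:(lra) HE HG) as [M HM].
    exists M; intros x t Ht'. unfold uder. simpl ((-1) ^ 0). rewrite Rmult_1_l. apply HM; lra.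
  (* The bound [T / 2] keeps the starting time [T - m] positive. *)
  - set (m := Rmin tau0 (T / 2)). assert (Hm : 0 < m <= T / 2) by (split; [apply Rmin_glb_lt; lra|apply Rmin_r]).
    assert (Hm0 : m <= tau0) by apply Rmin_l.
    assert (Hg : forall t, LOG p r a sigma (1 / (T - t)) / Rpower (T - t) delta = (-1) ^ sigma * (logprod p r a (1 / (T - t)) * Rpower (T - t) (- delta))).
    { intros t. unfold LOG, logprod, Rdiv. rewrite Rpower_Ropp. ring. }
    assert (Hu : forall t, phys 0 U (x0 - x0) (T - t) = IR (fun k => U k (T - t))).
    { intros t. rewrite phys_0. apply IR_ext; intros k. rewrite Rminus_diag, Rmult_0_r, cos_0. ring. }
    assert (Has' : forall t, T - m <= t < T -> c1 * (logprod p r a (1 / (T - t)) * Rpower (T - t) (- delta)) <= (-1) ^ sigma * phys 0 U (x0 - x0) (T - t) <= c2 * (logprod p r a (1 / (T - t)) * Rpower (T - t) (- delta))).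
    { intros t Ht. rewrite Hu. apply Has; lra. }
    destruct Hs as [Es|Es]; rewrite Es in *.
    + exists (T - m), c1, c2. split; [lra|]. split; [lra|]. split; [lra|]. intros t Ht. rewrite Hg. specialize (Has' t Ht). lra.
    (* For [sigma = 1] the comparison function is negative, which exchanges the two constants. *)
    + exists (T - m), c2, c1. split; [lra|]. split; [lra|]. split; [lra|]. intros t Ht. rewrite Hg. specialize (Has' t Ht). lra.
  - destruct (phys_decay_2 eta (expo delta) U He HE0 eq_refl (HG 2%nat)) as (M & PM & HM).
    (* The added 1 makes the constant positive; the bound itself is the one without the factor
       [1 + x^2 >= 1]. *)
    exists (M + 1); split; [lra|]. intros x t Hx Ht. assert (Px : 0 < (x - x0) ^ 2) by (apply pow2_gt_0; lra).
    apply Rle_div_r; [exact Px|]. specialize (HM (x - x0) (T - t) ltac:(lra)). generalize (pow2_ge_0 x); nra.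
  - intros Hlt. destruct (phys_decay_1 eta (expo delta) U He HE0) as (M & PM & HM); [simpl; destruct (Rlt_dec delta (1 / 2)); [reflexivity|lra]|apply HG|].
    exists (M + 1); split; [lra|]. intros x t Hx Ht. assert (Px : 0 < Rabs (x - x0)) by (apply Rabs_pos_lt; lra).
    apply Rle_div_r; [exact Px|]. specialize (HM (x - x0) (T - t) ltac:(lra)). generalize (Rabs_pos x); nra.
Qed.
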